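(* Let $\mathbb{E}$ be a complex Banach space. Let $m_e=(m_e(p))_{p\ge0}$ be a sequence of moments, and let $\mathbb{M}$ be a strongly regular sequence which admits a nonzero proximate order. Let $a,b>0$ be such that $\omega(\mathbb{M})<2/(a+b)$. Then for any $(d_1,d_2)\in\mathbb{R}^2$ with $|d_1-d_2|<a\frac{\omega(\mathbb{M})\pi}{2}$, the space $\mathbb{E}\{z\}_{(\mathbb{M}^{b},\mathbb{M}^{a+b}),(d_1,d_2)}$ of formal power series in $\mathbb{E}[[z]]$ that are $(\mathbb{M}^b,\mathbb{M}^{a+b})$-summable in the multidirection $(d_1,d_2)$ is closed under $m_e$-differentiation, i.e. $\hat u\in\mathbb{E}\{z\}_{(\mathbb{M}^{b},\mathbb{M}^{a+b}),(d_1,d_2)}$ implies $\partial_{m_e,z}\hat u\in\mathbb{E}\{z\}_{(\mathbb{M}^{b},\mathbb{M}^{a+b}),(d_1,d_2)}$.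
   Context: **Sequences.** A sequence $\mathbb{M}=(M_p)_{p\ge0}$ of positive reals with $M_0=1$ is *strongly regular* if (lc) $M_p^2\le M_{p-1}M_{p+1}$ for $p\ge1$; (mg) there is $A_1>0$ with $M_{p+q}\le A_1^{p+q}M_pM_q$ for all $p,q\ge0$; (snq) there is $A_2>0$ with $\sum_{q\ge p}\frac{M_q}{(q+1)M_{q+1}}\le A_2\frac{M_p}{M_{p+1}}$ for all $p\ge0$. Put $M(t)=\sup_{p\ge0}\log(t^p/M_p)$ for $t>0$, $M(0)=0$, and $\omega(\mathbb{M})=\left(\limsup_{r\to\infty}\max\{0,\frac{\log M(r)}{\log r}\}\right)^{-1}$. For $s>0$, $\mathbb{M}^s=(M_p^s)_{p\ge0}$ is again strongly regular with $\omega(\mathbb{M}^s)=s\,\omega(\mathbb{M})$. A proximate order is a continuous, piecewise continuously differentiable $\rho:(c,\infty)\to[0,\infty)$ with $\rho(t)\to\rho<\infty$ and $t\rho'(t)\log t\to0$ as $t\to\infty$; it is nonzero if $\rho>0$. $\mathbb{M}$ *admits a nonzero proximate order* if there is a nonzero proximate order $\rho(t)$ such that $\log(t)\left(\rho(t)-\frac{\log M(t)}{\log t}\right)$ is bounded for large $t$. **Sectors and growth.** On the Riemann surface $\mathcal{R}$ of the logarithm, $S_d(\theta)=\{z:|\arg z-d|<\theta/2\}$; $S_d$ denotes such an infinite sector with unspecified opening; $\hat S_d=S_d\cup D(0,r)$ for some $r>0$. $\mathcal{O}^{\mathbb{M}}(S_d(\theta),\mathbb{E})$ is the set of holomorphic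 $f:S_d(\theta)\to\mathbb{E}$ such that for every $0<\theta'<\theta$ there are $C,K>0$ with $\|f(z)\|_{\mathbb{E}}\le C\exp(M(|z|/K))$ on $S_d(\theta')$. $\mathcal{O}^{\mathbb{M}}(\hat S_d,\mathbb{E})$ consists of functions holomorphic on $\hat S_d$ with this growth on $S_d$. **Kernels and moments.** Let $\mathbb{M}$ be strongly regular, admitting a nonzero proximate order, $\omega(\mathbb{M})<2$. Strong kernel functions for $\mathbb{M}$-summability are functions $e,E$ such that: (1) $e\in\mathcal{O}(S_0(\omega(\mathbb{M})\pi))$, $e(x)\in\mathbb{R}$ for $x>0$; there is $\alpha>0$ such that for every bounded proper subsector $T$ of $S_0(\omega(\mathbb{M})\pi)$ there is $C>0$ with $|e(z)|\le C|z|^\alpha$ on $T$; for every $\varepsilon>0$ there are $C,K>0$ with $|e(z)|\le C\exp(-M(|z|/K))$ on $S_0(\omega(\mathbb{M})\pi-\varepsilon)$. (2) $E$ is entire, $|E(z)|\le\tilde c\exp(M(|z|/\tilde k))$ on $\mathbb{C}$ for some $\tilde c,\tilde k>0$; there is $\beta>0$ such that for all $0<\tilde\theta<2\pi-\omega(\mathbb{M})\pi$ and $M_E>0$ there is $\tilde c_2>0$ with $|E(z)|\le\tilde c_2|z|^{-\beta}$ for $z\in S_\pi(\tilde\theta)\setminus D(0,M_E)$. (3) With $m_e(z)=\int_0^\infty t^{z-1}e(t)\,dt$ (holomorphic on $\mathrm{Re}(z)>0$, continuous up to the boundary), $E(z)=\sum_{p\ge0}z^p/m_e(p)$. $(m_e(p))_{p\ge0}$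 is the sequence of moments associated with $\mathbb{M}$. A *sequence of moments* is a sequence arising this way from some strongly regular sequence admitting a nonzero proximate order and with $\omega<2$. **Summability.** $\hat{\mathcal{B}}_{m_e,z}(\sum_p u_pz^p)=\sum_p\frac{u_p}{m_e(p)}z^p$. A series $\hat u\in\mathbb{E}[[z]]$ is $\mathbb{M}$-summable along direction $d$ if, for a moment sequence $m_e$ associated with $\mathbb{M}$, $\hat{\mathcal{B}}_{m_e,z}\hat u$ has positive radius of convergence and its sum $h$ extends to some $\hat S_d$ with $h\in\mathcal{O}^{\mathbb{M}}(\hat S_d,\mathbb{E})$. This does not depend on the kernel chosen. Its $\mathbb{M}$-sum is $(T_{e,d}h)(z)=\int_0^{\infty(\tau)}e(\xi/z)h(\xi)\frac{d\xi}{\xi}$ ($\tau$ varying in $\arg(S_d)$), holomorphic on a sectorial region of bisecting direction $d$ and opening larger than $\omega(\mathbb{M})\pi$. **Multisummability.** Let $\mathbb{M}_1,\mathbb{M}_2$ be strongly regular, admitting nonzero proximate orders, with $\omega(\mathbb{M}_1)<\omega(\mathbb{M}_2)<2$, and $|d_1-d_2|<\pi(\omega(\mathbb{M}_2)-\omega(\mathbb{M}_1))/2$. With $m_1$ a moment sequence associated with $\mathbb{M}_1$, a series $\hat f\in\mathbb{E}[[z]]$ is $(\mathbb{M}_1,\mathbb{M}_2)$-summable in the multidirection $(d_1,d_2)$ if $\hat{\mathcal{B}}_{m_1,z}\hat f$ is $\mathbb{M}_2/\mathbb{M}_1$-summable along $d_2$ (termwise quotient; here $\mathbb{M}^{a+b}/\mathbb{M}^b=\mathbb{M}^a$)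 and its sum admits analytic continuation to an infinite sector $S_{d_1}$ belonging to $\mathcal{O}^{\mathbb{M}_1}(S_{d_1},\mathbb{E})$. Equivalently, $\hat f=\hat f_1+\hat f_2$ with $\hat f_j$ being $\mathbb{M}_j$-summable along $d_j$, $j=1,2$. **Moment derivative.** $\partial_{m_e,z}\left(\sum_{p\ge0}\frac{a_p}{m_e(p)}z^p\right)=\sum_{p\ge0}\frac{a_{p+1}}{m_e(p)}z^p$ on $\mathbb{E}[[z]]$. *)

(* Defs.v *)
From Stdlib Require Import Reals Lra.
From Coquelicot Require Import Coquelicot.

Open Scope R_scope.

Record strongly_regular (M : nat -> R) : Prop := {
  sr_pos : forall p, 0 < M p;
  sr_0 : M 0%nat = 1;
  sr_lc : forall p, (1 <= p)%nat -> (M p) ^ 2 <= M (p - 1)%nat * M (p + 1)%nat;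
  sr_mg : exists A1, 0 < A1 /\
    forall p q, M (p + q)%nat <= A1 ^ (p + q) * M p * M q;
  sr_snq : exists A2, 0 < A2 /\ forall p,
    ex_series (fun k => M (p + k)%nat / (INR (p + k + 1) * M (p + k + 1)%nat)) /\
    Series (fun k => M (p + k)%nat / (INR (p + k + 1) * M (p + k + 1)%nat))
      <= A2 * (M p / M (p + 1)%nat)
}.

Definition powseq (M : nat -> R) (s : R) : nat -> R := fun p => Rpower (M p) s.

(** The supremum is finite for strongly regular [M] (by (snq),
    [M (p+1) / M p] tends to infinity), so [real] loses nothing there. *)
Definition Mfun (M : nat -> R) (t : R) : R :=
  if Rle_dec t 0 then 0 else real (Sup_seq (fun p => Finite (ln (t ^ p / M p)))).

Definition limsup_infty (f : R -> R) : Rbar :=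
  Inf_seq (fun n => Lub_Rbar (fun y => exists r, INR n < r /\ y = f r)).

(** For strongly regular [M] the upper limit is known to be positive and
    finite, so neither [real] nor the total inverse is used outside its
    natural domain. *)
Definition omega (M : nat -> R) : R :=
  / real (limsup_infty (fun r => Rmax 0 (ln (Mfun M r) / ln r))).

Definition C1 (g : R -> R) : Prop :=
  forall t, ex_derive g t /\ continuous (Derive g) t.

(** On each closed piece, C^1 up to the end points is expressed by the
    existence of a C^1 extension to the real line. *)
Definition piecewise_C1 (c : R) (rho : R -> R) : Prop :=
  forall a b, c < a -> a < b ->
    exists (n : nat) (x : nat -> R),
      x 0%nat = a /\ x n = b /\
      forall i, (i < n)%nat ->
        x i < x (S i) /\
        exists g, C1 g /\ forall t, x i <= t <= x (S i) -> rho t = g t.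

Record nonzero_proximate_order (c : R) (rho : R -> R) (rho0 : R) : Prop := {
  po_cont : forall t, c < t -> continuous rho t;
  po_pw : piecewise_C1 c rho;
  po_nonneg : forall t, c < t -> 0 <= rho t;
  po_lim : is_lim rho p_infty rho0;
  po_deriv : forall eps, 0 < eps -> exists A, forall t l,
    A < t -> is_derive rho t l -> Rabs (t * l * ln t) < eps;
  po_nonzero : 0 < rho0
}.

Definition admits_nonzero_proximate_order (M : nat -> R) : Prop :=
  exists c rho rho0, nonzero_proximate_order c rho rho0 /\
    exists A B, forall t, A < t ->
      Rabs (ln t * (rho t - ln (Mfun M t) / ln t)) <= B.

(** A point [z] of the Riemann surface of the logarithm is given by its global coordinate
    [log z = ln |z| + i arg z], an arbitrary complex number; [proj] is the
    covering map onto the punctured plane.  The complex structure is the one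
    making [proj] a local biholomorphism; as [proj] is the exponential in this
    coordinate, a function is holomorphic on the surface iff it is holomorphic
    in the coordinate.  Quotients [xi / z] on the surface are differences of
    coordinates. *)

Definition logsurf : Type := C.

Definition modulus (z : logsurf) : R := exp (Re z).
Definition arg (z : logsurf) : R := Im z.
Definition polar (r phi : R) : logsurf := (ln r, phi).
Definition sdiv (x z : logsurf) : logsurf := Cminus x z.

Definition Cexp (w : C) : C := (exp (Re w) * cos (Im w), exp (Re w) * sin (Im w)).
Definition proj (z : logsurf) : C := Cexp z.

Definition sector (d theta : R) (z : logsurf) : Prop := Rabs (arg z - d) < theta / 2.

Definition holomorphic_on {V : NormedModule C_AbsRing}
    (D : C -> Prop) (f : C -> V) : Prop :=
  forall z, D z -> exists l : V, is_derive (K := C_AbsRing) f z l.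

Definition OM {V : NormedModule C_AbsRing} (M : nat -> R) (d theta : R)
    (f : logsurf -> V) : Prop :=
  holomorphic_on (sector d theta) f /\
  forall theta', 0 < theta' < theta ->
    exists c k, 0 < c /\ 0 < k /\ forall z, sector d theta' z ->
      norm (f z) <= c * exp (Mfun M (modulus z / k)).

Definition connected_set (G : logsurf -> Prop) : Prop :=
  forall U V : C -> Prop, open U -> open V ->
    (forall z, G z -> U z \/ V z) ->
    (exists z, G z /\ U z) -> (exists z, G z /\ V z) ->
    exists z, G z /\ U z /\ V z.

Record sectorial_region (d theta : R) (G : logsurf -> Prop) : Prop := {
  sreg_open : open (G : C -> Prop);
  sreg_connected : connected_set G;
  sreg_sub : forall z, G z -> sector d theta z;
  sreg_sectors : forall theta', 0 < theta' < theta ->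
    exists r, 0 < r /\ forall z, sector d theta' z -> modulus z < r -> G z
}.

(** [m] is the moment function of [e]; the kernel estimates make it
    holomorphic on [Re z > 0] and continuous on [Re z >= 0]. *)
Definition moment_function (e : logsurf -> C) (m : C -> C) : Prop :=
  forall z, 0 <= Re z ->
    is_RInt_gen (V := C_R_NormedModule)
      (fun t => Cmult (Cexp (Cmult (Cminus z (RtoC 1)) (RtoC (ln t)))) (e (polar t 0)))
      (at_right 0) (Rbar_locally p_infty) (m z).

(** [m] is the sequence of moments of the strong kernel [e], [E].  The moments are real because [e] is real
    on the positive axis; [sk_nonzero] is what makes the coefficients
    [1 / m p] of [E] meaningful. *)
Record strong_kernel (M : nat -> R) (e : logsurf -> C) (E : C -> C)
    (m : nat -> R) : Prop := {
  sk_e_hol : holomorphic_on (V := C_NormedModule) (sector 0 (omega M * PI)) e;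
  sk_e_real : forall x, 0 < x -> Im (e (polar x 0)) = 0;
  sk_e_zero : exists alpha, 0 < alpha /\
    forall phi1 phi2 R0,
      - (omega M * PI / 2) < phi1 -> phi1 < phi2 -> phi2 < omega M * PI / 2 ->
      0 < R0 ->
      exists c, 0 < c /\ forall z,
        phi1 < arg z < phi2 -> modulus z < R0 ->
        Cmod (e z) <= c * Rpower (modulus z) alpha;
  sk_e_inf : forall eps, 0 < eps ->
    exists c k, 0 < c /\ 0 < k /\ forall z,
      sector 0 (omega M * PI - eps) z ->
      Cmod (e z) <= c * exp (- Mfun M (modulus z / k));
  sk_E_entire : holomorphic_on (V := C_NormedModule) (fun _ => True) E;
  sk_E_growth : exists c k, 0 < c /\ 0 < k /\ forall z : C,
    Cmod (E z) <= c * exp (Mfun M (Cmod z / k));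
  sk_E_decay : exists beta, 0 < beta /\
    forall theta ME, 0 < theta < 2 * PI - omega M * PI -> 0 < ME ->
      exists c2, 0 < c2 /\ forall z,
        sector PI theta z -> ME <= modulus z ->
        Cmod (E (proj z)) <= c2 * Rpower (modulus z) (- beta);
  sk_moments : exists me : C -> C, moment_function e me /\
    forall p, me (RtoC (INR p)) = RtoC (m p);
  sk_nonzero : forall p, m p <> 0;
  sk_E_series : forall z : C,
    is_pseries (K := C_AbsRing) (V := C_NormedModule)
      (fun p => RtoC (/ m p)) z (E z)
}.

Definition moment_sequence (m : nat -> R) : Prop :=
  exists M, strongly_regular M /\ admits_nonzero_proximate_order M /\
    omega M < 2 /\ exists e E, strong_kernel M e E m.

Definition borel {E : NormedModule C_AbsRing} (m : nat -> R) (u : nat -> E)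
  : nat -> E :=
  fun p => scal (RtoC (/ m p)) (u p).

(** Formal power series are sequences of coefficients.  Writing [u p = a p / m p], the coefficients of the moment derivative are
    [a (p+1) / m p]. *)
Definition moment_derivative {E : NormedModule C_AbsRing} (m : nat -> R)
    (u : nat -> E) : nat -> E :=
  let a := fun p => scal (RtoC (m p)) (u p) in
  fun p => scal (RtoC (/ m p)) (a (S p)).

(** Restriction of scalars from C to R, needed because Coquelicot integrates
    functions with values in real normed modules. *)
Section RestrictScalars.
Context (E : CompleteNormedModule C_AbsRing).

Lemma Rscal_assoc (x y : R) (u : E) :
  scal (RtoC x) (scal (RtoC y) u) = scal (RtoC (mult x y)) u.
Proof. rewrite scal_assoc; unfold mult; simpl; now rewrite RtoC_mult. Qed.

Lemma Rscal_one (u : E) : scal (RtoC one) u = u.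
Proof. exact (scal_one u). Qed.

Lemma Rscal_distr_l (x : R) (u v : E) :
  scal (RtoC x) (plus u v) = plus (scal (RtoC x) u) (scal (RtoC x) v).
Proof. exact (scal_distr_l (RtoC x) u v). Qed.

Lemma Rscal_distr_r (x y : R) (u : E) :
  scal (RtoC (plus x y)) u = plus (scal (RtoC x) u) (scal (RtoC y) u).
Proof.
  rewrite <- scal_distr_r; unfold plus at 1 2; simpl; now rewrite RtoC_plus.
Qed.

Definition restr_ModuleSpace_mixin :
    ModuleSpace.mixin_of R_Ring (CompleteNormedModule.AbelianGroup C_AbsRing E) :=
  ModuleSpace.Mixin R_Ring (CompleteNormedModule.AbelianGroup C_AbsRing E)
    (fun (x : R) (u : E) => scal (RtoC x) u)
    Rscal_assoc Rscal_one Rscal_distr_l Rscal_distr_r.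

Definition restr_NormedModuleAux : NormedModuleAux R_AbsRing :=
  NormedModuleAux.Pack R_AbsRing E
    (NormedModuleAux.Class R_AbsRing E
       (ModuleSpace.Class R_Ring E
          (AbelianGroup.class (CompleteNormedModule.AbelianGroup C_AbsRing E))
          restr_ModuleSpace_mixin)
       (UniformSpace.class (CompleteNormedModule.UniformSpace C_AbsRing E)))
    E.

Lemma Rscal_norm (x : R) (u : E) :
  norm (scal (RtoC x) u) <= abs x * norm u.
Proof.
  eapply Rle_trans; [exact (norm_scal (RtoC x) u) | right].
  apply f_equal2; [exact (Cmod_R x) | reflexivity].
Qed.

Definition restr_NormedModule_mixin :
    NormedModule.mixin_of R_AbsRing restr_NormedModuleAux :=
  NormedModule.Mixin R_AbsRing restr_NormedModuleAux
    (fun u : E => norm u) (@norm_factor C_AbsRing E)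
    (@norm_triangle C_AbsRing E) Rscal_norm
    (@norm_compat1 C_AbsRing E) (@norm_compat2 C_AbsRing E)
    (@norm_eq_zero C_AbsRing E).

Definition restr_class : CompleteNormedModule.class_of R_AbsRing E :=
  CompleteNormedModule.Class R_AbsRing E
    (NormedModule.Class R_AbsRing E
       (NormedModuleAux.class R_AbsRing restr_NormedModuleAux)
       restr_NormedModule_mixin)
    (CompleteNormedModule.mixin C_AbsRing E
       (CompleteNormedModule.class C_AbsRing E)).

Definition restrict_scalars : CompleteNormedModule R_AbsRing :=
  CompleteNormedModule.Pack R_AbsRing E restr_class E.

End RestrictScalars.

(** Along direction [d], and by means of a kernel with moment sequence [m]:
    the Borel transform of [u] converges near 0 and its sum extends to a
    function [h] of O^M on the union of S_d(theta) and a disc [D(0,r)]. *)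
Definition borel_sum {E : CompleteNormedModule C_AbsRing} (M : nat -> R)
    (m : nat -> R) (d theta : R) (u : nat -> E) (h : logsurf -> E) : Prop :=
  0 < theta /\
  OM M d theta h /\
  exists r, 0 < r /\
    (forall x : C, Cmod x < r -> exists y : E,
       is_pseries (K := C_AbsRing) (borel m u) x y) /\
    (forall z, sector d theta z -> modulus z < r ->
       is_pseries (K := C_AbsRing) (borel m u) (proj z) (h z)).

Definition summable {E : CompleteNormedModule C_AbsRing} (M : nat -> R)
    (d : R) (u : nat -> E) : Prop :=
  exists e Ek m theta h, strong_kernel M e Ek m /\ borel_sum M m d theta u h.

(** [(T_{e,tau} h)(z) = y], the integral being along the ray [xi = s e^{i tau}]. *)
Definition is_laplace {E : CompleteNormedModule C_AbsRing} (e : logsurf -> C)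
    (tau : R) (h : logsurf -> E) (z : logsurf) (y : E) : Prop :=
  is_RInt_gen (V := restrict_scalars E)
    (fun s : R =>
       scal (RtoC (/ s)) (scal (e (sdiv (polar s tau) z)) (h (polar s tau))))
    (at_right 0) (Rbar_locally p_infty) y.

(** [f], holomorphic on the sectorial region [G], is [T_{e,d} h] for [h] given
    on S_d(theta): for every [tau] in arg(S_d(theta)) it is given by the
    integral along the direction [tau], for [z] in the closed subsectors of
    |arg z - tau| < omega(M) pi / 2 and |z| small. *)
Definition laplace_sum {E : CompleteNormedModule C_AbsRing} (M : nat -> R)
    (e : logsurf -> C) (d theta : R) (h : logsurf -> E)
    (G : logsurf -> Prop) (f : logsurf -> E) : Prop :=
  (exists Theta, omega M * PI < Theta /\ sectorial_region d Theta G) /\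
  holomorphic_on G f /\
  forall tau delta, Rabs (tau - d) < theta / 2 -> 0 < delta < omega M * PI / 2 ->
    exists r, 0 < r /\ forall z,
      Rabs (arg z - tau) <= delta -> modulus z < r ->
      is_laplace e tau h z (f z).

Definition is_Msum {E : CompleteNormedModule C_AbsRing} (M : nat -> R) (d : R)
    (u : nat -> E) (G : logsurf -> Prop) (f : logsurf -> E) : Prop :=
  exists e Ek m theta h, strong_kernel M e Ek m /\
    borel_sum M m d theta u h /\ laplace_sum M e d theta h G f.

(** [F], holomorphic on S_d(theta), continues analytically [f], given on a
    sectorial region [G] containing small sectors bisected by [d]; by the
    identity theorem it suffices that they agree on one of these. *)
Definition continues {E : CompleteNormedModule C_AbsRing} (G : logsurf -> Prop)
    (f : logsurf -> E) (d theta : R) (F : logsurf -> E) : Prop :=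
  exists theta' r, 0 < theta' <= theta /\ 0 < r /\
    forall z, sector d theta' z -> modulus z < r -> G z /\ F z = f z.

(** [M2 / M1] is the termwise quotient; the standing assumptions on [M1], [M2],
    [d1], [d2] are left to the statements using this notion. *)
Definition multisummable {E : CompleteNormedModule C_AbsRing} (M1 M2 : nat -> R)
    (d1 d2 : R) (u : nat -> E) : Prop :=
  exists e1 E1 m1, strong_kernel M1 e1 E1 m1 /\
    summable (fun p => M2 p / M1 p) d2 (borel m1 u) /\
    exists G f, is_Msum (fun p => M2 p / M1 p) d2 (borel m1 u) G f /\
      exists theta F, 0 < theta /\ OM M1 d1 theta F /\ continues G f d1 theta F.

(* Main.v *)
Require Import Defs.
From Stdlib Require Import Reals Lra Lia List ClassicalEpsilon FunctionalExtensionality.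
From Coquelicot Require Import Coquelicot.

Open Scope R_scope.

(** Passing from [u] to its moment derivative shifts the coefficients by one and
    multiplies them by the quotients [me (p+1) / me p]. Each of these two operations
    preserves all the data that make up multisummability.

    The shift is absorbed by the kernels: if [e] is a strong kernel with moments
    [m p], then [x e(x)] is a strong kernel for the same sequence, with moments
    [m (p+1)] ([strong_kernel_shift]). Let [h] be the sum of the two successive
    Borel transforms of [u], [f] its Laplace transform and [F] the analytic
    continuation of [f]. With the new kernels the shifted series has the data
    [(h - h0)/x], [(f - x0)/x] and [(F - x0)/x] for suitable constants
    ([laplace_shift]), whose growth is that of [h], [f] and [F].

    The quotients [me (p+1) / me p] are moments of a complex measure carried by a
    path in a bounded sector of arbitrarily small opening ([moment_ratio_contours]).
    The measure comes from the kernel [int E(x y) e(x) dx], integrated along a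
    keyhole contour in [y] near the positive axis. Accordingly the multiplication of
    coefficients by these quotients is realised by averaging [g(z)] into
    [int w(s) g(z exp(l s)) ds]. This operator maps sums of power series to sums of
    power series ([average_borel]), preserves the growth conditions on slightly
    smaller sectors ([OM_average]) and, being built from dilations and rotations,
    commutes with the Laplace transform ([average_laplace]) and with analytic
    continuation. Since its contours are as narrow as desired, it applies to all the
    sectors at hand, the one of opening larger than [omega(M^a) pi] included.

    Everything is done in the coordinate [log x], where rays are horizontal lines
    and the Laplace transform is a convolution. The complex analysis for functions
    with values in a Banach space that this takes rests on one subdivision argument
    ([bisection]), which yields both the exchange of integrals and Goursat's theorem
    ([goursat]); from the latter come the Cauchy and Taylor estimates
    ([cauchy_estimate], [taylor_estimate]) and the rotation of lines of integration
    ([line_rotation]). *)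

(** * Linear identities in modules *)

Section ModuleTactic.
Context {K : Ring} {V : ModuleSpace K}.

(** Linear expressions in vectors are compared by the coefficients of their atoms;
    [ring] proves vector identities only coefficient by coefficient. *)
Inductive mexpr :=
| MVar (n : nat) | MZero | MPlus (a b : mexpr) | MOpp (a : mexpr)
| MScal (k : K) (a : mexpr).

Fixpoint meval (l : list V) (e : mexpr) : V :=
  match e with
  | MVar n => nth n l zero
  | MZero => zero
  | MPlus a b => plus (meval l a) (meval l b)
  | MOpp a => opp (meval l a)
  | MScal k a => scal k (meval l a)
  end.

Fixpoint mcoef (e : mexpr) (n : nat) : K :=
  match e with
  | MVar m => if Nat.eqb m n then one else zero
  | MZero => zero
  | MPlus a b => plus (mcoef a n) (mcoef b n)
  | MOpp a => opp (mcoef a n)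
  | MScal k a => mult k (mcoef a n)
  end.

Fixpoint mcomb (l : list V) (c : nat -> K) : V :=
  match l with
  | nil => zero
  | v :: l' => plus (scal (c 0%nat) v) (mcomb l' (fun n => c (S n)))
  end.

Lemma mcomb_ext l : forall c d, (forall n, c n = d n) -> mcomb l c = mcomb l d.
Proof.
  induction l as [|v l IH]; intros c d H; simpl; auto.
  rewrite H; f_equal; auto.
Qed.

Lemma mcomb_zero l : mcomb l (fun _ => zero) = zero.
Proof.
  induction l as [|v l IH]; simpl; auto.
  now rewrite scal_zero_l, IH, plus_zero_l.
Qed.

Lemma mcomb_plus l : forall c d,
  mcomb l (fun n => plus (c n) (d n)) = plus (mcomb l c) (mcomb l d).
Proof.
  induction l as [|v l IH]; intros c d; simpl; [now rewrite plus_zero_l|].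
  rewrite IH, scal_distr_r, <- !plus_assoc; f_equal.
  rewrite !plus_assoc; f_equal; apply plus_comm.
Qed.

Lemma mcomb_scal l : forall k c,
  mcomb l (fun n => mult k (c n)) = scal k (mcomb l c).
Proof.
  induction l as [|v l IH]; intros k c; simpl; [now rewrite scal_zero_r|].
  now rewrite IH, scal_distr_l, scal_assoc.
Qed.

Lemma mcomb_opp l : forall c, mcomb l (fun n => opp (c n)) = opp (mcomb l c).
Proof.
  intros c; rewrite <- scal_opp_one, <- mcomb_scal.
  apply mcomb_ext; intros n; now rewrite <- opp_mult_l, mult_one_l.
Qed.

Lemma mcomb_var l : forall m,
  mcomb l (fun n => if Nat.eqb m n then one else zero) = nth m l zero.
Proof.
  induction l as [|v l IH]; intros [|m]; simpl; auto.
  - now rewrite scal_one, mcomb_zero, plus_zero_r.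
  - now rewrite scal_zero_l, plus_zero_l, IH.
Qed.

Lemma meval_comb l e : meval l e = mcomb l (mcoef e).
Proof.
  induction e as [n| |a IHa b IHb|a IHa|k a IHa]; simpl.
  - now rewrite mcomb_var.
  - now rewrite mcomb_zero.
  - now rewrite IHa, IHb, mcomb_plus.
  - now rewrite IHa, mcomb_opp.
  - now rewrite IHa, mcomb_scal.
Qed.

Lemma meval_eq l e1 e2 : mcomb l (mcoef e1) = mcomb l (mcoef e2) ->
  meval l e1 = meval l e2.
Proof. now rewrite !meval_comb. Qed.

End ModuleTactic.

Ltac mlookup x l :=
  lazymatch l with
  | x :: _ => constr:(O)
  | _ :: ?l' => let n := mlookup x l' in constr:(S n)
  end.
Ltac madd x l :=
  match l with
  | _ => let _ := mlookup x l in l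
  | _ => constr:(x :: l)
  end.
Ltac matoms t l :=
  lazymatch t with
  | plus ?a ?b => let l1 := matoms a l in matoms b l1
  | minus ?a ?b => let l1 := matoms a l in matoms b l1
  | opp ?a => matoms a l
  | zero => l
  | scal _ ?a => matoms a l
  | _ => madd t l
  end.
Ltac mreify K t l :=
  lazymatch t with
  | plus ?a ?b => let x := mreify K a l in let y := mreify K b l in constr:(@MPlus K x y)
  | minus ?a ?b => let x := mreify K a l in let y := mreify K b l in constr:(@MPlus K x (@MOpp K y))
  | opp ?a => let x := mreify K a l in constr:(@MOpp K x)
  | zero => constr:(@MZero K)
  | scal ?k ?a => let x := mreify K a l in constr:(@MScal K k x)
  | _ => let n := mlookup t l in constr:(@MVar K n)
  end.

(** The coefficients may belong to a ring that [tac] handles up to unfolding; [V] is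
    a parameter because the structure found by unification is not always the one in
    which the identity is meant. *)
Ltac module_with K V tac :=
  lazymatch goal with
  | |- ?a = ?b =>
    let l0 := constr:(@nil V) in
    let l1 := matoms a l0 in
    let l := matoms b l1 in
    let x := mreify K a l in
    let y := mreify K b l in
    change (@meval K V l x = @meval K V l y);
    apply meval_eq; simpl mcoef; simpl mcomb;
    repeat (apply f_equal2; [apply f_equal2; [tac|reflexivity]|]); try reflexivity
  end.
Ltac Rcoef := unfold plus, mult, one, zero, opp; simpl; ring.
Ltac Rmodule V := module_with R_Ring V ltac:(Rcoef).
Ltac Cmodule V := module_with C_Ring V ltac:(Rcoef).

(** * Norms and limits *)

Lemma norm_minus_sym {K : AbsRing} {V : NormedModule K} (x y : V) :
  norm (minus x y) = norm (minus y x).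
Proof.
  rewrite <- (norm_opp (minus x y)); apply f_equal.
  apply (@opp_minus V).
Qed.

Lemma norm_minus_le {K : AbsRing} {V : NormedModule K} (x y : V) :
  norm (minus x y) <= norm x + norm y.
Proof. rewrite <- (norm_opp y); apply (norm_triangle x (opp y)). Qed.

Lemma norm_minus_trans {K : AbsRing} {V : NormedModule K} (y x z : V) :
  norm (minus x z) <= norm (minus x y) + norm (minus y z).
Proof. rewrite (minus_trans y x z); apply norm_triangle. Qed.

Lemma norm_minus_lt {K : AbsRing} {V : NormedModule K} (y x z : V) (a b : R) :
  norm (minus x y) < a -> norm (minus z y) < b -> norm (minus x z) < a + b.
Proof.
  intros H1 H2; rewrite norm_minus_sym in H2.
  pose proof (norm_minus_trans y x z); lra.
Qed.

Lemma norm_le_eps {K : AbsRing} {V : NormedModule K} (x : V) (S : R) :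
  (forall eps, 0 < eps -> norm x <= eps * S) -> x = zero.
Proof.
  intros H.
  apply norm_eq_zero.
  assert (HS : 0 <= norm x) by apply norm_ge_0.
  destruct (Rle_lt_dec (norm x) 0) as [H0|H0]; [lra|exfalso].
  assert (HS' : 0 < S).
  { specialize (H 1 Rlt_0_1). lra. }
  assert (H1 : 0 < norm x / (2 * S)) by (apply Rdiv_lt_0_compat; lra).
  specialize (H _ H1).
  replace (norm x / (2 * S) * S) with (norm x / 2) in H by (field; lra).
  lra.
Qed.

Lemma filterlim_norm_eps {T : Type} {K : AbsRing} {V : NormedModule K}
    (F : (T -> Prop) -> Prop) {FF : Filter F} (f : T -> V) (l : V) :
  filterlim f F (locally l) <->
  forall eps, 0 < eps -> F (fun y => norm (minus (f y) l) < eps).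
Proof.
  split.
  - intros H eps He.
    exact (proj1 (filterlim_locally_ball_norm f l) H (mkposreal eps He)).
  - intros H; apply (proj2 (filterlim_locally_ball_norm f l)).
    intros eps; apply H, cond_pos.
Qed.

Lemma eps_filterlim {T : Type} {K : AbsRing} {V : NormedModule K}
    (F : (T -> Prop) -> Prop) {FF : Filter F} (f : T -> V) (l : V) :
  (forall eps, 0 < eps -> F (fun y => norm (minus (f y) l) < eps)) ->
  filterlim f F (locally l).
Proof. intros H; apply filterlim_norm_eps; auto. Qed.

Lemma filterlim_eps {T : Type} {K : AbsRing} {V : NormedModule K}
    (F : (T -> Prop) -> Prop) {FF : Filter F} (f : T -> V) (l : V) :
  filterlim f F (locally l) ->
  forall eps, 0 < eps -> F (fun y => norm (minus (f y) l) < eps).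
Proof. intros H; apply filterlim_norm_eps; auto. Qed.

Lemma continuous_eps {U : UniformSpace} {K : AbsRing} {V : NormedModule K}
    (f : U -> V) (x : U) :
  continuous f x ->
  forall eps, 0 < eps -> locally x (fun y => norm (minus (f y) (f x)) < eps).
Proof. apply filterlim_norm_eps, locally_filter. Qed.

Lemma eps_continuous {U : UniformSpace} {K : AbsRing} {V : NormedModule K}
    (f : U -> V) (x : U) :
  (forall eps, 0 < eps -> locally x (fun y => norm (minus (f y) (f x)) < eps)) ->
  continuous f x.
Proof. apply filterlim_norm_eps, locally_filter. Qed.

Lemma linear_continuous {V W : NormedModule R_AbsRing} (T : V -> W) (k : R)
    (Tadd : forall x y, T (plus x y) = plus (T x) (T y))
    (Tscal : forall (r : R) x, T (scal r x) = scal r (T x))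
    (Tnorm : forall x, norm (T x) <= k * norm x) (l : V) : continuous T l.
Proof.
  assert (Topp : forall x, T (opp x) = opp (T x)).
  { intros x; transitivity (T (scal (-1) x)).
    - apply f_equal; symmetry; apply (@scal_opp_one R_Ring V).
    - rewrite Tscal; apply (@scal_opp_one R_Ring W). }
  apply eps_continuous; intros eps He.
  assert (Hk : 0 < Rabs k + 1) by (pose proof (Rabs_pos k); lra).
  apply (locally_le_locally_norm l).
  exists (mkposreal (eps / (Rabs k + 1)) (Rdiv_lt_0_compat _ _ He Hk)).
  intros y Hy; unfold ball_norm in Hy; simpl in Hy.
  unfold minus; rewrite <- Topp, <- Tadd.
  eapply Rle_lt_trans; [apply Tnorm|].
  apply Rle_lt_trans with ((Rabs k + 1) * norm (minus y l)).
  { apply Rmult_le_compat_r; [apply norm_ge_0|]. pose proof (Rle_abs k); lra. }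
  apply Rmult_lt_compat_l with (1 := Hk) in Hy.
  replace ((Rabs k + 1) * (eps / (Rabs k + 1))) with eps in Hy by (field; lra).
  exact Hy.
Qed.

Lemma is_RInt_linear {V W : NormedModule R_AbsRing} (T : V -> W) (k : R)
    (Tadd : forall x y, T (plus x y) = plus (T x) (T y))
    (Tscal : forall (r : R) x, T (scal r x) = scal r (T x))
    (Tnorm : forall x, norm (T x) <= k * norm x)
    (f : R -> V) (a b : R) (l : V) :
  is_RInt f a b l -> is_RInt (fun x => T (f x)) a b (T l).
Proof.
  assert (T0 : T zero = zero).
  { transitivity (T (scal 0 zero)).
    - apply f_equal; symmetry; apply (@scal_zero_l R_Ring V).
    - rewrite Tscal; apply (@scal_zero_l R_Ring W). }
  assert (RS : forall ptd, Riemann_sum (fun x => T (f x)) ptd = T (Riemann_sum f ptd)).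
  { intros ptd; pattern ptd; apply SF_cons_ind; clear ptd.
    - intros x; unfold Riemann_sum; simpl; exact (eq_sym T0).
    - intros h s IH; rewrite !Riemann_sum_cons, Tadd, Tscal, IH; reflexivity. }
  intros H.
  assert (H2 := filterlim_comp _ _ _ _ T _ _ _ H (linear_continuous T k Tadd Tscal Tnorm l)).
  eapply filterlim_ext; [|exact H2].
  intros ptd; simpl; now rewrite RS, Tscal.
Qed.

(** Quartering a rectangle halves its size [(x' - x) + (y' - y)], so the four
    quarters have together the same squared size; a functional that is additive and
    locally negligible against it vanishes by repeated quartering. Both Fubini's
    theorem and Goursat's theorem are instances. *)
Lemma bisection {V : NormedModule R_AbsRing} (D : R -> R -> R -> R -> V) (a b c d : R) :
  a <= b -> c <= d ->
  (forall x m x' y y', a <= x -> x <= m -> m <= x' -> x' <= b -> c <= y -> y <= y' -> y' <= d ->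
     D x x' y y' = plus (D x m y y') (D m x' y y')) ->
  (forall x x' y m y', a <= x -> x <= x' -> x' <= b -> c <= y -> y <= m -> m <= y' -> y' <= d ->
     D x x' y y' = plus (D x x' y m) (D x x' m y')) ->
  (forall p q, a <= p <= b -> c <= q <= d -> forall eps, 0 < eps ->
     exists rho, 0 < rho /\ forall x x' y y',
       a <= x -> x <= p <= x' -> x' <= b -> c <= y -> y <= q <= y' -> y' <= d ->
       x' - x < rho -> y' - y < rho ->
       norm (D x x' y y') <= eps * ((x' - x) + (y' - y)) ^ 2) ->
  D a b c d = zero.
Proof.
  intros Hab Hcd Hadd1 Hadd2 Hloc.
  set (N := norm (D a b c d)).
  set (wx := fun n => (b - a) / 2 ^ n).
  set (wy := fun n => (d - c) / 2 ^ n).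
  assert (P2 : forall n, 0 < 2 ^ n) by (intros n; apply pow_lt; lra).
  assert (Hwx : forall n, 0 <= wx n).
  { intros n; apply Rmult_le_pos; [lra|]; left; apply Rinv_0_lt_compat, P2. }
  assert (Hwy : forall n, 0 <= wy n).
  { intros n; apply Rmult_le_pos; [lra|]; left; apply Rinv_0_lt_compat, P2. }
  assert (Swx : forall n, wx n = 2 * wx (S n)).
  { intros n; unfold wx; simpl; field; specialize (P2 n); lra. }
  assert (Swy : forall n, wy n = 2 * wy (S n)).
  { intros n; unfold wy; simpl; field; specialize (P2 n); lra. }
  (* the n-th rectangle of a nested sequence carries at least the 4^(-n)-th part of the norm *)
  set (big := fun n x y => Rle_dec (N / 4 ^ n) (norm (D x (x + wx n) y (y + wy n)))).
  set (step := fun n (p : R * R) => let (x, y) := p in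
     if big (S n) x y then (x, y) else
     if big (S n) (x + wx (S n)) y then (x + wx (S n), y) else
     if big (S n) x (y + wy (S n)) then (x, y + wy (S n)) else
     (x + wx (S n), y + wy (S n))).
  set (P := fix P n := match n with O => (a, c) | S n => step n (P n) end).
  assert (Inv : forall n, a <= fst (P n) /\ fst (P n) + wx n <= b /\
      c <= snd (P n) /\ snd (P n) + wy n <= d /\
      N / 4 ^ n <= norm (D (fst (P n)) (fst (P n) + wx n) (snd (P n)) (snd (P n) + wy n)) /\
      fst (P n) <= fst (P (S n)) <= fst (P n) + wx (S n) /\
      snd (P n) <= snd (P (S n)) <= snd (P n) + wy (S n)).
  { assert (Inv0 : forall n, fst (P n) <= fst (P (S n)) <= fst (P n) + wx (S n) /\
      snd (P n) <= snd (P (S n)) <= snd (P n) + wy (S n)).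
    { intros n; simpl; destruct (P n) as [x y]; unfold step, fst, snd.
      specialize (Hwx (S n)); specialize (Hwy (S n)).
      destruct (big (S n) x y); [lra|].
      destruct (big (S n) (x + wx (S n)) y); [lra|].
      destruct (big (S n) x (y + wy (S n))); lra. }
    assert (H : forall n, a <= fst (P n) /\ fst (P n) + wx n <= b /\
      c <= snd (P n) /\ snd (P n) + wy n <= d /\
      N / 4 ^ n <= norm (D (fst (P n)) (fst (P n) + wx n) (snd (P n)) (snd (P n) + wy n))).
    { induction n as [|n IH].
      - simpl; unfold wx, wy; simpl.
        replace (a + (b - a) / 1) with b by field.
        replace (c + (d - c) / 1) with d by field.
        unfold N; repeat split; lra.
      - specialize (Inv0 n).
        destruct IH as (I1 & I2 & I3 & I4 & I5).
        rewrite Swx in I2, I5; rewrite Swy in I4, I5.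
        repeat split; try lra.
        revert I1 I2 I3 I4 I5; simpl P; destruct (P n) as [x y]; unfold step, fst, snd.
        intros I1 I2 I3 I4 I5.
        specialize (Hwx (S n)); specialize (Hwy (S n)).
        destruct (big (S n) x y) as [B1|B1]; [exact B1|].
        destruct (big (S n) (x + wx (S n)) y) as [B2|B2]; [exact B2|].
        destruct (big (S n) x (y + wy (S n))) as [B3|B3]; [exact B3|].
        apply Rnot_le_lt in B1, B2, B3.
        destruct (Rle_lt_dec (N / 4 ^ S n)
          (norm (D (x + wx (S n)) (x + wx (S n) + wx (S n)) (y + wy (S n)) (y + wy (S n) + wy (S n)))))
          as [B4|B4]; [exact B4|exfalso].
        replace (x + 2 * wx (S n)) with (x + wx (S n) + wx (S n)) in I5 by ring.
        replace (y + 2 * wy (S n)) with (y + wy (S n) + wy (S n)) in I5 by ring.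
        rewrite (Hadd1 _ (x + wx (S n))) in I5 by lra.
        rewrite (Hadd2 x _ _ (y + wy (S n))) in I5 by lra.
        rewrite (Hadd2 (x + wx (S n)) _ _ (y + wy (S n))) in I5 by lra.
        replace (N / 4 ^ n) with (4 * (N / 4 ^ S n)) in I5
          by (simpl; field; apply pow_nonzero; lra).
        revert I5; apply Rlt_not_le.
        eapply Rle_lt_trans; [apply norm_triangle|].
        eapply Rle_lt_trans; [apply Rplus_le_compat; apply norm_triangle|].
        lra. }
    intros n; destruct (H n) as (?&?&?&?&?); destruct (Inv0 n); tauto. }
  assert (Mono : forall u : nat -> R, (forall n, u n <= u (S n)) -> forall n k, u n <= u (n + k)%nat).
  { intros u Hu n k; induction k; [rewrite Nat.add_0_r; lra|].
    rewrite Nat.add_succ_r; specialize (Hu (n + k)%nat); lra. }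
  assert (Lim : forall u w : nat -> R, (forall n, u n <= u (S n)) ->
     (forall n, u (S n) + w (S n) <= u n + w n) -> (forall n, 0 <= w n) ->
     exists p, forall n, u n <= p <= u n + w n).
  { intros u w H1 H2 H3.
    assert (Hdec : forall n k, u (n + k)%nat + w (n + k)%nat <= u n + w n).
    { intros n k; induction k; [rewrite Nat.add_0_r; lra|].
      rewrite Nat.add_succ_r; specialize (H2 (n + k)%nat); lra. }
    assert (Hup : forall n m, u m <= u n + w n).
    { intros n m; destruct (Nat.le_ge_cases n m) as [Hm|Hm].
      - replace m with (n + (m - n))%nat by lia.
        specialize (Hdec n (m - n)%nat); specialize (H3 (n + (m - n))%nat); lra.
      - pose proof (Mono u H1 m (n - m)%nat) as Hq.
        replace (m + (n - m))%nat with n in Hq by lia. specialize (H3 n); lra. }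
    destruct (completeness (fun x => exists n, x = u n)) as [p [Hp1 Hp2]].
    - exists (u 0%nat + w 0%nat); intros x [n ->]; apply Hup.
    - exists (u 0%nat), 0%nat; reflexivity.
    - exists p; intros n; split; [apply Hp1; now exists n|].
      apply Hp2; intros x [m ->]; apply Hup. }
  destruct (Lim (fun n => fst (P n)) wx) as [p Hp]; auto.
  { intros n; apply Inv. }
  { intros n; pose proof (Inv n) as (_&_&_&_&_&H&_); specialize (Swx n); lra. }
  destruct (Lim (fun n => snd (P n)) wy) as [q Hq]; auto.
  { intros n; apply Inv. }
  { intros n; pose proof (Inv n) as (_&_&_&_&_&_&H); specialize (Swy n); lra. }
  assert (Hp' : a <= p <= b).
  { destruct (Inv 0%nat) as (I1&I2&_). specialize (Hp 0%nat); lra. }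
  assert (Hq' : c <= q <= d).
  { destruct (Inv 0%nat) as (_&_&I1&I2&_). specialize (Hq 0%nat); lra. }
  apply (norm_le_eps _ (((b - a) + (d - c)) ^ 2)); fold N.
  intros eps He.
  destruct (Hloc p q Hp' Hq' eps He) as [rho [Hrho Hr]].
  assert (Small : exists n, wx n < rho /\ wy n < rho).
  { assert (H0 : 0 < rho / ((b - a) + (d - c) + 1)) by (apply Rdiv_lt_0_compat; lra).
    destruct (pow_lt_1_zero (/ 2)) with (y := rho / ((b - a) + (d - c) + 1)) as [n Hn]; auto.
    { rewrite Rabs_pos_eq; lra. }
    exists n; specialize (Hn n (Nat.le_refl n)).
    rewrite Rabs_pos_eq in Hn by (left; apply pow_lt; lra).
    assert (Hx : forall t, 0 <= t -> t <= (b - a) + (d - c) -> t / 2 ^ n < rho).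
    { intros t Ht1 Ht2; unfold Rdiv; rewrite <- pow_inv.
      apply Rle_lt_trans with (((b - a) + (d - c) + 1) * (/ 2) ^ n).
      - apply Rmult_le_compat_r; [left; apply pow_lt; lra|lra].
      - apply Rmult_lt_compat_l with (r := (b - a) + (d - c) + 1) in Hn; [|lra].
        replace (((b - a) + (d - c) + 1) * (rho / ((b - a) + (d - c) + 1))) with rho in Hn
          by (field; lra). exact Hn. }
    split; apply Hx; lra. }
  destruct Small as [n [Hn1 Hn2]].
  destruct (Inv n) as (I1 & I2 & I3 & I4 & I5 & _).
  specialize (Hr (fst (P n)) (fst (P n) + wx n) (snd (P n)) (snd (P n) + wy n)).
  assert (Hr' := Rle_trans _ _ _ I5 (Hr I1 (Hp n) I2 I3 (Hq n) I4 ltac:(lra) ltac:(lra))).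
  replace (fst (P n) + wx n - fst (P n)) with (wx n) in Hr' by ring.
  replace (snd (P n) + wy n - snd (P n)) with (wy n) in Hr' by ring.
  assert (H4 : (wx n + wy n) ^ 2 = ((b - a) + (d - c)) ^ 2 / 4 ^ n).
  { unfold wx, wy.
    replace (4 ^ n) with (2 ^ n * 2 ^ n) by (rewrite <- Rpow_mult_distr; f_equal; lra).
    field; specialize (P2 n); lra. }
  rewrite H4 in Hr'.
  assert (P4 : 0 < 4 ^ n) by (apply pow_lt; lra).
  apply Rmult_le_compat_r with (r := 4 ^ n) in Hr'; [|lra].
  replace (N / 4 ^ n * 4 ^ n) with N in Hr' by (field; lra).
  replace (eps * ((b - a + (d - c)) ^ 2 / 4 ^ n) * 4 ^ n)
    with (eps * (b - a + (d - c)) ^ 2) in Hr' by (field; lra).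
  exact Hr'.
Qed.

Ltac norm_replace V b :=
  match goal with |- context [norm ?x] =>
    let H := fresh in assert (H : x = b) by (Rmodule V); rewrite H; clear H end.

(** * Integrals depending on a parameter *)

Section Integrals.
Context {V : CompleteNormedModule R_AbsRing}.

Lemma continuous_pair_l {U : UniformSpace} (f : R -> R -> U) (s t : R) :
  continuous (fun p => f (fst p) (snd p)) (s, t) -> continuous (fun u => f u t) s.
Proof.
  intros H.
  apply (continuous_comp_2 (fun u : R => u) (fun _ : R => t) (fun a b => f a b) s).
  - apply continuous_id.
  - apply continuous_const.
  - exact H.
Qed.

Lemma continuous_pair_r {U : UniformSpace} (f : R -> R -> U) (s t : R) :
  continuous (fun p => f (fst p) (snd p)) (s, t) -> continuous (fun u => f s u) t.
Proof.
  intros H.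
  apply (continuous_comp_2 (fun _ : R => s) (fun u : R => u) (fun a b => f a b) t).
  - apply continuous_const.
  - apply continuous_id.
  - exact H.
Qed.

Lemma pair_locally (P : R * R -> Prop) (s t : R) :
  locally (s, t) P <-> exists rho, 0 < rho /\ forall x y,
     Rabs (x - s) < rho -> Rabs (y - t) < rho -> P (x, y).
Proof.
  split.
  - intros [eps H]; exists eps; split; [apply cond_pos|].
    intros x y Hx Hy; apply H; split; assumption.
  - intros (rho & H & H0); exists (mkposreal rho H).
    intros [x y] [Hx Hy]; apply H0; assumption.
Qed.

(** Continuity at the points of the segment [{s} * [c, d]] is uniform along it, by
    compactness. *)
Lemma uniform_in_parameter (f : R -> R -> V) (s c d : R) :
  (forall t, c <= t <= d -> continuous (fun p => f (fst p) (snd p)) (s, t)) ->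
  forall eps, 0 < eps -> exists rho, 0 < rho /\
    forall u t, Rabs (u - s) < rho -> c <= t <= d -> norm (minus (f u t) (f s t)) < eps.
Proof.
  intros Hc eps He.
  assert (Hloc : forall t, exists rho : posreal, c <= t <= d -> forall x y,
     Rabs (x - s) < rho -> Rabs (y - t) < rho ->
     norm (minus (f x y) (f s t)) < eps / 2).
  { intros t; destruct (classic (c <= t <= d)) as [Ht|Ht].
    - specialize (Hc t Ht).
      assert (He2 : 0 < eps / 2) by lra.
      pose proof (continuous_eps (V := V) _ _ Hc _ He2) as Hc'; clear Hc; rename Hc' into Hc.
      apply pair_locally in Hc; simpl in Hc.
      destruct Hc as (rho & H1 & H2); exists (mkposreal rho H1); auto.
    - exists (mkposreal 1 Rlt_0_1); tauto. }
  assert (Hch : exists rho : R -> posreal, forall t, c <= t <= d -> forall x y,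
     Rabs (x - s) < rho t -> Rabs (y - t) < rho t ->
     norm (minus (f x y) (f s t)) < eps / 2).
  { exists (fun t => proj1_sig (constructive_indefinite_description _ (Hloc t))).
    intros t; exact (proj2_sig (constructive_indefinite_description _ (Hloc t))). }
  destruct Hch as [rho Hrho].
  destruct (compactness_value_1d c d rho) as [r Hr].
  exists r; split; [apply cond_pos|].
  intros u t Hu Ht.
  apply NNPP; intros Hn; apply (Hr t Ht); intros (z & Hz & H1 & H2); apply Hn; clear Hn.
  pose proof (Hrho z Hz u t ltac:(lra) H1) as Ha.
  pose proof (Hrho z Hz s t) as Hb.
  rewrite Rminus_diag, Rabs_R0 in Hb; specialize (Hb (cond_pos _) H1).
  replace eps with (eps / 2 + eps / 2) by field.
  exact (norm_minus_lt (f s z) _ _ _ _ Ha Hb).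
Qed.

Lemma RInt_close (f g : R -> V) (a b eps : R) :
  a <= b -> ex_RInt f a b -> ex_RInt g a b ->
  (forall t, a <= t <= b -> norm (minus (f t) (g t)) <= eps) ->
  norm (minus (RInt f a b) (RInt g a b)) <= (b - a) * eps.
Proof.
  intros Hab Hf Hg H.
  apply (norm_RInt_le_const (fun t => minus (f t) (g t)) a b); [exact Hab|exact H|].
  apply (is_RInt_minus f g); apply RInt_correct; assumption.
Qed.

Lemma continuous_RInt_param (f : R -> R -> V) (s c d : R) :
  c <= d ->
  (forall t, c <= t <= d -> continuous (fun p => f (fst p) (snd p)) (s, t)) ->
  locally s (fun u => ex_RInt (f u) c d) ->
  continuous (fun u => RInt (f u) c d) s.
Proof.
  intros Hcd Hc Hex; apply (eps_continuous (V := V)); intros eps He.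
  assert (He' : 0 < eps / (d - c + 1)) by (apply Rdiv_lt_0_compat; lra).
  destruct (uniform_in_parameter f s c d Hc _ He') as (rho & H1 & H2).
  assert (Hs := locally_singleton _ _ Hex).
  assert (Hr : locally s (fun u => Rabs (u - s) < rho)).
  { exists (mkposreal rho H1); intros u Hu; exact Hu. }
  generalize (filter_and _ _ Hr Hex); apply filter_imp; intros u [Hu Hu'].
  eapply Rle_lt_trans.
  - apply (RInt_close (f u) (f s)) with (eps := eps / (d - c + 1));
      [exact Hcd|exact Hu'|exact Hs|].
    intros t Ht; left; apply H2; auto.
  - apply Rmult_lt_reg_r with ((d - c + 1) / eps).
    { apply Rdiv_lt_0_compat; lra. }
    field_simplify; lra.
Qed.

Lemma ex_RInt_cont (f : R -> V) (a b : R) : (forall t, continuous f t) -> ex_RInt f a b.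
Proof. intros H; apply ex_RInt_continuous; auto. Qed.

Lemma continuous_RInt_slices (f : R -> R -> V) (c d : R) :
  c <= d -> (forall s t, continuous (fun p => f (fst p) (snd p)) (s, t)) ->
  forall s, continuous (fun u => RInt (f u) c d) s.
Proof.
  intros Hcd Hc s; apply continuous_RInt_param; auto.
  apply filter_forall; intros u; apply ex_RInt_cont.
  intros t; apply continuous_pair_r; auto.
Qed.

Lemma continuous_swap_args (f : R -> R -> V) (s t : R) :
  continuous (fun p => f (fst p) (snd p)) (s, t) ->
  continuous (fun p => f (snd p) (fst p)) (t, s).
Proof.
  intros H.
  apply (continuous_comp_2 (fun p : R * R => snd p) (fun p : R * R => fst p)
    (fun a b => f a b) (t, s)).
  - apply continuous_snd.
  - apply continuous_fst.
  - exact H.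
Qed.

Lemma RInt_close_const (f : R -> V) (a b eps : R) (v : V) :
  a <= b -> ex_RInt f a b ->
  (forall t, a <= t <= b -> norm (minus (f t) v) <= eps) ->
  norm (minus (RInt f a b) (scal (b - a) v)) <= (b - a) * eps.
Proof.
  intros Hab Hf H.
  rewrite <- (RInt_const (V := V) a b v).
  apply (RInt_close f (fun _ => v)); [exact Hab|exact Hf|apply ex_RInt_const|exact H].
Qed.

(** Both iterated integrals over a small rectangle differ from the value at one of
    its points times the area by a negligible amount. *)
Lemma RInt_swap (f : R -> R -> V) (a b c d : R) :
  a <= b -> c <= d ->
  (forall s t, continuous (fun p => f (fst p) (snd p)) (s, t)) ->
  RInt (fun s => RInt (fun t => f s t) c d) a b =
  RInt (fun t => RInt (fun s => f s t) a b) c d.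
Proof.
  intros Hab Hcd Hc.
  assert (Hc' : forall t s, continuous (fun p => f (snd p) (fst p)) (t, s))
    by (intros t s; apply continuous_swap_args, Hc).
  assert (Cs : forall s t, continuous (f s) t) by (intros; apply continuous_pair_r, Hc).
  assert (Ct : forall s t, continuous (fun u => f u t) s)
    by (intros; apply continuous_pair_l, Hc).
  set (I := fun x x' y y' => RInt (fun s => RInt (fun t => f s t) y y') x x').
  set (J := fun x x' y y' => RInt (fun t => RInt (fun s => f s t) x x') y y').
  assert (EI : forall y y', y <= y' -> forall x x', ex_RInt (fun s => RInt (fun t => f s t) y y') x x').
  { intros y y' Hy x x'; apply ex_RInt_cont; intros s.
    apply (continuous_RInt_slices (fun s t => f s t)); auto. }
  assert (EJ : forall x x', x <= x' -> forall y y', ex_RInt (fun t => RInt (fun s => f s t) x x') y y').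
  { intros y y' Hy x x'; apply ex_RInt_cont; intros s.
    apply (continuous_RInt_slices (fun t s => f s t)); auto. }
  assert (I1 : forall x m x' y y', y <= y' -> I x x' y y' = plus (I x m y y') (I m x' y y')).
  { intros; symmetry; apply (RInt_Chasles (V := V)); apply EI; assumption. }
  assert (J2 : forall x x' y m y', x <= x' -> J x x' y y' = plus (J x x' y m) (J x x' m y')).
  { intros; symmetry; apply (RInt_Chasles (V := V)); apply EJ; assumption. }
  assert (I2 : forall x x' y m y', y <= m -> m <= y' ->
     I x x' y y' = plus (I x x' y m) (I x x' m y')).
  { intros x x' y m y' Hy Hy'; unfold I.
    rewrite <- (RInt_plus (V := V)) by (apply EI; assumption).
    apply RInt_ext; intros s _; symmetry.
    apply (RInt_Chasles (V := V)); apply ex_RInt_cont; auto. }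
  assert (J1 : forall x m x' y y', x <= m -> m <= x' ->
     J x x' y y' = plus (J x m y y') (J m x' y y')).
  { intros x m x' y y' Hy Hy'; unfold J.
    rewrite <- (RInt_plus (V := V)) by (apply EJ; assumption).
    apply RInt_ext; intros s _; symmetry.
    apply (RInt_Chasles (V := V)); apply ex_RInt_cont; intros t; apply Ct. }
  assert (Z : minus (I a b c d) (J a b c d) = zero).
  2:{ change (I a b c d = J a b c d).
      transitivity (plus (minus (I a b c d) (J a b c d)) (J a b c d)); [Rmodule V|].
      rewrite Z; Rmodule V. }
  apply (bisection (fun x x' y y' => minus (I x x' y y') (J x x' y y')) a b c d); auto.
  - intros x m x' y y' H1 H2 H3 H4 H5 H6 H7; rewrite (I1 x m), (J1 x m) by assumption. Rmodule V.
  - intros x x' y m y' H1 H2 H3 H4 H5 H6 H7; rewrite (I2 x x' y m), (J2 x x' y m) by assumption. Rmodule V.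
  - intros p q Hp Hq eps Heps.
    pose proof (continuous_eps (V := V) _ _ (Hc p q) (eps / 2) ltac:(lra)) as Hl.
    apply pair_locally in Hl; destruct Hl as (rho & Hr1 & Hr2); simpl in Hr2.
    exists rho; split; [exact Hr1|].
    intros x x' y y' _ Hx _ _ Hy _ Hx' Hy'.
    assert (Hn : forall s t, x <= s <= x' -> y <= t <= y' ->
       norm (minus (f s t) (f p q)) <= eps / 2).
    { intros s t Hs Ht; left; apply Hr2; apply Rabs_def1; lra. }
    assert (Bi : norm (minus (I x x' y y') (scal (x' - x) (scal (y' - y) (f p q)))) <=
       (x' - x) * ((y' - y) * (eps / 2))).
    { apply RInt_close_const; [lra|apply EI; lra|]; intros s Hs.
      apply RInt_close_const; [lra|apply ex_RInt_cont, Cs|]; intros t Ht; auto. }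
    assert (Bj : norm (minus (J x x' y y') (scal (y' - y) (scal (x' - x) (f p q)))) <=
       (y' - y) * ((x' - x) * (eps / 2))).
    { apply RInt_close_const; [lra|apply EJ; lra|]; intros s Hs.
      apply RInt_close_const; [lra|apply ex_RInt_cont; intros u; apply Ct|]; intros t Ht; auto. }
    replace (scal (y' - y) (scal (x' - x) (f p q))) with
      (scal (x' - x) (scal (y' - y) (f p q))) in Bj by (Rmodule V).
    set (A := scal (x' - x) (scal (y' - y) (f p q))) in *.
    apply Rle_trans with ((x' - x) * ((y' - y) * (eps / 2)) + (y' - y) * ((x' - x) * (eps / 2))).
    + eapply Rle_trans; [apply (norm_minus_trans (V := V) A)|].
      apply Rplus_le_compat; [exact Bi|].
      eapply Rle_trans; [right; apply (norm_minus_sym (V := V))|exact Bj].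
    + set (u := x' - x) in *; set (w := y' - y) in *.
      assert (0 <= u /\ 0 <= w) by (unfold u, w; lra).
      assert (0 <= u * w /\ 0 <= u ^ 2 /\ 0 <= w ^ 2) by (repeat split; nra).
      assert (u * w <= (u + w) ^ 2) by nra.
      replace (u * (w * (eps / 2)) + w * (u * (eps / 2))) with (eps * (u * w)) by field.
      apply Rmult_le_compat_l; lra.
Qed.

(** * Integrals over the real line *)

(** Domination by [C / (1 + v ^ 2)], whose primitive is bounded, makes all the
    integrals over the line below absolutely convergent. *)
Definition dominated (C : R) (f : R -> V) : Prop :=
  forall v, norm (f v) <= C / (1 + v ^ 2).

(** In the logarithmic coordinate every integral over a ray from the origin becomes
    an integral over a horizontal line. *)
Definition is_line_int (f : R -> V) (l : V) : Prop :=
  is_RInt_gen f (Rbar_locally m_infty) (Rbar_locally p_infty) l.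

Lemma is_RInt_Cauchy_density (C a b : R) :
  is_RInt (fun v => C / (1 + v ^ 2)) a b (C * (atan b - atan a)).
Proof.
  replace (C * (atan b - atan a)) with (minus (C * atan b) (C * atan a))
    by (unfold minus, plus, opp; simpl; ring).
  apply (is_RInt_derive (fun v => C * atan v)).
  - intros x _; auto_derive; [trivial|].
    unfold Rsqr; field; nra.
  - intros x _; apply (ex_derive_continuous (V := R_NormedModule)); auto_derive; nra.
Qed.

Lemma dominated_RInt (C : R) (f : R -> V) (a b : R) :
  (forall v, continuous f v) -> dominated C f -> a <= b ->
  norm (RInt f a b) <= C * (atan b - atan a).
Proof.
  intros Hc Hd Hab.
  apply (norm_RInt_le f (fun v => C / (1 + v ^ 2)) a b); [exact Hab| | |].
  - intros x _; apply Hd.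
  - apply (RInt_correct (V := V)), ex_RInt_cont, Hc.
  - apply is_RInt_Cauchy_density.
Qed.

Lemma dominated_pos (C : R) (f : R -> V) : dominated C f -> 0 <= C.
Proof.
  intros H; specialize (H 0); pose proof (norm_ge_0 (f 0)).
  replace (C / (1 + 0 ^ 2)) with C in H by field. lra.
Qed.

Lemma atan_tail (eps : R) : 0 < eps -> exists A, 0 < A /\ forall v, A <= v ->
  PI / 2 - atan v < eps /\ atan (- v) + PI / 2 < eps.
Proof.
  intros He.
  assert (H : forall x, 0 < x -> PI / 2 - atan x <= / x).
  { intros x Hx; rewrite <- (atan_inv x Hx).
    pose proof (Rinv_0_lt_compat x Hx) as Hi.
    destruct (MVT_gen atan 0 (/ x) (fun y => / (1 + y ^ 2))) as (c & Hc1 & Hc2).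
    - intros y _; auto_derive; [trivial|]; unfold Rsqr; field; nra.
    - intros y _; apply derivable_continuous_pt, derivable_pt_atan.
    - rewrite atan_0 in Hc2.
      assert (/ (1 + c ^ 2) <= 1).
      { rewrite <- Rinv_1; apply Rinv_le_contravar; nra. }
      nra. }
  exists (2 / eps); split; [apply Rdiv_lt_0_compat; lra|].
  intros v Hv.
  assert (0 < 2 / eps) by (apply Rdiv_lt_0_compat; lra).
  specialize (H v ltac:(lra)).
  assert (/ v <= eps / 2).
  { replace (eps / 2) with (/ (2 / eps)) by (field; lra). apply Rinv_le_contravar; lra. }
  rewrite atan_opp; lra.
Qed.

(** Under a domination the convergence of the symmetric integrals, at the rate of
    the tail of the dominating function, suffices. *)
Lemma is_line_int_intro (C : R) (f : R -> V) (l : V) :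
  (forall v, continuous f v) ->
  (forall n : R, 0 < n ->
     norm (minus (RInt f (- n) n) l) <= C * (PI - (atan n - atan (- n)))) ->
  dominated C f -> is_line_int f l.
Proof.
  intros Hc Hl Hd.
  pose proof (dominated_pos C f Hd) as HC.
  unfold is_line_int, is_RInt_gen.
  intros P HP; unfold filtermapi.
  assert (Hfl : filterlim (fun ab => RInt f (fst ab) (snd ab))
    (filter_prod (Rbar_locally m_infty) (Rbar_locally p_infty)) (locally l)).
  2:{ generalize (Hfl P HP); unfold filtermap; apply filter_imp.
      intros ab H; exists (RInt f (fst ab) (snd ab)); split; [|exact H].
      apply (RInt_correct (V := V)), ex_RInt_cont, Hc. }
  apply (eps_filterlim (V := V)); [typeclasses eauto|]; intros eps He.
  destruct (atan_tail (eps / (4 * (C + 1)))) as (A & HA & HA').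
  { apply Rdiv_lt_0_compat; lra. }
  apply Filter_prod with (Q := fun x => x < - A) (R := fun y => A < y).
  { exists (- A); auto. }
  { exists A; auto. }
  intros x y Hx Hy; simpl.
  assert (E1 : ex_RInt f x (- A)) by (apply ex_RInt_cont, Hc).
  assert (E2 : ex_RInt f (- A) A) by (apply ex_RInt_cont, Hc).
  assert (E3 : ex_RInt f A y) by (apply ex_RInt_cont, Hc).
  assert (Hs : RInt f x y = plus (RInt f x (- A)) (plus (RInt f (- A) A) (RInt f A y))).
  { rewrite (RInt_Chasles (V := V) f (- A) A y) by assumption.
    rewrite (RInt_Chasles (V := V) f x (- A) y); [reflexivity|assumption|].
    apply ex_RInt_cont, Hc. }
  rewrite Hs.
  norm_replace V (plus (plus (RInt f x (- A)) (RInt f A y)) (minus (RInt f (- A) A) l)).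
  pose proof (dominated_RInt C f x (- A) Hc Hd ltac:(lra)) as B1.
  pose proof (dominated_RInt C f A y Hc Hd ltac:(lra)) as B2.
  pose proof (Hl A HA) as B3.
  eapply Rle_lt_trans; [exact (norm_triangle (V := V) (plus (RInt f x (- A)) (RInt f A y))
    (minus (RInt f (- A) A) l))|].
  eapply Rle_lt_trans; [apply Rplus_le_compat; [apply (norm_triangle (V := V))|exact B3]|].
  eapply Rle_lt_trans; [apply Rplus_le_compat_r, Rplus_le_compat; [exact B1|exact B2]|].
  destruct (HA' A (Rle_refl A)) as [T1 T2].
  pose proof (atan_bound x); pose proof (atan_bound y).
  rewrite <- (Rmult_1_l eps) at 1.
  set (e := eps / (4 * (C + 1))) in *.
  assert (Ee : eps = 4 * (C + 1) * e) by (unfold e; field; lra).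
  assert (0 < e) by (unfold e; apply Rdiv_lt_0_compat; lra).
  nra.
Qed.

Lemma line_int_bound (C : R) (f : R -> V) (l : V) (n : R) :
  (forall v, continuous f v) -> dominated C f -> is_line_int f l -> 0 <= n ->
  norm (minus (RInt f (- n) n) l) <= C * (PI - (atan n - atan (- n))).
Proof.
  intros Hc Hd Hl Hn.
  pose proof (dominated_pos C f Hd) as HC.
  apply le_epsilon; intros eps He.
  assert (Hf : filterlim (fun ab => RInt f (fst ab) (snd ab))
    (filter_prod (Rbar_locally m_infty) (Rbar_locally p_infty)) (locally l)).
  { intros P HP; generalize (Hl P HP); unfold filtermapi, filtermap; apply filter_imp.
    intros ab (y & Hy1 & Hy2); rewrite (is_RInt_unique _ _ _ _ Hy1); exact Hy2. }
  pose proof (filterlim_eps (V := V) _ _ _ Hf eps He) as Hf'.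
  destruct Hf' as [Q1 Q2 [a1 H1] [a2 H2] H3].
  set (x := Rmin (a1 - 1) (- n)); set (y := Rmax (a2 + 1) n).
  assert (Hx : x < a1) by (unfold x; pose proof (Rmin_l (a1 - 1) (- n)); lra).
  assert (Hx' : x <= - n) by apply Rmin_r.
  assert (Hy : a2 < y) by (unfold y; pose proof (Rmax_l (a2 + 1) n); lra).
  assert (Hy' : n <= y) by apply Rmax_r.
  specialize (H3 x y (H1 x Hx) (H2 y Hy)); simpl in H3.
  assert (Hs : RInt f x y = plus (RInt f x (- n)) (plus (RInt f (- n) n) (RInt f n y))).
  { rewrite (RInt_Chasles (V := V) f (- n) n y) by (apply ex_RInt_cont, Hc).
    rewrite (RInt_Chasles (V := V) f x (- n) y); [reflexivity| |];
    apply ex_RInt_cont, Hc. }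
  rewrite Hs in H3.
  norm_replace V (minus (minus (plus (RInt f x (- n)) (plus (RInt f (- n) n) (RInt f n y))) l)
    (plus (RInt f x (- n)) (RInt f n y))).
  pose proof (dominated_RInt C f x (- n) Hc Hd Hx') as B1.
  pose proof (dominated_RInt C f n y Hc Hd Hy') as B2.
  eapply Rle_trans; [apply (norm_minus_le (V := V))|].
  eapply Rle_trans; [apply Rplus_le_compat; [left; exact H3|apply (norm_triangle (V := V))]|].
  eapply Rle_trans; [apply Rplus_le_compat_l, Rplus_le_compat; [exact B1|exact B2]|].
  pose proof (atan_bound x); pose proof (atan_bound y). nra.
Qed.

Lemma line_int_norm (C : R) (f : R -> V) (l : V) :
  (forall v, continuous f v) -> dominated C f -> is_line_int f l -> norm l <= C * PI.
Proof.
  intros Hc Hd Hl.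
  pose proof (line_int_bound C f l 0 Hc Hd Hl (Rle_refl 0)) as H.
  rewrite Ropp_0, RInt_point, Rminus_diag, Rminus_0_r in H.
  match type of H with norm ?x <= _ =>
    assert (H0 : x = opp l) by (Rmodule V); rewrite H0 in H end.
  eapply Rle_trans; [|exact H].
  right; symmetry; apply (norm_opp (V := V)).
Qed.

Lemma ex_line_int (C : R) (f : R -> V) :
  (forall v, continuous f v) -> dominated C f -> exists l, is_line_int f l.
Proof.
  intros Hc Hd.
  pose proof (dominated_pos C f Hd) as HC.
  assert (Hcau : forall n m, 0 <= n <= m ->
    norm (minus (RInt f (- n) n) (RInt f (- m) m)) <= C * (PI - (atan n - atan (- n)))).
  { intros n m Hnm.
    assert (Hs : RInt f (- m) m = plus (RInt f (- m) (- n)) (plus (RInt f (- n) n) (RInt f n m))).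
    { rewrite (RInt_Chasles (V := V) f (- n) n m) by (apply ex_RInt_cont, Hc).
      rewrite (RInt_Chasles (V := V) f (- m) (- n) m); [reflexivity| |];
      apply ex_RInt_cont, Hc. }
    rewrite Hs.
    norm_replace V (opp (plus (RInt f (- m) (- n)) (RInt f n m))).
    eapply Rle_trans; [right; apply (norm_opp (V := V))|].
    eapply Rle_trans; [apply (norm_triangle (V := V))|].
    eapply Rle_trans; [apply Rplus_le_compat;
      [apply (dominated_RInt C f); [exact Hc|exact Hd|lra]
      |apply (dominated_RInt C f); [exact Hc|exact Hd|lra]]|].
    pose proof (atan_bound (- m)); pose proof (atan_bound m). nra. }
  destruct (proj1 (filterlim_locally_cauchy (U := V) (F := Rbar_locally p_infty)
    (fun n => RInt f (- n) n))) as [l Hl].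
  { intros eps.
    destruct (atan_tail (eps / (4 * (C + 1)))) as (A & HA & HA').
    { apply Rdiv_lt_0_compat; [apply cond_pos|lra]. }
    exists (fun n => A < n); split; [exists A; auto|].
    assert (Ha : forall u v, A < u -> u <= v -> norm (minus (RInt f (- u) u) (RInt f (- v) v)) < eps).
    { intros u v Hu Huv; eapply Rle_lt_trans; [apply Hcau; lra|].
      destruct (HA' u ltac:(lra)) as [T1 T2].
      set (e := eps / (4 * (C + 1))) in *.
      assert (Ee : pos eps = 4 * (C + 1) * e) by (unfold e; field; lra).
      assert (0 < e) by (unfold e; apply Rdiv_lt_0_compat; [apply cond_pos|lra]).
      nra. }
    intros u v Hu Hv; apply (norm_compat1 (V := V)).
    destruct (Rle_dec u v) as [Huv|Huv].
    - eapply Rle_lt_trans; [right; apply (norm_minus_sym (V := V))|]; apply Ha; auto.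
    - apply Ha; lra. }
  exists l; apply (is_line_int_intro C); auto.
  intros n Hn.
  apply le_epsilon; intros eps He.
  pose proof (filterlim_eps (V := V) _ _ _ Hl eps He) as [a Ha].
  specialize (Ha (Rmax (a + 1) n)).
  pose proof (Rmax_l (a + 1) n); pose proof (Rmax_r (a + 1) n).
  eapply Rle_trans; [apply (norm_minus_trans (V := V) (RInt f (- Rmax (a + 1) n) (Rmax (a + 1) n)))|].
  apply Rplus_le_compat; [apply Hcau; lra|left; apply Ha; lra].
Qed.

Lemma is_line_int_unique (f : R -> V) (l l' : V) :
  is_line_int f l -> is_line_int f l' -> l = l'.
Proof.
  intros H H'.
  rewrite <- (is_RInt_gen_unique f l H), <- (is_RInt_gen_unique f l' H'); reflexivity.
Qed.

Lemma is_line_int_ext (f g : R -> V) (l : V) :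
  (forall v, f v = g v) -> is_line_int f l -> is_line_int g l.
Proof.
  intros H; apply (is_RInt_gen_ext (V := V)); apply filter_forall; auto.
Qed.

End Integrals.

(** * Integrals over the real line: images, substitutions, exchange *)

Lemma is_RInt_gen_linear {V W : NormedModule R_AbsRing} (T : V -> W) (k : R)
    (Tadd : forall x y, T (plus x y) = plus (T x) (T y))
    (Tscal : forall (r : R) x, T (scal r x) = scal r (T x))
    (Tnorm : forall x, norm (T x) <= k * norm x)
    (Fa Fb : (R -> Prop) -> Prop) {FFa : Filter Fa} {FFb : Filter Fb} (f : R -> V) (l : V) :
  is_RInt_gen f Fa Fb l -> is_RInt_gen (fun x => T (f x)) Fa Fb (T l).
Proof.
  intros H P HP.
  pose proof (linear_continuous T k Tadd Tscal Tnorm l) as Tc.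
  generalize (H _ (Tc P HP)); unfold filtermapi; apply filter_imp.
  intros ab (y & Hy1 & Hy2); exists (T y); split; [|exact Hy2].
  eapply is_RInt_linear; eauto.
Qed.

Section LineIntegrals.
Context {V : CompleteNormedModule R_AbsRing}.

Lemma line_int_translate (f : R -> V) (l : V) (x : R) :
  is_line_int f l -> is_line_int (fun v => f (v + x)) l.
Proof.
  intros H P HP; destruct (H P HP) as [Q1 Q2 [a Ha] [b Hb] H3].
  apply Filter_prod with (Q := fun y => y < a - x) (R := fun y => b - x < y).
  { exists (a - x); auto. }
  { exists (b - x); auto. }
  intros y z Hy Hz; simpl.
  destruct (H3 (y + x) (z + x)) as (w & Hw1 & Hw2); [apply Ha; lra|apply Hb; lra|].
  exists w; split; [|exact Hw2].
  pose proof (is_RInt_comp_lin (V := V) f 1 x y z w) as Hc.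
  rewrite !Rmult_1_l in Hc; specialize (Hc Hw1).
  eapply (is_RInt_ext (V := V)); [|exact Hc].
  intros t _; simpl; rewrite Rmult_1_l; apply (scal_one (V := V)).
Qed.

(** By the substitution [s = exp v] the integrals over the half line that define
    moments and Laplace transforms are line integrals. *)
Lemma line_int_exp (f : R -> V) (l : V) :
  (forall v, continuous f v) -> is_line_int f l ->
  is_RInt_gen (fun s => scal (/ s) (f (ln s))) (at_right 0) (Rbar_locally p_infty) l.
Proof.
  intros Hc H P HP; destruct (H P HP) as [Q1 Q2 [a Ha] [b Hb] H3].
  apply Filter_prod with (Q := fun y => 0 < y < exp a) (R := fun y => exp b < y).
  { exists (mkposreal _ (exp_pos a)); intros y Hy Hy0.
    unfold ball in Hy; simpl in Hy; unfold AbsRing_ball, abs, minus, plus, opp in Hy; simpl in Hy.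
    apply Rabs_def2 in Hy; lra. }
  { exists (exp b); auto. }
  intros y z Hy Hz; simpl.
  assert (Hz0 : 0 < z) by (pose proof (exp_pos b); lra).
  destruct (H3 (ln y) (ln z)) as (w & Hw1 & Hw2).
  { apply Ha; rewrite <- (ln_exp a); apply ln_increasing; lra. }
  { apply Hb; rewrite <- (ln_exp b); apply ln_increasing; [apply exp_pos|lra]. }
  exists w; split; [|exact Hw2].
  simpl in Hw1; rewrite <- (is_RInt_unique _ _ _ _ Hw1).
  apply (is_RInt_comp f ln (fun y => / y)).
  - intros; apply Hc.
  - intros x Hx.
    assert (0 < x) by (pose proof (Rmin_glb_lt y z 0 ltac:(lra) Hz0); lra).
    split; [auto_derive; [lra|field; lra]|].
    apply (ex_derive_continuous (V := R_NormedModule)); auto_derive; lra.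
Qed.

(** The truncated integrals converge uniformly in the parameter, by the domination,
    so the exchange is inherited from bounded rectangles. *)
Lemma line_int_fubini (f : R -> R -> V) (L : R -> V) (C a b : R) :
  a <= b -> (forall s t, continuous (fun p => f (fst p) (snd p)) (s, t)) ->
  (forall s, dominated C (f s)) ->
  (forall s, is_line_int (f s) (L s)) ->
  (forall s, continuous L s) /\
  (forall t, continuous (fun t => RInt (fun s => f s t) a b) t) /\
  is_line_int (fun t => RInt (fun s => f s t) a b) (RInt L a b).
Proof.
  intros Hab Hc Hd HL.
  pose proof (dominated_pos C _ (Hd 0)) as HC.
  assert (Hc' : forall t s, continuous (fun p => f (snd p) (fst p)) (t, s))
    by (intros t s; apply continuous_swap_args, Hc).
  assert (Cs : forall s t, continuous (f s) t) by (intros; apply continuous_pair_r, Hc).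
  assert (Ct : forall s t, continuous (fun u => f u t) s)
    by (intros; apply continuous_pair_l, Hc).
  assert (B : forall s n, 0 <= n ->
    norm (minus (RInt (f s) (- n) n) (L s)) <= C * (PI - (atan n - atan (- n)))).
  { intros s n Hn; apply line_int_bound; auto. }
  assert (CL : forall s, continuous L s).
  { intros s; apply (eps_continuous (V := V)); intros eps He.
    destruct (atan_tail (eps / (8 * (C + 1)))) as (A & HA & HA').
    { apply Rdiv_lt_0_compat; lra. }
    assert (HB : forall u, norm (minus (RInt (f u) (- A) A) (L u)) < eps / 3).
    { intros u; eapply Rle_lt_trans; [apply B; lra|].
      destruct (HA' A (Rle_refl A)) as [T1 T2].
      set (e := eps / (8 * (C + 1))) in *.
      assert (Ee : eps = 8 * (C + 1) * e) by (unfold e; field; lra).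
      assert (0 < e) by (unfold e; apply Rdiv_lt_0_compat; lra).
      nra. }
    pose proof (continuous_RInt_slices f (- A) A ltac:(lra) Hc s) as Hn.
    generalize (continuous_eps (V := V) _ _ Hn (eps / 3) ltac:(lra)); apply filter_imp.
    intros u Hu.
    replace eps with ((eps / 3 + eps / 3) + eps / 3) by field.
    apply (norm_minus_lt (V := V) (RInt (f s) (- A) A)).
    - apply (norm_minus_lt (V := V) (RInt (f u) (- A) A)).
      + eapply Rle_lt_trans; [right; apply (norm_minus_sym (V := V))|apply HB].
      + eapply Rle_lt_trans; [right; apply (norm_minus_sym (V := V))|apply Hu].
    - eapply Rle_lt_trans; [right; apply (norm_minus_sym (V := V))|apply HB]. }
  assert (CJ : forall t, continuous (fun t => RInt (fun s => f s t) a b) t).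
  { intros t; apply (continuous_RInt_slices (fun t s => f s t)); auto. }
  repeat split; auto.
  apply (is_line_int_intro (C * (b - a))); auto.
  - intros n Hn.
    rewrite <- (RInt_swap f a b (- n) n Hab ltac:(lra) Hc).
    rewrite (Rmult_comm C), Rmult_assoc.
    apply (RInt_close (V := V)); [exact Hab| | |].
    + apply ex_RInt_cont; intros s; apply continuous_RInt_slices; [lra|auto].
    + apply ex_RInt_cont, CL.
    + intros s _; apply B; lra.
  - intros t.
    replace (C * (b - a) / (1 + t ^ 2)) with ((b - a) * (C / (1 + t ^ 2))) by (field; nra).
    apply (norm_RInt_le_const (fun s => f s t) a b); [exact Hab| |].
    + intros s _; apply Hd.
    + apply (RInt_correct (V := V)), ex_RInt_cont; intros; apply Ct.
Qed.

End LineIntegrals.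

(** * Derivatives and the complex exponential *)

Lemma plus_minus_cancel {G : AbelianGroup} (x h : G) : minus (plus x h) x = h.
Proof. unfold minus; rewrite (plus_comm x h), <- plus_assoc.
  etransitivity; [apply f_equal, plus_opp_r|apply plus_zero_r]. Qed.

Lemma minus_plus_cancel {G : AbelianGroup} (x y : G) : plus x (minus y x) = y.
Proof. unfold minus; rewrite (plus_comm y), plus_assoc.
  etransitivity; [apply (f_equal (fun z => plus z y)), plus_opp_r|apply plus_zero_l]. Qed.

Lemma is_derive_eps {K : AbsRing} {V : NormedModule K} (f : K -> V) (x : K) (l : V) :
  is_derive f x l <->
  forall eps, 0 < eps -> exists rho, 0 < rho /\ forall h : K, abs h < rho ->
    norm (minus (minus (f (plus x h)) (f x)) (scal h l)) <= eps * abs h.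
Proof.
  split.
  - intros [_ H] eps He.
    specialize (H x (fun P H => H) (mkposreal eps He)).
    destruct H as [rho Hr]; exists rho; split; [apply cond_pos|].
    intros h Hh.
    assert (E : minus (plus x h) x = h).
    { apply (@plus_minus_cancel K). }
    specialize (Hr (plus x h)).
    assert (Hb : ball x rho (plus x h)).
    { unfold ball; simpl; unfold AbsRing_ball; rewrite E; exact Hh. }
    assert (Hr' : norm (minus (minus (f (plus x h)) (f x)) (scal (minus (plus x h) x) l)) <=
      eps * abs (minus (plus x h) x)) by exact (Hr Hb).
    rewrite E in Hr'; exact Hr'.
  - intros H; split.
    + apply is_linear_scal_l.
    + intros y Hy.
      assert (Hxy : x = y).
      { apply (is_filter_lim_locally_unique (V := AbsRing_NormedModule K)); exact Hy. }
      subst y; intros eps.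
      destruct (H eps (cond_pos eps)) as (rho & Hr1 & Hr2).
      exists (mkposreal rho Hr1); intros y Hb.
      unfold ball in Hb; simpl in Hb; unfold AbsRing_ball in Hb.
      specialize (Hr2 (minus y x) Hb).
      assert (E : plus x (minus y x) = y).
      { apply (@minus_plus_cancel K). }
      change (norm (minus (minus (f y) (f x)) (scal (minus y x) l)) <= eps * abs (minus y x)).
      rewrite E in Hr2; exact Hr2.
Qed.

Lemma Cmod_le_abs (z : C) : Cmod z <= Rabs (Re z) + Rabs (Im z).
Proof.
  destruct z as [x y]; unfold Re, Im; simpl.
  replace (x, y) with (Cplus (RtoC x) (Cmult Ci (RtoC y)))
    by (unfold Cplus, Cmult, RtoC, Ci; simpl; f_equal; ring).
  eapply Rle_trans; [apply Cmod_triangle|].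
  rewrite Cmod_mult, !Cmod_R, Cmod_Ci; lra.
Qed.

Lemma im_le_Cmod (z : C) : Rabs (Im z) <= Cmod z.
Proof. eapply Rle_trans; [apply Rmax_r|apply (Rmax_Cmod z)]. Qed.

Lemma locally_ball_C (z : C) (P : C -> Prop) :
  locally (T := C_UniformSpace) z P ->
  exists rho, 0 < rho /\ forall w, Cmod (Cminus w z) < rho -> P w.
Proof.
  intros H; apply locally_C in H; destruct H as [rho H].
  exists rho; split; [apply cond_pos|]; intros w Hw; apply H, Hw.
Qed.

Lemma Cexp_plus (a b : C) : Cexp (Cplus a b) = Cmult (Cexp a) (Cexp b).
Proof.
  destruct a as [a1 a2], b as [b1 b2]; unfold Cexp, Re, Im, Cplus, Cmult; simpl.
  rewrite exp_plus, cos_plus, sin_plus; f_equal; ring.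
Qed.

Lemma Cexp_0 : Cexp (RtoC 0) = RtoC 1.
Proof. unfold Cexp, RtoC, Re, Im; simpl. rewrite exp_0, cos_0, sin_0; f_equal; ring. Qed.

Lemma Cmod_Cexp (w : C) : Cmod (Cexp w) = exp (Re w).
Proof.
  unfold Cexp.
  replace (exp (Re w) * cos (Im w), exp (Re w) * sin (Im w)) with
    (Cmult (RtoC (exp (Re w))) (cos (Im w), sin (Im w)))
    by (unfold Cmult, RtoC; simpl; f_equal; ring).
  rewrite Cmod_mult, Cmod_R, Rabs_pos_eq by (left; apply exp_pos).
  replace (Cmod (cos (Im w), sin (Im w))) with 1; [ring|].
  unfold Cmod; simpl.
  replace (cos (Im w) * (cos (Im w) * 1) + sin (Im w) * (sin (Im w) * 1)) with 1.
  - now rewrite sqrt_1.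
  - pose proof (sin2_cos2 (Im w)) as H; unfold Rsqr in H; lra.
Qed.

Lemma Cexp_neq_0 (w : C) : Cexp w <> RtoC 0.
Proof. apply Cmod_gt_0; rewrite Cmod_Cexp; apply exp_pos. Qed.

Lemma Cexp_opp (w : C) : Cmult (Cexp (Copp w)) (Cexp w) = RtoC 1.
Proof. rewrite <- Cexp_plus, <- Cexp_0; f_equal; ring. Qed.

Lemma Cexp_period (w : C) : Cexp (Cplus w (0, 2 * PI)) = Cexp w.
Proof.
  destruct w as [x y]; unfold Cexp, Re, Im, Cplus; simpl.
  rewrite Rplus_0_r, cos_plus, sin_plus, cos_2PI, sin_2PI; f_equal; ring.
Qed.

Lemma Cexp_R (x : R) : Cexp (RtoC x) = RtoC (exp x).
Proof.
  unfold Cexp, RtoC, Re, Im; simpl; rewrite cos_0, sin_0; f_equal; ring.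
Qed.

Lemma is_derive_R_eps (f : R -> R) (x l eps : R) : is_derive f x l -> 0 < eps ->
  exists rho, 0 < rho /\ forall h, Rabs h < rho -> Rabs (f (x + h) - f x - h * l) <= eps * Rabs h.
Proof. intros H He; exact (proj1 (is_derive_eps f x l) H eps He). Qed.

(** By the functional equation only the derivatives of [exp], [cos] and [sin] at 0
    are needed. *)
Lemma Cexp_derive (w : C) : is_derive (K := C_AbsRing) (V := C_NormedModule) Cexp w (Cexp w).
Proof.
  apply is_derive_eps; intros eps He.
  set (e := Rmin 1 (eps / (7 * exp (Re w)))).
  pose proof (exp_pos (Re w)) as Hw.
  assert (He0 : 0 < e) by (apply Rmin_glb_lt; [lra|apply Rdiv_lt_0_compat; lra]).
  assert (He1 : 7 * exp (Re w) * e <= eps).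
  { apply Rle_trans with (7 * exp (Re w) * (eps / (7 * exp (Re w)))).
    - apply Rmult_le_compat_l; [lra|apply Rmin_r].
    - right; field; lra. }
  assert (D1 : is_derive exp 0 1) by (auto_derive; [trivial|rewrite exp_0; ring]).
  assert (D2 : is_derive cos 0 0) by (auto_derive; [trivial|rewrite sin_0; ring]).
  assert (D3 : is_derive sin 0 1) by (auto_derive; [trivial|rewrite cos_0; ring]).
  destruct (is_derive_R_eps _ _ _ _ D1 He0) as (r1 & Hr1 & B1).
  destruct (is_derive_R_eps _ _ _ _ D2 He0) as (r2 & Hr2 & B2).
  destruct (is_derive_R_eps _ _ _ _ D3 He0) as (r3 & Hr3 & B3).
  exists (Rmin (Rmin r1 r2) (Rmin r3 e)); split.
  { clearbody e; repeat apply Rmin_glb_lt; lra. }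
  intros h Hh.
  assert (Hh' : Cmod h < Rmin (Rmin r1 r2) (Rmin r3 e)) by exact Hh.
  pose proof (Rmin_l (Rmin r1 r2) (Rmin r3 e)); pose proof (Rmin_r (Rmin r1 r2) (Rmin r3 e)).
  pose proof (Rmin_l r1 r2); pose proof (Rmin_r r1 r2).
  pose proof (Rmin_l r3 e); pose proof (Rmin_r r3 e).
  pose proof (re_le_Cmod h) as Hx; pose proof (im_le_Cmod h) as Hy.
  change (Cmod (Cminus (Cminus (Cexp (Cplus w h)) (Cexp w)) (Cmult h (Cexp w))) <= eps * Cmod h).
  rewrite Cexp_plus.
  replace (Cminus (Cminus (Cmult (Cexp w) (Cexp h)) (Cexp w)) (Cmult h (Cexp w))) with
    (Cmult (Cexp w) (Cminus (Cminus (Cexp h) (RtoC 1)) h)) by ring.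
  rewrite Cmod_mult, Cmod_Cexp.
  apply Rle_trans with (exp (Re w) * (7 * e * Cmod h)).
  2:{ pose proof (Cmod_ge_0 h); nra. }
  apply Rmult_le_compat_l; [lra|].
  eapply Rle_trans; [apply Cmod_le_abs|].
  destruct h as [x y]; unfold Re, Im in Hx, Hy; simpl in Hx, Hy.
  set (m := Cmod (x, y)) in *.
  specialize (B1 x ltac:(lra)); specialize (B2 y ltac:(lra)); specialize (B3 y ltac:(lra)).
  rewrite Rplus_0_l in B1, B2, B3; rewrite exp_0 in B1; rewrite cos_0 in B2; rewrite sin_0 in B3.
  unfold Cexp, Re, Im, Cminus, Cplus, Copp, RtoC; simpl.
  pose proof (COS_bound y) as Hcos; pose proof (SIN_bound y) as Hsin.
  assert (Hm : 0 <= m) by apply Cmod_ge_0.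
  assert (He2 : e <= 1) by apply Rmin_l.
  replace (exp x * cos y + - (1) + - x) with
    ((exp x - 1 - x * 1) * cos y + (cos y - 1 - y * 0) * (1 + x)) by ring.
  replace (exp x * sin y + - 0 + - y) with
    ((exp x - 1 - x * 1) * sin y + (sin y - 0 - y * 1) * (1 + x) + x * y) by ring.
  assert (A1 : Rabs (cos y) <= 1) by (apply Rabs_le; lra).
  assert (A2 : Rabs (sin y) <= 1) by (apply Rabs_le; lra).
  assert (A3 : Rabs (1 + x) <= 2).
  { eapply Rle_trans; [apply Rabs_triang|]; rewrite Rabs_R1; lra. }
  assert (U : forall p q P Q, Rabs p <= P -> Rabs q <= Q -> Rabs (p * q) <= P * Q).
  { intros p q P' Q' H7 H8; rewrite Rabs_mult; apply Rmult_le_compat; auto using Rabs_pos. }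
  pose proof (U _ _ _ _ B1 A1) as U1; pose proof (U _ _ _ _ B2 A3) as U2.
  pose proof (U _ _ _ _ B1 A2) as U3; pose proof (U _ _ _ _ B3 A3) as U4.
  assert (U5 : Rabs (x * y) <= e * m) by (apply U; lra).
  pose proof (Rabs_triang ((exp x - 1 - x * 1) * cos y) ((cos y - 1 - y * 0) * (1 + x))).
  pose proof (Rabs_triang ((exp x - 1 - x * 1) * sin y + (sin y - 0 - y * 1) * (1 + x)) (x * y)).
  pose proof (Rabs_triang ((exp x - 1 - x * 1) * sin y) ((sin y - 0 - y * 1) * (1 + x))).
  assert (e * Rabs x <= e * m) by (apply Rmult_le_compat_l; lra).
  assert (e * Rabs y <= e * m) by (apply Rmult_le_compat_l; lra).
  assert (Z : e * Rabs x + 2 * (e * Rabs y) + (e * Rabs x + 2 * (e * Rabs y) + e * m) <= 7 * (e * m)) by lra.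
  lra.
Qed.

(** * Goursat's theorem in a Banach space *)

Notation VC := (restrict_scalars C_CompleteNormedModule).

Lemma is_derive_pair (p q : R -> R) (t p' q' : R) :
  is_derive p t p' -> is_derive q t q' ->
  is_derive (V := VC) (fun u => (p u, q u)) t (p', q').
Proof.
  intros Hp Hq; apply is_derive_eps; intros eps He.
  destruct (is_derive_R_eps _ _ _ (eps / 2) Hp ltac:(lra)) as (r1 & Hr1 & B1).
  destruct (is_derive_R_eps _ _ _ (eps / 2) Hq ltac:(lra)) as (r2 & Hr2 & B2).
  exists (Rmin r1 r2); split; [apply Rmin_glb_lt; lra|].
  intros h Hh; change (abs h) with (Rabs h) in *.
  pose proof (Rmin_l r1 r2); pose proof (Rmin_r r1 r2).
  specialize (B1 h ltac:(lra)); specialize (B2 h ltac:(lra)).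
  change (plus t h) with (t + h).
  change (Cmod (Cminus (Cminus (p (t + h), q (t + h)) (p t, q t)) (Cmult (RtoC h) (p', q')))
    <= eps * Rabs h).
  eapply Rle_trans; [apply Cmod_le_abs|].
  unfold Re, Im, Cminus, Cplus, Copp, Cmult, RtoC; simpl.
  replace (p (t + h) + - p t + - (h * p' - 0 * q')) with (p (t + h) - p t - h * p') by ring.
  replace (q (t + h) + - q t + - (h * q' + 0 * p')) with (q (t + h) - q t - h * q') by ring.
  lra.
Qed.

Ltac Cnorm_replace V b :=
  match goal with |- context [norm ?x] =>
    let H := fresh in assert (H : x = b) by (Cmodule V); rewrite H; clear H end.

Section Complex.
Context (E : CompleteNormedModule C_AbsRing).
Let VE := restrict_scalars E.

Lemma is_derive_continuous_C (f : C -> E) (z : C) (l : E) :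
  is_derive (K := C_AbsRing) f z l -> continuous (T := C_UniformSpace) (U := E) f z.
Proof.
  intros H P HP; apply locally_C.
  apply (ex_derive_continuous (K := C_AbsRing)); [exists l; exact H|exact HP].
Qed.

Lemma is_derive_curve (f : C -> E) (g : R -> C) (t : R) (g' : C) (l : E) :
  is_derive (K := C_AbsRing) f (g t) l -> is_derive (V := VC) g t g' ->
  is_derive (V := VE) (fun u => f (g u)) t (scal g' l).
Proof.
  intros Hf Hg; apply is_derive_eps; intros eps He.
  pose proof (proj1 (is_derive_eps _ _ _) Hf) as Bf.
  pose proof (proj1 (is_derive_eps _ _ _) Hg) as Bg.
  set (N := norm l). assert (HN : 0 <= N) by apply norm_ge_0.
  set (G := Cmod g'). assert (HG : 0 <= G) by apply Cmod_ge_0.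
  destruct (Bf (eps / (2 * (G + 1)))) as (rf & Hrf & Cf); [apply Rdiv_lt_0_compat; lra|].
  set (eg := Rmin 1 (eps / (2 * (N + 1)))).
  assert (Heg : 0 < eg) by (apply Rmin_glb_lt; [lra|apply Rdiv_lt_0_compat; lra]).
  assert (Heg1 : eg <= 1) by apply Rmin_l.
  assert (Heg2 : eg * (N + 1) <= eps / 2).
  { apply Rle_trans with (eps / (2 * (N + 1)) * (N + 1)).
    - apply Rmult_le_compat_r; [lra|apply Rmin_r].
    - right; field; lra. }
  destruct (Bg eg Heg) as (rg & Hrg & Cg).
  exists (Rmin rg (rf / (G + 1))); split.
  { apply Rmin_glb_lt; [lra|apply Rdiv_lt_0_compat; lra]. }
  intros h Hh.
  assert (Hh' : Rabs h < Rmin rg (rf / (G + 1))) by exact Hh; clear Hh.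
  pose proof (Rmin_l rg (rf / (G + 1))); pose proof (Rmin_r rg (rf / (G + 1))).
  set (k := Cminus (g (t + h)) (g t)).
  assert (Hk1 : Cmod (Cminus k (Cmult (RtoC h) g')) <= eg * Rabs h).
  { apply (Cg h); change (Rabs h < rg); lra. }
  assert (Hk2 : Cmod k <= (G + 1) * Rabs h).
  { replace k with (Cplus (Cminus k (Cmult (RtoC h) g')) (Cmult (RtoC h) g')) by ring.
    eapply Rle_trans; [apply Cmod_triangle|].
    rewrite Cmod_mult, Cmod_R; fold G.
    pose proof (Rabs_pos h). nra. }
  assert (Hk3 : Cmod k < rf).
  { eapply Rle_lt_trans; [exact Hk2|].
    apply Rlt_le_trans with ((G + 1) * (rf / (G + 1))).
    - apply Rmult_lt_compat_l; lra.
    - right; field; lra. }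
  specialize (Cf k Hk3).
  assert (Ek : g (t + h) = Cplus (g t) k) by (unfold k; ring).
  change (norm (minus (minus (f (g (t + h))) (f (g t))) (scal (RtoC h) (scal g' l)))
    <= eps * Rabs h).
  rewrite Ek.
  assert (Es : minus (minus (f (Cplus (g t) k)) (f (g t))) (scal (RtoC h) (scal g' l)) =
    plus (minus (minus (f (Cplus (g t) k)) (f (g t))) (scal k l))
      (scal (Cminus k (Cmult (RtoC h) g')) l)).
  { Cmodule E. }
  rewrite Es.
  eapply Rle_trans; [apply (norm_triangle (V := E))|].
  assert (Hs : norm (scal (Cminus k (Cmult (RtoC h) g')) l) <= eg * Rabs h * N).
  { eapply Rle_trans; [apply (norm_scal (V := E))|].
    apply Rmult_le_compat_r; [exact HN|exact Hk1]. }
  assert (Cf' : norm (minus (minus (f (Cplus (g t) k)) (f (g t))) (scal k l))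
     <= eps / (2 * (G + 1)) * Cmod k) by exact Cf.
  assert (Cf2 : eps / (2 * (G + 1)) * Cmod k <= eps / 2 * Rabs h).
  { replace (eps / 2 * Rabs h) with (eps / (2 * (G + 1)) * ((G + 1) * Rabs h)) by (field; lra).
    apply Rmult_le_compat_l; [left; apply Rdiv_lt_0_compat; lra|exact Hk2]. }
  pose proof (Rabs_pos h).
  apply Rle_trans with (eps / 2 * Rabs h + eg * Rabs h * N).
  - apply Rplus_le_compat; [eapply Rle_trans; [exact Cf'|exact Cf2]|exact Hs].
  - nra.
Qed.

Lemma continuous_horizontal (f : C -> E) (x y : R) :
  continuous (T := C_UniformSpace) (U := E) f (x, y) -> continuous (U := VE) (fun t => f (t, y)) x.
Proof.
  intros H P HP; destruct (H P HP) as [eps He]; exists eps; intros t Ht.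
  apply (He (t, y)); split; [exact Ht|apply (ball_center (M := R_UniformSpace))].
Qed.

Lemma continuous_vertical (f : C -> E) (x y : R) :
  continuous (T := C_UniformSpace) (U := E) f (x, y) -> continuous (U := VE) (fun t => f (x, t)) y.
Proof.
  intros H P HP; destruct (H P HP) as [eps He]; exists eps; intros t Ht.
  apply (He (x, t)); split; [apply (ball_center (M := R_UniformSpace))|exact Ht].
Qed.

Lemma Enorm_scal (c : C) (x : E) : norm (scal c x) <= Cmod c * norm x.
Proof. apply (norm_scal (V := E)). Qed.
Lemma Enorm_plus (x y : E) : norm (plus x y) <= norm x + norm y.
Proof. apply (norm_triangle (V := E)). Qed.
Lemma Enorm_minus (x y : E) : norm (minus x y) <= norm x + norm y.
Proof. apply (norm_minus_le (V := E)). Qed.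
Lemma Enorm_minus_sym (x y : E) : norm (minus x y) = norm (minus y x).
Proof. apply (norm_minus_sym (V := E)). Qed.
Lemma Enorm_ge_0 (x : E) : 0 <= norm x.
Proof. apply (norm_ge_0 (V := E)). Qed.

Lemma is_RInt_Cscal (f : R -> E) (c : C) (a b : R) (l : E) :
  is_RInt (V := VE) f a b l -> is_RInt (V := VE) (fun t => scal c (f t)) a b (scal c l).
Proof.
  apply (is_RInt_linear (V := VE) (W := VE) (fun x : E => scal c x) (Cmod c)).
  - intros x y; apply (scal_distr_l (V := E)).
  - intros r x; change (scal c (scal (RtoC r) x) = scal (RtoC r) (scal c x)).
    Cmodule E.
  - intros x; apply Enorm_scal.
Qed.

Lemma is_derive_horizontal (P : C -> E) (x y : R) (l : E) :
  is_derive (K := C_AbsRing) P (x, y) l ->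
  is_derive (V := VE) (fun t => P (t, y)) x l.
Proof.
  intros H.
  replace l with (scal (RtoC 1) l) by apply (scal_one (V := E)).
  apply (is_derive_curve P (fun t => (t, y)) x (RtoC 1)); [exact H|].
  apply (is_derive_pair (fun t => t) (fun _ => y)); auto_derive; auto.
Qed.

Lemma is_derive_vertical (P : C -> E) (x y : R) (l : E) :
  is_derive (K := C_AbsRing) P (x, y) l ->
  is_derive (V := VE) (fun t => P (x, t)) y (scal Ci l).
Proof.
  intros H.
  apply (is_derive_curve P (fun t => (x, t)) y Ci); [exact H|].
  apply (is_derive_pair (fun _ => x) (fun t => t)); auto_derive; auto.
Qed.

Lemma RInt_horizontal (P g : C -> E) (x x' y : R) :
  (forall t, Rmin x x' <= t <= Rmax x x' -> is_derive (K := C_AbsRing) P (t, y) (g (t, y)) /\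
     continuous (T := C_UniformSpace) (U := E) g (t, y)) ->
  is_RInt (V := VE) (fun t => g (t, y)) x x' (minus (P (x', y)) (P (x, y))).
Proof.
  intros H; apply (is_RInt_derive (V := VE) (fun t => P (t, y))).
  - intros t Ht; apply is_derive_horizontal, H, Ht.
  - intros t Ht; apply continuous_horizontal, H, Ht.
Qed.

Lemma RInt_vertical (P g : C -> E) (x y y' : R) :
  (forall t, Rmin y y' <= t <= Rmax y y' -> is_derive (K := C_AbsRing) P (x, t) (g (x, t)) /\
     continuous (T := C_UniformSpace) (U := E) g (x, t)) ->
  is_RInt (V := VE) (fun t => scal Ci (g (x, t))) y y' (minus (P (x, y')) (P (x, y))).
Proof.
  intros H; apply (is_RInt_derive (V := VE) (fun t => P (x, t)) (fun t => scal Ci (g (x, t)))).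
  - intros t Ht; apply is_derive_vertical, H, Ht.
  - intros t Ht; apply (continuous_scal_r (V := E)).
    apply (continuous_vertical g), H, Ht.
Qed.

(** The integrals of [f(z) dz] along the sides of rectangles. *)
Definition hint (f : C -> E) (x x' y : R) : E := RInt (V := VE) (fun t => f (t, y)) x x'.
Definition vint (f : C -> E) (x y y' : R) : E := RInt (V := VE) (fun t => scal Ci (f (x, t))) y y'.

(** A primitive of the affine approximation used in Goursat's theorem. *)
Lemma affine_derive (z0 : C) (u l : E) (z : C) :
  is_derive (K := C_AbsRing) (fun w => plus (scal w u)
     (scal (Cmult (RtoC (/ 2)) (Cmult (Cminus w z0) (Cminus w z0))) l)) z
     (plus u (scal (Cminus z z0) l)) /\
  continuous (T := C_UniformSpace) (U := E) (fun w => plus u (scal (Cminus w z0) l)) z.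
Proof.
  assert (Aff : is_derive (K := C_AbsRing) (fun w => plus u (scal (Cminus w z0) l)) z l).
  { apply (proj2 (is_derive_eps (V := E) _ _ _)); intros eps He.
    exists 1; split; [lra|]; intros h _.
    change (norm (minus (minus (plus u (scal (Cminus (Cplus z h) z0) l))
       (plus u (scal (Cminus z z0) l))) (scal h l)) <= eps * Cmod h).
    assert (E0 : minus (minus (plus u (scal (Cminus (Cplus z h) z0) l))
       (plus u (scal (Cminus z z0) l))) (scal h l) = zero) by (Cmodule E).
    rewrite E0; eapply Rle_trans; [right; apply (norm_zero (V := E))|]. pose proof (Cmod_ge_0 h); nra. }
  split; [|eapply is_derive_continuous_C; exact Aff].
  apply (proj2 (is_derive_eps (V := E) _ _ _)); intros eps He.
  set (N := norm l + 1). assert (HN : 0 < N) by (pose proof (Enorm_ge_0 l); unfold N; lra).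
  exists (eps / N); split; [apply Rdiv_lt_0_compat; lra|]; intros h Hh.
  assert (Hh' : Cmod h < eps / N) by exact Hh.
  match goal with |- norm ?x <= _ =>
    assert (E0 : x = scal (Cmult (RtoC (/ 2)) (Cmult h h)) l) end.
  { change (minus (minus (plus (scal (Cplus z h) u)
       (scal (Cmult (RtoC (/ 2)) (Cmult (Cminus (Cplus z h) z0) (Cminus (Cplus z h) z0))) l))
     (plus (scal z u) (scal (Cmult (RtoC (/ 2)) (Cmult (Cminus z z0) (Cminus z z0))) l)))
     (scal h (plus u (scal (Cminus z z0) l))) = scal (Cmult (RtoC (/ 2)) (Cmult h h)) l).
    assert (C2 : RtoC (/ 2) = Cinv (RtoC 2)) by (rewrite RtoC_inv; [reflexivity|lra]).
    rewrite C2.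
    module_with C_Ring E ltac:(unfold plus, mult, one, zero, opp; simpl; try field; try (apply RtoC_inj_neq; lra)). }
  rewrite E0.
  eapply Rle_trans; [apply Enorm_scal|].
  rewrite !Cmod_mult, Cmod_R, Rabs_pos_eq by lra.
  change (abs h) with (Cmod h).
  assert (Cmod h * N <= eps).
  { apply Rle_trans with (eps / N * N); [apply Rmult_le_compat_r; lra|right; field; lra]. }
  pose proof (Cmod_ge_0 h); pose proof (Enorm_ge_0 l).
  assert (norm l <= N) by (unfold N; lra).
  assert (Cmod h * norm l <= eps) by nra.
  nra.
Qed.

Definition C_differentiable (f : C -> E) (z : C) : Prop :=
  exists l, is_derive (K := C_AbsRing) f z l.

Lemma C_differentiable_continuous (f : C -> E) (z : C) :
  C_differentiable f z -> continuous (T := C_UniformSpace) (U := E) f z.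
Proof. intros [l H]; eapply is_derive_continuous_C; exact H. Qed.

Lemma ex_hint (f : C -> E) (x x' y : R) :
  (forall t, Rmin x x' <= t <= Rmax x x' -> C_differentiable f (t, y)) ->
  ex_RInt (V := VE) (fun t => f (t, y)) x x'.
Proof.
  intros H; apply (ex_RInt_continuous (V := VE)); intros t Ht.
  apply continuous_horizontal, C_differentiable_continuous, H, Ht.
Qed.

Lemma ex_vint (f : C -> E) (x y y' : R) :
  (forall t, Rmin y y' <= t <= Rmax y y' -> C_differentiable f (x, t)) ->
  ex_RInt (V := VE) (fun t => scal Ci (f (x, t))) y y'.
Proof.
  intros H; apply (ex_RInt_continuous (V := VE)); intros t Ht.
  apply (continuous_scal_r (V := E)).
  apply (continuous_vertical f), C_differentiable_continuous, H, Ht.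
Qed.

Lemma RInt_edge (u v : R -> E) (x x' d : R) (l : E) :
  x <= x' -> ex_RInt (V := VE) u x x' -> is_RInt (V := VE) v x x' l ->
  (forall t, x <= t <= x' -> norm (minus (u t) (v t)) <= d) ->
  norm (minus (RInt (V := VE) u x x') l : E) <= (x' - x) * d.
Proof.
  intros Hx Hu Hv Hd.
  apply (norm_RInt_le_const (V := VE) (fun t => minus (u t) (v t)) x x'); [exact Hx|exact Hd|].
  apply (is_RInt_minus (V := VE)); [apply (RInt_correct (V := VE)), Hu|exact Hv].
Qed.

(** Goursat: differentiability at a point gives an affine approximation, whose
    boundary integral over a rectangle vanishes. *)
Lemma goursat (f : C -> E) (a b c d : R) : a <= b -> c <= d ->
  (forall x y, a <= x <= b -> c <= y <= d -> C_differentiable f (x, y)) ->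
  plus (hint f a b c) (vint f b c d) = plus (hint f a b d) (vint f a c d).
Proof.
  intros Hab Hcd Hf.
  assert (EH : forall x x' y, a <= x -> x <= x' -> x' <= b -> c <= y <= d ->
    ex_RInt (V := VE) (fun t => f (t, y)) x x').
  { intros x x' y H1 H2 H3 H4; apply ex_hint; intros t Ht.
    rewrite Rmin_left, Rmax_right in Ht by exact H2; apply Hf; lra. }
  assert (EV : forall x y y', a <= x <= b -> c <= y -> y <= y' -> y' <= d ->
    ex_RInt (V := VE) (fun t => scal Ci (f (x, t))) y y').
  { intros x y y' H1 H2 H3 H4; apply ex_vint; intros t Ht.
    rewrite Rmin_left, Rmax_right in Ht by exact H3; apply Hf; lra. }
  set (D := fun x x' y y' => minus (plus (hint f x x' y) (vint f x' y y'))
    (plus (hint f x x' y') (vint f x y y'))).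
  assert (Z : D a b c d = zero).
  2:{ transitivity (plus (D a b c d) (plus (hint f a b d) (vint f a c d))).
      - unfold D; Cmodule E.
      - rewrite Z; Cmodule E. }
  apply (bisection (V := VE) D a b c d Hab Hcd).
  - intros x m x' y y' H1 H2 H3 H4 H5 H6 H7; unfold D.
    assert (S1 : hint f x x' y = plus (hint f x m y) (hint f m x' y)).
    { symmetry; apply (RInt_Chasles (V := VE)); apply EH; lra. }
    assert (S2 : hint f x x' y' = plus (hint f x m y') (hint f m x' y')).
    { symmetry; apply (RInt_Chasles (V := VE)); apply EH; lra. }
    rewrite S1, S2; Cmodule E.
  - intros x x' y m y' H1 H2 H3 H4 H5 H6 H7; unfold D.
    assert (S1 : vint f x y y' = plus (vint f x y m) (vint f x m y')).
    { symmetry; apply (RInt_Chasles (V := VE)); apply EV; lra. }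
    assert (S2 : vint f x' y y' = plus (vint f x' y m) (vint f x' m y')).
    { symmetry; apply (RInt_Chasles (V := VE)); apply EV; lra. }
    rewrite S1, S2; Cmodule E.
  - intros p q Hp Hq eps He.
    destruct (Hf p q Hp Hq) as [l Hl].
    destruct (proj1 (is_derive_eps (V := E) _ _ _) Hl (eps / 2) ltac:(lra)) as (r & Hr & B).
    exists (r / 2); split; [lra|].
    intros x x' y y' Ha Hx Hb Hc Hy Hd Hx' Hy'.
    set (z0 := (p, q) : C) in *.
    set (s := (x' - x) + (y' - y)).
    set (A := fun z : C => plus (f z0) (scal (Cminus z z0) l)).
    set (P := fun w : C => plus (scal w (f z0))
     (scal (Cmult (RtoC (/ 2)) (Cmult (Cminus w z0) (Cminus w z0))) l)).
    assert (Hclose : forall u v, x <= u <= x' -> y <= v <= y' ->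
      norm (minus (f (u, v)) (A (u, v))) <= eps / 2 * s).
    { intros u v Hu Hv.
      set (h := Cminus (u, v) z0).
      assert (Hh : Cmod h <= s).
      { eapply Rle_trans; [apply Cmod_le_abs|]; unfold h, z0, s, Re, Im; simpl.
        apply Rplus_le_compat; apply Rabs_le; lra. }
      assert (Hh' : Cmod h < r) by (unfold s in *; lra).
      specialize (B h Hh').
      assert (Ez : Cplus z0 h = (u, v)) by (unfold h; ring).
      assert (B' : norm (minus (minus (f (Cplus z0 h)) (f z0)) (scal h l)) <= eps / 2 * Cmod h)
        by exact B.
      rewrite Ez in B'.
      replace (minus (f (u, v)) (A (u, v))) with (minus (minus (f (u, v)) (f z0)) (scal h l))
        by (unfold A, h; Cmodule E).
      eapply Rle_trans; [exact B'|]. apply Rmult_le_compat_l; lra. }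
    assert (IH : forall v, y <= v <= y' ->
      norm (minus (hint f x x' v) (minus (P (x', v)) (P (x, v)))) <= (x' - x) * (eps / 2 * s)).
    { intros v Hv; apply (RInt_edge (fun t => f (t, v)) (fun t => A (t, v))).
      - lra.
      - apply EH; lra.
      - apply RInt_horizontal; intros t _; apply affine_derive.
      - intros t Ht; apply Hclose; lra. }
    assert (IV : forall u, x <= u <= x' ->
      norm (minus (vint f u y y') (minus (P (u, y')) (P (u, y)))) <= (y' - y) * (eps / 2 * s)).
    { intros u Hu; apply (RInt_edge (fun t => scal Ci (f (u, t))) (fun t => scal Ci (A (u, t)))).
      - lra.
      - apply EV; lra.
      - apply RInt_vertical; intros t _; apply affine_derive.
      - intros t Ht.
        Cnorm_replace E (scal Ci (minus (f (u, t)) (A (u, t)))).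
        eapply Rle_trans; [apply Enorm_scal|].
        rewrite Cmod_Ci, Rmult_1_l; apply Hclose; lra. }
    pose proof (IH y ltac:(lra)) as I1; pose proof (IH y' ltac:(lra)) as I2.
    pose proof (IV x ltac:(lra)) as I3; pose proof (IV x' ltac:(lra)) as I4.
    assert (ED : D x x' y y' = minus
      (plus (minus (hint f x x' y) (minus (P (x', y)) (P (x, y))))
            (minus (vint f x' y y') (minus (P (x', y')) (P (x', y)))))
      (plus (minus (hint f x x' y') (minus (P (x', y')) (P (x, y'))))
            (minus (vint f x y y') (minus (P (x, y')) (P (x, y)))))).
    { unfold D; generalize (P (x, y)) (P (x', y)) (P (x, y')) (P (x', y')); intros; Cmodule E. }
    change (norm (D x x' y y' : E) <= eps * s ^ 2).
    rewrite ED.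
    eapply Rle_trans; [apply Enorm_minus|].
    eapply Rle_trans; [apply Rplus_le_compat; apply Enorm_plus|].
    assert (Es : eps * s ^ 2 = 2 * (((x' - x) + (y' - y)) * (eps / 2 * s))) by (unfold s; field).
    rewrite Es; lra.
Qed.

Lemma hint_swap (f : C -> E) (a b y : R) :
  (forall t, Rmin a b <= t <= Rmax a b -> C_differentiable f (t, y)) ->
  hint f b a y = opp (hint f a b y).
Proof. intros H; symmetry; apply (opp_RInt_swap (V := VE)), ex_hint, H. Qed.

Lemma vint_swap (f : C -> E) (x a b : R) :
  (forall t, Rmin a b <= t <= Rmax a b -> C_differentiable f (x, t)) ->
  vint f x b a = opp (vint f x a b).
Proof. intros H; symmetry; apply (opp_RInt_swap (V := VE)), ex_vint, H. Qed.

(** The primitive below is compared at points in arbitrary position, so the ends of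
    the sides cannot be assumed to be ordered. *)
Lemma goursat_gen (f : C -> E) (a b c d : R) :
  (forall x y, Rmin a b <= x <= Rmax a b -> Rmin c d <= y <= Rmax c d ->
     C_differentiable f (x, y)) ->
  plus (hint f a b c) (vint f b c d) = plus (hint f a b d) (vint f a c d).
Proof.
  intros Hf.
  set (a' := Rmin a b) in *; set (b' := Rmax a b) in *.
  set (c' := Rmin c d) in *; set (d' := Rmax c d) in *.
  assert (Hab : a' <= b') by apply Rminmax.
  assert (Hcd : c' <= d') by apply Rminmax.
  pose proof (goursat f a' b' c' d' Hab Hcd Hf) as G.
  assert (Sx : forall y, c' <= y <= d' -> hint f b' a' y = opp (hint f a' b' y)).
  { intros y Hy; apply hint_swap; intros t Ht.
    rewrite Rmin_left, Rmax_right in Ht by exact Hab; auto. }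
  assert (Sy : forall x, a' <= x <= b' -> vint f x d' c' = opp (vint f x c' d')).
  { intros y Hy; apply vint_swap; intros t Ht.
    rewrite Rmin_left, Rmax_right in Ht by exact Hcd; auto. }
  assert (Fin : forall p q r s p' q' r' s' : E, plus p q = plus r s ->
    (minus (plus p' q') (plus r' s') = minus (plus p q) (plus r s) \/
     minus (plus p' q') (plus r' s') = minus (plus r s) (plus p q)) -> plus p' q' = plus r' s').
  { intros p q r s p' q' r' s' H [H'|H'].
    - transitivity (plus (minus (plus p' q') (plus r' s')) (plus r' s')); [Cmodule E|].
      rewrite H', H; Cmodule E.
    - transitivity (plus (minus (plus p' q') (plus r' s')) (plus r' s')); [Cmodule E|].
      rewrite H', H; Cmodule E. }
  apply (Fin _ _ _ _ _ _ _ _ G).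
  destruct (Rle_dec a b) as [H1|H1]; destruct (Rle_dec c d) as [H2|H2].
  - assert (a' = a) by (apply Rmin_left; lra). assert (b' = b) by (apply Rmax_right; lra).
    assert (c' = c) by (apply Rmin_left; lra). assert (d' = d) by (apply Rmax_right; lra).
    left; congruence.
  - assert (Ea : a' = a) by (apply Rmin_left; lra). assert (Eb : b' = b) by (apply Rmax_right; lra).
    assert (Ec : c' = d) by (apply Rmin_right; lra). assert (Ed : d' = c) by (apply Rmax_left; lra).
    right; rewrite <- Ea, <- Eb, <- Ec, <- Ed, !Sy by lra; Cmodule E.
  - assert (Ea : a' = b) by (apply Rmin_right; lra). assert (Eb : b' = a) by (apply Rmax_left; lra).
    assert (Ec : c' = c) by (apply Rmin_left; lra). assert (Ed : d' = d) by (apply Rmax_right; lra).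
    right; rewrite <- Ea, <- Eb, <- Ec, <- Ed, !Sx by lra; Cmodule E.
  - assert (Ea : a' = b) by (apply Rmin_right; lra). assert (Eb : b' = a) by (apply Rmax_left; lra).
    assert (Ec : c' = d) by (apply Rmin_right; lra). assert (Ed : d' = c) by (apply Rmax_left; lra).
    left; rewrite <- Ea, <- Eb, <- Ec, <- Ed, !Sx, !Sy by lra; Cmodule E.
Qed.

(** The primitive is the integral along two sides of a rectangle with a corner at
    the origin; by Goursat's theorem either choice of the two sides may be used to
    estimate an increment. *)
Lemma entire_primitive (f : C -> E) : (forall z, C_differentiable f z) ->
  exists P : C -> E, forall z, is_derive (K := C_AbsRing) P z (f z).
Proof.
  intros Hf.
  assert (Hc : forall x x' y, ex_RInt (V := VE) (fun t => f (t, y)) x x').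
  { intros; apply ex_hint; auto. }
  assert (Hv : forall x y y', ex_RInt (V := VE) (fun t => scal Ci (f (x, t))) y y').
  { intros; apply ex_vint; auto. }
  exists (fun z => plus (hint f 0 (fst z) 0) (vint f (fst z) 0 (snd z))).
  intros [x y]; apply (proj2 (is_derive_eps (V := E) _ _ _)); intros eps He.
  pose proof (continuous_eps (V := E) _ _ (C_differentiable_continuous f (x, y) (Hf (x, y)))
     (eps / 2) ltac:(lra)) as Hl.
  apply locally_ball_C in Hl; destruct Hl as (r & Hr & B).
  exists (r / 2); split; [lra|]; intros [h k] Hh.
  assert (Hh' : Cmod (h, k) < r / 2) by exact Hh.
  pose proof (re_le_Cmod (h, k)) as Hre; pose proof (im_le_Cmod (h, k)) as Him.
  unfold Re, Im in Hre, Him; simpl in Hre, Him.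
  change (norm (minus (minus (plus (hint f 0 (x + h) 0) (vint f (x + h) 0 (y + k)))
    (plus (hint f 0 x 0) (vint f x 0 y))) (scal ((h, k) : C) (f (x, y)))) <= eps * Cmod (h, k)).
  assert (G := goursat_gen f x (x + h) 0 y (fun u v _ _ => Hf (u, v))).
  assert (S1 : hint f 0 (x + h) 0 = plus (hint f 0 x 0) (hint f x (x + h) 0)).
  { symmetry; apply (RInt_Chasles (V := VE)); apply Hc. }
  assert (S2 : vint f (x + h) 0 (y + k) = plus (vint f (x + h) 0 y) (vint f (x + h) y (y + k))).
  { symmetry; apply (RInt_Chasles (V := VE)); apply Hv. }
  assert (Eq : minus (minus (plus (hint f 0 (x + h) 0) (vint f (x + h) 0 (y + k)))
    (plus (hint f 0 x 0) (vint f x 0 y))) (scal ((h, k) : C) (f (x, y))) =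
    plus (minus (hint f x (x + h) y) (scal (RtoC h) (f (x, y))))
         (minus (vint f (x + h) y (y + k)) (scal (Cmult Ci (RtoC k)) (f (x, y))))).
  { transitivity (plus (minus (plus (hint f x (x + h) 0) (vint f (x + h) 0 y)) (vint f x 0 y))
      (minus (vint f (x + h) y (y + k)) (scal ((h, k) : C) (f (x, y))))).
    - rewrite S1, S2; Cmodule E.
    - rewrite G.
      replace (h, k) with (Cplus (RtoC h) (Cmult Ci (RtoC k)))
        by (unfold Cplus, Cmult, Ci, RtoC; simpl; f_equal; ring).
      Cmodule E. }
  rewrite Eq.
  eapply Rle_trans; [apply Enorm_plus|].
  assert (B1 : norm (minus (hint f x (x + h) y) (scal (RtoC h) (f (x, y)))) <= Rabs h * (eps / 2)).
  { replace (Rabs h) with (Rabs (x + h - x)) by (f_equal; ring).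
    apply (norm_RInt_le_const_abs (V := VE) (fun t => minus (f (t, y)) (f (x, y))) x (x + h)).
    - intros t Ht; left; apply B.
      eapply Rle_lt_trans; [apply Cmod_le_abs|]; unfold Re, Im; simpl.
      rewrite Rplus_opp_r, Rabs_R0, Rplus_0_r.
      assert (Rabs (t + - x) <= Rabs h); [|lra].
      unfold Rmin, Rmax in Ht; destruct (Rle_dec x (x + h)).
      + rewrite !Rabs_pos_eq; lra.
      + rewrite !Rabs_left1; lra.
    - apply (is_RInt_minus (V := VE)); [apply (RInt_correct (V := VE)), Hc|].
      assert (Hk := is_RInt_const (V := VE) x (x + h) (f (x, y))).
      replace (x + h - x) with h in Hk by ring. exact Hk. }
  assert (B2 : norm (minus (vint f (x + h) y (y + k)) (scal (Cmult Ci (RtoC k)) (f (x, y))))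
      <= Rabs k * (eps / 2)).
  { replace (Rabs k) with (Rabs (y + k - y)) by (f_equal; ring).
    apply (norm_RInt_le_const_abs (V := VE)
      (fun t => minus (scal Ci (f (x + h, t))) (scal Ci (f (x, y)))) y (y + k)).
    - intros t Ht.
      Cnorm_replace E (scal Ci (minus (f (x + h, t)) (f (x, y)))).
      eapply Rle_trans; [apply Enorm_scal|]; rewrite Cmod_Ci, Rmult_1_l.
      left; apply B.
      eapply Rle_lt_trans; [apply Cmod_le_abs|]; unfold Re, Im; simpl.
      replace (x + h + - x) with h by ring.
      assert (Rabs (t + - y) <= Rabs k); [|lra].
      unfold Rmin, Rmax in Ht; destruct (Rle_dec y (y + k)).
      + rewrite !Rabs_pos_eq; lra.
      + rewrite !Rabs_left1; lra.
    - apply (is_RInt_minus (V := VE)); [apply (RInt_correct (V := VE)), Hv|].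
      assert (Hk := is_RInt_const (V := VE) y (y + k) (scal Ci (f (x, y)) : E)).
      replace (y + k - y) with k in Hk by ring.
      replace (scal (Cmult Ci (RtoC k)) (f (x, y))) with
        (scal (RtoC k) (scal Ci (f (x, y)))) by (Cmodule E).
      exact Hk. }
  pose proof (Cmod_ge_0 (h, k)).
  apply Rle_trans with (Rabs h * (eps / 2) + Rabs k * (eps / 2)).
  - apply Rplus_le_compat; assumption.
  - assert (Rabs h * (eps / 2) <= Cmod (h, k) * (eps / 2)) by (apply Rmult_le_compat_r; lra).
    assert (Rabs k * (eps / 2) <= Cmod (h, k) * (eps / 2)) by (apply Rmult_le_compat_r; lra).
    lra.
Qed.

End Complex.

(** * Cauchy estimates and uniform Taylor estimates *)

Section CauchyEstimate.
Context {E : CompleteNormedModule C_AbsRing}.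
Let VE := restrict_scalars E.

Lemma norm_mvt (phi phi' : R -> E) (M : R) :
  (forall t, 0 <= t <= 1 -> is_derive (V := VE) phi t (phi' t)) ->
  (forall t, 0 <= t <= 1 -> norm (phi' t) <= M) ->
  norm (minus (phi 1) (phi 0)) <= M.
Proof.
  intros Hd HM; apply le_epsilon; intros eps He.
  set (K := M + eps).
  assert (Hloc : forall s, 0 <= s <= 1 -> exists r, 0 < r /\ forall h, Rabs h < r ->
     norm (minus (phi (s + h)) (phi s)) <= K * Rabs h).
  { intros s Hs.
    destruct (proj1 (is_derive_eps (V := VE) _ _ _) (Hd s Hs) eps He) as (r & Hr & B).
    exists r; split; [exact Hr|]; intros h Hh; specialize (B h Hh).
    assert (B' : norm (minus (minus (phi (s + h)) (phi s)) (scal (RtoC h) (phi' s))) <= eps * Rabs h)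
      by exact B.
    Cnorm_replace E (plus (minus (minus (phi (s + h)) (phi s)) (scal (RtoC h) (phi' s)))
      (scal (RtoC h) (phi' s))).
    eapply Rle_trans; [apply Enorm_plus|].
    eapply Rle_trans; [apply Rplus_le_compat; [exact B'|apply Enorm_scal]|].
    rewrite Cmod_R; specialize (HM s Hs); pose proof (Rabs_pos h); unfold K; nra. }
  assert (HK : 0 <= K).
  { specialize (HM 0 ltac:(lra)); pose proof (Enorm_ge_0 E (phi' 0)); unfold K; lra. }
  set (S := fun t => 0 <= t <= 1 /\ norm (minus (phi t) (phi 0)) <= K * t).
  assert (S0 : S 0).
  { split; [lra|].
    Cnorm_replace E (@zero E); eapply Rle_trans; [right; apply (norm_zero (V := E))|lra]. }
  destruct (completeness S) as [s [Hs1 Hs2]].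
  { exists 1; intros t [Ht _]; lra. }
  { exists 0; exact S0. }
  assert (Hs : 0 <= s <= 1).
  { split; [apply Hs1, S0|apply Hs2; intros t [Ht _]; lra]. }
  destruct (Hloc s Hs) as (r & Hr & B).
  assert (HS : S s).
  { split; [exact Hs|].
    destruct (classic (exists t, S t /\ s - r < t)) as [(t & Ht & Htr)|Hn].
    - assert (Hts : t <= s) by apply Hs1, Ht.
      specialize (B (t - s)).
      replace (s + (t - s)) with t in B by ring.
      rewrite Rabs_left1 in B by lra; specialize (B ltac:(lra)).
      destruct Ht as [_ Ht].
      Cnorm_replace E (minus (minus (phi t) (phi 0)) (minus (phi t) (phi s))).
      eapply Rle_trans; [apply Enorm_minus|].
      eapply Rle_trans; [apply Rplus_le_compat; [exact Ht|exact B]|]. nra.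
    - exfalso; assert (s <= s - r); [|lra].
      apply Hs2; intros t Ht; apply Rnot_lt_le; intros Hlt; apply Hn; exists t; split; auto. }
  assert (H1 : s = 1).
  { apply Rle_antisym; [lra|]; apply Rnot_lt_le; intros Hlt.
    set (h := Rmin (r / 2) (1 - s)).
    assert (Hh0 : 0 < h) by (apply Rmin_glb_lt; lra).
    assert (Hh1 : h <= r / 2) by apply Rmin_l. assert (Hh2 : h <= 1 - s) by apply Rmin_r.
    assert (s + h <= s); [|lra].
    apply Hs1; split; [lra|].
    specialize (B h); rewrite Rabs_pos_eq in B by lra; specialize (B ltac:(lra)).
    Cnorm_replace E (plus (minus (phi (s + h)) (phi s)) (minus (phi s) (phi 0))).
    eapply Rle_trans; [apply Enorm_plus|].
    eapply Rle_trans; [apply Rplus_le_compat; [exact B|apply HS]|]. lra. }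
  rewrite H1 in HS; destruct HS as [_ HS].
  eapply Rle_trans; [exact HS|unfold K; lra].
Qed.

Lemma is_derive_shift (f : C -> E) (h z : C) (l : E) :
  is_derive (K := C_AbsRing) f (Cplus z h) l ->
  is_derive (K := C_AbsRing) (fun w => f (Cplus w h)) z l.
Proof.
  intros H; apply (proj2 (is_derive_eps (V := E) _ _ _)); intros eps He.
  destruct (proj1 (is_derive_eps (V := E) _ _ _) H eps He) as (r & Hr & B).
  exists r; split; [exact Hr|]; intros k Hk.
  specialize (B k Hk).
  assert (Ek : Cplus (Cplus z h) k = Cplus (Cplus z k) h) by ring.
  change (norm (minus (minus (f (Cplus (Cplus z h) k)) (f (Cplus z h))) (scal k l)) <= eps * abs k) in B.
  rewrite Ek in B; exact B.
Qed.

Lemma is_derive_C_AbsRing (a : C -> C) (z a' : C) :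
  is_derive (K := C_AbsRing) (V := C_NormedModule) a z a' <->
  is_derive (K := C_AbsRing) (V := AbsRing_NormedModule C_AbsRing) a z a'.
Proof.
  split; intros H.
  - apply (proj2 (is_derive_eps (V := AbsRing_NormedModule C_AbsRing) a z a')).
    exact (proj1 (is_derive_eps (V := C_NormedModule) a z a') H).
  - apply (proj2 (is_derive_eps (V := C_NormedModule) a z a')).
    exact (proj1 (is_derive_eps (V := AbsRing_NormedModule C_AbsRing) a z a') H).
Qed.

Lemma is_derive_Cid (z : C) :
  is_derive (K := C_AbsRing) (V := C_NormedModule) (fun w => w) z (RtoC 1).
Proof. apply is_derive_C_AbsRing, (is_derive_id (K := C_AbsRing)). Qed.

Lemma is_derive_Ccomp (f : C -> E) (g : C -> C) (z g' : C) (l : E) :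
  is_derive (K := C_AbsRing) f (g z) l ->
  is_derive (K := C_AbsRing) (V := C_NormedModule) g z g' ->
  is_derive (K := C_AbsRing) (fun w => f (g w)) z (scal g' l).
Proof.
  intros Hf Hg; apply (is_derive_comp (K := C_AbsRing) (V := E)); [exact Hf|].
  apply is_derive_C_AbsRing, Hg.
Qed.

Lemma is_derive_Cscal_l (a : C -> C) (x : E) (z a' : C) :
  is_derive (K := C_AbsRing) (V := C_NormedModule) a z a' ->
  is_derive (K := C_AbsRing) (fun w => scal (a w) x) z (scal a' x).
Proof.
  intros Ha; apply (is_derive_scal_l (K := C_AbsRing) (V := E)), is_derive_C_AbsRing, Ha.
Qed.

Lemma is_derive_Cscal (a : C -> C) (f : C -> E) (z a' : C) (l : E) :
  is_derive (K := C_AbsRing) (V := C_NormedModule) a z a' ->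
  is_derive (K := C_AbsRing) f z l ->
  is_derive (K := C_AbsRing) (fun w => scal (a w) (f w)) z
    (plus (scal a' (f z)) (scal (a z) l)).
Proof.
  intros Ha Hf.
  apply is_derive_C_AbsRing in Ha.
  destruct (filterdiff_scal_fct (K := C_AbsRing) (U := AbsRing_NormedModule C_AbsRing)
    (V := E) z a f _ _ Cmult_comm Ha Hf) as [H1 H2].
  split.
  - apply is_linear_scal_l.
  - intros x Hx; specialize (H2 x Hx); intros eps; generalize (H2 eps).
    apply filter_imp; intros y Hy.
    eapply Rle_trans; [|exact Hy]; right; f_equal.
    assert (forall u : C, scal u (plus (scal a' (f z)) (scal (a z) l)) =
       plus (scal (Cmult u a') (f z)) (scal (a z) (scal u l))) as Hu by (intros; Cmodule E).
    apply (f_equal2 minus); [reflexivity|apply Hu].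
Qed.

Lemma Cexp_opp_derive (w : C) : is_derive (K := C_AbsRing) (V := C_NormedModule)
  (fun w => Cexp (Copp w)) w (Copp (Cexp (Copp w))).
Proof.
  replace (Copp (Cexp (Copp w))) with (Cmult (Copp (RtoC 1)) (Cexp (Copp w))) by ring.
  apply (is_derive_comp (K := C_AbsRing) (V := C_NormedModule) Cexp Copp).
  - apply Cexp_derive.
  - apply is_derive_C_AbsRing.
    apply (is_derive_opp (K := C_AbsRing) (V := C_NormedModule) (fun x => x)), is_derive_Cid.
Qed.

(** In the coordinate [w = log (zeta - z)] the function [(zeta - z)^(-1) f(zeta)]
    has the same integral over all vertical segments of length [2 pi]; far to the
    left these are close to [2 pi i] times the derivative. *)
Lemma cauchy_estimate (f : C -> E) (z : C) (r B : R) (l : E) : 0 < r ->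
  (forall w, Cmod (Cminus w z) <= r -> C_differentiable E f w /\ norm (f w) <= B) ->
  is_derive (K := C_AbsRing) f z l -> norm l <= B / r.
Proof.
  intros Hr Hf Hl.
  set (G := fun w => scal (Cexp (Copp w)) (f (Cplus z (Cexp w)))).
  assert (Hw : forall w, Re w <= ln r -> Cmod (Cminus (Cplus z (Cexp w)) z) <= r).
  { intros w Hw; replace (Cminus (Cplus z (Cexp w)) z) with (Cexp w) by ring.
    rewrite Cmod_Cexp, <- (exp_ln r) by exact Hr.
    destruct Hw as [Hw|Hw]; [left; apply exp_increasing, Hw|rewrite Hw; lra]. }
  assert (HG : forall w, Re w <= ln r -> C_differentiable E G w).
  { intros w Hw'.
    destruct (proj1 (Hf _ (Hw w Hw'))) as [l' Hl'].
    eexists; apply is_derive_Cscal; [apply Cexp_opp_derive|].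
    apply (is_derive_Ccomp f (fun w => Cplus z (Cexp w))); [exact Hl'|].
    apply (is_derive_plus (K := C_AbsRing) (V := C_NormedModule) (fun _ => z) Cexp).
    - apply (is_derive_const (K := C_AbsRing) (V := C_NormedModule)).
    - apply Cexp_derive. }
  pose proof PI_RGT_0 as HPI.
  assert (Hconst : forall rho, rho <= ln r -> vint E G rho 0 (2 * PI) = vint E G (ln r) 0 (2 * PI)).
  { intros rho Hrho.
    assert (Gs := goursat E G rho (ln r) 0 (2 * PI) Hrho ltac:(lra)).
    specialize (Gs ltac:(intros; apply HG; simpl; lra)).
    assert (Hper : hint E G rho (ln r) (2 * PI) = hint E G rho (ln r) 0).
    { apply (RInt_ext (V := VE)); intros t _; unfold G.
      assert (E1 : Cexp (t, 2 * PI) = Cexp (t, 0)).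
      { rewrite <- (Cexp_period (t, 0)); f_equal; unfold Cplus; simpl; f_equal; ring. }
      assert (E2 : Cexp (Copp (t, 2 * PI)) = Cexp (Copp (t, 0))).
      { rewrite <- (Cexp_period (Copp (t, 2 * PI))); f_equal; unfold Cplus, Copp; simpl; f_equal; ring. }
      rewrite E1, E2; reflexivity. }
    rewrite Hper in Gs.
    transitivity (minus (plus (hint E G rho (ln r) 0) (vint E G rho 0 (2 * PI))) (hint E G rho (ln r) 0));
      [Cmodule E|].
    rewrite <- Gs; Cmodule E. }
  assert (Hval : vint E G (ln r) 0 (2 * PI) = scal (Cmult (RtoC (2 * PI)) Ci) l).
  { assert (Z : minus (vint E G (ln r) 0 (2 * PI)) (scal (Cmult (RtoC (2 * PI)) Ci) l) = zero).
    { apply (norm_le_eps (V := E) _ (2 * PI)); intros eps He.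
      destruct (proj1 (is_derive_eps (V := E) _ _ _) Hl eps He) as (d & Hd & Bd).
      set (rho := Rmin (ln r) (ln (d / 2))).
      assert (H1 : rho <= ln r) by apply Rmin_l.
      assert (H2 : exp rho < d).
      { apply Rle_lt_trans with (d / 2); [|lra].
        rewrite <- (exp_ln (d / 2)) by lra.
        destruct (Rmin_r (ln r) (ln (d / 2))) as [H|H]; [left; apply exp_increasing, H|].
        unfold rho; rewrite H; lra. }
      rewrite <- (Hconst rho H1).
      set (A := fun w => plus (scal (Cexp (Copp w)) (f z)) l).
      set (P := fun w => minus (scal w l) (scal (Cexp (Copp w)) (f z))).
      assert (HP : forall w, is_derive (K := C_AbsRing) P w (A w)).
      { intros w.
        assert (HA : A w = minus (scal (RtoC 1) l) (scal (Copp (Cexp (Copp w))) (f z))).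
        { unfold A; Cmodule E. }
        rewrite HA.
        apply (is_derive_minus (K := C_AbsRing) (V := E) (fun w => scal w l)
          (fun w => scal (Cexp (Copp w)) (f z))).
        - apply is_derive_Cscal_l, is_derive_Cid.
        - apply is_derive_Cscal_l, Cexp_opp_derive. }
      assert (CA : forall w, continuous (T := C_UniformSpace) (U := E) A w).
      { intros w; eapply (is_derive_continuous_C E).
        apply (is_derive_plus (K := C_AbsRing) (V := E) (fun w => scal (Cexp (Copp w)) (f z)) (fun _ => l)).
        - apply is_derive_Cscal_l, Cexp_opp_derive.
        - apply (is_derive_const (K := C_AbsRing) (V := E)). }
      assert (HI := RInt_edge E (fun t => scal Ci (G (rho, t))) (fun t => scal Ci (A (rho, t)))
        0 (2 * PI) eps _ ltac:(lra)
        ltac:(apply ex_vint; intros; apply HG; simpl; lra)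
        (RInt_vertical E P A rho 0 (2 * PI) (fun t _ => conj (HP (rho, t)) (CA (rho, t))))).
      assert (EP : minus (P (rho, 2 * PI)) (P (rho, 0)) = scal (Cmult (RtoC (2 * PI)) Ci) l).
      { unfold P.
        assert (E2 : Cexp (Copp (rho, 2 * PI)) = Cexp (Copp (rho, 0))).
        { rewrite <- (Cexp_period (Copp (rho, 2 * PI))); f_equal; unfold Cplus, Copp; simpl; f_equal; ring. }
        rewrite E2.
        replace (rho, 2 * PI) with (Cplus (rho, 0) (Cmult (RtoC (2 * PI)) Ci))
          by (unfold Cplus, Cmult, RtoC, Ci; simpl; f_equal; ring).
        Cmodule E. }
      rewrite <- EP.
      eapply Rle_trans; [apply HI|right; ring].
      intros t Ht.
      Cnorm_replace E (scal Ci (minus (G (rho, t)) (A (rho, t)))).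
      eapply Rle_trans; [apply Enorm_scal|]; rewrite Cmod_Ci, Rmult_1_l.
      specialize (Bd (Cexp (rho, t))).
      assert (Hc : Cmod (Cexp (rho, t)) = exp rho) by apply Cmod_Cexp.
      assert (Bd' : norm (minus (minus (f (Cplus z (Cexp (rho, t)))) (f z)) (scal (Cexp (rho, t)) l))
        <= eps * exp rho).
      { rewrite <- Hc; apply Bd; change (Cmod (Cexp (rho, t)) < d); rewrite Hc; exact H2. }
      assert (EG : minus (G (rho, t)) (A (rho, t)) = scal (Cexp (Copp (rho, t)))
        (minus (minus (f (Cplus z (Cexp (rho, t)))) (f z)) (scal (Cexp (rho, t)) l))).
      { transitivity (minus (scal (Cexp (Copp (rho, t))) (minus (f (Cplus z (Cexp (rho, t)))) (f z)))
          (scal (Cmult (Cexp (Copp (rho, t))) (Cexp (rho, t))) l)).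
        - rewrite Cexp_opp; unfold G, A; Cmodule E.
        - Cmodule E. }
      rewrite EG.
      eapply Rle_trans; [apply Enorm_scal|].
      rewrite Cmod_Cexp; unfold Re, Copp; simpl.
      apply Rle_trans with (exp (- rho) * (eps * exp rho)).
      - apply Rmult_le_compat_l; [left; apply exp_pos|exact Bd'].
      - right; rewrite exp_Ropp; field; apply Rgt_not_eq, exp_pos. }
    transitivity (plus (minus (vint E G (ln r) 0 (2 * PI)) (scal (Cmult (RtoC (2 * PI)) Ci) l))
      (scal (Cmult (RtoC (2 * PI)) Ci) l)); [Cmodule E|].
    rewrite Z; Cmodule E. }
  assert (Hn : norm (vint E G (ln r) 0 (2 * PI)) <= (2 * PI - 0) * (B / r)).
  { apply (norm_RInt_le_const (V := VE) (fun t => scal Ci (G (ln r, t))) 0 (2 * PI)); [lra| |].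
    - intros t _; change (norm (scal Ci (G (ln r, t)) : E) <= B / r).
      eapply Rle_trans; [apply Enorm_scal|]; rewrite Cmod_Ci, Rmult_1_l.
      unfold G; eapply Rle_trans; [apply Enorm_scal|].
      rewrite Cmod_Cexp; unfold Re, Copp; simpl.
      rewrite exp_Ropp, exp_ln by exact Hr.
      unfold Rdiv; rewrite Rmult_comm; apply Rmult_le_compat_r.
      + left; apply Rinv_0_lt_compat, Hr.
      + apply Hf, Hw; simpl; lra.
    - apply (RInt_correct (V := VE)), ex_vint; intros; apply HG; simpl; lra. }
  rewrite Hval in Hn.
  assert (El : l = scal (Cmult (RtoC (/ (2 * PI))) (Copp Ci)) (scal (Cmult (RtoC (2 * PI)) Ci) l)).
  { transitivity (scal (Cmult (RtoC (/ (2 * PI) * (2 * PI))) (Cmult (Copp Ci) Ci)) l).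
    - rewrite Rinv_l by lra.
      replace (Cmult (RtoC 1) (Cmult (Copp Ci) Ci)) with (RtoC 1)
        by (unfold Cmult, Copp, RtoC, Ci; simpl; f_equal; ring).
      symmetry; apply (scal_one (V := E)).
    - rewrite RtoC_mult; Cmodule E. }
  rewrite El.
  eapply Rle_trans; [apply Enorm_scal|].
  rewrite Cmod_mult, Cmod_opp, Cmod_Ci, Cmod_R, Rabs_pos_eq, Rmult_1_r
    by (left; apply Rinv_0_lt_compat; lra).
  apply Rle_trans with (/ (2 * PI) * ((2 * PI - 0) * (B / r))).
  - apply Rmult_le_compat_l; [left; apply Rinv_0_lt_compat; lra|exact Hn].
  - right; field; lra.
Qed.
End CauchyEstimate.

Section TaylorEstimate.
Context {E : CompleteNormedModule C_AbsRing}.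
Let VE := restrict_scalars E.

Lemma is_derive_segment (f : C -> E) (z h : C) (t : R) (l : E) :
  is_derive (K := C_AbsRing) f (Cplus z (Cmult (RtoC t) h)) l ->
  is_derive (V := VE) (fun s : R => f (Cplus z (Cmult (RtoC s) h))) t (scal h l).
Proof.
  intros H.
  apply (is_derive_curve E f (fun s => Cplus z (Cmult (RtoC s) h)) t h); [exact H|].
  destruct z as [z1 z2], h as [h1 h2].
  apply (is_derive_ext (V := VC) (fun s => (z1 + s * h1, z2 + s * h2))).
  - intros s; unfold Cplus, Cmult, RtoC; simpl; f_equal; ring.
  - apply is_derive_pair; auto_derive; auto; ring.
Qed.

(** The estimates depend on the bound and the radius only, which allows
    differentiation under the integral sign. The estimate of the derivative comes
    from the Cauchy estimate for the difference [f(w + h) - f(w)], which is of the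
    order of [h]; each application costs one radius. *)
Lemma taylor_estimate (f : C -> E) (z : C) (r B : R) : 0 < r ->
  (forall w, Cmod (Cminus w z) < 4 * r -> C_differentiable E f w /\ norm (f w) <= B) ->
  forall l, is_derive (K := C_AbsRing) f z l ->
  norm l <= B / r /\
  forall h, Cmod h < r ->
    norm (minus (minus (f (Cplus z h)) (f z)) (scal h l)) <= B / r ^ 2 * Cmod h ^ 2 /\
    forall l', is_derive (K := C_AbsRing) f (Cplus z h) l' ->
      norm (minus l' l) <= B / r ^ 2 * Cmod h.
Proof.
  intros Hr Hf l Hl.
  assert (HB : 0 <= B).
  { destruct (Hf z) as [_ H].
    - replace (Cminus z z) with (RtoC 0) by ring. rewrite Cmod_0; lra.
    - pose proof (Enorm_ge_0 E (f z)); lra. }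
  assert (Tri : forall u v w, Cmod (Cminus u w) <= Cmod (Cminus u v) + Cmod (Cminus v w)).
  { intros u v w; replace (Cminus u w) with (Cplus (Cminus u v) (Cminus v w)) by ring.
    apply Cmod_triangle. }
  assert (Cz : forall w h, Cmod (Cminus (Cplus w h) w) = Cmod h).
  { intros w h; f_equal; ring. }
  assert (D1 : forall w l', Cmod (Cminus w z) < 3 * r -> is_derive (K := C_AbsRing) f w l' ->
     norm l' <= B / r).
  { intros w l' Hw Hl'; apply (cauchy_estimate f w r B l' Hr); [|exact Hl'].
    intros v Hv; apply Hf; pose proof (Tri v w z); lra. }
  assert (Seg : forall h t, 0 <= t <= 1 -> Cmod (Cmult (RtoC t) h) <= t * Cmod h).
  { intros h t Ht; rewrite Cmod_mult, Cmod_R, Rabs_pos_eq; lra. }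
  assert (MV : forall (w h : C) (M : R) (m : E), 0 <= M ->
     (forall t, 0 <= t <= 1 -> Cmod (Cminus (Cplus w (Cmult (RtoC t) h)) z) < 3 * r) ->
     (forall t l', 0 <= t <= 1 -> is_derive (K := C_AbsRing) f (Cplus w (Cmult (RtoC t) h)) l' ->
         norm (minus l' m) <= M) ->
     norm (minus (minus (f (Cplus w h)) (f w)) (scal h m)) <= Cmod h * M).
  { intros w h M m HM0 Hw HM.
    assert (Hd : forall t, exists l' : E, 0 <= t <= 1 ->
       is_derive (K := C_AbsRing) f (Cplus w (Cmult (RtoC t) h)) l').
    { intros t; destruct (classic (0 <= t <= 1)) as [Ht|Ht].
      - destruct (proj1 (Hf (Cplus w (Cmult (RtoC t) h)) ltac:(specialize (Hw t Ht); lra))) as [l' Hl'].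
        exists l'; auto.
      - exists zero; tauto. }
    assert (Hd' : exists d : R -> E, forall t, 0 <= t <= 1 ->
       is_derive (K := C_AbsRing) f (Cplus w (Cmult (RtoC t) h)) (d t)).
    { exists (fun t => proj1_sig (constructive_indefinite_description _ (Hd t))).
      intros t; exact (proj2_sig (constructive_indefinite_description _ (Hd t))). }
    destruct Hd' as [d Hd'].
    assert (Hm := norm_mvt (fun s => minus (f (Cplus w (Cmult (RtoC s) h))) (scal (RtoC s) (scal h m)))
      (fun s => scal h (minus (d s) m)) (Cmod h * M)).
    assert (E0 : Cplus w (Cmult (RtoC 0) h) = w) by ring.
    assert (E1 : Cplus w (Cmult (RtoC 1) h) = Cplus w h) by ring.
    assert (Hm' : norm (minus (minus (f (Cplus w (Cmult (RtoC 1) h))) (scal (RtoC 1) (scal h m)))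
      (minus (f (Cplus w (Cmult (RtoC 0) h))) (scal (RtoC 0) (scal h m)))) <= Cmod h * M).
    { apply Hm; clear Hm.
      - intros t Ht.
        replace (scal h (minus (d t) m)) with (minus (scal h (d t)) (scal (RtoC 1) (scal h m)))
          by (Cmodule E).
        apply (is_derive_minus (V := VE) (fun s => f (Cplus w (Cmult (RtoC s) h)))
          (fun s => scal (RtoC s) (scal h m))).
        + apply is_derive_segment, Hd', Ht.
        + apply (is_derive_scal_l (V := VE) (fun s => s) t 1 (scal h m)).
          apply (is_derive_id (K := R_AbsRing)).
      - intros t Ht; eapply Rle_trans; [apply Enorm_scal|].
        apply Rmult_le_compat_l; [apply Cmod_ge_0|]. apply (HM t); auto. }
    rewrite E0, E1 in Hm'.
    eapply Rle_trans; [right|exact Hm'].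
    apply f_equal; Cmodule E. }
  split; [apply (D1 z); [|exact Hl]; replace (Cminus z z) with (RtoC 0) by ring; rewrite Cmod_0; lra|].
  (* first order: the derivative is bounded along the segment *)
  assert (Lip : forall w h, Cmod (Cminus w z) < 2 * r -> Cmod h < r ->
     norm (minus (f (Cplus w h)) (f w)) <= Cmod h * (B / r)).
  { intros w h Hw Hh.
    assert (HM := MV w h (B / r) zero).
    eapply Rle_trans; [right|apply HM].
    - apply f_equal; Cmodule E.
    - apply Rmult_le_pos; [exact HB|left; apply Rinv_0_lt_compat, Hr].
    - intros t Ht; pose proof (Tri (Cplus w (Cmult (RtoC t) h)) w z) as HT.
      rewrite Cz in HT; specialize (Seg h t Ht); pose proof (Cmod_ge_0 h); nra.
    - intros t l' Ht Hl'.
      Cnorm_replace E l'; apply (D1 (Cplus w (Cmult (RtoC t) h))); [|exact Hl'].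
      pose proof (Tri (Cplus w (Cmult (RtoC t) h)) w z) as HT.
      rewrite Cz in HT; specialize (Seg h t Ht); pose proof (Cmod_ge_0 h); nra. }
  assert (LipD : forall h l', Cmod h < r -> is_derive (K := C_AbsRing) f (Cplus z h) l' ->
     norm (minus l' l) <= B / r ^ 2 * Cmod h).
  { intros h l' Hh Hl'.
    replace (B / r ^ 2 * Cmod h) with (Cmod h * (B / r) / r) by (field; lra).
    apply (cauchy_estimate (fun w => minus (f (Cplus w h)) (f w)) z r); [exact Hr| |].
    - intros w Hw; split; [|apply Lip; lra].
      destruct (proj1 (Hf w ltac:(lra))) as [l1 H1].
      destruct (proj1 (Hf (Cplus w h) ltac:(pose proof (Tri (Cplus w h) w z) as HT; rewrite Cz in HT; lra))) as [l2 H2].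
      exists (minus l2 l1).
      apply (is_derive_minus (V := E) (fun w => f (Cplus w h)) f); [|exact H1].
      apply is_derive_shift, H2.
    - apply (is_derive_minus (V := E) (fun w => f (Cplus w h)) f); [|exact Hl].
      apply is_derive_shift, Hl'. }
  intros h Hh; split; [|intros l' Hl'; apply LipD; auto].
  eapply Rle_trans; [apply (MV z h (B / r ^ 2 * Cmod h) l)|].
  - apply Rmult_le_pos; [|apply Cmod_ge_0].
    apply Rmult_le_pos; [exact HB|left; apply Rinv_0_lt_compat; nra].
  - intros t Ht; rewrite Cz; specialize (Seg h t Ht); pose proof (Cmod_ge_0 h); nra.
  - intros t l' Ht Hl'.
    specialize (Seg h t Ht); pose proof (Cmod_ge_0 h).
    assert (Ht' : Cmod (Cmult (RtoC t) h) <= Cmod h) by nra.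
    eapply Rle_trans; [apply (LipD _ _ (Rle_lt_trans _ _ _ Ht' Hh) Hl')|].
    apply Rmult_le_compat_l; [|exact Ht'].
    apply Rmult_le_pos; [exact HB|left; apply Rinv_0_lt_compat; nra].
  - right; ring.
Qed.

(** Turning a line of integration in the logarithmic coordinate means turning a ray:
    the vertical sides of the rectangles between two horizontal lines contribute
    nothing in the limit. *)
Lemma line_rotation (f : C -> E) (c d K : R) (I1 I2 : E) : c <= d ->
  (forall x y, c <= y <= d -> C_differentiable E f (x, y) /\ norm (f (x, y)) <= K / (1 + x ^ 2)) ->
  is_line_int (V := VE) (fun x => f (x, c)) I1 ->
  is_line_int (V := VE) (fun x => f (x, d)) I2 -> I1 = I2.
Proof.
  intros Hcd Hf H1 H2.
  assert (Hcont : forall y, c <= y <= d -> forall x, continuous (U := VE) (fun x => f (x, y)) x).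
  { intros y Hy x; apply continuous_horizontal, C_differentiable_continuous, Hf, Hy. }
  assert (Hdom : forall y, c <= y <= d -> dominated (V := VE) K (fun x => f (x, y))).
  { intros y Hy x; apply Hf, Hy. }
  assert (HK : 0 <= K) by (apply (dominated_pos (V := VE) K (fun x => f (x, c))), Hdom; lra).
  assert (Z : minus I1 I2 = zero).
  2:{ transitivity (plus (minus I1 I2) I2); [Cmodule E|rewrite Z; Cmodule E]. }
  apply (norm_le_eps (V := E) _ (4 * K + 2 * ((d - c) * K))); intros eps He.
  destruct (atan_tail eps He) as (A & HA & HA').
  set (n := Rmax A (/ eps)).
  assert (Hn1 : A <= n) by apply Rmax_l. assert (Hn2 : / eps <= n) by apply Rmax_r.
  assert (Hn3 : 0 < / eps) by (apply Rinv_0_lt_compat, He).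
  destruct (HA' n Hn1) as [T1 T2].
  pose proof (line_int_bound (V := VE) K _ _ n (Hcont c ltac:(lra)) (Hdom c ltac:(lra)) H1 ltac:(lra)) as B1.
  pose proof (line_int_bound (V := VE) K _ _ n (Hcont d ltac:(lra)) (Hdom d ltac:(lra)) H2 ltac:(lra)) as B2.
  assert (G := goursat E f (- n) n c d ltac:(lra) Hcd (fun x y _ Hy => proj1 (Hf x y Hy))).
  assert (Hinv : / (1 + n ^ 2) <= eps).
  { rewrite <- (Rinv_inv eps); apply Rinv_le_contravar; [exact Hn3|]. nra. }
  assert (BV : forall x, x ^ 2 = n ^ 2 -> norm (vint E f x c d) <= (d - c) * K * eps).
  { intros x Hx.
    replace ((d - c) * K * eps) with ((d - c) * (K * eps)) by ring.
    apply (norm_RInt_le_const (V := VE) (fun t => scal Ci (f (x, t))) c d); [exact Hcd| |].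
    - intros t Ht; change (norm (scal Ci (f (x, t)) : E) <= K * eps).
      eapply Rle_trans; [apply Enorm_scal|]; rewrite Cmod_Ci, Rmult_1_l.
      eapply Rle_trans; [apply (Hf x t Ht)|]; rewrite Hx.
      unfold Rdiv; apply Rmult_le_compat_l; [exact HK|exact Hinv].
    - apply (RInt_correct (V := VE)), ex_vint; intros t Ht.
      rewrite Rmin_left, Rmax_right in Ht by exact Hcd; apply Hf, Ht. }
  pose proof (BV n eq_refl) as V1. pose proof (BV (- n) ltac:(ring)) as V2.
  assert (Eq : minus I1 I2 = plus (minus (minus (hint E f (- n) n d) I2) (minus (hint E f (- n) n c) I1))
     (minus (vint E f (- n) c d) (vint E f n c d))).
  { transitivity (plus (minus (minus (hint E f (- n) n d) I2) (minus (hint E f (- n) n c) I1))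
     (minus (minus (plus (hint E f (- n) n d) (vint E f (- n) c d)) (hint E f (- n) n d)) (vint E f n c d)));
     [rewrite <- G|]; Cmodule E. }
  rewrite Eq.
  eapply Rle_trans; [apply Enorm_plus|].
  eapply Rle_trans; [apply Rplus_le_compat; apply Enorm_minus|].
  eapply Rle_trans; [apply Rplus_le_compat; (apply Rplus_le_compat; [first [exact B2|exact V2]|first [exact B1|exact V1]])|].
  assert (K * (PI - (atan n - atan (- n))) <= K * (2 * eps)) by (apply Rmult_le_compat_l; lra).
  lra.
Qed.
End TaylorEstimate.

(** * Weight sequences and their growth functions *)

(** The part of strong regularity that bears on the growth function; unlike the
    conditions (lc) and (snq), it visibly passes to powers. *)
Record weight (M : nat -> R) : Prop := {
  w_pos : forall p, 0 < M p;
  w_0 : M 0%nat = 1;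
  w_mg : exists A, 1 <= A /\ forall p q, M (p + q)%nat <= A ^ (p + q) * M p * M q;
  w_bdd : forall t, 0 < t -> exists B, forall p, t ^ p / M p <= B
}.

Lemma exp_le_mono (x y : R) : x <= y -> exp x <= exp y.
Proof. intros [H| ->]; [left; apply exp_increasing, H|lra]. Qed.

(** The partial sums dominate the logarithm. *)
Lemma harmonic_diverges : ~ ex_series (fun k => / INR (k + 1)).
Proof.
  intros [l Hl].
  assert (Hlow : forall n, ln (INR (n + 2)) <= sum_n (fun k => / INR (k + 1)) n).
  { assert (Hs : forall x, 0 < x -> ln (x + 1) <= ln x + / x).
    { intros x Hx.
      replace (x + 1) with (x * (1 + / x)) by (field; lra).
      assert (0 < / x) by (apply Rinv_0_lt_compat, Hx).
      rewrite ln_mult by lra.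
      apply Rplus_le_compat_l.
      rewrite <- (ln_exp (/ x)) at 2.
      apply ln_le; [lra|]. apply exp_ineq1_le. }
    induction n as [|n IH].
    - rewrite sum_O; simpl. pose proof (Hs 1 Rlt_0_1) as H. rewrite ln_1 in H. lra.
    - rewrite sum_Sn; unfold plus; simpl plus.
      replace (INR (S n + 2)) with (INR (n + 2) + 1) by (rewrite <- S_INR; f_equal; lia).
      replace (INR (S n + 1)) with (INR (n + 2)) by (f_equal; lia).
      specialize (Hs (INR (n + 2)) ltac:(apply lt_0_INR; lia)). simpl; lra. }
  assert (Hup : forall n, sum_n (fun k => / INR (k + 1)) n <= l).
  { intros n; apply (is_lim_seq_incr_compare (sum_n (fun k => / INR (k + 1))) l Hl).
    intros k; rewrite sum_Sn; unfold plus; simpl.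
    assert (0 < / INR (S k + 1)) by (apply Rinv_0_lt_compat, lt_0_INR; lia). simpl in *; lra. }
  destruct (nfloor_ex (exp (l + 1))) as [n [Hn1 Hn2]]; [left; apply exp_pos|].
  specialize (Hlow n); specialize (Hup n).
  assert (l + 1 < ln (INR (n + 2))); [|lra].
  rewrite <- (ln_exp (l + 1)); apply ln_increasing; [apply exp_pos|].
  rewrite plus_INR; simpl; lra.
Qed.

(** By (lc) the quotients [M p / M (p + 1)] decrease; by (snq) they tend to 0, since
    a positive lower bound would make the series in (snq) dominate the harmonic
    series. So [t ^ p / M p] eventually decreases. *)
Lemma strongly_regular_weight (M : nat -> R) : strongly_regular M -> weight M.
Proof.
  intros [Hpos H0 Hlc Hmg Hsnq]; split; auto.
  - destruct Hmg as (A1 & HA1 & H).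
    exists (Rmax 1 A1); split; [apply Rmax_l|]; intros p q.
    eapply Rle_trans; [apply H|].
    rewrite !Rmult_assoc; apply Rmult_le_compat_r.
    + pose proof (Hpos p); pose proof (Hpos q); nra.
    + apply pow_incr; pose proof (Rmax_r 1 A1); lra.
  - intros t Ht.
    set (q := fun p => M p / M (S p)).
    assert (Hq0 : forall p, 0 < q p) by (intros p; apply Rdiv_lt_0_compat; apply Hpos).
    assert (Hqdec : forall p, q (S p) <= q p).
    { intros p; unfold q; specialize (Hlc (S p) ltac:(lia)).
      replace (S p - 1)%nat with p in Hlc by lia. replace (S p + 1)%nat with (S (S p)) in Hlc by lia.
      pose proof (Hpos (S p)); pose proof (Hpos (S (S p))); pose proof (Hpos p).
      apply Rmult_le_reg_r with (M (S (S p)) * M (S p)); [nra|].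
      replace (M (S p) / M (S (S p)) * (M (S (S p)) * M (S p))) with (M (S p) ^ 2) by (field; lra).
      replace (M p / M (S p) * (M (S (S p)) * M (S p))) with (M p * M (S (S p))) by (field; lra).
      exact Hlc. }
    assert (Hsmall : exists p0, q p0 * t <= 1).
    { apply NNPP; intros Hn.
      assert (Hbig : forall p, / t <= q p).
      { intros p; apply Rnot_lt_le; intros Hlt; apply Hn; exists p.
        apply Rmult_lt_compat_r with (r := t) in Hlt; [|exact Ht].
        rewrite Rinv_l in Hlt; lra. }
      destruct Hsnq as (A2 & _ & H); destruct (H 0%nat) as [Hex _].
      apply harmonic_diverges.
      apply (ex_series_le (V := R_CompleteNormedModule) _
        (fun k => t * (M (0 + k)%nat / (INR (0 + k + 1) * M (0 + k + 1)%nat)))).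
      - intros k; unfold norm; simpl; unfold abs; simpl.
        assert (0 < / INR (k + 1)) by (apply Rinv_0_lt_compat, lt_0_INR; lia).
        assert (0 < INR (k + 1)) by (apply lt_0_INR; lia).
        rewrite Rabs_pos_eq by lra.
        specialize (Hbig k); unfold q in Hbig.
        replace (k + 1)%nat with (S k) in * by lia.
        replace (t * (M k / (INR (S k) * M (S k)))) with (/ INR (S k) * (t * (M k / M (S k))))
          by (field; split; [pose proof (Hpos (S k)); lra|lra]).
        rewrite <- (Rmult_1_r (/ INR (S k))) at 1.
        apply Rmult_le_compat_l; [lra|].
        apply Rmult_le_reg_l with (/ t); [apply Rinv_0_lt_compat, Ht|].
        rewrite <- Rmult_assoc, Rinv_l by lra. lra.
      - apply (ex_series_scal (V := R_NormedModule) t), Hex. }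
    destruct Hsmall as [p0 Hp0].
    assert (Hfin : forall n, exists B, forall p, (p <= n)%nat -> t ^ p / M p <= B).
    { induction n as [|n [B HB]].
      - exists (t ^ 0 / M 0%nat); intros p Hp; replace p with 0%nat by lia; lra.
      - exists (Rmax B (t ^ S n / M (S n))); intros p Hp.
        destruct (Nat.eq_dec p (S n)) as [->|Hne]; [apply Rmax_r|].
        eapply Rle_trans; [apply HB; lia|apply Rmax_l]. }
    destruct (Hfin p0) as [B HB]; exists B; intros p.
    destruct (Nat.le_gt_cases p p0) as [Hp|Hp]; [auto|].
    replace p with (p0 + (p - p0))%nat by lia; generalize (p - p0)%nat; intros k.
    induction k as [|k IH]; [rewrite Nat.add_0_r; auto|].
    eapply Rle_trans; [|exact IH].
    assert (Hk : q (p0 + k)%nat * t <= 1).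
    { assert (q (p0 + k)%nat <= q p0).
      { clear IH; induction k as [|k IH]; [rewrite Nat.add_0_r; lra|].
        rewrite Nat.add_succ_r; eapply Rle_trans; [apply Hqdec|exact IH]. }
      nra. }
    rewrite Nat.add_succ_r; simpl pow; unfold q in Hk.
    pose proof (Hpos (p0 + k)%nat); pose proof (Hpos (S (p0 + k))).
    assert (0 < t ^ (p0 + k)) by (apply pow_lt, Ht).
    replace (t * t ^ (p0 + k) / M (S (p0 + k))) with
      (t ^ (p0 + k) / M (p0 + k)%nat * (M (p0 + k)%nat / M (S (p0 + k)) * t)) by (field; lra).
    rewrite <- (Rmult_1_r (t ^ (p0 + k) / M (p0 + k)%nat)) at 2.
    apply Rmult_le_compat_l; [|exact Hk].
    left; apply Rdiv_lt_0_compat; lra.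
Qed.

Lemma Rpower_pow_l (x s : R) (p : nat) : 0 < x -> Rpower (x ^ p) s = Rpower x s ^ p.
Proof.
  intros Hx; rewrite <- !Rpower_pow by (auto; apply exp_pos).
  rewrite !Rpower_mult; f_equal; ring.
Qed.

Lemma powseq_ratio (M : nat -> R) (s t : R) (p : nat) : 0 < M p -> 0 < s -> 0 < t ->
  t ^ p / powseq M s p = Rpower (Rpower t (/ s) ^ p / M p) s.
Proof.
  intros HM Hs Ht; unfold powseq.
  assert (Hr : 0 < Rpower t (/ s)) by apply exp_pos.
  unfold Rdiv; rewrite <- Rpower_mult_distr; [|apply pow_lt, Hr|apply Rinv_0_lt_compat, HM].
  rewrite Rpower_pow_l, Rpower_mult, Rinv_l, Rpower_1 by lra.
  f_equal; rewrite <- Rpower_Ropp; unfold Rpower; f_equal.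
  rewrite ln_Rinv by exact HM; ring.
Qed.

Lemma powseq_weight (M : nat -> R) (s : R) : 0 < s -> weight M -> weight (powseq M s).
Proof.
  intros Hs [Hpos H0 (A & HA & Hstep) Hbdd]; split.
  - intros p; apply exp_pos.
  - unfold powseq; rewrite H0; unfold Rpower; rewrite ln_1, Rmult_0_r; apply exp_0.
  - exists (Rpower A s); split.
    + rewrite <- (Rpower_O A) by lra. apply Rle_Rpower; lra.
    + intros p q; unfold powseq.
      assert (HAp : 0 < A ^ (p + q)) by (apply pow_lt; lra).
      rewrite <- Rpower_pow_l by lra.
      rewrite Rpower_mult_distr by (auto; apply Hpos).
      rewrite Rpower_mult_distr; [|apply Rmult_lt_0_compat; auto|apply Hpos].
      apply Rle_Rpower_l; [lra|split; [apply Hpos|apply Hstep]].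
  - intros t Ht.
    destruct (Hbdd (Rpower t (/ s)) (exp_pos _)) as [B HB].
    exists (Rpower B s); intros p.
    rewrite powseq_ratio by auto.
    apply Rle_Rpower_l; [lra|split; [|apply HB]].
    apply Rdiv_lt_0_compat; [apply pow_lt, exp_pos|apply Hpos].
Qed.

Section Mfun.
Context (M : nat -> R) (HM : weight M).

Lemma Mfun_sup (t : R) : 0 < t ->
  (forall p, ln (t ^ p / M p) <= Mfun M t) /\
  (forall b, (forall p, ln (t ^ p / M p) <= b) -> Mfun M t <= b).
Proof.
  intros Ht; unfold Mfun; destruct (Rle_dec t 0) as [H|_]; [lra|].
  destruct (w_bdd M HM t Ht) as [B HB].
  assert (Hr : forall p, 0 < t ^ p / M p)
    by (intros; apply Rdiv_lt_0_compat; [apply pow_lt, Ht|apply w_pos, HM]).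
  assert (HBl : forall p, ln (t ^ p / M p) <= ln B) by (intros p; apply ln_le; auto).
  pose proof (Sup_seq_correct (fun p => Finite (ln (t ^ p / M p)))) as HS.
  apply is_sup_seq_lub in HS; destruct HS as [S1 S2].
  destruct (Sup_seq (fun p => Finite (ln (t ^ p / M p)))) as [s| |]; simpl in *.
  - split.
    + intros p; apply (S1 (Finite (ln (t ^ p / M p)))); exists p; reflexivity.
    + intros b Hb; apply (S2 (Finite b)); intros x [p ->]; apply Hb.
  - exfalso; apply (S2 (Finite (ln B))); intros x [p ->]; apply HBl.
  - exfalso; apply (S1 (Finite (ln (t ^ 0 / M 0%nat)))); exists 0%nat; reflexivity.
Qed.

Lemma exp_Mfun_ge (t : R) (p : nat) : 0 < t -> t ^ p / M p <= exp (Mfun M t).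
Proof.
  intros Ht.
  assert (Hr : 0 < t ^ p / M p)
    by (intros; apply Rdiv_lt_0_compat; [apply pow_lt, Ht|apply w_pos, HM]).
  rewrite <- (exp_ln _ Hr).
  apply exp_le_mono, Mfun_sup, Ht.
Qed.

Lemma exp_Mfun_le (t B : R) : 0 < t -> (forall p, t ^ p / M p <= B) -> exp (Mfun M t) <= B.
Proof.
  intros Ht HB.
  assert (Hr : forall p, 0 < t ^ p / M p)
    by (intros; apply Rdiv_lt_0_compat; [apply pow_lt, Ht|apply w_pos, HM]).
  assert (HB0 : 0 < B) by (eapply Rlt_le_trans; [apply (Hr 0%nat)|apply HB]).
  rewrite <- (exp_ln B HB0); apply exp_le_mono, Mfun_sup; [exact Ht|].
  intros p; apply ln_le; auto.
Qed.

Lemma Mfun_nonneg (t : R) : 0 <= Mfun M t.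
Proof.
  unfold Mfun at 1; destruct (Rle_dec t 0) as [H|H]; [lra|].
  fold (Mfun M t).
  pose proof (proj1 (Mfun_sup t ltac:(lra)) 0%nat) as H0.
  unfold Mfun in H0; destruct (Rle_dec t 0); [lra|].
  rewrite (w_0 M HM) in H0; simpl in H0; rewrite Rdiv_1_r, ln_1 in H0; exact H0.
Qed.

Lemma Mfun_mono (s t : R) : s <= t -> Mfun M s <= Mfun M t.
Proof.
  intros Hst; destruct (Rle_dec s 0) as [H|H].
  - unfold Mfun at 1; destruct (Rle_dec s 0); [apply Mfun_nonneg|lra].
  - apply Rnot_lt_le; intros Hlt; apply exp_increasing in Hlt; revert Hlt; apply Rle_not_lt.
    apply exp_Mfun_le; [lra|]; intros p.
    eapply Rle_trans; [|apply exp_Mfun_ge; lra].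
    apply Rmult_le_compat_r; [left; apply Rinv_0_lt_compat, w_pos, HM|].
    apply pow_incr; lra.
Qed.

(** Condition (mg): a power of the variable costs only a dilation of the growth
    function, and the dilation does not depend on the power. *)
Lemma exp_Mfun_absorb : exists A, 1 <= A /\ forall (n : nat) t, 0 < t ->
  t ^ n * exp (Mfun M t) <= M n * exp (Mfun M (A * t)).
Proof.
  destruct (w_mg M HM) as (A & HA & Hmg); exists A; split; [exact HA|]; intros n t Ht.
  assert (Hn : 0 < t ^ n) by (apply pow_lt, Ht).
  apply Rmult_le_reg_l with (/ t ^ n); [apply Rinv_0_lt_compat, Hn|].
  rewrite <- Rmult_assoc, Rinv_l, Rmult_1_l by lra.
  apply exp_Mfun_le; [exact Ht|]; intros p.
  apply Rmult_le_reg_l with (t ^ n); [exact Hn|].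
  rewrite <- (Rmult_assoc (t ^ n) (/ t ^ n)), Rinv_r, Rmult_1_l by lra.
  pose proof (w_pos M HM p) as P1; pose proof (w_pos M HM (p + n)%nat) as P2.
  pose proof (w_pos M HM n) as P3.
  apply Rle_trans with (M n * ((A * t) ^ (p + n) / M (p + n)%nat)).
  2:{ apply Rmult_le_compat_l; [lra|]; apply exp_Mfun_ge; nra. }
  specialize (Hmg p n).
  apply Rmult_le_reg_r with (M p * M (p + n)%nat); [nra|].
  replace (t ^ n * (t ^ p / M p) * (M p * M (p + n)%nat)) with (t ^ (p + n) * M (p + n)%nat)
    by (rewrite pow_add; field; lra).
  replace (M n * ((A * t) ^ (p + n) / M (p + n)%nat) * (M p * M (p + n)%nat)) with
    (t ^ (p + n) * (A ^ (p + n) * M p * M n)) by (rewrite Rpow_mult_distr; field; lra).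
  apply Rmult_le_compat_l; [left; apply pow_lt, Ht|exact Hmg].
Qed.
End Mfun.

Lemma Mfun_powseq (M : nat -> R) (s t : R) : weight M -> 0 < s -> 0 < t ->
  Mfun (powseq M s) t = s * Mfun M (Rpower t (/ s)).
Proof.
  intros HM Hs Ht.
  assert (Hr : 0 < Rpower t (/ s)) by apply exp_pos.
  assert (Hln : forall p, ln (t ^ p / powseq M s p) = s * ln (Rpower t (/ s) ^ p / M p)).
  { intros p; rewrite powseq_ratio by (auto; apply w_pos, HM).
    unfold Rpower at 1; apply ln_exp. }
  destruct (Mfun_sup _ (powseq_weight M s Hs HM) t Ht) as [A1 A2].
  destruct (Mfun_sup M HM (Rpower t (/ s)) Hr) as [B1 B2].
  apply Rle_antisym.
  - apply A2; intros p; rewrite Hln; apply Rmult_le_compat_l; [lra|apply B1].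
  - apply Rmult_le_reg_l with (/ s); [apply Rinv_0_lt_compat, Hs|].
    rewrite <- Rmult_assoc, Rinv_l, Rmult_1_l by lra.
    apply B2; intros p.
    apply Rmult_le_reg_l with s; [exact Hs|].
    rewrite <- Hln, <- Rmult_assoc, Rinv_r, Rmult_1_l by lra; apply A1.
Qed.

Definition tends_infty (f : R -> R) (l : R) : Prop :=
  forall eps, 0 < eps -> exists T, forall t, T < t -> Rabs (f t - l) < eps.

Lemma ln_large (A : R) : exists T, forall t, T < t -> 0 < t /\ A < ln t.
Proof.
  exists (exp A); intros t Ht; pose proof (exp_pos A); split; [lra|].
  rewrite <- (ln_exp A); apply ln_increasing; [apply exp_pos|exact Ht].
Qed.

(** A proximate order turns the upper limit in the definition of [omega] into a
    limit, which makes [omega] multiplicative under powers of the sequence. *)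
Lemma proximate_order_limit (M : nat -> R) : admits_nonzero_proximate_order M ->
  exists rho, 0 < rho /\ tends_infty (fun r => ln (Mfun M r) / ln r) rho.
Proof.
  intros (c & rho & rho0 & [_ _ _ Hlim _ Hrho0] & A & B & HB).
  exists rho0; split; [exact Hrho0|]; intros eps He.
  apply is_lim_spec in Hlim; destruct (Hlim (mkposreal (eps / 2) ltac:(lra))) as [T1 HT1].
  simpl in HT1.
  destruct (ln_large (2 * (Rabs B + 1) / eps)) as [T2 HT2].
  exists (Rmax A (Rmax T1 T2)); intros t Ht.
  pose proof (Rmax_l A (Rmax T1 T2)); pose proof (Rmax_r A (Rmax T1 T2)).
  pose proof (Rmax_l T1 T2); pose proof (Rmax_r T1 T2).
  specialize (HB t ltac:(lra)); specialize (HT1 t ltac:(lra)); destruct (HT2 t ltac:(lra)) as [_ Hl].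
  assert (HBp : 0 < Rabs B + 1) by (pose proof (Rabs_pos B); lra).
  assert (0 < 2 * (Rabs B + 1) / eps) by (apply Rdiv_lt_0_compat; lra).
  rewrite Rabs_mult, Rabs_pos_eq in HB by lra.
  set (x := ln (Mfun M t) / ln t) in *.
  assert (Hx : Rabs (rho t - x) < eps / 2).
  { apply Rmult_lt_reg_l with (ln t); [lra|].
    eapply Rle_lt_trans; [exact HB|].
    pose proof (Rle_abs B).
    apply Rlt_le_trans with (2 * (Rabs B + 1) / eps * (eps / 2)).
    - replace (2 * (Rabs B + 1) / eps * (eps / 2)) with (Rabs B + 1) by (field; lra). lra.
    - apply Rmult_le_compat_r; lra. }
  replace (x - rho0) with ((rho t - rho0) - (rho t - x)) by ring.
  unfold Rminus at 1; eapply Rle_lt_trans; [apply Rabs_triang|]; rewrite Rabs_Ropp; lra.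
Qed.

Lemma omega_limit (M : nat -> R) (l : R) : 0 < l ->
  tends_infty (fun r => ln (Mfun M r) / ln r) l -> omega M = / l.
Proof.
  intros Hl H; unfold omega; f_equal.
  set (f := fun r => Rmax 0 (ln (Mfun M r) / ln r)).
  assert (Hf : tends_infty f l).
  { intros eps He; destruct (H (Rmin eps l) ltac:(apply Rmin_glb_lt; lra)) as [T HT].
    exists T; intros t Ht; specialize (HT t Ht).
    pose proof (Rmin_l eps l); pose proof (Rmin_r eps l).
    unfold f; rewrite Rmax_right; [lra|]. apply Rabs_def2 in HT; lra. }
  assert (Hn : forall T, exists n, T < INR n).
  { intros T; destruct (nfloor_ex (Rmax 0 T) (Rmax_l _ _)) as [n [_ Hn]].
    exists (S n); rewrite S_INR; pose proof (Rmax_r 0 T); lra. }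
  set (S := fun (n : nat) y => exists r, INR n < r /\ y = f r).
  assert (HI : is_inf_seq (fun n => Lub_Rbar (S n)) (Finite l)).
  { intros eps; split.
    - intros n; destruct (Hf eps (cond_pos eps)) as [T HT].
      set (r := Rmax T (INR n) + 1).
      pose proof (Rmax_l T (INR n)); pose proof (Rmax_r T (INR n)).
      specialize (HT r ltac:(unfold r; lra)); apply Rabs_def2 in HT.
      apply (Rbar_lt_le_trans _ (Finite (f r))); [simpl; lra|].
      apply (proj1 (Lub_Rbar_correct (S n))); exists r; split; [unfold r; lra|reflexivity].
    - destruct (Hf (eps / 2)) as [T HT]; [pose proof (cond_pos eps); lra|].
      destruct (Hn T) as [n Hn']; exists n.
      apply (Rbar_le_lt_trans _ (Finite (l + eps / 2))); [|simpl; pose proof (cond_pos eps); lra].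
      apply (proj2 (Lub_Rbar_correct (S n))); intros y (r & Hr & ->); simpl.
      specialize (HT r ltac:(lra)); apply Rabs_def2 in HT; lra. }
  apply is_inf_seq_unique in HI.
  change (real (Inf_seq (fun n => Lub_Rbar (S n))) = l); rewrite HI; reflexivity.
Qed.

Lemma Rpower_large (s A : R) : 0 < s -> exists T, 0 < T /\ forall t, T < t -> A < Rpower t s.
Proof.
  intros Hs; set (B := Rmax A 1).
  assert (HB : 0 < B) by (pose proof (Rmax_r A 1); unfold B; lra).
  exists (Rpower B (/ s)); split; [apply exp_pos|]; intros t Ht.
  apply Rle_lt_trans with B; [apply Rmax_l|].
  assert (H0 : 0 < Rpower B (/ s)) by apply exp_pos.
  rewrite <- (Rpower_1 B HB), <- (Rinv_l s), <- Rpower_mult by lra.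
  apply Rlt_Rpower_l; lra.
Qed.

Lemma Mfun_pos_large (M : nat -> R) : weight M -> exists T, 0 < T /\ forall t, T < t -> 0 < Mfun M t.
Proof.
  intros HM; exists (M 1%nat); pose proof (w_pos M HM 1%nat); split; [auto|].
  intros t Ht; eapply Rlt_le_trans; [|apply (proj1 (Mfun_sup M HM t ltac:(lra)) 1%nat)].
  rewrite <- ln_1; apply ln_increasing; [lra|]; simpl; rewrite Rmult_1_r.
  apply Rmult_lt_reg_r with (M 1%nat); [lra|]. unfold Rdiv; rewrite Rmult_assoc, Rinv_l; lra.
Qed.

Lemma omega_powseq (M : nat -> R) (s : R) : weight M -> admits_nonzero_proximate_order M ->
  0 < s -> 0 < omega M /\ omega (powseq M s) = s * omega M.
Proof.
  intros HM Hpo Hs; destruct (proximate_order_limit M Hpo) as (l & Hl & Hlim).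
  rewrite (omega_limit M l Hl Hlim); split; [apply Rinv_0_lt_compat, Hl|].
  rewrite (omega_limit (powseq M s) (l / s)).
  - field; lra.
  - apply Rdiv_lt_0_compat; lra.
  - intros eps He.
    destruct (Hlim (s * eps / 2) ltac:(nra)) as [T1 HT1].
    destruct (Mfun_pos_large M HM) as (T2 & _ & HT2).
    destruct (Rpower_large (/ s) (Rmax T1 T2)) as (T3 & HT3p & HT3); [apply Rinv_0_lt_compat, Hs|].
    destruct (ln_large (2 * (Rabs (ln s) + 1) / eps)) as [T4 HT4].
    exists (Rmax T3 T4); intros t Ht.
    pose proof (Rmax_l T3 T4); pose proof (Rmax_r T3 T4).
    specialize (HT3 t ltac:(lra)); destruct (HT4 t ltac:(lra)) as [Ht0 Hlt].
    pose proof (Rmax_l T1 T2); pose proof (Rmax_r T1 T2).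
    rewrite Mfun_powseq by assumption.
    set (r := Rpower t (/ s)) in *.
    specialize (HT1 r ltac:(lra)); specialize (HT2 r ltac:(lra)).
    assert (Hlr : ln t = s * ln r).
    { unfold r, Rpower; rewrite ln_exp; field; lra. }
    assert (Habs : 0 < 2 * (Rabs (ln s) + 1) / eps).
    { apply Rdiv_lt_0_compat; [pose proof (Rabs_pos (ln s)); lra|lra]. }
    assert (Hr0 : 0 < ln r) by nra.
    rewrite ln_mult by assumption.
    replace ((ln s + ln (Mfun M r)) / ln t - l / s) with
      (ln s / ln t + (ln (Mfun M r) / ln r - l) / s) by (rewrite Hlr; field; lra).
    eapply Rle_lt_trans; [apply Rabs_triang|].
    assert (Rabs (ln s / ln t) < eps / 2).
    { unfold Rdiv; rewrite Rabs_mult, (Rabs_pos_eq (/ ln t)) by (left; apply Rinv_0_lt_compat; lra).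
      apply Rmult_lt_reg_r with (ln t); [lra|]. rewrite Rmult_assoc, Rinv_l, Rmult_1_r by lra.
      apply Rlt_le_trans with (2 * (Rabs (ln s) + 1) / eps * (eps / 2)).
      - replace (2 * (Rabs (ln s) + 1) / eps * (eps / 2)) with (Rabs (ln s) + 1) by (field; lra). lra.
      - rewrite Rmult_comm; apply Rmult_le_compat_l; lra. }
    assert (Rabs ((ln (Mfun M r) / ln r - l) / s) < eps / 2).
    { unfold Rdiv at 1; rewrite Rabs_mult, (Rabs_pos_eq (/ s)) by (left; apply Rinv_0_lt_compat; lra).
      apply Rmult_lt_reg_r with s; [lra|]. rewrite Rmult_assoc, Rinv_l, Rmult_1_r by lra. lra. }
    lra.
Qed.

(** * Power series with coefficients in a Banach space *)

Lemma Cmod_pow_n (x : C) (n : nat) : Cmod (pow_n (K := C_Ring) x n) = Cmod x ^ n.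
Proof.
  induction n as [|n IH]; [apply Cmod_1|].
  simpl; rewrite <- IH; apply Cmod_mult.
Qed.

Ltac norm_rewrite H :=
  match type of H with _ = ?b =>
    match goal with |- context [norm ?x] => replace x with b by (symmetry; exact H) end end.

Section PowerSeries.
Context {E : CompleteNormedModule C_AbsRing}.

Lemma norm_lim_le (u : nat -> E) (l : E) (B : R) :
  filterlim u eventually (locally l) -> (exists N, forall n, (N <= n)%nat -> norm (u n) <= B) ->
  norm l <= B.
Proof.
  intros H [N HN]; apply le_epsilon; intros eps He.
  destruct (filterlim_eps (V := E) _ _ _ H eps He) as [N' HN'].
  set (n := Nat.max N N').
  specialize (HN n (Nat.le_max_l _ _)); specialize (HN' n (Nat.le_max_r _ _)).
  Cnorm_replace E (minus (u n) (minus (u n) l)).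
  eapply Rle_trans; [apply Enorm_minus|]. apply Rplus_le_compat; [exact HN|left; exact HN'].
Qed.

Lemma pseries_coef_bound (a : nat -> E) (x : C) (y : E) :
  is_pseries (K := C_AbsRing) a x y -> exists B, 0 < B /\ forall n, norm (a n) * Cmod x ^ n <= B.
Proof.
  intros H.
  assert (Hc : exists N, forall n, (N <= n)%nat ->
     norm (sum_n (fun k => scal (pow_n (K := C_Ring) x k) (a k)) n : E) <= norm y + 1).
  { destruct (filterlim_eps (V := E) _ _ _ H 1 Rlt_0_1) as [N HN]; exists N; intros n Hn.
    specialize (HN n Hn).
    Cnorm_replace E (plus (minus (sum_n (fun k => scal (pow_n (K := C_Ring) x k) (a k)) n) y) y).
    eapply Rle_trans; [apply Enorm_plus|]. rewrite Rplus_comm; apply Rplus_le_compat_l; left; exact HN. }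
  destruct Hc as [N HN].
  assert (Hfin : forall n, exists B, forall p, (p <= n)%nat -> norm (a p) * Cmod x ^ p <= B).
  { induction n as [|n [B HB]].
    - eexists; intros p Hp; replace p with 0%nat by lia; apply Rle_refl.
    - exists (Rmax B (norm (a (S n)) * Cmod x ^ S n)); intros p Hp.
      destruct (Nat.eq_dec p (S n)) as [->|Hne]; [apply Rmax_r|].
      eapply Rle_trans; [apply HB; lia|apply Rmax_l]. }
  destruct (Hfin (S N)) as [B HB].
  exists (Rmax 1 (Rmax B (2 * (norm y + 1)))); split; [pose proof (Rmax_l 1 (Rmax B (2 * (norm y + 1)))); lra|].
  intros n.
  destruct (Nat.le_gt_cases n (S N)) as [Hn|Hn].
  { eapply Rle_trans; [apply HB, Hn|]. eapply Rle_trans; [apply Rmax_l|apply Rmax_r]. }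
  destruct n as [|n]; [lia|].
  eapply Rle_trans; [|apply Rmax_r]. eapply Rle_trans; [|apply Rmax_r].
  set (s := fun n => sum_n (fun k => scal (pow_n (K := C_Ring) x k) (a k)) n : E) in *.
  assert (Es : scal (pow_n (K := C_Ring) x (S n)) (a (S n)) = minus (s (S n)) (s n)).
  { unfold s; rewrite sum_Sn; generalize (pow_n (K := C_Ring) x (S n)); intros q.
    symmetry; apply (plus_minus_cancel (G := E)). }
  assert (Hb : norm (scal (pow_n (K := C_Ring) x (S n)) (a (S n))) <= 2 * (norm y + 1)).
  { norm_rewrite Es; eapply Rle_trans; [apply Enorm_minus|].
    pose proof (HN (S n) ltac:(lia)); pose proof (HN n ltac:(lia)). lra. }
  destruct (Req_dec (Cmod x) 0) as [Hx|Hx].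
  { simpl pow; rewrite Hx; rewrite Rmult_0_l, Rmult_0_r.
    pose proof (Enorm_ge_0 E y); lra. }
  assert (Hx0 : x <> RtoC 0) by (intros ->; apply Hx, Cmod_0).
  assert (Hp : pow_n (K := C_Ring) x (S n) <> RtoC 0).
  { apply Cmod_gt_0; rewrite Cmod_pow_n; apply pow_lt; pose proof (Cmod_ge_0 x); lra. }
  assert (Ea : a (S n) = scal (Cinv (pow_n (K := C_Ring) x (S n)))
     (scal (pow_n (K := C_Ring) x (S n)) (a (S n)))).
  { transitivity (scal (RtoC 1) (a (S n))); [symmetry; apply (scal_one (V := E))|].
    rewrite <- (Cinv_l _ Hp); generalize (Cinv (pow_n (K := C_Ring) x (S n))); intros; Cmodule E. }
  rewrite Ea; apply Rmult_le_reg_l with (/ Cmod x ^ S n).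
  { apply Rinv_0_lt_compat, pow_lt; pose proof (Cmod_ge_0 x); lra. }
  assert (Hpp : 0 < Cmod x ^ S n) by (apply pow_lt; pose proof (Cmod_ge_0 x); lra).
  apply Rle_trans with (norm (scal (Cinv (pow_n (K := C_Ring) x (S n)))
     (scal (pow_n (K := C_Ring) x (S n)) (a (S n))))).
  { right; field; lra. }
  eapply Rle_trans; [apply Enorm_scal|].
  rewrite Cmod_inv, Cmod_pow_n by exact Hp.
  apply Rmult_le_compat_l; [left; apply Rinv_0_lt_compat, Hpp|exact Hb].
Qed.

(** Geometric comparison: on half of the disc [|x| <= R] the remainders of the
    series decay geometrically. *)
Lemma pseries_remainder (a : nat -> E) (B R : R) (x : C) (y : E) (N : nat) :
  0 < R -> (forall n, norm (a n) * R ^ n <= B) -> Cmod x <= R / 2 ->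
  is_pseries (K := C_AbsRing) a x y ->
  norm y <= 2 * B /\
  norm (minus y (sum_n (fun k => scal (pow_n (K := C_Ring) x k) (a k)) N)) <= 2 * B * (/ 2) ^ S N.
Proof.
  intros HR Ha Hx Hy.
  assert (HB : 0 <= B).
  { specialize (Ha 0%nat); simpl in Ha; pose proof (Enorm_ge_0 E (a 0%nat)); lra. }
  set (t := fun k => scal (pow_n (K := C_Ring) x k) (a k) : E) in *.
  assert (Ht : forall k, norm (t k) <= B * (/ 2) ^ k).
  { intros k; unfold t; eapply Rle_trans; [apply Enorm_scal|].
    rewrite Cmod_pow_n.
    apply Rle_trans with ((R / 2) ^ k * norm (a k)).
    - apply Rmult_le_compat_r; [apply Enorm_ge_0|]. apply pow_incr; split; [apply Cmod_ge_0|exact Hx].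
    - unfold Rdiv; rewrite Rpow_mult_distr.
      replace (R ^ k * (/ 2) ^ k * norm (a k)) with (norm (a k) * R ^ k * (/ 2) ^ k) by ring.
      apply Rmult_le_compat_r; [left; apply pow_lt; lra|apply Ha]. }
  split.
  - apply (norm_lim_le (sum_n t) y (2 * B) Hy).
    exists 0%nat; intros n _.
    apply Rle_trans with (2 * B * (1 - (/ 2) ^ S n)).
    + induction n as [|n IH].
      * rewrite sum_O; eapply Rle_trans; [apply Ht|]; simpl; lra.
      * rewrite sum_Sn; eapply Rle_trans; [apply Enorm_plus|].
        eapply Rle_trans; [apply Rplus_le_compat; [exact IH|apply Ht]|]. simpl; lra.
    + assert (0 < (/ 2) ^ S n) by (apply pow_lt; lra). nra.
  - apply (norm_lim_le (fun n => minus (sum_n t n) (sum_n t N)) (minus y (sum_n t N))).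
    + apply (eps_filterlim (V := E)); [typeclasses eauto|]; intros eps He.
      generalize (filterlim_eps (V := E) _ _ _ Hy eps He); apply filter_imp; intros n Hn.
      Cnorm_replace E (minus (sum_n t n) y); exact Hn.
    + exists N; intros n Hn; replace n with (N + (n - N))%nat by lia.
      generalize (n - N)%nat; clear n Hn; intros n.
      assert (P : 0 < (/ 2) ^ S N) by (apply pow_lt; lra).
      apply Rle_trans with (2 * B * (/ 2) ^ S N * (1 - (/ 2) ^ n)).
      * induction n as [|n IH].
        -- rewrite Nat.add_0_r; Cnorm_replace E (@zero E).
           eapply Rle_trans; [right; apply (norm_zero (V := E))|]. simpl; lra.
        -- rewrite Nat.add_succ_r, sum_Sn.
           Cnorm_replace E (plus (minus (sum_n t (N + n)) (sum_n t N)) (t (S (N + n)))).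
           eapply Rle_trans; [apply Enorm_plus|].
           eapply Rle_trans; [apply Rplus_le_compat; [exact IH|apply Ht]|].
           replace ((/ 2) ^ S (N + n)) with ((/ 2) ^ S N * (/ 2) ^ n)
             by (rewrite <- pow_add; f_equal; lia).
           simpl; lra.
      * assert (0 < (/ 2) ^ n) by (apply pow_lt; lra).
        assert (0 <= B * (/ 2) ^ S N) by (apply Rmult_le_pos; lra). nra.
Qed.

Lemma pseries_geometric (a : nat -> E) (B R : R) (x : C) :
  0 < R -> (forall n, norm (a n) * R ^ n <= B) -> Cmod x <= R / 2 ->
  exists y, is_pseries (K := C_AbsRing) a x y.
Proof.
  intros HR Ha Hx.
  assert (He : ex_series (K := C_AbsRing) (V := E) (fun k => scal (pow_n (K := C_Ring) x k) (a k))).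
  { apply (ex_series_le (V := E) _ (fun k => B * (/ 2) ^ k)).
    - intros k; eapply Rle_trans; [apply Enorm_scal|]; rewrite Cmod_pow_n.
      apply Rle_trans with ((R / 2) ^ k * norm (a k)).
      + apply Rmult_le_compat_r; [apply Enorm_ge_0|]. apply pow_incr; split; [apply Cmod_ge_0|exact Hx].
      + unfold Rdiv; rewrite Rpow_mult_distr.
        replace (R ^ k * (/ 2) ^ k * norm (a k)) with (norm (a k) * R ^ k * (/ 2) ^ k) by ring.
        apply Rmult_le_compat_r; [left; apply pow_lt; lra|apply Ha].
    - apply (ex_series_scal (V := R_NormedModule) B), ex_series_geom.
      rewrite Rabs_pos_eq; lra. }
  exact He.
Qed.

Lemma pseries_at_0 (a : nat -> E) : is_pseries (K := C_AbsRing) a (RtoC 0) (a 0%nat).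
Proof. apply (is_pseries_0 (K := C_AbsRing)). Qed.

Lemma pseries_unique (a : nat -> E) (x : C) (y y' : E) :
  is_pseries (K := C_AbsRing) a x y -> is_pseries (K := C_AbsRing) a x y' -> y = y'.
Proof. apply (filterlim_locally_unique (V := E)). Qed.

Lemma pseries_shift (a : nat -> E) (x : C) (y : E) : x <> RtoC 0 ->
  is_pseries (K := C_AbsRing) a x y ->
  is_pseries (K := C_AbsRing) (fun n => a (S n)) x (scal (Cinv x) (minus y (a 0%nat))).
Proof.
  intros Hx H.
  apply (eps_filterlim (V := E)); [typeclasses eauto|]; intros eps He.
  assert (Hc : 0 < Cmod x) by (apply Cmod_gt_0, Hx).
  destruct (filterlim_eps (V := E) _ _ _ H (eps * Cmod x) ltac:(nra)) as [N HN].
  exists N; intros n Hn; specialize (HN (S n) ltac:(lia)).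
  assert (Hs : forall n, sum_n (fun k => scal (pow_n (K := C_Ring) x k) (a k) : E) (S n) =
    plus (a 0%nat) (scal x (sum_n (fun k => scal (pow_n (K := C_Ring) x k) (a (S k))) n))).
  { induction n0 as [|k IH].
    - rewrite sum_Sn, !sum_O; simpl.
      change (plus (scal (RtoC 1) (a 0%nat)) (scal (Cmult x (RtoC 1)) (a 1%nat)) =
        plus (a 0%nat) (scal x (scal (RtoC 1) (a 1%nat)))). Cmodule E.
    - rewrite sum_Sn, IH, sum_Sn.
      generalize (sum_n (fun k => scal (pow_n (K := C_Ring) x k) (a (S k)) : E) k); intros s.
      change (pow_n (K := C_Ring) x (S (S k))) with (Cmult x (pow_n (K := C_Ring) x (S k))).
      generalize (pow_n (K := C_Ring) x (S k)); intros q. Cmodule E. }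
  rewrite Hs in HN.
  set (s := sum_n (fun k => scal (pow_n (K := C_Ring) x k) (a (S k)) : E) n) in *.
  assert (Es : minus s (scal (Cinv x) (minus y (a 0%nat))) =
    scal (Cinv x) (minus (plus (a 0%nat) (scal x s)) y)).
  { transitivity (minus (scal (Cmult (Cinv x) x) s) (scal (Cinv x) (minus y (a 0%nat)))).
    - rewrite Cinv_l by exact Hx. Cmodule E.
    - Cmodule E. }
  norm_rewrite Es; eapply Rle_lt_trans; [apply Enorm_scal|].
  rewrite Cmod_inv by exact Hx.
  apply Rmult_lt_reg_l with (Cmod x); [exact Hc|].
  rewrite <- Rmult_assoc, Rinv_r, Rmult_1_l by lra.
  rewrite (Rmult_comm (Cmod x)); exact HN.
Qed.

(** Needed where the quotient [(f(x) - f(0)) / x] is completed at the origin. *)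
Lemma pseries_derive_0 (a : nat -> E) (f : C -> E) (r : R) : 0 < r ->
  (forall x, Cmod x < r -> is_pseries (K := C_AbsRing) a x (f x)) ->
  is_derive (K := C_AbsRing) f (RtoC 0) (a 1%nat).
Proof.
  intros Hr Hf.
  set (R0 := r / 2).
  destruct (pseries_coef_bound a (RtoC R0) (f (RtoC R0))) as (B & HB & Ha).
  { apply Hf; rewrite Cmod_R, Rabs_pos_eq; unfold R0; lra. }
  rewrite Cmod_R, Rabs_pos_eq in Ha by (unfold R0; lra).
  assert (HR : 0 < R0) by (unfold R0; lra).
  assert (H0 : f (RtoC 0) = a 0%nat).
  { apply (pseries_unique a (RtoC 0)); [apply Hf; rewrite Cmod_0; exact Hr|apply pseries_at_0]. }
  set (C0 := 2 * (B / R0 ^ 2)).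
  assert (HR2 : 0 < R0 ^ 2) by nra.
  assert (HC0 : 0 < C0) by (unfold C0; apply Rmult_lt_0_compat; [lra|apply Rdiv_lt_0_compat; lra]).
  apply (proj2 (is_derive_eps (V := E) _ _ _)); intros eps He.
  exists (Rmin (R0 / 2) (eps / C0)); split.
  { apply Rmin_glb_lt; [lra|apply Rdiv_lt_0_compat; lra]. }
  intros h Hh; assert (Hh' : Cmod h < Rmin (R0 / 2) (eps / C0)) by exact Hh; clear Hh.
  pose proof (Rmin_l (R0 / 2) (eps / C0)); pose proof (Rmin_r (R0 / 2) (eps / C0)).
  assert (E0 : Cplus (RtoC 0) h = h) by ring.
  change (norm (minus (minus (f (Cplus (RtoC 0) h)) (f (RtoC 0))) (scal h (a 1%nat))) <= eps * Cmod h).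
  rewrite E0, H0.
  destruct (classic (h = RtoC 0)) as [->|Hh].
  { rewrite H0; Cnorm_replace E (@zero E).
    eapply Rle_trans; [right; apply (norm_zero (V := E))|]. rewrite Cmod_0; lra. }
  pose proof (pseries_shift _ _ _ Hh (Hf h ltac:(unfold R0 in *; lra))) as P1.
  pose proof (pseries_shift _ _ _ Hh P1) as P2; simpl in P2.
  set (y2 := scal (Cinv h) (minus (scal (Cinv h) (minus (f h) (a 0%nat))) (a 1%nat))) in *.
  assert (Hy2 : norm y2 <= 2 * (B / R0 ^ 2)).
  { apply (pseries_remainder (fun n => a (S (S n))) (B / R0 ^ 2) R0 h y2 0 HR); [|lra|exact P2].
    intros n; apply Rmult_le_reg_r with (R0 ^ 2); [exact HR2|].
    replace (B / R0 ^ 2 * R0 ^ 2) with B by (field; lra).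
    specialize (Ha (S (S n))); simpl in *; nra. }
  assert (Ey : minus (minus (f h) (a 0%nat)) (scal h (a 1%nat)) = scal (Cmult h h) y2).
  { unfold y2; transitivity (minus (scal (Cmult (Cmult h (Cinv h)) (Cmult h (Cinv h))) (minus (f h) (a 0%nat)))
      (scal (Cmult (Cmult h (Cinv h)) h) (a 1%nat))).
    - rewrite Cinv_r by exact Hh. Cmodule E.
    - Cmodule E. }
  norm_rewrite Ey; eapply Rle_trans; [apply Enorm_scal|]; rewrite Cmod_mult.
  pose proof (Cmod_ge_0 h).
  assert (Cmod h * C0 <= eps).
  { apply Rle_trans with (eps / C0 * C0); [apply Rmult_le_compat_r; lra|right; field; lra]. }
  assert (norm y2 <= C0) by exact Hy2.
  assert (Cmod h * norm y2 <= eps) by (pose proof (Enorm_ge_0 E y2); nra).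
  nra.
Qed.
End PowerSeries.

(** * Shifting the moments of a kernel *)

Lemma modulus_pos (z : logsurf) : 0 < modulus z.
Proof. apply exp_pos. Qed.

Lemma is_derive_C_congr (f g : C -> C) (z l : C) :
  (exists rho, 0 < rho /\ forall w, Cmod (Cminus w z) < rho -> f w = g w) ->
  is_derive (K := C_AbsRing) (V := C_NormedModule) f z l ->
  is_derive (K := C_AbsRing) (V := C_NormedModule) g z l.
Proof.
  intros (rho & H1 & H2); apply (is_derive_ext_loc (K := C_AbsRing) (V := C_NormedModule)).
  exists (mkposreal rho H1); intros w Hw; apply H2, Hw.
Qed.

(** The kernel [x e(x)], whose moments are those of [e] shifted by one. *)
Definition shift_kernel (e : logsurf -> C) : logsurf -> C := fun z => Cmult (Cexp z) (e z).

(** The entire function [(E(x) - a 0) / x]. *)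
Definition shift_entire (E : C -> C) (a : nat -> C) : C -> C := fun x =>
  if excluded_middle_informative (x = RtoC 0) then a 1%nat
  else Cmult (Cinv x) (Cminus (E x) (a 0%nat)).

Lemma shift_entire_series (E : C -> C) (a : nat -> C) (x : C) :
  is_pseries (K := C_AbsRing) (V := C_NormedModule) a x (E x) ->
  is_pseries (K := C_AbsRing) (V := C_NormedModule) (fun p => a (S p)) x (shift_entire E a x).
Proof.
  intros H; unfold shift_entire.
  destruct (excluded_middle_informative (x = RtoC 0)) as [->|Hx].
  - apply (pseries_at_0 (E := C_CompleteNormedModule) (fun p => a (S p))).
  - apply (pseries_shift (E := C_CompleteNormedModule) a x (E x) Hx H).
Qed.

Lemma shift_entire_hol (E : C -> C) (a : nat -> C) :
  (forall z, is_pseries (K := C_AbsRing) (V := C_NormedModule) a z (E z)) ->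
  holomorphic_on (V := C_NormedModule) (fun _ => True) E ->
  holomorphic_on (V := C_NormedModule) (fun _ => True) (shift_entire E a).
Proof.
  intros Hs Hh z _.
  destruct (classic (z = RtoC 0)) as [->|Hz].
  - exists (a 2%nat).
    apply (pseries_derive_0 (E := C_CompleteNormedModule) (fun p => a (S p))
      (shift_entire E a) 1 Rlt_0_1).
    intros x _; apply shift_entire_series, Hs.
  - destruct (Hh z I) as [l Hl].
    assert (Hc : 0 < Cmod z) by (apply Cmod_gt_0, Hz).
    assert (Hi : is_derive (K := C_AbsRing) (V := C_NormedModule) Cinv z (Copp (Cinv (Cmult z z)))).
    { apply (proj2 (is_derive_eps (V := C_NormedModule) _ _ _)); intros eps He.
      exists (Rmin (Cmod z / 2) (eps * Cmod z ^ 3 / 2)); split.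
      { apply Rmin_glb_lt; [lra|].
        assert (0 < Cmod z ^ 3) by (apply pow_lt, Hc). nra. }
      intros h Hh'; assert (H1 : Cmod h < Rmin (Cmod z / 2) (eps * Cmod z ^ 3 / 2)) by exact Hh'.
      pose proof (Rmin_l (Cmod z / 2) (eps * Cmod z ^ 3 / 2)).
      pose proof (Rmin_r (Cmod z / 2) (eps * Cmod z ^ 3 / 2)).
      assert (Hzh : Cmod z / 2 < Cmod (Cplus z h)).
      { pose proof (Cmod_triangle (Cplus z h) (Copp h)) as T.
        replace (Cplus (Cplus z h) (Copp h)) with z in T by ring. rewrite Cmod_opp in T. lra. }
      assert (Hzh0 : Cplus z h <> RtoC 0) by (apply Cmod_gt_0; lra).
      change (Cmod (Cminus (Cminus (Cinv (Cplus z h)) (Cinv z)) (Cmult h (Copp (Cinv (Cmult z z)))))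
        <= eps * Cmod h).
      replace (Cminus (Cminus (Cinv (Cplus z h)) (Cinv z)) (Cmult h (Copp (Cinv (Cmult z z))))) with
        (Cmult h (Cmult h (Cinv (Cmult (Cplus z h) (Cmult z z))))) by (field; auto).
      assert (Hp0 : Cmult (Cplus z h) (Cmult z z) <> RtoC 0).
      { apply Cmod_gt_0; rewrite !Cmod_mult; apply Rmult_lt_0_compat; nra. }
      rewrite !Cmod_mult, Cmod_inv, !Cmod_mult by exact Hp0.
      rewrite Rmult_comm; apply Rmult_le_compat_r; [apply Cmod_ge_0|].
      apply Rle_trans with (Cmod h * / (Cmod z / 2 * (Cmod z * Cmod z))).
      - apply Rmult_le_compat_l; [apply Cmod_ge_0|].
        apply Rinv_le_contravar; [apply Rmult_lt_0_compat; nra|].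
        apply Rmult_le_compat_r; [nra|lra].
      - replace (Cmod z / 2 * (Cmod z * Cmod z)) with (Cmod z ^ 3 / 2) by field.
        assert (0 < Cmod z ^ 3) by (apply pow_lt, Hc).
        apply Rmult_le_reg_r with (Cmod z ^ 3 / 2); [lra|].
        rewrite Rmult_assoc, Rinv_l by lra. lra. }
    eexists.
    apply (is_derive_C_congr (fun w => Cmult (Cinv w) (Cminus (E w) (a 0%nat)))).
    + exists (Cmod z); split; [exact Hc|]; intros w Hw; unfold shift_entire.
      destruct (excluded_middle_informative (w = RtoC 0)) as [->|_]; [|reflexivity].
      replace (Cminus (RtoC 0) z) with (Copp z) in Hw by ring. rewrite Cmod_opp in Hw; lra.
    + apply (is_derive_Cscal (E := C_CompleteNormedModule) Cinv (fun w => Cminus (E w) (a 0%nat)));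
        [exact Hi|].
      apply (is_derive_minus (K := C_AbsRing) (V := C_NormedModule) E (fun _ => a 0%nat));
        [exact Hl|apply (is_derive_const (K := C_AbsRing) (V := C_NormedModule))].
Qed.

(** Multiplying [e] by [x] shifts its moments by one, and dividing [E - E(0)] by [x]
    shifts the coefficients accordingly. The class of kernels is preserved because
    (mg) absorbs the factor [x] in the decay of [e]; the new [E] decays like [1/x].
    *)
Lemma strong_kernel_shift (M : nat -> R) (e : logsurf -> C) (E : C -> C) (m : nat -> R) :
  weight M -> strong_kernel M e E m ->
  strong_kernel M (shift_kernel e) (shift_entire E (fun p => RtoC (/ m p))) (fun p => m (S p)).
Proof.
  intros HM HK.
  destruct (exp_Mfun_absorb M HM) as (A & HA & Habs).
  assert (Habs1 : forall t, 0 < t -> t * exp (Mfun M t) <= M 1%nat * exp (Mfun M (A * t))).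
  { intros t Ht; specialize (Habs 1%nat t Ht); rewrite pow_1 in Habs; exact Habs. }
  pose proof (w_pos M HM 1%nat) as HM1.
  split.
  - intros z Hz; destruct (sk_e_hol _ _ _ _ HK z Hz) as [l Hl].
    eexists; apply (is_derive_Cscal (E := C_CompleteNormedModule) Cexp e); [apply Cexp_derive|exact Hl].
  - intros x Hx; pose proof (sk_e_real _ _ _ _ HK x Hx) as H.
    unfold shift_kernel, polar in *.
    assert (Hr : Cexp (ln x, 0) = RtoC x).
    { change (ln x, 0) with (RtoC (ln x)); rewrite Cexp_R, exp_ln; auto. }
    rewrite Hr; destruct (e (ln x, 0)) as [u v]; unfold Im in *; simpl in *. rewrite H; ring.
  - destruct (sk_e_zero _ _ _ _ HK) as (al & Hal & H).
    exists (al + 1); split; [lra|]; intros p1 p2 R0 H1 H2 H3 H4.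
    destruct (H p1 p2 R0 H1 H2 H3 H4) as (c & Hc & Hb); exists c; split; [exact Hc|].
    intros z Hz Hm; unfold shift_kernel; rewrite Cmod_mult, Cmod_Cexp.
    change (exp (Re z)) with (modulus z).
    rewrite Rpower_plus, Rpower_1 by apply modulus_pos.
    specialize (Hb z Hz Hm); pose proof (modulus_pos z). nra.
  - intros eps He; destruct (sk_e_inf _ _ _ _ HK eps He) as (c & k & Hc & Hk & H).
    exists (c * (A * k) * M 1%nat), (A * k); repeat split; try nra.
    { apply Rmult_lt_0_compat; [apply Rmult_lt_0_compat; nra|exact HM1]. }
    intros z Hz; unfold shift_kernel; rewrite Cmod_mult, Cmod_Cexp.
    change (exp (Re z)) with (modulus z).
    pose proof (modulus_pos z) as Hm.
    specialize (H z Hz); set (t := modulus z / (A * k)).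
    assert (Ht : 0 < t) by (apply Rdiv_lt_0_compat; nra).
    specialize (Habs1 t Ht).
    replace (A * t) with (modulus z / k) in Habs1 by (unfold t; field; lra).
    apply Rle_trans with (modulus z * (c * exp (- Mfun M (modulus z / k)))).
    + apply Rmult_le_compat_l; [lra|exact H].
    + replace (modulus z) with (A * k * t) at 1 by (unfold t; field; lra).
      replace (A * k * t * (c * exp (- Mfun M (modulus z / k)))) with
        (c * (A * k) * (t * exp (- Mfun M (modulus z / k)))) by ring.
      rewrite (Rmult_assoc _ (M 1%nat)).
      apply Rmult_le_compat_l; [apply Rmult_le_pos; nra|].
      rewrite !exp_Ropp.
      pose proof (exp_pos (Mfun M t)); pose proof (exp_pos (Mfun M (modulus z / k))).
      apply Rmult_le_reg_r with (exp (Mfun M t) * exp (Mfun M (modulus z / k))); [nra|].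
      field_simplify; [|lra|lra]. fold t; lra.
  - apply shift_entire_hol; [apply (sk_E_series _ _ _ _ HK)|apply (sk_E_entire _ _ _ _ HK)].
  - destruct (sk_E_growth _ _ _ _ HK) as (c & k & Hc & Hk & H).
    pose proof (shift_entire_series E (fun p => RtoC (/ m p)) (RtoC 2) (sk_E_series _ _ _ _ HK (RtoC 2))) as Hs.
    destruct (pseries_coef_bound (E := C_CompleteNormedModule) _ _ _ Hs) as (B & HB & Hcoef).
    rewrite Cmod_R, Rabs_pos_eq in Hcoef by lra.
    exists (c + Rabs (/ m 0%nat) + 2 * B), k; repeat split; [pose proof (Rabs_pos (/ m 0%nat)); lra|exact Hk|].
    intros z.
    assert (H1 : 1 <= exp (Mfun M (Cmod z / k))).
    { rewrite <- exp_0; apply exp_le_mono, Mfun_nonneg, HM. }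
    pose proof (Rabs_pos (/ m 0%nat)).
    destruct (Rle_dec (Cmod z) 1) as [Hz|Hz].
    + pose proof (proj1 (pseries_remainder (E := C_CompleteNormedModule) _ B 2 z _ 0 ltac:(lra) Hcoef
        ltac:(lra) (shift_entire_series E (fun p => RtoC (/ m p)) z (sk_E_series _ _ _ _ HK z)))) as Hb.
      change (Cmod (shift_entire E (fun p => RtoC (/ m p)) z) <= 2 * B) in Hb.
      eapply Rle_trans; [exact Hb|]. nra.
    + unfold shift_entire; destruct (excluded_middle_informative (z = RtoC 0)) as [->|Hz0].
      { rewrite Cmod_0 in Hz; lra. }
      rewrite Cmod_mult, Cmod_inv by exact Hz0.
      assert (Hi : / Cmod z <= 1) by (rewrite <- Rinv_1; apply Rinv_le_contravar; lra).
      assert (Hi0 : 0 < / Cmod z) by (apply Rinv_0_lt_compat; lra).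
      assert (Hd : Cmod (Cminus (E z) (RtoC (/ m 0%nat))) <= c * exp (Mfun M (Cmod z / k)) + Rabs (/ m 0%nat)).
      { eapply Rle_trans; [apply Cmod_triangle|]; rewrite Cmod_opp, Cmod_R.
        apply Rplus_le_compat_r, H. }
      pose proof (Cmod_ge_0 (Cminus (E z) (RtoC (/ m 0%nat)))).
      apply Rle_trans with (Cmod (Cminus (E z) (RtoC (/ m 0%nat)))); [nra|].
      eapply Rle_trans; [exact Hd|]. nra.
  - destruct (sk_E_decay _ _ _ _ HK) as (be & Hbe & H).
    (* the constant term limits the rate of decay to that of 1/x *)
    exists 1; split; [lra|]; intros th ME Hth HME.
    destruct (H th ME Hth HME) as (c2 & Hc2 & Hb).
    exists (c2 * Rpower ME (- be) + Rabs (/ m 0%nat)); split.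
    { pose proof (Rabs_pos (/ m 0%nat)).
      pose proof (exp_pos (- be * ln ME)). unfold Rpower. nra. }
    intros z Hz Hm; unfold shift_entire.
    destruct (excluded_middle_informative (proj z = RtoC 0)) as [H0|H0].
    { exfalso; apply (Cexp_neq_0 z), H0. }
    rewrite Cmod_mult, Cmod_inv by exact H0.
    unfold proj at 1; rewrite Cmod_Cexp; change (exp (Re z)) with (modulus z).
    rewrite (Rpower_Ropp (modulus z)), Rpower_1 by apply modulus_pos.
    rewrite Rmult_comm; apply Rmult_le_compat_r.
    { left; apply Rinv_0_lt_compat, modulus_pos. }
    eapply Rle_trans; [apply Cmod_triangle|]; rewrite Cmod_opp, Cmod_R.
    apply Rplus_le_compat_r.
    eapply Rle_trans; [apply Hb; auto|].
    apply Rmult_le_compat_l; [lra|].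
    rewrite !Rpower_Ropp; apply Rinv_le_contravar; [apply exp_pos|].
    apply Rle_Rpower_l; lra.
  - destruct (sk_moments _ _ _ _ HK) as (me & Hme & Hmp).
    exists (fun z => me (Cplus z (RtoC 1))); split.
    + intros z Hz.
      assert (Hz1 : 0 <= Re (Cplus z (RtoC 1))) by (unfold Re, Cplus, RtoC in *; simpl in *; lra).
      pose proof (Hme _ Hz1) as Hg.
      eapply (is_RInt_gen_ext (V := C_R_NormedModule)); [|exact Hg].
      apply Filter_prod with (Q := fun x => 0 < x) (R := fun x => 0 < x).
      { exists (mkposreal 1 Rlt_0_1); auto. }
      { exists 0; auto. }
      intros x y Hx Hy t Ht; simpl in Ht.
      assert (Ht0 : 0 < t) by (pose proof (Rmin_glb_lt x y 0 Hx Hy); lra).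
      unfold shift_kernel, polar.
      assert (Hr : Cexp (ln t, 0) = Cexp (RtoC (ln t))) by reflexivity.
      rewrite Hr, Cmult_assoc, <- Cexp_plus.
      f_equal; f_equal; ring.
    + intros p; rewrite <- Hmp; f_equal.
      rewrite S_INR, RtoC_plus; reflexivity.
  - intros p; apply (sk_nonzero _ _ _ _ HK).
  - intros z; apply shift_entire_series, (sk_E_series _ _ _ _ HK).
Qed.

(** * Kernel bounds in the logarithmic coordinate *)

Notation Cd := (C_differentiable C_CompleteNormedModule).

Lemma exp_abs_dominated (v : R) : exp (- Rabs v / 2) <= 16 / (1 + v ^ 2).
Proof.
  assert (H1 : 1 + Rabs v / 4 <= exp (Rabs v / 4)) by apply exp_ineq1_le.
  pose proof (Rabs_pos v) as H0.
  assert (H2 : 1 + v ^ 2 <= 16 * exp (Rabs v / 2)).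
  { replace (Rabs v / 2) with (Rabs v / 4 + Rabs v / 4) by field. rewrite exp_plus.
    rewrite <- (pow2_abs v). nra. }
  replace (- Rabs v / 2) with (- (Rabs v / 2)) by field.
  rewrite exp_Ropp.
  pose proof (exp_pos (Rabs v / 2)).
  apply Rmult_le_reg_r with (exp (Rabs v / 2) * (1 + v ^ 2)); [nra|].
  field_simplify; nra.
Qed.

(** A primitive, in the logarithmic coordinate, of an entire function times
    [x^(-p)]; its period is [2 pi i] times a residue, namely the coefficient of
    order [p]. The induction on [p] peels off the constant coefficient. *)
Lemma log_primitive (p : nat) : forall (a : nat -> C) (F : C -> C),
  (forall x, is_pseries (K := C_AbsRing) (V := C_NormedModule) a x (F x)) ->
  holomorphic_on (V := C_NormedModule) (fun _ => True) F ->
  exists Q : C -> C,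
   (forall w, is_derive (K := C_AbsRing) (V := C_NormedModule) Q w
      (Cmult (F (Cexp w)) (Cexp (Copp (Cmult (RtoC (INR p)) w))))) /\
   (forall w, Q (Cplus w (0, 2 * PI)) = Cplus (Q w) (Cmult (0, 2 * PI) (a p))).
Proof.
  assert (HF : forall (a : nat -> C) (F : C -> C) (w : C), F (Cexp w) =
    Cplus (a 0%nat) (Cmult (Cexp w) (shift_entire F a (Cexp w)))).
  { intros a F w; unfold shift_entire.
    destruct (excluded_middle_informative (Cexp w = RtoC 0)) as [H|H].
    - exfalso; apply (Cexp_neq_0 w H).
    - rewrite Cmult_assoc, Cinv_r by exact H; ring. }
  induction p as [|p IH]; intros a F Ha HFh.
  - destruct (entire_primitive C_CompleteNormedModule (shift_entire F a)) as [P HP].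
    { intros z; apply (shift_entire_hol F a Ha HFh z I). }
    exists (fun w => Cplus (Cmult w (a 0%nat)) (P (Cexp w))); split.
    + intros w.
      replace (Cmult (F (Cexp w)) (Cexp (Copp (Cmult (RtoC (INR 0)) w)))) with
        (Cplus (Cmult (RtoC 1) (a 0%nat)) (Cmult (Cexp w) (shift_entire F a (Cexp w)))).
      * apply (is_derive_plus (K := C_AbsRing) (V := C_NormedModule) (fun w => Cmult w (a 0%nat)) (fun w => P (Cexp w))).
        -- apply (is_derive_Cscal_l (E := C_CompleteNormedModule) (fun w => w)), is_derive_Cid.
        -- apply (is_derive_Ccomp (E := C_CompleteNormedModule) P Cexp); [apply HP|apply Cexp_derive].
      * simpl INR; replace (Copp (Cmult (RtoC 0) w)) with (RtoC 0) by ring.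
        rewrite Cexp_0, (HF a F w); ring.
    + intros w; rewrite Cexp_period; ring.
  - destruct (IH (fun n => a (S n)) (shift_entire F a)) as (Q & HQ1 & HQ2).
    { intros x; apply shift_entire_series, Ha. }
    { apply shift_entire_hol; assumption. }
    set (n := INR (S p)).
    assert (Hn : n <> 0) by (apply not_0_INR; lia).
    set (c := Cmult (RtoC (- / n)) (a 0%nat)).
    exists (fun w => Cplus (Cmult (Cexp (Copp (Cmult (RtoC n) w))) c) (Q w)); split.
    + intros w.
      assert (Hd : is_derive (K := C_AbsRing) (V := C_NormedModule)
        (fun w => Cexp (Copp (Cmult (RtoC n) w))) w
        (Cmult (Cmult (RtoC 1) (RtoC n)) (Copp (Cexp (Copp (Cmult (RtoC n) w)))))).
      { apply (is_derive_Ccomp (E := C_CompleteNormedModule) (fun w => Cexp (Copp w)) (fun w => Cmult (RtoC n) w)).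
        - apply Cexp_opp_derive.
        - apply (is_derive_ext (K := C_AbsRing) (V := C_NormedModule) (fun w => Cmult w (RtoC n))).
          + intros t; apply Cmult_comm.
          + apply (is_derive_Cscal_l (E := C_CompleteNormedModule) (fun w => w)), is_derive_Cid. }
      replace (Cmult (F (Cexp w)) (Cexp (Copp (Cmult (RtoC n) w)))) with
        (Cplus (Cmult (Cmult (Cmult (RtoC 1) (RtoC n)) (Copp (Cexp (Copp (Cmult (RtoC n) w))))) c)
          (Cmult (shift_entire F a (Cexp w)) (Cexp (Copp (Cmult (RtoC (INR p)) w))))).
      * apply (is_derive_plus (K := C_AbsRing) (V := C_NormedModule)
          (fun w => Cmult (Cexp (Copp (Cmult (RtoC n) w))) c) Q); [|apply HQ1].
        apply (is_derive_Cscal_l (E := C_CompleteNormedModule) (fun w => Cexp (Copp (Cmult (RtoC n) w)))), Hd.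
      * rewrite (HF a F w).
        assert (He : Cexp (Copp (Cmult (RtoC (INR p)) w)) = Cmult (Cexp w) (Cexp (Copp (Cmult (RtoC n) w)))).
        { rewrite <- Cexp_plus; f_equal; unfold n; rewrite S_INR, RtoC_plus; ring. }
        rewrite He; unfold c.
        replace (RtoC (- / n)) with (Copp (Cinv (RtoC n))).
        -- field. intros H; apply Hn; injection H; auto.
        -- rewrite RtoC_opp, RtoC_inv; auto.
    + intros w; rewrite HQ2.
      assert (He : Cexp (Copp (Cmult (RtoC n) (Cplus w (0, 2 * PI)))) = Cexp (Copp (Cmult (RtoC n) w))).
      { assert (Hk : forall k u, Cexp (Cplus u (0, - (INR k * (2 * PI)))) = Cexp u).
        { induction k as [|k IHk]; intros u.
          - simpl INR; f_equal; unfold Cplus; destruct u; simpl; f_equal; ring.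
          - rewrite <- (IHk u), <- (Cexp_period (Cplus u (0, - (INR (S k) * (2 * PI))))).
            f_equal; rewrite S_INR; unfold Cplus; destruct u; simpl; f_equal; ring. }
        rewrite <- (Hk (S p) (Copp (Cmult (RtoC n) w))); f_equal.
        unfold n, Cplus, Copp, Cmult, RtoC; destruct w; simpl; f_equal; ring. }
      rewrite He; ring.
Qed.

Section KernelBounds.
Context (M : nat -> R) (e : logsurf -> C) (E : C -> C) (m : nat -> R)
  (HM : weight M) (HK : strong_kernel M e E m).
Let eta := omega M * PI / 2.
Context (Heta : 0 < eta < PI) (delta : R) (Hd : 0 < delta) (Hd1 : delta <= eta) (Hd2 : delta <= PI - eta).
Let H : C -> C := fun z => E (Cexp z).
Let et : C -> C := shift_kernel e.

(** Inside its sector, the kernel beats the growth function together with any power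
    of the variable; the dilation [k] is the same for all powers. *)
Lemma kernel_decay : exists k, 0 < k /\ forall N : nat, exists K, 0 < K /\ forall z : C,
  Rabs (Im z) <= eta - delta / 2 ->
  Cmod (et z) * exp (Mfun M (exp (Re z) / k)) <= K * exp (Re z - INR N * Rmax (Re z) 0).
Proof.
  destruct (exp_Mfun_absorb M HM) as (A & HA & Habs).
  destruct (sk_e_inf _ _ _ _ HK (delta / 2) ltac:(lra)) as (c & k & Hc & Hk & Hinf).
  destruct (sk_e_zero _ _ _ _ HK) as (al & Hal & Hz0).
  destruct (Hz0 (- (eta - delta / 4)) (eta - delta / 4) 2) as (c0 & Hc0 & Hzero); try (unfold eta in *; lra).
  assert (HkA : 0 < k * A) by nra.
  exists (k * A); split; [exact HkA|]; intros N.
  set (C1 := c * (M N * (k * A) ^ N)). set (C2 := c0 * exp (Mfun M (1 / (k * A)))).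
  assert (HMN := w_pos M HM N).
  assert (HC1 : 0 < C1) by (unfold C1; apply Rmult_lt_0_compat; [lra|]; apply Rmult_lt_0_compat; [lra|apply pow_lt, HkA]).
  assert (HC2 : 0 < C2) by (unfold C2; apply Rmult_lt_0_compat; [lra|apply exp_pos]).
  exists (C1 + C2); split; [lra|]; intros z Hz.
  unfold et, shift_kernel; rewrite Cmod_mult, Cmod_Cexp.
  assert (Hz' : Rabs (Im z) < eta - delta / 4) by lra.
  apply Rabs_def2 in Hz'.
  pose proof (exp_pos (Re z)) as Hx.
  destruct (Rle_dec (Re z) 0) as [Hneg|Hpos].
  - rewrite Rmax_right by exact Hneg; rewrite Rmult_0_r, Rminus_0_r.
    assert (He1 : exp (Re z) <= 1) by (rewrite <- exp_0; apply exp_le_mono, Hneg).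
    specialize (Hzero z ltac:(unfold arg; lra) ltac:(unfold modulus; lra)).
    assert (Hpw : Rpower (modulus z) al <= 1).
    { unfold Rpower, modulus; rewrite ln_exp, <- exp_0; apply exp_le_mono; nra. }
    assert (Hm : exp (Mfun M (exp (Re z) / (k * A))) <= exp (Mfun M (1 / (k * A)))).
    { apply exp_le_mono, Mfun_mono; [exact HM|]; apply Rmult_le_compat_r; [left; apply Rinv_0_lt_compat, HkA|exact He1]. }
    pose proof (exp_pos (Mfun M (exp (Re z) / (k * A)))) as Hp1.
    pose proof (Cmod_ge_0 (e z)).
    assert (Cmod (e z) <= c0) by nra.
    assert (Cmod (e z) * exp (Mfun M (exp (Re z) / (k * A))) <= C2).
    { unfold C2; apply Rmult_le_compat; lra. }
    nra.
  - rewrite Rmax_left by lra.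
    assert (Hsec : sector 0 (omega M * PI - delta / 2) z).
    { unfold sector, arg; rewrite Rminus_0_r; unfold eta in *; lra. }
    specialize (Hinf z Hsec); unfold modulus in Hinf.
    set (t := exp (Re z) / (k * A)).
    assert (Ht : 0 < t) by (apply Rdiv_lt_0_compat; lra).
    specialize (Habs N t Ht).
    replace (A * t) with (exp (Re z) / k) in Habs by (unfold t; field; lra).
    rewrite exp_Ropp in Hinf.
    set (P := exp (Mfun M (exp (Re z) / k))) in *.
    set (q := exp (Mfun M t)) in *.
    assert (HP : 0 < P) by apply exp_pos. assert (Hq : 0 < q) by apply exp_pos.
    assert (HtN : 0 < t ^ N) by (apply pow_lt, Ht).
    assert (Hexp : exp (Re z - INR N * Re z) = exp (Re z) * / exp (Re z) ^ N).
    { unfold Rminus; rewrite exp_plus; f_equal.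
      rewrite exp_Ropp; f_equal. rewrite <- Rpower_pow by exact Hx. unfold Rpower; rewrite ln_exp; reflexivity. }
    rewrite Hexp.
    assert (HxN : 0 < exp (Re z) ^ N) by (apply pow_lt, Hx).
    assert (Eq : exp (Re z) ^ N = (k * A) ^ N * t ^ N).
    { rewrite <- Rpow_mult_distr; f_equal; unfold t; field; lra. }
    apply Rle_trans with (exp (Re z) * (c * / P) * q).
    { apply Rmult_le_compat_r; [lra|]; apply Rmult_le_compat_l; lra. }
    apply Rle_trans with (C1 * (exp (Re z) * / exp (Re z) ^ N)).
    2:{ apply Rmult_le_compat_r; [|lra]. apply Rmult_le_pos; [lra|left; apply Rinv_0_lt_compat, HxN]. }
    rewrite Eq; unfold C1.
    assert (HkN : 0 < (k * A) ^ N) by (apply pow_lt, HkA).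
    apply Rmult_le_reg_r with (P * t ^ N); [nra|].
    replace (exp (Re z) * (c * / P) * q * (P * t ^ N)) with (exp (Re z) * c * (t ^ N * q)) by (field; lra).
    replace (c * (M N * (k * A) ^ N) * (exp (Re z) * / ((k * A) ^ N * t ^ N)) * (P * t ^ N)) with
      (exp (Re z) * c * (M N * P)) by (field; lra).
    apply Rmult_le_compat_l; [nra|exact Habs].
Qed.

Lemma entire_growth : exists c k, 0 < c /\ 0 < k /\ forall z : C,
  Cmod (H z) <= c * exp (Mfun M (exp (Re z) / k)).
Proof.
  destruct (sk_E_growth _ _ _ _ HK) as (c & k & Hc & Hk & Hg).
  exists c, k; repeat split; auto; intros z.
  unfold H; rewrite <- Cmod_Cexp; apply Hg.
Qed.

(** Away from the sector of opening [omega M * PI] around the positive axis, seen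
    from either sheet. The exponent is bounded by 1/2 so that the decay is weaker
    than that of the kernel at the origin. *)
Lemma entire_decay : exists b K, 0 < b <= / 2 /\ 0 < K /\ forall z : C,
  (eta + delta / 2 <= Im z <= 2 * PI - eta - delta / 2 \/
   eta + delta / 2 <= - Im z <= 2 * PI - eta - delta / 2) ->
  Cmod (H z) <= K * exp (- b * Re z).
Proof.
  destruct (sk_E_decay _ _ _ _ HK) as (be & Hbe & Hdec).
  destruct (Hdec (2 * PI - 2 * eta - delta / 2) 1) as (c2 & Hc2 & Hb); [unfold eta in *; lra|lra|].
  destruct entire_growth as (c & k & Hc & Hk & Hg).
  set (b := Rmin be (/ 2)).
  assert (Hb0 : 0 < b) by (apply Rmin_glb_lt; lra).
  assert (Hb1 : b <= be) by apply Rmin_l. assert (Hb2 : b <= / 2) by apply Rmin_r.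
  set (C1 := c * exp (Mfun M (1 / k))).
  assert (HC1 : 0 < C1) by (apply Rmult_lt_0_compat; [lra|apply exp_pos]).
  exists b, (c2 + C1); repeat split; try lra.
  assert (Main : forall z : C, eta + delta / 2 <= Im z <= 2 * PI - eta - delta / 2 ->
    Cmod (H z) <= (c2 + C1) * exp (- b * Re z)).
  { intros z Hz; pose proof (exp_pos (- b * Re z)) as He.
    destruct (Rle_dec 0 (Re z)) as [Hx|Hx].
    - assert (Hs : sector PI (2 * PI - 2 * eta - delta / 2) z).
      { unfold sector, arg; apply Rabs_def1; lra. }
      specialize (Hb z Hs); unfold modulus in Hb.
      specialize (Hb ltac:(rewrite <- exp_0; apply exp_le_mono, Hx)).
      unfold Rpower in Hb; rewrite ln_exp in Hb.
      assert (exp (- be * Re z) <= exp (- b * Re z)) by (apply exp_le_mono; nra).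
      unfold proj in Hb; unfold H; nra.
    - assert (H1 : 1 <= exp (- b * Re z)) by (rewrite <- exp_0; apply exp_le_mono; nra).
      specialize (Hg z).
      assert (Hm : exp (Mfun M (exp (Re z) / k)) <= exp (Mfun M (1 / k))).
      { apply exp_le_mono, Mfun_mono; [exact HM|]; apply Rmult_le_compat_r; [left; apply Rinv_0_lt_compat, Hk|].
        rewrite <- exp_0; apply exp_le_mono; lra. }
      assert (Cmod (H z) <= C1) by (unfold C1; nra). nra. }
  intros z [Hz|Hz]; [auto|].
  assert (E1 : H z = H (Cplus z (0, 2 * PI))) by (unfold H; rewrite Cexp_period; reflexivity).
  rewrite E1.
  assert (E2 : Re z = Re (Cplus z (0, 2 * PI))) by (unfold Re, Cplus; simpl; ring).
  rewrite E2; apply Main; unfold Im, Cplus in *; simpl in *; lra.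
Qed.
End KernelBounds.

(** * Contours with moments *)

Ltac Cring := match goal with |- @eq _ ?a ?b => change (@eq C a b) end; ring.

(** A path [exp (l s)] with a density [w s]; as [s] tends to 0 the path may tend to
    the origin, that is [Re (l s)] may tend to minus infinity. The bounds keep the
    path in a bounded sector of half opening [delta], where averages of holomorphic
    functions along the path make sense. *)
Record contour (w l : R -> C) (W L delta : R) : Prop := {
  ct_w : forall s, 0 < s -> continuous (T := R_UniformSpace) (U := C_UniformSpace) w s;
  ct_l : forall s, 0 < s -> continuous (T := R_UniformSpace) (U := C_UniformSpace) l s;
  ct_W : forall s, 0 < s -> Cmod (w s) <= W * s;
  ct_re : forall s, 0 < s -> Re (l s) <= L;
  ct_im : forall s, 0 < s -> Rabs (Im (l s)) <= delta
}.

(** Nothing is known of the contour at [s = 0]; since the density vanishes there,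
    the extension by 0 makes the integrands continuous on the whole line. *)
Definition ext0 {T : AbelianGroup} (g : R -> T) (s : R) : T :=
  if Rlt_dec 0 s then g s else zero.

Lemma ext0_continuous {E : CompleteNormedModule C_AbsRing} (g : R -> R -> E) (K : R) :
  (forall s v, 0 < s -> continuous (U := E) (fun p : R * R => g (fst p) (snd p)) (s, v)) ->
  (forall s v, 0 < s -> norm (g s v) <= K * s) ->
  forall s v, continuous (U := restrict_scalars E)
    (fun p : R * R => ext0 (T := E) (fun s => g s (snd p)) (fst p)) (s, v).
Proof.
  intros Hc Hb s v.
  destruct (Rlt_dec 0 s) as [Hs|Hs].
  - apply (continuous_ext_loc (U := E) _ (fun p : R * R => g (fst p) (snd p))); [|apply Hc, Hs].
    apply pair_locally; exists s; split; [exact Hs|]; intros x y Hx _; unfold ext0; simpl.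
    apply Rabs_def2 in Hx. destruct (Rlt_dec 0 x); [reflexivity|lra].
  - apply (eps_continuous (V := E)); intros eps He.
    apply pair_locally; exists (eps / (Rabs K + 1)).
    pose proof (Rabs_pos K) as HK.
    assert (Hr : 0 < eps / (Rabs K + 1)) by (apply Rdiv_lt_0_compat; lra).
    split; [exact Hr|]; intros x y Hx _; unfold ext0; simpl.
    destruct (Rlt_dec 0 s) as [Hs'|_]; [lra|].
    destruct (Rlt_dec 0 x) as [Hx0|Hx0].
    + Cnorm_replace E (g x y); eapply Rle_lt_trans; [apply Hb, Hx0|].
      apply Rabs_def2 in Hx.
      apply Rle_lt_trans with ((Rabs K + 1) * x).
      * apply Rmult_le_compat_r; [lra|]; pose proof (Rle_abs K); lra.
      * apply Rlt_le_trans with ((Rabs K + 1) * (eps / (Rabs K + 1))).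
        -- apply Rmult_lt_compat_l; lra.
        -- right; field; lra.
    + Cnorm_replace E (@zero E); eapply Rle_lt_trans; [right; apply (norm_zero (V := E))|exact He].
Qed.

Lemma ext0_continuous_1 {E : CompleteNormedModule C_AbsRing} (g : R -> E) (K : R) :
  (forall s, 0 < s -> continuous (U := E) g s) ->
  (forall s, 0 < s -> norm (g s) <= K * s) ->
  forall s, continuous (U := restrict_scalars E) (ext0 (T := E) g) s.
Proof.
  intros Hc Hb s.
  apply (continuous_pair_l (U := restrict_scalars E) (fun s _ => ext0 (T := E) g s) s 0).
  apply (ext0_continuous (fun s _ => g s) K); [|auto].
  intros s' v Hs'; apply (continuous_comp (fun p : R * R => fst p) g (s', v)).
  - apply continuous_fst.
  - apply Hc, Hs'.
Qed.

Lemma continuous_Cmult {T : UniformSpace} (f g : T -> C) (x : T) :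
  continuous (U := C_UniformSpace) f x -> continuous (U := C_UniformSpace) g x ->
  continuous (U := C_UniformSpace) (fun t => Cmult (f t) (g t)) x.
Proof.
  intros Hf Hg.
  apply (continuous_scal (K := C_AbsRing) (V := C_NormedModule) f g x); [|exact Hg].
  intros P HP; apply Hf, locally_C, HP.
Qed.

Lemma continuous_Cplus {T : UniformSpace} (f g : T -> C) (x : T) :
  continuous (U := C_UniformSpace) f x -> continuous (U := C_UniformSpace) g x ->
  continuous (U := C_UniformSpace) (fun t => Cplus (f t) (g t)) x.
Proof. apply (continuous_plus (V := C_NormedModule)). Qed.

Lemma continuous_Copp {T : UniformSpace} (f : T -> C) (x : T) :
  continuous (U := C_UniformSpace) f x ->
  continuous (U := C_UniformSpace) (fun t => Copp (f t)) x.
Proof. apply (continuous_opp (V := C_NormedModule)). Qed.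

Lemma continuous_mkC {T : UniformSpace} (f g : T -> R) (x : T) :
  continuous f x -> continuous g x ->
  continuous (U := C_UniformSpace) (fun t => (f t, g t)) x.
Proof.
  intros Hf Hg; apply (continuous_comp_2 f g (fun a b => (a, b) : C_UniformSpace) x Hf Hg).
  intros P [eps HP]; exists eps; intros [a b] [Ha Hb]; apply HP; split; assumption.
Qed.

Lemma holomorphic_continuous (f : C -> C) (z l : C) :
  is_derive (K := C_AbsRing) (V := C_NormedModule) f z l ->
  continuous (T := C_UniformSpace) (U := C_UniformSpace) f z.
Proof. apply (is_derive_continuous_C C_CompleteNormedModule). Qed.

Lemma is_derive_R_continuous_C (f : R -> C) (t : R) (l : C) :
  is_derive (V := VC) f t l -> continuous (U := C_UniformSpace) f t.
Proof. intros H; apply (ex_derive_continuous (V := VC)); exists l; exact H. Qed.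

Lemma continuous_clamp (s : R) : continuous (fun u : R => Rmin u 1) s.
Proof.
  apply (eps_continuous (V := R_NormedModule)); intros eps He.
  exists (mkposreal eps He); intros y Hy.
  change (Rabs (Rmin y 1 - Rmin s 1) < eps); change (Rabs (y - s) < eps) in Hy.
  apply Rabs_def2 in Hy; apply Rabs_def1; unfold Rmin; destruct (Rle_dec y 1), (Rle_dec s 1); lra.
Qed.

Section Piece.
Context (H et : C -> C) (tau L delta : R) (Y Y' : R -> C) (B : R -> R) (K0 : R).
Context (Hcont : forall z, continuous (T := C_UniformSpace) (U := C_UniformSpace) H z)
  (Hetc : forall v, continuous (U := C_UniformSpace) (fun v => et (v, tau)) v)
  (HY : forall s, 0 < s -> is_derive (V := VC) Y s (Y' s))
  (HY' : forall s, 0 < s -> continuous (U := C_UniformSpace) Y' s)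
  (Hre : forall s, 0 < s <= 1 -> - L <= Re (Y s))
  (Him : forall s, 0 < s <= 1 -> Rabs (Im (Y s)) <= delta)
  (HB0 : forall v, 0 <= B v)
  (HBet : forall v, B v * Cmod (et (v, tau)) <= K0 / (1 + v ^ 2))
  (HB : forall p : nat, exists K, 0 < K /\ forall s v, 0 < s <= 1 ->
     Cmod (H (Cplus (Y s) (v, tau))) * Cmod (Cexp (Copp (Cmult (RtoC (INR p)) (Y s)))) *
     Cmod (Y' s) <= K * s * B v).

(** One side [Y] of the contour. The density is the integral of [H (Y s + x) et x]
    over the line [Im x = tau], times [Y' s]; here [H] stands for the entire
    function of a kernel and [et] for the kernel itself, both in the logarithmic
    coordinate. Exchanging this integral with the one along [Y] gives the moments of
    order [p] as line integrals, whose inner integral [J v] is that of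
    [H (y) exp (- p y)] along a translate of [Y]; it is expressed by a primitive
    [Q], up to a limit at the end [s = 0] of the side. *)
Lemma contour_piece : exists w W, contour w (fun s => Copp (Y (Rmin s 1))) W L delta /\
  forall p : nat, exists (mu : C) (J : R -> C),
    is_RInt (V := VC) (ext0 (T := C_AbelianGroup)
      (fun s => Cmult (w s) (Cexp (Cmult (RtoC (INR p)) (Copp (Y (Rmin s 1))))))) 0 1 mu /\
    is_line_int (V := VC) (fun v => Cmult (Cmult (et (v, tau)) (Cexp (Cmult (RtoC (INR p)) (v, tau)))) (J v)) mu /\
    forall Q : C -> C, (forall z, is_derive (K := C_AbsRing) (V := C_NormedModule) Q z
        (Cmult (H z) (Cexp (Copp (Cmult (RtoC (INR p)) z))))) ->
      forall v eps, 0 < eps -> exists rho, 0 < rho /\ forall s, 0 < s < rho ->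
        Cmod (Cminus (J v) (Cminus (Q (Cplus (Y 1) (v, tau))) (Q (Cplus (Y s) (v, tau))))) < eps.
Proof.
  assert (HK0 : 0 <= K0).
  { specialize (HBet 0); specialize (HB0 0); pose proof (Cmod_ge_0 (et (0, tau))).
    assert (0 <= B 0 * Cmod (et (0, tau))) by nra.
    replace (K0 / (1 + 0 ^ 2)) with K0 in HBet by (simpl; field). lra. }
  (* clamping the parameter at 1 makes the integrands continuous on the whole line *)
  set (c := fun s => Rmin s 1).
  assert (Hc0 : forall s, 0 < s -> 0 < c s <= 1).
  { intros s Hs; split; [apply Rmin_glb_lt; lra|apply Rmin_r]. }
  assert (Hcs : forall s, c s <= s) by (intros; apply Rmin_l).
  assert (CY : forall s, 0 < s -> continuous (U := C_UniformSpace) (fun s => Y (c s)) s).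
  { intros s Hs; apply (continuous_comp (V := R_UniformSpace) c Y); [apply continuous_clamp|].
    eapply is_derive_R_continuous_C, HY, Hc0, Hs. }
  assert (CY' : forall s, 0 < s -> continuous (U := C_UniformSpace) (fun s => Y' (c s)) s).
  { intros s Hs; apply (continuous_comp (V := R_UniformSpace) c Y'); [apply continuous_clamp|].
    apply HY', Hc0, Hs. }
  assert (Cexpc : forall z, continuous (T := C_UniformSpace) (U := C_UniformSpace) Cexp z)
    by (intros z; eapply holomorphic_continuous, Cexp_derive).
  set (ex := fun (p : nat) s => Cexp (Copp (Cmult (RtoC (INR p)) (Y (c s))))).
  assert (Cex : forall p s, 0 < s -> continuous (U := C_UniformSpace) (ex p) s).
  { intros p s Hs; unfold ex; apply (continuous_comp (V := C_UniformSpace) _ Cexp); [|apply Cexpc].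
    apply continuous_Copp, continuous_Cmult; [apply continuous_const|apply CY, Hs]. }
  set (g := fun (p : nat) s v => Cmult (Cmult (Cmult (H (Cplus (Y (c s)) (v, tau))) (ex p s)) (Y' (c s)))
     (et (v, tau))).
  assert (Hg : forall p, exists K, 0 < K /\ forall s v, 0 < s -> Cmod (g p s v) <= (K * c s) / (1 + v ^ 2)).
  { intros p; destruct (HB p) as (K & HK & Hb); exists (K * (K0 + 1)); split; [nra|].
    intros s v Hs; unfold g; rewrite !Cmod_mult.
    specialize (Hb (c s) v (Hc0 s Hs)); fold (ex p s) in Hb.
    specialize (HBet v); pose proof (Cmod_ge_0 (et (v, tau))); destruct (Hc0 s Hs) as [Hc1 _].
    apply Rle_trans with (K * c s * B v * Cmod (et (v, tau))); [apply Rmult_le_compat_r; assumption|].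
    rewrite Rmult_assoc.
    apply Rle_trans with (K * c s * (K0 / (1 + v ^ 2))); [apply Rmult_le_compat_l; [nra|exact HBet]|].
    assert (0 < / (1 + v ^ 2)) by (apply Rinv_0_lt_compat; nra).
    assert (0 < K * c s * / (1 + v ^ 2)) by (apply Rmult_lt_0_compat; [nra|lra]).
    unfold Rdiv; lra. }
  assert (Cg : forall p s v, 0 < s ->
    continuous (U := C_UniformSpace) (fun q : R * R => g p (fst q) (snd q)) (s, v)).
  { intros p s v Hs; unfold g.
    assert (F1 : forall f : R -> C, continuous (U := C_UniformSpace) f s ->
       continuous (U := C_UniformSpace) (fun q : R * R => f (fst q)) (s, v)).
    { intros f Hf; apply (continuous_comp (V := R_UniformSpace) (fun q : R * R => fst q) f);
        [apply continuous_fst|exact Hf]. }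
    apply continuous_Cmult; [apply continuous_Cmult; [apply continuous_Cmult|]|].
    - apply (continuous_comp (V := C_UniformSpace) (fun q : R * R => Cplus (Y (c (fst q))) (snd q, tau)) H);
        [|apply Hcont].
      apply continuous_Cplus; [apply (F1 (fun s => Y (c s))), CY, Hs|].
      apply continuous_mkC; [apply continuous_snd|apply continuous_const].
    - apply (F1 (ex p)), Cex, Hs.
    - apply (F1 (fun s => Y' (c s))), CY', Hs.
    - apply (continuous_comp (V := R_UniformSpace) (fun q : R * R => snd q) (fun v => et (v, tau)));
        [apply continuous_snd|apply Hetc]. }
  set (f := fun p s v => ext0 (T := C_AbelianGroup) (fun s => g p s v) s).
  assert (Cf : forall p s v, continuous (U := VC) (fun q : R * R => f p (fst q) (snd q)) (s, v)).
  { intros p; destruct (Hg p) as (K & HK & Hb).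
    apply (ext0_continuous (E := C_CompleteNormedModule) (g p) K); [apply Cg|].
    intros s v Hs; eapply Rle_trans; [apply Hb, Hs|].
    specialize (Hcs s); destruct (Hc0 s Hs) as [Hc1 _].
    assert (Hi : / (1 + v ^ 2) <= 1) by (rewrite <- Rinv_1; apply Rinv_le_contravar; nra).
    assert (Hi0 : 0 < / (1 + v ^ 2)) by (apply Rinv_0_lt_compat; nra).
    assert (H1 : K * c s <= K * s) by nra.
    assert (H2 : 0 < K * c s) by nra.
    unfold Rdiv; nra. }
  assert (Df : forall p, exists K, 0 < K /\ forall s, dominated (V := VC) (K * Rmax 0 (c s)) (f p s)).
  { intros p; destruct (Hg p) as (K & HK & Hb); exists K; split; [exact HK|]; intros s v.
    unfold f, ext0; destruct (Rlt_dec 0 s) as [Hs|Hs].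
    - rewrite Rmax_right by (left; apply Hc0, Hs). apply Hb, Hs.
    - eapply Rle_trans; [right; apply (norm_zero (V := VC))|].
      apply Rmult_le_pos; [|left; apply Rinv_0_lt_compat; nra].
      apply Rmult_le_pos; [lra|apply Rmax_l]. }
  assert (Df1 : forall p, exists K, 0 < K /\ forall s, dominated (V := VC) K (f p s)).
  { intros p; destruct (Df p) as (K & HK & Hb); exists K; split; [exact HK|]; intros s v.
    eapply Rle_trans; [apply Hb|].
    apply Rmult_le_compat_r; [left; apply Rinv_0_lt_compat; nra|].
    assert (Rmax 0 (c s) <= 1) by (apply Rmax_lub; [lra|apply Rmin_r]). nra. }
  assert (Cf1 : forall p s v, continuous (U := VC) (f p s) v).
  { intros p s v; apply (continuous_pair_r (U := VC) (f p)), Cf. }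
  assert (EL : forall p s, exists l : C, is_line_int (V := VC) (f p s) l).
  { intros p s; destruct (Df1 p) as (K & HK & Hb).
    apply (ex_line_int (V := VC) K); [apply Cf1|apply Hb]. }
  set (Lf := fun p s => proj1_sig (constructive_indefinite_description _ (EL p s))).
  assert (HL : forall p s, is_line_int (V := VC) (f p s) (Lf p s)).
  { intros p s; exact (proj2_sig (constructive_indefinite_description _ (EL p s))). }
  assert (Fub : forall p, (forall s, continuous (U := VC) (Lf p) s) /\
    (forall t, continuous (U := VC) (fun t => RInt (V := VC) (fun s => f p s t) 0 1) t) /\
    is_line_int (V := VC) (fun t => RInt (V := VC) (fun s => f p s t) 0 1) (RInt (V := VC) (Lf p) 0 1)).
  { intros p; destruct (Df1 p) as (K & HK & Hb).
    apply (line_int_fubini (V := VC) (f p) (Lf p) K 0 1 ltac:(lra)); auto. }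
  assert (Lp : forall p s, 0 < s -> Lf p s = Cmult (Lf 0%nat s) (ex p s)).
  { intros p s Hs.
    apply (is_line_int_unique (V := VC) (f p s)); [apply HL|].
    apply (is_line_int_ext (V := VC) (fun v => Cmult (f 0%nat s v) (ex p s))).
    - intros v; unfold f, ext0; destruct (Rlt_dec 0 s); [|lra]. unfold g.
      assert (E0 : ex 0%nat s = RtoC 1).
      { unfold ex; simpl INR; rewrite <- Cexp_0; f_equal; ring. }
      rewrite E0; Cring.
    - apply (is_RInt_gen_linear (V := VC) (W := VC) (fun x : C => Cmult x (ex p s)) (Cmod (ex p s))); auto.
      + intros x y; change (Cmult (Cplus x y) (ex p s) = Cplus (Cmult x (ex p s)) (Cmult y (ex p s))); ring.
      + intros r x; change (Cmult (Cmult (RtoC r) x) (ex p s) = Cmult (RtoC r) (Cmult x (ex p s))); ring.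
      + intros x; change (Cmod (Cmult x (ex p s)) <= Cmod (ex p s) * Cmod x).
        rewrite Cmod_mult; lra.
      + typeclasses eauto.
      + typeclasses eauto.
      + apply HL. }
  destruct (Df 0%nat) as (KW & HKW & DW).
  exists (Lf 0%nat), (KW * PI); split.
  - split.
    + intros s _; exact (proj1 (Fub 0%nat) s).
    + intros s Hs; apply continuous_Copp, CY, Hs.
    + intros s Hs.
      pose proof (line_int_norm (V := VC) _ _ _ (Cf1 0%nat s) (DW s) (HL 0%nat s)) as Hn.
      destruct (Hc0 s Hs) as [Hc1 _]; rewrite Rmax_right in Hn by lra.
      eapply Rle_trans; [exact Hn|].
      pose proof PI_RGT_0; specialize (Hcs s).
      replace (KW * c s * PI) with (KW * PI * c s) by ring.
      apply Rmult_le_compat_l; [nra|exact Hcs].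
    + intros s Hs; specialize (Hre (c s) (Hc0 s Hs)); unfold Copp, Re in *; simpl in *; fold (c s); lra.
    + intros s Hs; specialize (Him (c s) (Hc0 s Hs)); unfold Copp, Im in *; simpl in *; fold (c s).
      rewrite Rabs_Ropp; exact Him.
  - intros p.
    set (h := fun v s => Cmult (Cmult (H (Cplus (Y (c s)) (v, tau)))
       (Cexp (Copp (Cmult (RtoC (INR p)) (Cplus (Y (c s)) (v, tau)))))) (Y' (c s))).
    assert (Hex : forall v s, Cexp (Copp (Cmult (RtoC (INR p)) (Cplus (Y (c s)) (v, tau)))) =
      Cmult (ex p s) (Cexp (Copp (Cmult (RtoC (INR p)) (v, tau))))).
    { intros v s; unfold ex; rewrite <- Cexp_plus; f_equal; ring. }
    assert (Bh : forall v, exists K, 0 < K /\ forall s, 0 < s -> Cmod (h v s) <= K * s).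
    { intros v; destruct (HB p) as (K & HK & Hb).
      set (q := Cmod (Cexp (Copp (Cmult (RtoC (INR p)) (v, tau))))).
      assert (Hq : 0 <= q) by apply Cmod_ge_0.
      exists (K * (B v * q + 1)); split; [pose proof (Rmult_le_pos _ _ (HB0 v) Hq); nra|]; intros s Hs.
      unfold h; rewrite Hex, !Cmod_mult; fold q.
      specialize (Hb (c s) v (Hc0 s Hs)); fold (ex p s) in Hb.
      specialize (HB0 v); specialize (Hcs s); destruct (Hc0 s Hs) as [Hc1 _].
      apply Rle_trans with (K * c s * B v * q).
      { match goal with |- ?x * (?y * q) * ?z <= _ =>
          replace (x * (y * q) * z) with (x * y * z * q) by ring end.
        apply Rmult_le_compat_r; [exact Hq|exact Hb]. }
      assert (K * c s <= K * s) by nra.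
      assert (0 <= B v * q) by (apply Rmult_le_pos; assumption).
      apply Rle_trans with (K * s * (B v * q)); [nra|].
      assert (0 < K * s) by nra. lra. }
    assert (Ch : forall v s, 0 < s -> continuous (U := C_UniformSpace) (h v) s).
    { intros v s Hs; unfold h; apply continuous_Cmult; [apply continuous_Cmult|].
      - apply (continuous_comp (V := C_UniformSpace) (fun s => Cplus (Y (c s)) (v, tau)) H); [|apply Hcont].
        apply continuous_Cplus; [apply CY, Hs|apply continuous_const].
      - apply (continuous_comp (V := C_UniformSpace) _ Cexp); [|apply Cexpc].
        apply continuous_Copp, continuous_Cmult; [apply continuous_const|].
        apply continuous_Cplus; [apply CY, Hs|apply continuous_const].
      - apply CY', Hs. }
    assert (Ch0 : forall v s, continuous (U := VC) (ext0 (T := C_AbelianGroup) (h v)) s).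
    { intros v; destruct (Bh v) as (K & HK & Hb).
      apply (ext0_continuous_1 (E := C_CompleteNormedModule) (h v) K); auto. }
    set (J := fun v => RInt (V := VC) (ext0 (T := C_AbelianGroup) (h v)) 0 1).
    exists (RInt (V := VC) (Lf p) 0 1), J; repeat split.
    + apply (is_RInt_ext (V := VC) (Lf p)).
      * intros s Hs; rewrite Rmin_left, Rmax_right in Hs by lra.
        unfold ext0; destruct (Rlt_dec 0 s); [|lra].
        rewrite Lp by lra; unfold ex; fold (c s); f_equal; f_equal; ring.
      * apply (RInt_correct (V := VC)), (ex_RInt_cont (V := VC)), (Fub p).
    + apply (is_line_int_ext (V := VC) (fun t => RInt (V := VC) (fun s => f p s t) 0 1)); [|apply (Fub p)].
      intros v; apply (is_RInt_unique (V := VC)).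
      apply (is_RInt_ext (V := VC) (fun s => Cmult (Cmult (et (v, tau)) (Cexp (Cmult (RtoC (INR p)) (v, tau))))
         (ext0 (T := C_AbelianGroup) (h v) s))).
      * intros s Hs; rewrite Rmin_left, Rmax_right in Hs by lra.
        unfold f, ext0; destruct (Rlt_dec 0 s); [|lra].
        unfold h, g; rewrite Hex.
        assert (E1 : Cmult (Cexp (Copp (Cmult (RtoC (INR p)) (v, tau)))) (Cexp (Cmult (RtoC (INR p)) (v, tau))) = RtoC 1)
          by apply Cexp_opp.
        transitivity (Cmult (Cmult (Cmult (Cmult (H (Cplus (Y (c s)) (v, tau))) (ex p s)) (Y' (c s))) (et (v, tau)))
          (Cmult (Cexp (Copp (Cmult (RtoC (INR p)) (v, tau)))) (Cexp (Cmult (RtoC (INR p)) (v, tau))))).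
        -- Cring.
        -- rewrite E1; Cring.
      * apply (is_RInt_Cscal C_CompleteNormedModule (ext0 (T := C_AbelianGroup) (h v))).
        apply (RInt_correct (V := VC)), (ex_RInt_cont (V := VC)), Ch0.
    + intros Q HQ v eps He.
      destruct (Bh v) as (K & HK & Hb).
      set (rho := Rmin 1 (eps / (2 * K))).
      assert (Hrho : 0 < rho) by (apply Rmin_glb_lt; [lra|apply Rdiv_lt_0_compat; lra]).
      exists rho; split; [exact Hrho|]; intros s Hs.
      assert (Hr1 : rho <= 1) by apply Rmin_l.
      assert (Hr2 : rho * (2 * K) <= eps).
      { apply Rle_trans with (eps / (2 * K) * (2 * K)); [apply Rmult_le_compat_r; [lra|apply Rmin_r]|].
        right; field; lra. }
      set (F := fun s => Q (Cplus (Y s) (v, tau))).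
      set (F' := fun s => Cmult (Y' s) (Cmult (H (Cplus (Y s) (v, tau)))
        (Cexp (Copp (Cmult (RtoC (INR p)) (Cplus (Y s) (v, tau))))))).
      assert (HF : is_RInt (V := VC) F' s 1 (Cminus (F 1) (F s))).
      { apply (is_RInt_derive (V := VC) F F').
        - intros x Hx; rewrite Rmin_left, Rmax_right in Hx by lra.
          apply (is_derive_curve C_CompleteNormedModule Q (fun s => Cplus (Y s) (v, tau))); [apply HQ|].
          assert (Ey : Y' x = Cplus (Y' x) (RtoC 0)) by ring.
          rewrite Ey.
          apply (is_derive_plus (V := VC) Y (fun _ => (v, tau))); [apply HY; lra|].
          apply (is_derive_const (V := VC)).
        - intros x Hx; rewrite Rmin_left, Rmax_right in Hx by lra.
          assert (CYx : continuous (U := C_UniformSpace) Y x)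
            by (eapply is_derive_R_continuous_C, HY; lra).
          unfold F'; apply continuous_Cmult; [|apply continuous_Cmult].
          + apply HY'; lra.
          + apply (continuous_comp (V := C_UniformSpace) (fun s => Cplus (Y s) (v, tau)) H); [|apply Hcont].
            apply continuous_Cplus; [exact CYx|apply continuous_const].
          + apply (continuous_comp (V := C_UniformSpace) _ Cexp); [|apply Cexpc].
            apply continuous_Copp, continuous_Cmult; [apply continuous_const|].
            apply continuous_Cplus; [exact CYx|apply continuous_const]. }
      assert (HF2 : RInt (V := VC) (ext0 (T := C_AbelianGroup) (h v)) s 1 = Cminus (F 1) (F s)).
      { apply (is_RInt_unique (V := VC)); apply (is_RInt_ext (V := VC) F'); [|exact HF].
        intros x Hx; rewrite Rmin_left, Rmax_right in Hx by lra.
        unfold ext0; destruct (Rlt_dec 0 x); [|lra].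
        unfold h, F'. replace (c x) with x by (unfold c; rewrite Rmin_left; lra). Cring. }
      assert (HJ : J v = Cplus (RInt (V := VC) (ext0 (T := C_AbelianGroup) (h v)) 0 s) (Cminus (F 1) (F s))).
      { rewrite <- HF2; symmetry.
        apply (RInt_Chasles (V := VC)); apply (ex_RInt_cont (V := VC)), Ch0. }
      match goal with |- Cmod ?x < _ =>
        assert (Ex : x = RInt (V := VC) (ext0 (T := C_AbelianGroup) (h v)) 0 s) end.
      { rewrite HJ; unfold F; Cring. }
      rewrite Ex.
      apply Rle_lt_trans with ((s - 0) * (K * 1)).
      * apply (norm_RInt_le_const (V := VC) (ext0 (T := C_AbelianGroup) (h v)) 0 s); [lra| |].
        -- intros x Hx; unfold ext0; destruct (Rlt_dec 0 x) as [Hx0|Hx0].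
           ++ eapply Rle_trans; [apply Hb, Hx0|]. apply Rmult_le_compat_l; lra.
           ++ eapply Rle_trans; [right; apply (norm_zero (V := VC))|]; lra.
        -- apply (RInt_correct (V := VC)), (ex_RInt_cont (V := VC)), Ch0.
      * nra.
Qed.
End Piece.

(** * The quotients of successive moments are moments on a narrow contour *)

(** By domination they exist, by rotation they coincide. *)
Lemma strip_line_int {E : CompleteNormedModule C_AbsRing} (g : C -> E) (t0 K : R) : 0 <= t0 ->
  (forall x y, Rabs y <= t0 -> C_differentiable E g (x, y) /\ norm (g (x, y)) <= K / (1 + x ^ 2)) ->
  exists I, forall y, Rabs y <= t0 -> is_line_int (V := restrict_scalars E) (fun x => g (x, y)) I.
Proof.
  intros Ht Hg.
  assert (Hex : forall y, Rabs y <= t0 -> exists I, is_line_int (V := restrict_scalars E) (fun x => g (x, y)) I).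
  { intros y Hy; apply (ex_line_int (V := restrict_scalars E) K).
    - intros v; apply continuous_horizontal, C_differentiable_continuous, Hg, Hy.
    - intros v; apply Hg, Hy. }
  destruct (Hex 0 ltac:(rewrite Rabs_R0; exact Ht)) as [I HI]; exists I; intros y Hy.
  destruct (Hex y Hy) as [I' HI'].
  assert (HII : I = I'); [|rewrite HII; exact HI'].
  destruct (Rle_dec 0 y) as [H0|H0].
  - rewrite Rabs_pos_eq in Hy by exact H0.
    apply (line_rotation g 0 y K); auto.
    intros x u Hu; apply Hg; rewrite Rabs_pos_eq; lra.
  - rewrite Rabs_left in Hy by lra; symmetry.
    apply (line_rotation g y 0 K); auto; [lra|].
    intros x u Hu; apply Hg; rewrite Rabs_left1; lra.
Qed.

Lemma line_int_VC_lin (f g : R -> C) (c If Ig : C) :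
  is_line_int (V := VC) f If -> is_line_int (V := VC) g Ig ->
  is_line_int (V := VC) (fun v => Cminus (f v) (Cmult c (g v))) (Cminus If (Cmult c Ig)).
Proof.
  intros Hf Hg.
  apply (is_RInt_gen_minus (V := VC) f (fun v => Cmult c (g v))); [exact Hf|].
  apply (is_RInt_gen_linear (V := VC) (W := VC) (fun x : C => Cmult c x) (Cmod c)); auto.
  - intros x y; change (Cmult c (Cplus x y) = Cplus (Cmult c x) (Cmult c y)); ring.
  - intros r x; change (Cmult c (Cmult (RtoC r) x) = Cmult (RtoC r) (Cmult c x)); ring.
  - intros x; change (Cmod (Cmult c x) <= Cmod c * Cmod x). rewrite Cmod_mult; lra.
  - typeclasses eauto.
  - typeclasses eauto.
Qed.

Lemma Clim_unique (a b : C) : (forall eps, 0 < eps -> Cmod (Cminus a b) < eps) -> a = b.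
Proof.
  intros H; destruct (classic (a = b)) as [|Hn]; [assumption|exfalso].
  assert (Hc : 0 < Cmod (Cminus a b)).
  { apply Cmod_gt_0; intros H0; apply Hn.
    replace a with (Cplus (Cminus a b) b) by ring. rewrite H0; ring. }
  specialize (H _ Hc); lra.
Qed.

Lemma Cmod_triangle_lt (c a b : C) (r s : R) :
  Cmod (Cminus a c) < r -> Cmod (Cminus b c) < s -> Cmod (Cminus a b) < r + s.
Proof.
  intros H1 H2; replace (Cminus a b) with (Cplus (Cminus a c) (Copp (Cminus b c))) by ring.
  eapply Rle_lt_trans; [apply Cmod_triangle|]; rewrite Cmod_opp; lra.
Qed.

(** A mean value estimate along the segment from the origin; on [Re z < 0] the
    factor [exp (- p z)] takes over. *)
Lemma primitive_growth (M : nat -> R) (H Q : C -> C) (c k T : R) (p : nat) : weight M ->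
  0 < c -> 0 < k -> 0 <= T ->
  (forall z, Cmod (H z) <= c * exp (Mfun M (exp (Re z) / k))) ->
  (forall z, is_derive (K := C_AbsRing) (V := C_NormedModule) Q z
     (Cmult (H z) (Cexp (Copp (Cmult (RtoC (INR p)) z))))) ->
  exists CQ, 0 < CQ /\ forall z, Rabs (Im z) <= T ->
    Cmod (Q z) <= CQ * (exp (Rabs (Re z) / 2 - INR p * Rmin (Re z) 0) * exp (Mfun M (exp (Re z) / k))).
Proof.
  intros HM Hc Hk HT HH HQ.
  assert (HMf1 : forall t, 1 <= exp (Mfun M t)).
  { intros t; rewrite <- exp_0; apply exp_le_mono, Mfun_nonneg, HM. }
  set (M1 := exp (Mfun M (1 / k))).
  assert (HM1 : 1 <= M1) by apply HMf1.
  pose proof (Cmod_ge_0 (Q (RtoC 0))) as HQ0.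
  exists (Cmod (Q (RtoC 0)) + (2 + T) * (c * M1)); split.
  { assert (0 < c * M1) by nra. nra. }
  intros z Hz; set (x := Re z).
  set (ep := exp (- INR p * Rmin x 0)). set (ex := exp (Mfun M (exp x / k))).
  pose proof (pos_INR p) as Hp.
  assert (Hep : 1 <= ep) by (unfold ep; rewrite <- exp_0; apply exp_le_mono; pose proof (Rmin_r x 0); nra).
  assert (Hex : 1 <= ex) by apply HMf1.
  assert (Hz1 : Cmod z <= (2 + T) * exp (Rabs x / 2)).
  { eapply Rle_trans; [apply Cmod_le_abs|]; fold x.
    pose proof (exp_ineq1_le (Rabs x / 2)); pose proof (Rabs_pos x). nra. }
  assert (He2 : 1 <= exp (Rabs x / 2)) by (rewrite <- exp_0; apply exp_le_mono; pose proof (Rabs_pos x); lra).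
  assert (Hm := norm_mvt (E := C_CompleteNormedModule) (fun t => Q (Cplus (RtoC 0) (Cmult (RtoC t) z)))
    (fun t => Cmult z (Cmult (H (Cplus (RtoC 0) (Cmult (RtoC t) z)))
       (Cexp (Copp (Cmult (RtoC (INR p)) (Cplus (RtoC 0) (Cmult (RtoC t) z)))))))
    ((2 + T) * exp (Rabs x / 2) * (c * (ex * M1) * ep))).
  assert (Hm' : Cmod (Cminus (Q (Cplus (RtoC 0) (Cmult (RtoC 1) z))) (Q (Cplus (RtoC 0) (Cmult (RtoC 0) z))))
    <= (2 + T) * exp (Rabs x / 2) * (c * (ex * M1) * ep)).
  { apply Hm; clear Hm.
    - intros t _; apply (is_derive_segment (E := C_CompleteNormedModule) Q); apply HQ.
    - intros t Ht.
      match goal with |- norm ?y <= _ => change (Cmod y <= (2 + T) * exp (Rabs x / 2) * (c * (ex * M1) * ep)) end.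
      rewrite !Cmod_mult, Cmod_Cexp.
      assert (Er : Re (Cplus (RtoC 0) (Cmult (RtoC t) z)) = t * x).
      { unfold x; destruct z; unfold Re, Cplus, Cmult, RtoC; simpl; ring. }
      assert (Er' : Re (Copp (Cmult (RtoC (INR p)) (Cplus (RtoC 0) (Cmult (RtoC t) z)))) = - INR p * (t * x)).
      { unfold x; destruct z; unfold Re, Copp, Cplus, Cmult, RtoC; simpl; ring. }
      rewrite Er'.
      assert (HHt : Cmod (H (Cplus (RtoC 0) (Cmult (RtoC t) z))) <= c * (ex * M1)).
      { eapply Rle_trans; [apply HH|]; rewrite Er; apply Rmult_le_compat_l; [lra|].
        destruct (Rle_dec 0 x).
        - apply Rle_trans with ex; [|nra].
          apply exp_le_mono, Mfun_mono; [exact HM|]; apply Rmult_le_compat_r; [left; apply Rinv_0_lt_compat, Hk|].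
          apply exp_le_mono; nra.
        - apply Rle_trans with M1; [|nra].
          apply exp_le_mono, Mfun_mono; [exact HM|]; apply Rmult_le_compat_r; [left; apply Rinv_0_lt_compat, Hk|].
          rewrite <- exp_0; apply exp_le_mono; nra. }
      assert (Het : exp (- INR p * (t * x)) <= ep).
      { apply exp_le_mono; destruct (Rle_dec 0 x).
        - rewrite Rmin_right by lra. assert (0 <= INR p * (t * x)) by (apply Rmult_le_pos; nra). lra.
        - rewrite Rmin_left by lra. assert (INR p * (t * x) >= INR p * x) by (apply Rmult_ge_compat_l; nra). lra. }
      apply Rmult_le_compat; [apply Cmod_ge_0| |exact Hz1|].
      + apply Rmult_le_pos; [apply Cmod_ge_0|left; apply exp_pos].
      + apply Rmult_le_compat; auto; [apply Cmod_ge_0|left; apply exp_pos]. }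
  replace (Cplus (RtoC 0) (Cmult (RtoC 1) z)) with z in Hm' by ring.
  replace (Cplus (RtoC 0) (Cmult (RtoC 0) z)) with (RtoC 0) in Hm' by ring.
  replace (Q z) with (Cplus (Cminus (Q z) (Q (RtoC 0))) (Q (RtoC 0))) by ring.
  eapply Rle_trans; [apply Cmod_triangle|].
  replace (Rabs x / 2 - INR p * Rmin x 0) with (Rabs x / 2 + - INR p * Rmin x 0) by ring.
  rewrite exp_plus; fold ep.
  set (e2 := exp (Rabs x / 2)) in *.
  assert (H1 : 1 <= e2 * ep) by nra. assert (H2 : 1 <= e2 * ep * ex) by nra.
  apply Rle_trans with ((2 + T) * e2 * (c * (ex * M1) * ep) + Cmod (Q (RtoC 0)) * (e2 * ep * ex)).
  - apply Rplus_le_compat; [exact Hm'|]. nra.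
  - right; ring.
Qed.

Lemma exp_Mfun_ge_1 (M : nat -> R) (t : R) : weight M -> 1 <= exp (Mfun M t).
Proof. intros HM; rewrite <- exp_0; apply exp_le_mono, Mfun_nonneg, HM. Qed.

Section Assembly.
Context (M : nat -> R) (e : logsurf -> C) (E : C -> C) (m : nat -> R)
  (HM : weight M) (HK : strong_kernel M e E m).
Let eta := omega M * PI / 2.
Context (Heta : 0 < eta < PI) (delta : R) (Hd : 0 < delta) (Hd1 : delta <= eta) (Hd2 : delta <= PI - eta).
Let H : C -> C := fun z => E (Cexp z).
Let et : C -> C := shift_kernel e.
Let t0 := eta - delta / 2.

Lemma et_diff (z : C) : Rabs (Im z) < eta -> Cd et z.
Proof.
  intros Hz; destruct (sk_e_hol _ _ _ _ HK z) as [l Hl].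
  { unfold sector, arg; rewrite Rminus_0_r; unfold eta in *; lra. }
  eexists; apply (is_derive_Cscal (E := C_CompleteNormedModule) Cexp e); [apply Cexp_derive|exact Hl].
Qed.

Lemma H_continuous (z : C) : continuous (T := C_UniformSpace) (U := C_UniformSpace) H z.
Proof.
  destruct (sk_E_entire _ _ _ _ HK (Cexp z) I) as [l Hl].
  eapply holomorphic_continuous, (is_derive_Ccomp (E := C_CompleteNormedModule) E Cexp);
    [exact Hl|apply Cexp_derive].
Qed.

(** In variables [x] and [y] on the surface of the logarithm, formally, [m (p+1) / m
    p = 1/(2 pi i) * int (int E(x y) e(x) dx) y^(-p-1) dy], the outer integral
    running around the origin: substituting [y/x] for [y] separates the moment of
    [e] from the Cauchy formula for the coefficient [1 / m p] of [E]. The integral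
    over [x] converges when [e] decays on the ray of [x], so [|arg x| < eta], and
    either [E] decays on the ray of [x y], so [|arg (x y)| > eta], or [y] is small.
    So [y] may run from infinity along the ray of argument [- delta], through a
    small arc, and back to infinity along the ray of argument [delta], the rays of
    [x] having arguments [-t0], 0 and [t0] respectively. In the variable [1/y] the
    contour is bounded and narrow. *)
Section Keyhole.
Context (k cE kE b CE L : R) (Hk : 0 < k) (HcE : 0 < cE) (HkE : 0 < kE) (Hb : 0 < b <= / 2) (HCE : 0 < CE)
  (HL0 : 0 <= L)
  (Hdec : forall N : nat, exists K, 0 < K /\ forall z : C, Rabs (Im z) <= eta - delta / 2 ->
     Cmod (et z) * exp (Mfun M (exp (Re z) / k)) <= K * exp (Re z - INR N * Rmax (Re z) 0))
  (Hgr : forall z : C, Cmod (H z) <= cE * exp (Mfun M (exp (Re z) / kE)))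
  (HdecE : forall z : C,
     (eta + delta / 2 <= Im z <= 2 * PI - eta - delta / 2 \/
      eta + delta / 2 <= - Im z <= 2 * PI - eta - delta / 2) ->
     Cmod (H z) <= CE * exp (- b * Re z))
  (HMf : forall x, exp (Mfun M (exp (x - L) / kE)) <= exp (Mfun M (exp x / k))).
Let Ht0 : 0 < t0.
Proof. unfold t0; lra. Qed.
Let HMf1 : forall t, 1 <= exp (Mfun M t).
Proof. intros t; apply exp_Mfun_ge_1, HM. Qed.
Let HPI : 0 < PI := PI_RGT_0.

Lemma kernel_line_continuous (y : R) : Rabs y <= t0 ->
  forall v, continuous (U := C_UniformSpace) (fun v => et (v, y)) v.
Proof.
  intros Hy v; apply (continuous_horizontal C_CompleteNormedModule et).
  apply C_differentiable_continuous, et_diff; unfold Im; simpl; unfold t0 in *; lra.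
Qed.

Definition kernel_moment (p : nat) (z : C) : C := Cmult (et z) (Cexp (Cmult (RtoC (INR p)) z)).

Let Y (s0 s : R) : C := (- L - (2 / b) * ln s, s0 * delta).
Let Y' (s : R) : C := (- ((2 / b) / s), 0).

(** On the rays, with this parameter, the entire function decays like [s ^ 2] and
    [dy] is of the order of [1 / s], which leaves the factor [s] required of the
    density. *)
Lemma ray_bounds (s0 : R) : s0 = 1 \/ s0 = -1 ->
  (forall s, 0 < s -> is_derive (V := VC) (Y s0) s (Y' s)) /\
  (forall s, 0 < s -> continuous (U := C_UniformSpace) Y' s) /\
  (forall s, 0 < s <= 1 -> - L <= Re (Y s0 s)) /\
  (forall s, 0 < s <= 1 -> Rabs (Im (Y s0 s)) <= delta) /\
  (exists K0, forall v, exp (- b * v) * Cmod (et (v, s0 * t0)) <= K0 / (1 + v ^ 2)) /\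
  (forall p : nat, exists K, 0 < K /\ forall s v, 0 < s <= 1 ->
   Cmod (H (Cplus (Y s0 s) (v, s0 * t0))) * Cmod (Cexp (Copp (Cmult (RtoC (INR p)) (Y s0 s)))) *
   Cmod (Y' s) <= K * s * exp (- b * v)).
Proof.
  intros Hs0.
  assert (Has : Rabs s0 = 1) by (destruct Hs0 as [->| ->]; [apply Rabs_R1|rewrite Rabs_left; lra]).
  assert (Hb2 : 0 < 2 / b) by (apply Rdiv_lt_0_compat; lra).
  assert (Hln : forall s, 0 < s <= 1 -> ln s <= 0).
  { intros s Hs; rewrite <- ln_1; apply ln_le; lra. }
  refine (conj _ (conj _ (conj _ (conj _ (conj _ _))))).
  - intros s Hs; apply (is_derive_pair (fun s => - L - 2 / b * ln s) (fun _ => s0 * delta)).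
    + auto_derive; [exact Hs|]; field; lra.
    + auto_derive; auto.
  - intros s Hs; apply continuous_mkC; [|apply continuous_const].
    apply (ex_derive_continuous (V := R_NormedModule)); auto_derive; lra.
  - intros s Hs; specialize (Hln s Hs); unfold Y, Re; simpl. nra.
  - intros s Hs; unfold Y, Im; simpl; rewrite Rabs_mult, Has, Rabs_pos_eq; lra.
  - destruct (Hdec 2%nat) as (K & HK0 & HKd); exists (K * 16); intros v.
    specialize (HKd (v, s0 * t0)); unfold Re, Im in HKd; simpl in HKd.
    assert (Hi : Rabs (s0 * t0) <= eta - delta / 2) by (rewrite Rabs_mult, Has, Rabs_pos_eq; unfold t0 in *; lra).
    specialize (HKd Hi).
    pose proof (Cmod_ge_0 (et (v, s0 * t0))) as Hm.
    pose proof (HMf1 (exp v / k)) as Hm1.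
    apply Rle_trans with (K * exp (- Rabs v / 2)).
    2:{ unfold Rdiv at 2; rewrite Rmult_assoc; apply Rmult_le_compat_l; [lra|apply exp_abs_dominated]. }
    apply Rle_trans with (exp (- b * v) * (K * exp (v - (1 + 1) * Rmax v 0))).
    + apply Rmult_le_compat_l; [left; apply exp_pos|]. nra.
    + replace (exp (- b * v) * (K * exp (v - (1 + 1) * Rmax v 0))) with
        (K * (exp (- b * v) * exp (v - (1 + 1) * Rmax v 0))) by ring.
      rewrite <- exp_plus; apply Rmult_le_compat_l; [lra|]; apply exp_le_mono.
      destruct (Rle_dec 0 v); [rewrite Rmax_left, Rabs_pos_eq by lra; nra|
        rewrite Rmax_right, Rabs_left by lra; nra].
  - intros p; exists (CE * exp (b * L) * exp (INR p * L) * (2 / b)); split.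
    { pose proof (exp_pos (b * L)); pose proof (exp_pos (INR p * L)).
      repeat apply Rmult_lt_0_compat; lra. }
    intros s v Hs; specialize (Hln s Hs).
    assert (HH : Cmod (H (Cplus (Y s0 s) (v, s0 * t0))) <= CE * (exp (b * L) * s ^ 2 * exp (- b * v))).
    { eapply Rle_trans; [apply HdecE|].
      - unfold Y, Im, Cplus; simpl; unfold t0; destruct Hs0 as [->| ->]; [left|right]; lra.
      - apply Rmult_le_compat_l; [lra|]; right.
        unfold Y, Re, Cplus; simpl.
        replace (- b * (- L - 2 / b * ln s + v)) with (b * L + (ln s + ln s) + - b * v) by (field; lra).
        rewrite !exp_plus, exp_ln by lra. ring. }
    assert (HX : Cmod (Cexp (Copp (Cmult (RtoC (INR p)) (Y s0 s)))) <= exp (INR p * L)).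
    { rewrite Cmod_Cexp; apply exp_le_mono; unfold Y, Re, Copp, Cmult, RtoC; simpl.
      pose proof (pos_INR p).
      assert (0 <= INR p * (2 / b) * (- ln s)) by (apply Rmult_le_pos; [apply Rmult_le_pos; lra|lra]).
      lra. }
    assert (HY' : Cmod (Y' s) = 2 / b * / s).
    { unfold Y'; replace (- (2 / b / s), 0) with (RtoC (- (2 / b / s))) by reflexivity.
      rewrite Cmod_R, Rabs_Ropp, Rabs_pos_eq; [reflexivity|].
      apply Rmult_le_pos; [lra|left; apply Rinv_0_lt_compat; lra]. }
    rewrite HY'.
    pose proof (Cmod_ge_0 (H (Cplus (Y s0 s) (v, s0 * t0)))).
    pose proof (Cmod_ge_0 (Cexp (Copp (Cmult (RtoC (INR p)) (Y s0 s))))).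
    replace (CE * exp (b * L) * exp (INR p * L) * (2 / b) * s * exp (- b * v)) with
      (CE * (exp (b * L) * s ^ 2 * exp (- b * v)) * exp (INR p * L) * (2 / b * / s)) by (field; lra).
    apply Rmult_le_compat_r; [apply Rmult_le_pos; [lra|left; apply Rinv_0_lt_compat; lra]|].
    apply Rmult_le_compat; assumption.
Qed.

Let Ya (s : R) : C := (- L, - delta + 2 * delta * s ^ 2).
Let Ya' (s : R) : C := (0, 4 * delta * s).

(** The parameter enters through its square, so that the density vanishes at [s = 0]. *)
Lemma arc_piece : exists w W, contour w (fun s => Copp (Ya (Rmin s 1))) W L delta /\
  forall p : nat, exists (mu : C) (J : R -> C),
  is_RInt (V := VC) (ext0 (T := C_AbelianGroup)
    (fun s => Cmult (w s) (Cexp (Cmult (RtoC (INR p)) (Copp (Ya (Rmin s 1))))))) 0 1 mu /\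
  is_line_int (V := VC) (fun v => Cmult (Cmult (et (v, 0)) (Cexp (Cmult (RtoC (INR p)) (v, 0)))) (J v)) mu /\
  forall Q : C -> C, (forall z, is_derive (K := C_AbsRing) (V := C_NormedModule) Q z
      (Cmult (H z) (Cexp (Copp (Cmult (RtoC (INR p)) z))))) ->
    forall v eps, 0 < eps -> exists rho, 0 < rho /\ forall s, 0 < s < rho ->
      Cmod (Cminus (J v) (Cminus (Q (Cplus (Ya 1) (v, 0))) (Q (Cplus (Ya s) (v, 0))))) < eps.
Proof.
  destruct (Hdec 2%nat) as (K & HK0 & HKd).
  apply (contour_piece H et 0 L delta Ya Ya' (fun v => exp (Mfun M (exp v / k))) (K * 16)).
  - apply H_continuous.
  - apply kernel_line_continuous; rewrite Rabs_R0; lra.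
  - intros s Hs; apply (is_derive_pair (fun _ => - L) (fun s => - delta + 2 * delta * s ^ 2)); auto_derive; auto; ring.
  - intros s Hs; apply continuous_mkC; [apply continuous_const|].
    apply (ex_derive_continuous (V := R_NormedModule)); auto_derive; auto.
  - intros s Hs; unfold Ya, Re; simpl; lra.
  - intros s Hs; unfold Ya, Im; cbn [snd].
    assert (Hs2 : 0 <= s ^ 2 <= 1) by (simpl; split; nra).
    apply Rabs_le; split; nra.
  - intros v; left; apply exp_pos.
  - intros v; rewrite Rmult_comm.
    specialize (HKd (v, 0)); unfold Re, Im in HKd; simpl in HKd; rewrite Rabs_R0 in HKd.
    specialize (HKd ltac:(unfold t0 in *; lra)).
    eapply Rle_trans; [exact HKd|].
    unfold Rdiv at 1; rewrite Rmult_assoc; apply Rmult_le_compat_l; [lra|].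
    eapply Rle_trans; [|apply exp_abs_dominated]; apply exp_le_mono.
    destruct (Rle_dec 0 v); [rewrite Rmax_left, Rabs_pos_eq by lra; lra|
        rewrite Rmax_right, Rabs_left by lra; lra].
  - intros p; exists (cE * exp (INR p * L) * (4 * delta)); split.
    { pose proof (exp_pos (INR p * L)); repeat apply Rmult_lt_0_compat; lra. }
    intros s v Hs.
    assert (HH : Cmod (H (Cplus (Ya s) (v, 0))) <= cE * exp (Mfun M (exp v / k))).
    { eapply Rle_trans; [apply Hgr|]; apply Rmult_le_compat_l; [lra|].
      unfold Ya, Re, Cplus; simpl. replace (- L + v) with (v - L) by ring. apply HMf. }
    assert (HX : Cmod (Cexp (Copp (Cmult (RtoC (INR p)) (Ya s)))) = exp (INR p * L)).
    { rewrite Cmod_Cexp; f_equal; unfold Ya, Re, Copp, Cmult, RtoC; simpl; ring. }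
    assert (HY' : Cmod (Ya' s) <= 4 * delta * s).
    { eapply Rle_trans; [apply Cmod_le_abs|]; unfold Ya', Re, Im; simpl.
      rewrite Rabs_R0, Rabs_pos_eq by nra. lra. }
    rewrite HX.
    pose proof (exp_pos (INR p * L)); pose proof (Cmod_ge_0 (H (Cplus (Ya s) (v, 0)))).
    replace (cE * exp (INR p * L) * (4 * delta) * s * exp (Mfun M (exp v / k))) with
      (cE * exp (Mfun M (exp v / k)) * exp (INR p * L) * (4 * delta * s)) by ring.
    apply Rmult_le_compat; [nra|apply Cmod_ge_0| |exact HY'].
    apply Rmult_le_compat_r; [lra|exact HH].
Qed.

(** The line of [y x] with [y] on a ray depends on [x] only by a translation, so the
    limit [q] of the primitive at infinity does not depend on [v]. *)
Lemma ray_limit (Q : C -> C) (s0 : R) (J : R -> C) :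
  (forall v eps, 0 < eps -> exists rho, 0 < rho /\ forall s, 0 < s < rho ->
    Cmod (Cminus (J v) (Cminus (Q (Cplus (Y s0 1) (v, s0 * t0))) (Q (Cplus (Y s0 s) (v, s0 * t0))))) < eps) ->
  exists q, (forall v, J v = Cminus (Q (Cplus (Y s0 1) (v, s0 * t0))) q) /\
    forall eps, 0 < eps -> exists X, forall x, X < x ->
      Cmod (Cminus (Q (x, s0 * (eta + delta / 2))) q) < eps.
Proof.
  intros HJ.
  assert (HX : forall v eps, 0 < eps -> exists X, forall x, X < x ->
      Cmod (Cminus (Q (x, s0 * (eta + delta / 2))) (Cminus (Q (Cplus (Y s0 1) (v, s0 * t0))) (J v))) < eps).
  { intros v eps He; destruct (HJ v eps He) as (rho & Hr & HJr).
    exists (- L - (2 / b) * ln rho + v); intros x Hx.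
    set (s := exp (- (x - v + L) * (b / 2))).
    assert (Hs : 0 < s < rho).
    { split; [apply exp_pos|]; rewrite <- (exp_ln rho Hr); apply exp_increasing.
      assert (Hq : 0 < b / 2) by lra.
      apply Rmult_lt_compat_r with (r := b / 2) in Hx; [|exact Hq].
      replace ((- L - 2 / b * ln rho + v) * (b / 2)) with (- (L - v) * (b / 2) - ln rho) in Hx by (field; lra).
      lra. }
    specialize (HJr s Hs).
    replace (Cplus (Y s0 s) (v, s0 * t0)) with ((x, s0 * (eta + delta / 2)) : C) in HJr.
    - replace (Cminus (Q (x, s0 * (eta + delta / 2))) (Cminus (Q (Cplus (Y s0 1) (v, s0 * t0))) (J v))) with
        (Cminus (J v) (Cminus (Q (Cplus (Y s0 1) (v, s0 * t0))) (Q (x, s0 * (eta + delta / 2))))) by ring.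
      exact HJr.
    - unfold Y, Cplus, s, t0; simpl; rewrite ln_exp; f_equal; field; lra. }
  exists (Cminus (Q (Cplus (Y s0 1) (0, s0 * t0))) (J 0)); split; [|apply HX].
  intros v.
  assert (Eq : Cminus (Q (Cplus (Y s0 1) (v, s0 * t0))) (J v) = Cminus (Q (Cplus (Y s0 1) (0, s0 * t0))) (J 0)).
  { apply Clim_unique; intros eps He.
    destruct (HX v (eps / 2) ltac:(lra)) as [X1 HX1]; destruct (HX 0 (eps / 2) ltac:(lra)) as [X2 HX2].
    set (x := Rmax X1 X2 + 1). pose proof (Rmax_l X1 X2); pose proof (Rmax_r X1 X2).
    specialize (HX1 x ltac:(unfold x; lra)); specialize (HX2 x ltac:(unfold x; lra)).
    replace eps with (eps / 2 + eps / 2) by field.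
    apply (Cmod_triangle_lt (Q (x, s0 * (eta + delta / 2)))).
    - rewrite <- Cmod_opp; match goal with |- Cmod ?a < _ => match type of HX1 with Cmod ?c < _ =>
        replace a with c by ring end end; exact HX1.
    - rewrite <- Cmod_opp; match goal with |- Cmod ?a < _ => match type of HX2 with Cmod ?c < _ =>
        replace a with c by ring end end; exact HX2. }
  rewrite <- Eq; ring.
Qed.

Section Primitive.
Context (p : nat) (a : C) (Q : C -> C)
  (HQ : forall z, is_derive (K := C_AbsRing) (V := C_NormedModule) Q z
     (Cmult (H z) (Cexp (Copp (Cmult (RtoC (INR p)) z)))))
  (HQper : forall z, Q (Cplus z (0, 2 * PI)) = Cplus (Q z) (Cmult (0, 2 * PI) a)).

(** The two lines lie at the borders of the region where the entire function decays,
    up to a translation by the period of the exponential; there the primitive tends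
    to a single limit, up to its own period. *)
Lemma ray_limits_period (qp qn : C) :
  (forall eps, 0 < eps -> exists X, forall x, X < x -> Cmod (Cminus (Q (x, 1 * (eta + delta / 2))) qp) < eps) ->
  (forall eps, 0 < eps -> exists X, forall x, X < x -> Cmod (Cminus (Q (x, -1 * (eta + delta / 2))) qn) < eps) ->
  Cminus qp qn = Cmult (0, 2 * PI) a.
Proof.
  intros Lqp Lqn.
  apply Clim_unique; intros eps He.
  destruct (Lqp (eps / 3) ltac:(lra)) as [X1 HX1]; destruct (Lqn (eps / 3) ltac:(lra)) as [X2 HX2].
  set (K := (2 * PI) * CE).
  assert (HKp : 0 < K) by (unfold K; nra).
  set (X3 := - ln (eps / (3 * K)) / b).
  set (x := Rmax (Rmax X1 X2) (Rmax X3 0) + 1).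
  pose proof (Rmax_l (Rmax X1 X2) (Rmax X3 0)); pose proof (Rmax_r (Rmax X1 X2) (Rmax X3 0)).
  pose proof (Rmax_l X1 X2); pose proof (Rmax_r X1 X2).
  pose proof (Rmax_l X3 0); pose proof (Rmax_r X3 0).
  specialize (HX1 x ltac:(unfold x; lra)); specialize (HX2 x ltac:(unfold x; lra)).
  assert (Hx0 : 0 < x) by (unfold x; lra).
  assert (Hx3 : K * exp (- b * x) < eps / 3).
  { assert (He3 : 0 < eps / (3 * K)) by (apply Rdiv_lt_0_compat; lra).
    assert (exp (- b * x) < eps / (3 * K)).
    { rewrite <- (exp_ln _ He3) at 1; apply exp_increasing.
      assert (X3 < x) by (unfold x; lra).
      assert (X3 * b = - ln (eps / (3 * K))) by (unfold X3; field; lra). nra. }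
    apply Rlt_le_trans with (K * (eps / (3 * K))); [apply Rmult_lt_compat_l; lra|right; field; lra]. }
  set (ps := eta + delta / 2) in *.
  set (h := (0, 2 * PI - 2 * ps) : C).
  assert (Hm := norm_mvt (E := C_CompleteNormedModule) (fun t => Q (Cplus (x, ps) (Cmult (RtoC t) h)))
    (fun t => Cmult h (Cmult (H (Cplus (x, ps) (Cmult (RtoC t) h)))
      (Cexp (Copp (Cmult (RtoC (INR p)) (Cplus (x, ps) (Cmult (RtoC t) h))))))) (K * exp (- b * x))).
  assert (Hm' : Cmod (Cminus (Q (Cplus (x, ps) (Cmult (RtoC 1) h))) (Q (Cplus (x, ps) (Cmult (RtoC 0) h))))
    <= K * exp (- b * x)).
  { apply Hm; clear Hm.
    - intros t _; apply (is_derive_segment (E := C_CompleteNormedModule) Q); apply HQ.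
    - intros t Ht.
      match goal with |- norm ?y <= _ => change (Cmod y <= K * exp (- b * x)) end.
      rewrite !Cmod_mult, Cmod_Cexp.
      set (z := Cplus (x, ps) (Cmult (RtoC t) h)).
      assert (Ez1 : Re z = x) by (unfold z, h, Re, Cplus, Cmult, RtoC; simpl; ring).
      assert (Ez2 : Im z = ps + t * (2 * PI - 2 * ps)) by (unfold z, h, Im, Cplus, Cmult, RtoC; simpl; ring).
      assert (Ez3 : Re (Copp (Cmult (RtoC (INR p)) z)) = - INR p * x).
      { rewrite <- Ez1; destruct z; unfold Re, Copp, Cmult, RtoC; simpl; ring. }
      assert (Hps : 0 <= 2 * PI - 2 * ps <= 2 * PI) by (unfold ps; lra).
      assert (Hz1 : Cmod (H z) <= CE * exp (- b * x)).
      { rewrite <- Ez1; apply HdecE; left; rewrite Ez2; unfold ps in *; split; nra. }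
      assert (Hz2 : exp (- INR p * x) <= 1).
      { rewrite <- exp_0; apply exp_le_mono; pose proof (pos_INR p). nra. }
      assert (Hz3 : Cmod h <= 2 * PI).
      { eapply Rle_trans; [apply Cmod_le_abs|]; unfold h, Re, Im; cbn [fst snd].
        rewrite Rabs_R0, Rabs_pos_eq; lra. }
      rewrite Ez3; unfold K.
      pose proof (Cmod_ge_0 h); pose proof (Cmod_ge_0 (H z)); pose proof (exp_pos (- INR p * x)).
      pose proof (exp_pos (- b * x)).
      rewrite (Rmult_assoc (2 * PI)); apply Rmult_le_compat; try nra. }
  replace (Cplus (x, ps) (Cmult (RtoC 0) h)) with ((x, ps) : C) in Hm'
    by (unfold h, Cplus, Cmult, RtoC; simpl; f_equal; ring).
  replace (Cplus (x, ps) (Cmult (RtoC 1) h)) with (Cplus (x, -1 * ps) (0, 2 * PI)) in Hm'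
    by (unfold h, Cplus, Cmult, RtoC; simpl; f_equal; ring).
  rewrite HQper in Hm'; rewrite Rmult_1_l in HX1.
  replace (Cminus (Cminus qp qn) (Cmult (0, 2 * PI) a)) with
    (Cplus (Cplus (Copp (Cminus (Q (x, ps)) qp)) (Cminus (Q (x, -1 * ps)) qn))
      (Copp (Cminus (Cplus (Q (x, -1 * ps)) (Cmult (0, 2 * PI) a)) (Q (x, ps))))) by ring.
  eapply Rle_lt_trans; [apply Cmod_triangle|].
  eapply Rle_lt_trans; [apply Rplus_le_compat_r, Cmod_triangle|].
  rewrite !Cmod_opp. lra.
Qed.

Let g3 := kernel_moment p.

Lemma Cmod_Cexp_mult (z : C) : Cmod (Cexp (Cmult (RtoC (INR p)) z)) = exp (INR p * Re z).
Proof. destruct z; rewrite Cmod_Cexp; f_equal; unfold Re, Cmult, RtoC; simpl; ring. Qed.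

Lemma moment_integrand_diff (z : C) : Rabs (Im z) <= t0 -> Cd g3 z.
Proof.
  intros Hz; destruct (et_diff z) as [l1 H1]; [unfold t0 in *; lra|].
  assert (Dexp : Cd (fun z => Cexp (Cmult (RtoC (INR p)) z)) z).
  { eexists; apply (is_derive_Ccomp (E := C_CompleteNormedModule) Cexp (fun z => Cmult (RtoC (INR p)) z)).
    - apply Cexp_derive.
    - apply (is_derive_ext (K := C_AbsRing) (V := C_NormedModule) (fun w => Cmult w (RtoC (INR p)))).
      + intros t; apply Cmult_comm.
      + apply (is_derive_Cscal_l (E := C_CompleteNormedModule) (fun w => w)), is_derive_Cid. }
  destruct Dexp as [l2 H2].
  eexists; apply (is_derive_Cscal (E := C_CompleteNormedModule) et (fun z => Cexp (Cmult (RtoC (INR p)) z))); eassumption.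
Qed.

Let Hnp : INR (p + 2) = INR p + 2.
Proof. rewrite plus_INR; simpl; ring. Qed.
Let Hp0 : 0 <= INR p := pos_INR p.

Lemma moment_integral : exists I3, forall y, Rabs y <= t0 -> is_line_int (V := VC) (fun x => g3 (x, y)) I3.
Proof.
  destruct (Hdec (p + 2)%nat) as (Kp & HKp & Hdp).
  apply (strip_line_int (E := C_CompleteNormedModule) g3 t0 (Kp * 16)); [lra|].
  intros x y Hy; split; [apply moment_integrand_diff, Hy|].
  change (Cmod (g3 (x, y)) <= Kp * 16 / (1 + x ^ 2)).
  unfold g3, kernel_moment; rewrite Cmod_mult, Cmod_Cexp_mult; unfold Re; cbn [fst].
  specialize (Hdp (x, y) Hy); unfold Re in Hdp; cbn [fst] in Hdp; rewrite Hnp in Hdp.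
  pose proof (HMf1 (exp x / k)); pose proof (Cmod_ge_0 (et (x, y))).
  pose proof (exp_pos (INR p * x)).
  apply Rle_trans with (Kp * exp (x - (INR p + 2) * Rmax x 0) * exp (INR p * x)).
  { apply Rmult_le_compat_r; [lra|]; nra. }
  rewrite Rmult_assoc, <- exp_plus; unfold Rdiv; rewrite Rmult_assoc.
  apply Rmult_le_compat_l; [lra|].
  eapply Rle_trans; [|apply exp_abs_dominated]; apply exp_le_mono.
  destruct (Rle_dec 0 x); [rewrite Rmax_left, Rabs_pos_eq by lra; lra|
    rewrite Rmax_right, Rabs_left by lra; nra].
Qed.

(** The value of the primitive at a corner [- L + i y0] of the contour, integrated
    over the line of [x]; holomorphy in [x] allows the line to be moved. *)
Lemma corner_integral (y0 : R) : Rabs y0 <= delta -> exists I, forall y, Rabs y <= t0 ->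
  is_line_int (V := VC) (fun x => Cmult (g3 (x, y)) (Q (Cplus (- L, y0) (x, y)))) I.
Proof.
  intros Hy0.
  destruct (Hdec (p + 2)%nat) as (Kp & HKp & Hdp).
  destruct (primitive_growth M H Q cE kE (2 * PI) p HM HcE HkE ltac:(lra) Hgr HQ) as (CQ & HCQ & HQg).
  apply (strip_line_int (E := C_CompleteNormedModule) (fun z => Cmult (g3 z) (Q (Cplus (- L, y0) z))) t0
    (CQ * exp (L / 2 + INR p * L) * Kp * 16)); [lra|].
  intros x y Hy; split.
  { destruct (moment_integrand_diff (x, y) Hy) as [l1 H1].
    eexists; apply (is_derive_Cscal (E := C_CompleteNormedModule) g3 (fun z => Q (Cplus (- L, y0) z))); [exact H1|].
    apply (is_derive_ext (K := C_AbsRing) (V := C_NormedModule) (fun z => Q (Cplus z (- L, y0)))).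
    - intros t; f_equal; apply Cplus_comm.
    - apply (is_derive_shift (E := C_CompleteNormedModule) Q); apply HQ. }
  change (Cmod (Cmult (g3 (x, y)) (Q (Cplus (- L, y0) (x, y)))) <= CQ * exp (L / 2 + INR p * L) * Kp * 16 / (1 + x ^ 2)).
  unfold g3, kernel_moment; rewrite !Cmod_mult, Cmod_Cexp_mult; unfold Re; cbn [fst].
  specialize (HQg (Cplus (- L, y0) (x, y))).
  unfold Re, Im in HQg; cbn [Cplus fst snd] in HQg.
  specialize (HQg ltac:(eapply Rle_trans; [apply Rabs_triang|]; unfold t0 in *; lra)).
  replace (- L + x) with (x - L) in HQg by ring.
  pose proof (HMf x) as HMfx.
  assert (Hx1 : Rabs (x - L) / 2 - INR p * Rmin (x - L) 0 <= (L / 2 + INR p * L) + (Rabs x / 2 - INR p * Rmin x 0)).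
  { assert (Rabs (x - L) <= Rabs x + L).
    { unfold Rminus; eapply Rle_trans; [apply Rabs_triang|]; rewrite Rabs_Ropp, (Rabs_pos_eq L); lra. }
    assert (Rmin x 0 - L <= Rmin (x - L) 0) by (unfold Rmin; destruct (Rle_dec x 0), (Rle_dec (x - L) 0); lra).
    nra. }
  apply exp_le_mono in Hx1; rewrite exp_plus in Hx1.
  specialize (Hdp (x, y) Hy); unfold Re in Hdp; cbn [fst] in Hdp; rewrite Hnp in Hdp.
  set (eL := exp (L / 2 + INR p * L)) in *.
  set (ex := exp (Rabs x / 2 - INR p * Rmin x 0)) in *.
  set (mm := exp (Mfun M (exp x / k))) in *.
  assert (HQ2 : Cmod (Q (Cplus (- L, y0) (x, y))) <= CQ * (eL * ex * mm)).
  { eapply Rle_trans; [exact HQg|]; apply Rmult_le_compat_l; [lra|].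
    apply Rmult_le_compat; [left; apply exp_pos|left; apply exp_pos|exact Hx1|exact HMfx]. }
  pose proof (Cmod_ge_0 (et (x, y))). pose proof (exp_pos (INR p * x)).
  assert (HeL : 0 < eL) by apply exp_pos. assert (Hex : 0 < ex) by apply exp_pos.
  apply Rle_trans with (Cmod (et (x, y)) * exp (INR p * x) * (CQ * (eL * ex * mm))).
  { apply Rmult_le_compat_l; [nra|exact HQ2]. }
  replace (Cmod (et (x, y)) * exp (INR p * x) * (CQ * (eL * ex * mm))) with
    (CQ * eL * (exp (INR p * x) * ex) * (Cmod (et (x, y)) * mm)) by ring.
  apply Rle_trans with (CQ * eL * (exp (INR p * x) * ex) * (Kp * exp (x - (INR p + 2) * Rmax x 0))).
  { apply Rmult_le_compat_l; [|exact Hdp]. apply Rmult_le_pos; nra. }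
  replace (CQ * eL * (exp (INR p * x) * ex) * (Kp * exp (x - (INR p + 2) * Rmax x 0))) with
    (CQ * eL * Kp * (exp (INR p * x) * ex * exp (x - (INR p + 2) * Rmax x 0))) by ring.
  replace (CQ * eL * Kp * 16 / (1 + x ^ 2)) with (CQ * eL * Kp * (16 / (1 + x ^ 2))) by (unfold Rdiv; ring).
  unfold ex; rewrite <- !exp_plus.
  apply Rmult_le_compat_l; [apply Rmult_le_pos; nra|].
  eapply Rle_trans; [|apply exp_abs_dominated]; apply exp_le_mono.
  destruct (Rle_dec 0 x); [rewrite Rmax_left, Rmin_right, Rabs_pos_eq by lra; lra|
    rewrite Rmax_right, Rmin_left, Rabs_left by lra; lra].
Qed.

Lemma arc_limit (Jv : C) (v : R) :
  (forall eps, 0 < eps -> exists rho, 0 < rho /\ forall s, 0 < s < rho ->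
     Cmod (Cminus Jv (Cminus (Q (Cplus (Ya 1) (v, 0))) (Q (Cplus (Ya s) (v, 0))))) < eps) ->
  Jv = Cminus (Q (Cplus (- L, delta) (v, 0))) (Q (Cplus (- L, - delta) (v, 0))).
Proof.
  intros A3.
  replace (- L, delta) with (Ya 1) by (unfold Ya; apply f_equal2; simpl; ring).
  replace (- L, - delta) with (Ya 0) by (unfold Ya; apply f_equal2; simpl; ring).
  apply Clim_unique; intros eps He.
  destruct (A3 (eps / 2) ltac:(lra)) as (rho & Hr & HA3).
  assert (CQ0 : continuous (U := C_UniformSpace) (fun s => Q (Cplus (Ya s) (v, 0))) 0).
  { apply (continuous_comp (V := C_UniformSpace) (fun s => Cplus (Ya s) (v, 0)) Q).
    - apply continuous_Cplus; [|apply continuous_const].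
      apply continuous_mkC; [apply continuous_const|].
      apply (ex_derive_continuous (V := R_NormedModule)); auto_derive; auto.
    - eapply holomorphic_continuous, HQ. }
  destruct (continuous_eps (V := C_NormedModule) _ _ CQ0 (eps / 2) ltac:(lra)) as [r Hr'].
  set (s := Rmin rho r / 2).
  assert (Hmin : 0 < Rmin rho r) by (apply Rmin_glb_lt; [lra|apply cond_pos]).
  pose proof (Rmin_l rho r); pose proof (Rmin_r rho r).
  specialize (HA3 s ltac:(unfold s; lra)).
  assert (Hb' : ball (M := R_UniformSpace) 0 r s).
  { change (Rabs (s - 0) < r); rewrite Rminus_0_r, Rabs_pos_eq; unfold s; lra. }
  specialize (Hr' s Hb').
  assert (Hr2 : Cmod (Cminus (Q (Cplus (Ya s) (v, 0))) (Q (Cplus (Ya 0) (v, 0)))) < eps / 2) by exact Hr'.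
  replace (Cminus Jv (Cminus (Q (Cplus (Ya 1) (v, 0))) (Q (Cplus (Ya 0) (v, 0))))) with
    (Cplus (Cminus Jv (Cminus (Q (Cplus (Ya 1) (v, 0))) (Q (Cplus (Ya s) (v, 0)))))
      (Copp (Cminus (Q (Cplus (Ya s) (v, 0))) (Q (Cplus (Ya 0) (v, 0)))))) by ring.
  eapply Rle_lt_trans; [apply Cmod_triangle|]; rewrite Cmod_opp; lra.
Qed.

(** The substitution [t = exp x] in the definition of the moment. *)
Lemma moment_integral_value (I3 : C) :
  is_line_int (V := VC) (fun x => g3 (x, 0)) I3 -> I3 = RtoC (m (S p)).
Proof.
  intros HI3.
  destruct (sk_moments _ _ _ _ HK) as (me & Hme & Hmp).
  assert (Hz : 0 <= Re (RtoC (INR (S p)))) by (unfold Re, RtoC; cbn [fst]; apply pos_INR).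
  pose proof (Hme _ Hz) as Hg; rewrite Hmp in Hg.
  assert (Hg' : is_RInt_gen (V := VC) (fun t => Cmult (Cexp (Cmult (Cminus (RtoC (INR (S p))) (RtoC 1)) (RtoC (ln t))))
     (e (polar t 0))) (at_right 0) (Rbar_locally p_infty) (RtoC (m (S p)))).
  { apply (is_RInt_gen_linear (V := C_R_NormedModule) (W := VC) (fun x : C => x) 1) in Hg; auto.
    - intros r [x y]; change ((r * x, r * y) = Cmult (RtoC r) (x, y)).
      unfold Cmult, RtoC; simpl; f_equal; ring.
    - intros [x y]; rewrite Rmult_1_l; right.
      change (sqrt (x ^ 2 + y ^ 2) = sqrt (Rabs x ^ 2 + Rabs y ^ 2)).
      rewrite !pow2_abs; reflexivity.
    - typeclasses eauto.
    - typeclasses eauto. }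
  assert (Hl := line_int_exp (V := VC) (fun v => g3 (v, 0)) I3).
  specialize (Hl ltac:(intros v; apply (continuous_horizontal C_CompleteNormedModule g3);
    apply C_differentiable_continuous, moment_integrand_diff; unfold Im; simpl; rewrite Rabs_R0; lra)).
  specialize (Hl HI3).
  rewrite <- (is_RInt_gen_unique (V := VC) _ _ Hg').
  symmetry; apply (is_RInt_gen_unique (V := VC)).
  eapply (is_RInt_gen_ext (V := VC)); [|exact Hl].
  apply Filter_prod with (Q := fun x => 0 < x) (R := fun x => 0 < x).
  { exists (mkposreal 1 Rlt_0_1); auto. }
  { exists 0; auto. }
  intros x y Hx Hy t Ht; simpl in Ht.
  assert (Ht1 : 0 < t) by (pose proof (Rmin_glb_lt x y 0 Hx Hy); lra).
  change (Cmult (RtoC (/ t)) (g3 (ln t, 0)) = Cmult (Cexp (Cmult (Cminus (RtoC (INR (S p))) (RtoC 1)) (RtoC (ln t)))) (e (ln t, 0))).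
  unfold g3, kernel_moment, et, shift_kernel.
  replace (Cminus (RtoC (INR (S p))) (RtoC 1)) with (RtoC (INR p)) by (rewrite S_INR, RtoC_plus; ring).
  change (ln t, 0) with (RtoC (ln t)).
  rewrite (Cexp_R (ln t)), exp_ln, RtoC_inv by lra.
  field; intros H0; injection H0; lra.
Qed.

End Primitive.

Lemma keyhole_contours : exists (w l : nat -> R -> C) (W L : R),
  (forall i, contour (w i) (l i) W L delta) /\
  forall p : nat, exists mu : nat -> C,
    (forall i, is_RInt (V := VC) (ext0 (T := C_AbelianGroup)
       (fun s => Cmult (w i s) (Cexp (Cmult (RtoC (INR p)) (l i s))))) 0 1 (mu i)) /\
    Cplus (Cplus (mu 0%nat) (mu 1%nat)) (mu 2%nat) = RtoC (m (S p) / m p).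
Proof.
  destruct (ray_bounds 1 ltac:(auto)) as (R1 & R2 & R3 & R4 & (K1 & R5) & R6).
  destruct (ray_bounds (-1) ltac:(auto)) as (S1 & S2 & S3 & S4 & (K2 & S5) & S6).
  assert (HBpos : forall v, 0 <= exp (- b * v)) by (intros; left; apply exp_pos).
  destruct (contour_piece H et (1 * t0) L delta (Y 1) _ (fun v => exp (- b * v)) K1 H_continuous
    (kernel_line_continuous (1 * t0) ltac:(rewrite Rmult_1_l, Rabs_pos_eq; lra)) R1 R2 R3 R4 HBpos R5 R6) as (wp & Wp & Cp & Pp).
  destruct (contour_piece H et (-1 * t0) L delta (Y (-1)) _ (fun v => exp (- b * v)) K2 H_continuous
    (kernel_line_continuous (-1 * t0) ltac:(rewrite Rabs_left; lra)) S1 S2 S3 S4 HBpos S5 S6) as (wn & Wn & Cn & Pn).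
  destruct arc_piece as (wa & Wa & Ca & Pa).
  set (c0 := Cinv (0, 2 * PI)).
  assert (Hc0 : (0, 2 * PI) <> RtoC 0) by (intros Hq; injection Hq; lra).
  exists (fun i => match i with O => fun s => Cmult (Copp c0) (wp s) | 1%nat => fun s => Cmult c0 (wa s)
     | _ => fun s => Cmult c0 (wn s) end),
    (fun i => match i with O => fun s => Copp (Y 1 (Rmin s 1)) | 1%nat => fun s => Copp (Ya (Rmin s 1))
     | _ => fun s => Copp (Y (-1) (Rmin s 1)) end),
    (Cmod c0 * (Rabs Wp + Rabs Wa + Rabs Wn)), L; split.
  { assert (Hsc : forall c w l W, Cmod c = Cmod c0 -> Rabs W <= Rabs Wp + Rabs Wa + Rabs Wn ->
      contour w l W L delta ->
      contour (fun s => Cmult c (w s)) l (Cmod c0 * (Rabs Wp + Rabs Wa + Rabs Wn)) L delta).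
    { intros c w l W Hc HW [C1 C2 C3 C4 C5]; split; auto.
      - intros s Hs; apply continuous_Cmult; [apply continuous_const|apply C1, Hs].
      - intros s Hs; rewrite Cmod_mult, Hc, Rmult_assoc; apply Rmult_le_compat_l; [apply Cmod_ge_0|].
        eapply Rle_trans; [apply C3, Hs|]; apply Rmult_le_compat_r; [lra|].
        pose proof (Rle_abs W); lra. }
    pose proof (Rabs_pos Wp); pose proof (Rabs_pos Wa); pose proof (Rabs_pos Wn).
    intros [|[|i]]; [apply (Hsc _ _ _ Wp)|apply (Hsc _ _ _ Wa)|apply (Hsc _ _ _ Wn)]; auto; try lra.
    apply Cmod_opp. }
  intros p.
  destruct (Pp p) as (mp & Jp & P1 & P2 & P3).
  destruct (Pa p) as (ma & Ja & A1 & A2 & A3).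
  destruct (Pn p) as (mn & Jn & N1 & N2 & N3).
  exists (fun i => match i with O => Cmult (Copp c0) mp | 1%nat => Cmult c0 ma | _ => Cmult c0 mn end).
  split.
  { assert (Hsc : forall c (w : R -> C) l mu, is_RInt (V := VC) (ext0 (T := C_AbelianGroup)
      (fun s => Cmult (w s) (Cexp (Cmult (RtoC (INR p)) (l s))))) 0 1 mu ->
      is_RInt (V := VC) (ext0 (T := C_AbelianGroup)
      (fun s => Cmult (Cmult c (w s)) (Cexp (Cmult (RtoC (INR p)) (l s))))) 0 1 (Cmult c mu)).
    { intros c w l mu Hmu.
      apply (is_RInt_Cscal C_CompleteNormedModule _ c) in Hmu.
      eapply (is_RInt_ext (V := VC)); [|exact Hmu].
      intros x Hx; rewrite Rmin_left, Rmax_right in Hx by lra.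
      unfold ext0; destruct (Rlt_dec 0 x); [|lra].
      apply Cmult_assoc. }
    intros [|[|i]]; apply Hsc; assumption. }
  destruct (log_primitive p (fun n => RtoC (/ m n)) E (sk_E_series _ _ _ _ HK) (sk_E_entire _ _ _ _ HK))
    as (Q & HQ & HQper).
  assert (Goal : Cminus (Cplus ma mn) mp = Cmult (Cmult (0, 2 * PI) (RtoC (/ m p))) (RtoC (m (S p)))).
  { destruct (ray_limit Q 1 Jp (P3 Q HQ)) as (qp & EJp & Lqp).
    destruct (ray_limit Q (-1) Jn (N3 Q HQ)) as (qn & EJn & Lqn).
    assert (Hq := ray_limits_period p (RtoC (/ m p)) Q HQ HQper qp qn Lqp Lqn).
    destruct (moment_integral p) as [I3 HI3].
    destruct (corner_integral p Q HQ delta ltac:(rewrite Rabs_pos_eq; lra)) as [I1 HI1].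
    destruct (corner_integral p Q HQ (- delta) ltac:(rewrite Rabs_Ropp, Rabs_pos_eq; lra)) as [I2 HI2].
    (* the corner terms cancel when their lines of integration are moved to a common
       one; what remains is the difference of the two limits times the moment *)
    assert (Emp : mp = Cminus I1 (Cmult qp I3)).
    { apply (is_line_int_unique (V := VC) _ _ _ P2).
      apply (is_line_int_ext (V := VC) (fun v => Cminus (Cmult (kernel_moment p (v, 1 * t0)) (Q (Cplus (- L, delta) (v, 1 * t0))))
        (Cmult qp (kernel_moment p (v, 1 * t0))))).
      - intros v; rewrite EJp; unfold Y, kernel_moment.
        cbv beta; rewrite ln_1, Rmult_0_r, Rminus_0_r, (Rmult_1_l delta). Cring.
      - apply line_int_VC_lin; [apply HI1|apply HI3]; rewrite Rmult_1_l, Rabs_pos_eq; lra. }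
    assert (Emn : mn = Cminus I2 (Cmult qn I3)).
    { apply (is_line_int_unique (V := VC) _ _ _ N2).
      apply (is_line_int_ext (V := VC) (fun v => Cminus (Cmult (kernel_moment p (v, -1 * t0)) (Q (Cplus (- L, - delta) (v, -1 * t0))))
        (Cmult qn (kernel_moment p (v, -1 * t0))))).
      - intros v; rewrite EJn; unfold Y, kernel_moment.
        cbv beta; rewrite ln_1, Rmult_0_r, Rminus_0_r.
        replace (-1 * delta) with (- delta) by ring. Cring.
      - apply line_int_VC_lin; [apply HI2|apply HI3]; rewrite Rabs_left; lra. }
    assert (Ema : ma = Cminus I1 I2).
    { replace (Cminus I1 I2) with (Cminus I1 (Cmult (RtoC 1) I2)) by ring.
      apply (is_line_int_unique (V := VC) _ _ _ A2).
      apply (is_line_int_ext (V := VC) (fun v => Cminus (Cmult (kernel_moment p (v, 0)) (Q (Cplus (- L, delta) (v, 0))))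
        (Cmult (RtoC 1) (Cmult (kernel_moment p (v, 0)) (Q (Cplus (- L, - delta) (v, 0))))))).
      - intros v; rewrite (arc_limit p Q HQ (Ja v) v (A3 Q HQ v)); unfold kernel_moment; Cring.
      - apply line_int_VC_lin; [apply HI1|apply HI2]; rewrite Rabs_R0; lra. }
    rewrite Ema, Emp, Emn, <- Hq, <- (moment_integral_value p I3 (HI3 0 ltac:(rewrite Rabs_R0; lra))); ring. }
  replace (Cplus (Cplus (Cmult (Copp c0) mp) (Cmult c0 ma)) (Cmult c0 mn)) with
    (Cmult c0 (Cminus (Cplus ma mn) mp)) by ring.
  rewrite Goal, !Cmult_assoc; unfold c0; rewrite Cinv_l, Cmult_1_l by exact Hc0.
  rewrite <- RtoC_mult; f_equal; unfold Rdiv; ring.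
Qed.
End Keyhole.

(** If the arc is small enough, the bounds of the kernel functions are those
    required of the contour. *)
Lemma moment_ratio_contours : exists (w l : nat -> R -> C) (W L : R),
  (forall i, contour (w i) (l i) W L delta) /\
  forall p : nat, exists mu : nat -> C,
    (forall i, is_RInt (V := VC) (ext0 (T := C_AbelianGroup)
       (fun s => Cmult (w i s) (Cexp (Cmult (RtoC (INR p)) (l i s))))) 0 1 (mu i)) /\
    Cplus (Cplus (mu 0%nat) (mu 1%nat)) (mu 2%nat) = RtoC (m (S p) / m p).
Proof.
  destruct (kernel_decay M e E m HM HK ltac:(exact Heta) delta Hd ltac:(exact Hd1)) as (k & Hk & Hdec).
  destruct (entire_growth M e E m HK) as (cE & kE & HcE & HkE & Hgr).
  destruct (entire_decay M e E m HM HK ltac:(exact Heta) delta Hd ltac:(exact Hd2)) as (b & CE & Hb & HCE & HdecE).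
  fold H in Hgr, HdecE; fold et eta in Hdec; fold eta in HdecE.
  (* on the arc, of radius exp (- L), the kernel outweighs the entire function *)
  set (L := Rmax 0 (ln (k / kE))).
  assert (HL0 : 0 <= L) by apply Rmax_l.
  assert (HL : forall x, exp (x - L) / kE <= exp x / k).
  { intros x; unfold Rminus; rewrite exp_plus.
    assert (exp (- L) <= kE / k).
    { replace (kE / k) with (/ (k / kE)) by (field; lra).
      assert (0 < k / kE) by (apply Rdiv_lt_0_compat; lra).
      rewrite exp_Ropp; apply Rinv_le_contravar; [lra|].
      rewrite <- (exp_ln (k / kE)) by lra. apply exp_le_mono, Rmax_r. }
    pose proof (exp_pos x).
    replace (exp x / k) with (exp x * (kE / k) / kE) by (field; lra).
    apply Rmult_le_compat_r; [left; apply Rinv_0_lt_compat, HkE|]. nra. }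
  assert (HMf : forall x, exp (Mfun M (exp (x - L) / kE)) <= exp (Mfun M (exp x / k))).
  { intros x; apply exp_le_mono, Mfun_mono; auto. }
  apply (keyhole_contours k cE kE b CE L); assumption.
Qed.
End Assembly.

(** * Averages along a contour *)

Section Average.
Context {E : CompleteNormedModule C_AbsRing}.
Let VE := restrict_scalars E.
Context (w l : R -> C) (W L delta : R) (Hct : contour w l W L delta).

(** In the variable [x = exp y] this is the integral of [w s * g (x * exp (l s))] over [0 < s < 1]. *)
Definition avg (g : C -> E) (y : C) : E :=
  RInt (V := VE) (ext0 (T := E) (fun s => scal (w s) (g (Cplus y (l s))))) 0 1.

Lemma contour_W : 0 <= W.
Proof.
  pose proof (ct_W _ _ _ _ _ Hct 1 Rlt_0_1) as H; pose proof (Cmod_ge_0 (w 1)); lra.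
Qed.

Lemma continuous_Cscal_E {T : UniformSpace} (a : T -> C) (f : T -> E) (x : T) :
  continuous (U := C_UniformSpace) a x -> continuous (U := E) f x ->
  continuous (U := E) (fun t => scal (a t) (f t)) x.
Proof.
  intros Ha Hf; apply (continuous_scal (K := C_AbsRing) (V := E) a f x); [|exact Hf].
  intros P HP; apply Ha, locally_C, HP.
Qed.

Lemma avg_integrand_continuous (k : R -> E) (B : R) :
  (forall s, 0 < s -> continuous (U := E) k s) -> (forall s, 0 < s -> norm (k s) <= B) ->
  forall s, continuous (U := VE) (ext0 (T := E) (fun s => scal (w s) (k s))) s.
Proof.
  intros Hk HB; apply (ext0_continuous_1 _ (W * B)).
  - intros s Hs; apply continuous_Cscal_E; [apply (ct_w _ _ _ _ _ Hct s Hs)|auto].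
  - intros s Hs; eapply Rle_trans; [apply Enorm_scal|].
    pose proof (ct_W _ _ _ _ _ Hct s Hs); specialize (HB s Hs).
    pose proof (Enorm_ge_0 E (k s)); pose proof (Cmod_ge_0 (w s)).
    replace (W * B * s) with (W * s * B) by ring.
    apply Rmult_le_compat; assumption.
Qed.

Lemma avg_integral_bound (k : R -> E) (B : R) (I : E) :
  (forall s, 0 < s -> norm (k s) <= B) ->
  is_RInt (V := VE) (ext0 (T := E) (fun s => scal (w s) (k s))) 0 1 I -> norm I <= W * B.
Proof.
  intros HB HI.
  assert (HB0 : 0 <= B) by (specialize (HB 1 Rlt_0_1); pose proof (Enorm_ge_0 E (k 1)); lra).
  pose proof contour_W as HW.
  replace (W * B) with ((1 - 0) * (W * B)) by ring.
  apply (norm_RInt_le_const (V := VE) (ext0 (T := E) (fun s => scal (w s) (k s))) 0 1); [lra| |exact HI].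
  intros s Hs; unfold ext0; destruct (Rlt_dec 0 s) as [H0|H0].
  - change (norm (scal (w s) (k s) : E) <= W * B).
    eapply Rle_trans; [apply Enorm_scal|].
    pose proof (ct_W _ _ _ _ _ Hct s H0); specialize (HB s H0).
    pose proof (Enorm_ge_0 E (k s)); pose proof (Cmod_ge_0 (w s)).
    apply Rle_trans with (W * s * B); [apply Rmult_le_compat; assumption|].
    assert (0 <= W * B) by nra. nra.
  - eapply Rle_trans; [right; apply (norm_zero (V := VE))|]. nra.
Qed.

Lemma continuous_along (g : C -> E) (y : C) :
  (forall s, 0 < s -> C_differentiable E g (Cplus y (l s))) ->
  forall s, 0 < s -> continuous (U := E) (fun s => g (Cplus y (l s))) s.
Proof.
  intros Hg s Hs; apply (continuous_comp (V := C_UniformSpace) (fun s => Cplus y (l s)) g).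
  - apply continuous_Cplus; [apply continuous_const|apply (ct_l _ _ _ _ _ Hct s Hs)].
  - apply C_differentiable_continuous, Hg, Hs.
Qed.

Lemma avg_correct (g : C -> E) (y : C) (B : R) :
  (forall s, 0 < s -> C_differentiable E g (Cplus y (l s)) /\ norm (g (Cplus y (l s))) <= B) ->
  is_RInt (V := VE) (ext0 (T := E) (fun s => scal (w s) (g (Cplus y (l s))))) 0 1 (avg g y).
Proof.
  intros Hg; apply (RInt_correct (V := VE)), (ex_RInt_cont (V := VE)).
  apply (avg_integrand_continuous _ B); [|intros; apply Hg; auto].
  apply continuous_along; intros; apply Hg; auto.
Qed.

Lemma avg_norm (g : C -> E) (y : C) (B : R) :
  (forall s, 0 < s -> C_differentiable E g (Cplus y (l s)) /\ norm (g (Cplus y (l s))) <= B) ->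
  norm (avg g y) <= W * B.
Proof.
  intros Hg; apply (avg_integral_bound (fun s => g (Cplus y (l s)))); [|apply (avg_correct g y B Hg)].
  intros s Hs; apply Hg, Hs.
Qed.

Lemma avg_ext (g1 g2 : C -> E) (y : C) :
  (forall s, 0 < s -> g1 (Cplus y (l s)) = g2 (Cplus y (l s))) -> avg g1 y = avg g2 y.
Proof.
  intros H; apply (RInt_ext (V := VE)); intros s Hs; unfold ext0; destruct (Rlt_dec 0 s); [|reflexivity].
  rewrite H; auto.
Qed.

Lemma ext0_RInt_comb (k1 k2 k3 : R -> E) (c : C) (I1 I2 I3 : E) :
  is_RInt (V := VE) (ext0 (T := E) (fun s => scal (w s) (k1 s))) 0 1 I1 ->
  is_RInt (V := VE) (ext0 (T := E) (fun s => scal (w s) (k2 s))) 0 1 I2 ->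
  is_RInt (V := VE) (ext0 (T := E) (fun s => scal (w s) (k3 s))) 0 1 I3 ->
  is_RInt (V := VE) (ext0 (T := E) (fun s => scal (w s) (minus (minus (k1 s) (k2 s)) (scal c (k3 s))))) 0 1
    (minus (minus I1 I2) (scal c I3)).
Proof.
  intros H1 H2 H3.
  apply (is_RInt_Cscal E _ c) in H3.
  pose proof (is_RInt_minus (V := VE) _ _ _ _ _ _ (is_RInt_minus (V := VE) _ _ _ _ _ _ H1 H2) H3) as H.
  eapply (is_RInt_ext (V := VE)); [|exact H].
  intros s _; unfold ext0; destruct (Rlt_dec 0 s).
  - change (minus (minus (scal (w s) (k1 s)) (scal (w s) (k2 s))) (scal c (scal (w s) (k3 s))) =
      scal (w s) (minus (minus (k1 s) (k2 s)) (scal c (k3 s)))). Cmodule E.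
  - change (minus (minus zero zero) (scal c zero) = @zero E). Cmodule E.
Qed.

(** Differentiation under the integral sign, by the uniform second order estimates;
    the factor 4 is the one in these estimates. *)
Lemma avg_differentiable (g : C -> E) (y : C) (r B : R) : 0 < r ->
  (forall s h, 0 < s -> Cmod h < 4 * r ->
     C_differentiable E g (Cplus (Cplus y h) (l s)) /\ norm (g (Cplus (Cplus y h) (l s))) <= B) ->
  C_differentiable E (avg g) y.
Proof.
  intros Hr Hg.
  assert (E0 : forall s, Cplus (Cplus y (RtoC 0)) (l s) = Cplus y (l s)) by (intros; ring).
  assert (HB0 : 0 <= B).
  { destruct (Hg 1 (RtoC 0) Rlt_0_1) as [_ H]; [rewrite Cmod_0; lra|].
    pose proof (Enorm_ge_0 E (g (Cplus (Cplus y (RtoC 0)) (l 1)))); lra. }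
  assert (Hd : forall s, exists d : E, 0 < s -> is_derive (K := C_AbsRing) g (Cplus y (l s)) d).
  { intros s; destruct (Rlt_dec 0 s) as [Hs|Hs]; [|exists zero; tauto].
    destruct (Hg s (RtoC 0) Hs) as [[d Hd] _]; [rewrite Cmod_0; lra|].
    rewrite E0 in Hd; exists d; auto. }
  assert (Hd' : exists d : R -> E, forall s, 0 < s -> is_derive (K := C_AbsRing) g (Cplus y (l s)) (d s)).
  { exists (fun s => proj1_sig (constructive_indefinite_description _ (Hd s))).
    intros s; exact (proj2_sig (constructive_indefinite_description _ (Hd s))). }
  destruct Hd' as [d Hd'].
  assert (T : forall s, 0 < s -> norm (d s) <= B / r /\
    forall h, Cmod h < r ->
    norm (minus (minus (g (Cplus (Cplus y (l s)) h)) (g (Cplus y (l s)))) (scal h (d s))) <= B / r ^ 2 * Cmod h ^ 2 /\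
    forall l', is_derive (K := C_AbsRing) g (Cplus (Cplus y (l s)) h) l' ->
      norm (minus l' (d s)) <= B / r ^ 2 * Cmod h).
  { intros s Hs; apply (taylor_estimate g (Cplus y (l s)) r B Hr); [|apply Hd', Hs].
    intros u Hu.
    replace u with (Cplus (Cplus y (Cminus u (Cplus y (l s)))) (l s)) by ring.
    apply Hg; auto. }
  assert (Br : 0 <= B / r ^ 2) by (apply Rmult_le_pos; [lra|left; apply Rinv_0_lt_compat; nra]).
  assert (Cd : forall s, 0 < s -> continuous (U := E) d s).
  { intros s Hs; apply (eps_continuous (V := E)); intros eps He.
    set (b := B / r ^ 2 + 1). assert (Hb : 0 < b) by (unfold b; lra).
    assert (He' : 0 < Rmin r (eps / b)) by (apply Rmin_glb_lt; [lra|apply Rdiv_lt_0_compat; lra]).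
    pose proof (continuous_eps (V := C_NormedModule) _ _ (ct_l _ _ _ _ _ Hct s Hs) _ He') as Hl.
    assert (Hp : locally s (fun u : R => 0 < u)).
    { exists (mkposreal s Hs); intros u Hu; change (Rabs (u - s) < s) in Hu. apply Rabs_def2 in Hu; lra. }
    generalize (filter_and _ _ Hp Hl); apply filter_imp; intros u [Hu0 Hu].
    assert (Hu' : Cmod (Cminus (l u) (l s)) < Rmin r (eps / b)) by exact Hu.
    pose proof (Rmin_l r (eps / b)); pose proof (Rmin_r r (eps / b)).
    set (h := Cminus (l u) (l s)) in *.
    destruct (T s Hs) as [_ Ts]; destruct (Ts h ltac:(lra)) as [_ Td].
    assert (Eu : Cplus (Cplus y (l s)) h = Cplus y (l u)) by (unfold h; ring).
    eapply Rle_lt_trans; [apply Td; rewrite Eu; apply Hd', Hu0|].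
    apply Rle_lt_trans with (b * Cmod h).
    - apply Rmult_le_compat_r; [apply Cmod_ge_0|unfold b; lra].
    - apply Rlt_le_trans with (b * (eps / b)); [apply Rmult_lt_compat_l; lra|right; field; lra]. }
  set (D := RInt (V := VE) (ext0 (T := E) (fun s => scal (w s) (d s))) 0 1).
  assert (HD : is_RInt (V := VE) (ext0 (T := E) (fun s => scal (w s) (d s))) 0 1 D).
  { apply (RInt_correct (V := VE)), (ex_RInt_cont (V := VE)), (avg_integrand_continuous d (B / r) Cd).
    intros s Hs; apply T, Hs. }
  assert (HA : forall h, Cmod h < 4 * r ->
    is_RInt (V := VE) (ext0 (T := E) (fun s => scal (w s) (g (Cplus (Cplus y h) (l s))))) 0 1 (avg g (Cplus y h))).
  { intros h Hh; apply (avg_correct g (Cplus y h) B); intros s Hs; auto. }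
  assert (HA0 : is_RInt (V := VE) (ext0 (T := E) (fun s => scal (w s) (g (Cplus y (l s))))) 0 1 (avg g y)).
  { replace y with (Cplus y (RtoC 0)) by ring; apply HA; rewrite Cmod_0; lra. }
  pose proof contour_W as HW.
  exists D; apply (proj2 (is_derive_eps (V := E) _ _ _)); intros eps He.
  set (b := W * (B / r ^ 2) + 1). assert (Hb : 0 < b) by (unfold b; nra).
  exists (Rmin r (eps / b)); split; [apply Rmin_glb_lt; [lra|apply Rdiv_lt_0_compat; lra]|].
  intros h Hh; assert (Hh' : Cmod h < Rmin r (eps / b)) by exact Hh; clear Hh.
  pose proof (Rmin_l r (eps / b)); pose proof (Rmin_r r (eps / b)).
  change (norm (minus (minus (avg g (Cplus y h)) (avg g y)) (scal h D)) <= eps * Cmod h).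
  eapply Rle_trans.
  - apply (avg_integral_bound (fun s => minus (minus (g (Cplus (Cplus y h) (l s))) (g (Cplus y (l s)))) (scal h (d s)))
      (B / r ^ 2 * Cmod h ^ 2)).
    + intros s Hs; destruct (T s Hs) as [_ Ts]; destruct (Ts h ltac:(lra)) as [Ts1 _].
      replace (Cplus (Cplus y h) (l s)) with (Cplus (Cplus y (l s)) h) by ring. exact Ts1.
    + apply ext0_RInt_comb; [apply HA; lra|exact HA0|exact HD].
  - pose proof (Cmod_ge_0 h).
    assert (Cmod h * b <= eps).
    { apply Rle_trans with (eps / b * b); [apply Rmult_le_compat_r; lra|right; field; lra]. }
    assert (W * (B / r ^ 2) * Cmod h <= eps) by (unfold b in *; nra).
    replace (W * (B / r ^ 2 * Cmod h ^ 2)) with (W * (B / r ^ 2) * Cmod h * Cmod h) by ring.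
    apply Rmult_le_compat_r; assumption.
Qed.

Lemma pow_n_Cexp_plus (y z : C) (n : nat) :
  pow_n (K := C_Ring) (Cexp (Cplus y z)) n =
  Cmult (pow_n (K := C_Ring) (Cexp y) n) (Cexp (Cmult (RtoC (INR n)) z)).
Proof.
  induction n as [|n IH].
  - simpl INR; replace (Cmult (RtoC 0) z) with (RtoC 0) by ring. rewrite Cexp_0; symmetry; apply Cmult_1_r.
  - change (Cmult (Cexp (Cplus y z)) (pow_n (K := C_Ring) (Cexp (Cplus y z)) n) =
      Cmult (Cmult (Cexp y) (pow_n (K := C_Ring) (Cexp y) n)) (Cexp (Cmult (RtoC (INR (S n))) z))).
    rewrite IH, Cexp_plus.
    replace (Cmult (RtoC (INR (S n))) z) with (Cplus z (Cmult (RtoC (INR n)) z))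
      by (rewrite S_INR, RtoC_plus; ring).
    rewrite Cexp_plus; ring.
Qed.

(** Along the contour the monomial of degree [n] is multiplied by [exp (n * l s)],
    so that averaging multiplies its coefficient by a moment of the density. *)
Lemma avg_pseries (mu : nat -> C) (a : nat -> E) (g : C -> E) (B R0 : R) (y : C) :
  (forall p, is_RInt (V := VC) (ext0 (T := C_AbelianGroup)
       (fun s => Cmult (w s) (Cexp (Cmult (RtoC (INR p)) (l s))))) 0 1 (mu p)) ->
  0 < R0 -> (forall n, norm (a n) * R0 ^ n <= B) ->
  (forall s, 0 < s -> C_differentiable E g (Cplus y (l s)) /\
     Cmod (Cexp (Cplus y (l s))) <= R0 / 2 /\
     is_pseries (K := C_AbsRing) a (Cexp (Cplus y (l s))) (g (Cplus y (l s)))) ->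
  is_pseries (K := C_AbsRing) (fun n => scal (mu n) (a n)) (Cexp y) (avg g y).
Proof.
  intros Hmu HR Ha Hg.
  assert (Hrem := fun s Hs N => pseries_remainder a B R0 _ _ N HR Ha
    (proj1 (proj2 (Hg s Hs))) (proj2 (proj2 (Hg s Hs)))).
  set (S := fun N s => sum_n (fun k => scal (pow_n (K := C_Ring) (Cexp (Cplus y (l s))) k) (a k)) N : E).
  set (T := fun k => scal (pow_n (K := C_Ring) (Cexp y) k) (scal (mu k) (a k)) : E).
  assert (HT : forall k, is_RInt (V := VE) (ext0 (T := E) (fun s => scal (w s)
     (scal (pow_n (K := C_Ring) (Cexp (Cplus y (l s))) k) (a k)))) 0 1 (T k)).
  { intros k.
    assert (Hl : is_RInt (V := VE) (fun s => scal (ext0 (T := C_AbelianGroup)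
       (fun s => Cmult (w s) (Cexp (Cmult (RtoC (INR k)) (l s)))) s)
       (scal (pow_n (K := C_Ring) (Cexp y) k) (a k))) 0 1
       (scal (mu k) (scal (pow_n (K := C_Ring) (Cexp y) k) (a k)))).
    { set (v := scal (pow_n (K := C_Ring) (Cexp y) k) (a k)).
      apply (is_RInt_linear (V := VC) (W := VE) (fun c : C => scal c v : E) (norm v)); [| | |apply Hmu].
      - intros x z; apply (scal_distr_r (V := E)).
      - intros r x; change (scal (Cmult (RtoC r) x) v = scal (RtoC r) (scal x v)); Cmodule E.
      - intros x; rewrite Rmult_comm; apply Enorm_scal. }
    unfold T; replace (scal (pow_n (K := C_Ring) (Cexp y) k) (scal (mu k) (a k))) with
      (scal (mu k) (scal (pow_n (K := C_Ring) (Cexp y) k) (a k)))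
      by (generalize (pow_n (K := C_Ring) (Cexp y) k) (mu k); intros; Cmodule E).
    eapply (is_RInt_ext (V := VE)); [|exact Hl].
    intros s _; unfold ext0; destruct (Rlt_dec 0 s).
    - rewrite pow_n_Cexp_plus; generalize (pow_n (K := C_Ring) (Cexp y) k) (Cexp (Cmult (RtoC (INR k)) (l s))).
      intros u v; change (scal (Cmult (w s) v) (scal u (a k)) = scal (w s) (scal (Cmult u v) (a k))). Cmodule E.
    - apply (scal_zero_l (V := E)). }
  assert (HS : forall N, is_RInt (V := VE) (ext0 (T := E) (fun s => scal (w s) (S N s))) 0 1 (sum_n T N)).
  { induction N as [|N IH].
    - rewrite sum_O; eapply (is_RInt_ext (V := VE)); [|apply HT].
      intros s _; unfold ext0, S; destruct (Rlt_dec 0 s); [|reflexivity]. rewrite sum_O; reflexivity.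
    - rewrite sum_Sn; eapply (is_RInt_ext (V := VE)); [|apply (is_RInt_plus (V := VE)); [exact IH|apply HT]].
      intros s _; unfold ext0, S; destruct (Rlt_dec 0 s).
      + rewrite sum_Sn; symmetry; apply (scal_distr_l (V := E)).
      + apply (plus_zero_l (G := E)). }
  assert (HA := avg_correct g y (2 * B) (fun s Hs => conj (proj1 (Hg s Hs)) (proj1 (Hrem s Hs 0%nat)))).
  pose proof contour_W as HW.
  assert (HB0 : 0 <= B).
  { specialize (Ha 0%nat); simpl in Ha; pose proof (Enorm_ge_0 E (a 0%nat)); lra. }
  apply (eps_filterlim (V := E)); [typeclasses eauto|]; intros eps He.
  destruct (pow_lt_1_zero (/ 2) ltac:(rewrite Rabs_pos_eq; lra) (eps / (2 * (W * B) + 1))) as [N HN].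
  { apply Rdiv_lt_0_compat; [exact He|]. assert (0 <= W * B) by (apply Rmult_le_pos; assumption). lra. }
  exists N; intros n Hn.
  assert (Hb : norm (minus (sum_n T n) (avg g y)) <= W * (2 * B * (/ 2) ^ Datatypes.S n)).
  { apply (avg_integral_bound (fun s => minus (S n s) (g (Cplus y (l s))))).
    - intros s Hs; eapply Rle_trans; [right; apply Enorm_minus_sym|]; apply Hrem, Hs.
    - pose proof (is_RInt_minus (V := VE) _ _ _ _ _ _ (HS n) HA) as Hm.
      eapply (is_RInt_ext (V := VE)); [|exact Hm].
      intros s _; unfold ext0; destruct (Rlt_dec 0 s).
      + change (minus (scal (w s) (S n s)) (scal (w s) (g (Cplus y (l s)))) =
          scal (w s) (minus (S n s) (g (Cplus y (l s))))). Cmodule E.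
      + change (minus zero zero = @zero E); Cmodule E. }
  eapply Rle_lt_trans; [exact Hb|].
  specialize (HN (Datatypes.S n) ltac:(lia)); rewrite Rabs_pos_eq in HN by (left; apply pow_lt; lra).
  assert (HWB : 0 <= W * B) by (apply Rmult_le_pos; assumption).
  set (q := (/ 2) ^ Datatypes.S n) in *.
  apply Rle_lt_trans with ((2 * (W * B)) * q); [right; ring|].
  assert (Hq : 0 < q) by (unfold q; apply pow_lt; lra).
  apply Rlt_le_trans with ((2 * (W * B) + 1) * (eps / (2 * (W * B) + 1))).
  - apply Rle_lt_trans with ((2 * (W * B) + 1) * q); [nra|]. apply Rmult_lt_compat_l; lra.
  - right; field; lra.
Qed.

Lemma contour_moment_bound (p : nat) (mu : C) :
  is_RInt (V := VC) (ext0 (T := C_AbelianGroup)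
       (fun s => Cmult (w s) (Cexp (Cmult (RtoC (INR p)) (l s))))) 0 1 mu ->
  Cmod mu <= W * exp L ^ p.
Proof.
  intros H; pose proof contour_W as HW.
  pose proof (exp_pos L) as HL.
  assert (HLp : 0 < exp L ^ p) by (apply pow_lt, HL).
  replace (W * exp L ^ p) with ((1 - 0) * (W * exp L ^ p)) by ring.
  apply (norm_RInt_le_const (V := VC) (ext0 (T := C_AbelianGroup)
       (fun s => Cmult (w s) (Cexp (Cmult (RtoC (INR p)) (l s))))) 0 1); [lra| |exact H].
  intros s Hs; unfold ext0; destruct (Rlt_dec 0 s) as [H0|H0].
  - change (Cmod (Cmult (w s) (Cexp (Cmult (RtoC (INR p)) (l s)))) <= W * exp L ^ p).
    rewrite Cmod_mult, Cmod_Cexp.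
    pose proof (ct_W _ _ _ _ _ Hct s H0); pose proof (ct_re _ _ _ _ _ Hct s H0).
    apply Rmult_le_compat; [apply Cmod_ge_0|left; apply exp_pos|nra|].
    rewrite <- Rpower_pow by exact HL; unfold Rpower; rewrite ln_exp; apply exp_le_mono.
    replace (Re (Cmult (RtoC (INR p)) (l s))) with (INR p * Re (l s))
      by (destruct (l s); unfold Re, Cmult, RtoC; simpl; ring).
    apply Rmult_le_compat_l; [apply pos_INR|assumption].
  - eapply Rle_trans; [right; apply (norm_zero (V := VC))|]. nra.
Qed.

(** An exchange of integrals: the density vanishes at the end of the contour, which
    gives a continuous integrand on the closed interval. *)
Lemma avg_line_int (k : R -> C) (g : C -> E) (tau K : R) (F : R -> E) :
  (forall v, continuous (U := C_UniformSpace) k v) ->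
  (forall s v, 0 < s -> C_differentiable E g (Cplus (v, tau) (l s))) ->
  (forall v, exists B, forall s, 0 < s -> norm (g (Cplus (v, tau) (l s))) <= B) ->
  (forall s v, 0 < s -> Cmod (k v) * norm (g (Cplus (v, tau) (l s))) <= K / (1 + v ^ 2)) ->
  (forall s, 0 < s -> is_line_int (V := VE) (fun v => scal (k v) (g (Cplus (v, tau) (l s)))) (F s)) ->
  is_line_int (V := VE) (fun v => scal (k v) (avg g (v, tau)))
    (RInt (V := VE) (ext0 (T := E) (fun s => scal (w s) (F s))) 0 1) /\
  (forall v, continuous (U := VE) (fun v => scal (k v) (avg g (v, tau))) v).
Proof.
  intros Hk Hg HgB Hdom HF.
  pose proof contour_W as HW.
  assert (HK : 0 <= K).
  { specialize (Hdom 1 0 Rlt_0_1); pose proof (Cmod_ge_0 (k 0)); pose proof (Enorm_ge_0 E (g (Cplus (0, tau) (l 1)))).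
    replace (K / (1 + 0 ^ 2)) with K in Hdom by (simpl; field). nra. }
  set (c := fun s => Rmin s 1).
  assert (Hc0 : forall s, 0 < s -> 0 < c s <= 1).
  { intros s Hs; split; [apply Rmin_glb_lt; lra|apply Rmin_r]. }
  set (f := fun s v => ext0 (T := E) (fun s => scal (w (c s)) (scal (k v) (g (Cplus (v, tau) (l (c s)))))) s).
  assert (Hb : forall s v, 0 < s -> norm (scal (w (c s)) (scal (k v) (g (Cplus (v, tau) (l (c s)))))) <=
    W * c s * (K / (1 + v ^ 2))).
  { intros s v Hs; eapply Rle_trans; [apply Enorm_scal|].
    apply Rmult_le_compat; [apply Cmod_ge_0|apply Enorm_ge_0|apply (ct_W _ _ _ _ _ Hct), Hc0, Hs|].
    eapply Rle_trans; [apply Enorm_scal|]. apply Hdom, Hc0, Hs. }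
  assert (Hi : forall v, 0 < / (1 + v ^ 2) <= 1).
  { intros v; split; [apply Rinv_0_lt_compat; nra|]. rewrite <- Rinv_1; apply Rinv_le_contravar; nra. }
  assert (Cc : forall (p : R -> C), (forall s, 0 < s -> continuous (U := C_UniformSpace) p s) ->
    forall s (v : R), 0 < s -> continuous (U := C_UniformSpace) (fun q : R * R => p (c (fst q))) (s, v)).
  { intros p Hp s v Hs.
    apply (continuous_comp (V := R_UniformSpace) (fun q : R * R => c (fst q)) p); [|apply Hp, Hc0, Hs].
    apply (continuous_comp (V := R_UniformSpace) (fun q : R * R => fst q) c); [apply continuous_fst|].
    apply continuous_clamp. }
  assert (Cf : forall s v, continuous (U := VE) (fun p : R * R => f (fst p) (snd p)) (s, v)).
  { apply (ext0_continuous (fun s v => scal (w (c s)) (scal (k v) (g (Cplus (v, tau) (l (c s)))))) (W * K)).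
    - intros s v Hs; apply continuous_Cscal_E; [apply (Cc w (ct_w _ _ _ _ _ Hct) s v Hs)|].
      apply continuous_Cscal_E.
      + apply (continuous_comp (V := R_UniformSpace) (fun q : R * R => snd q) k); [apply continuous_snd|apply Hk].
      + apply (continuous_comp (V := C_UniformSpace) (fun q : R * R => Cplus (snd q, tau) (l (c (fst q)))) g).
        * apply continuous_Cplus; [|apply (Cc l (ct_l _ _ _ _ _ Hct) s v Hs)].
          apply continuous_mkC; [apply continuous_snd|apply continuous_const].
        * apply C_differentiable_continuous, Hg, Hc0, Hs.
    - intros s v Hs; eapply Rle_trans; [apply Hb, Hs|].
      specialize (Hi v); assert (c s <= s) by apply Rmin_l; destruct (Hc0 s Hs) as [Hc1 _].
      assert (K / (1 + v ^ 2) <= K) by (unfold Rdiv; nra).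
      assert (0 <= K / (1 + v ^ 2)) by (unfold Rdiv; nra).
      replace (W * K * s) with (W * s * K) by ring.
      apply Rmult_le_compat; [nra|assumption|nra|assumption]. }
  assert (Df : forall s, dominated (V := VE) (W * K) (f s)).
  { intros s v; unfold f, ext0; destruct (Rlt_dec 0 s) as [Hs|Hs].
    - eapply Rle_trans; [apply Hb, Hs|].
      specialize (Hi v); destruct (Hc0 s Hs) as [Hc1 Hc2].
      replace (W * K / (1 + v ^ 2)) with (W * 1 * (K / (1 + v ^ 2))) by (unfold Rdiv; ring).
      apply Rmult_le_compat_r; [unfold Rdiv; nra|]. apply Rmult_le_compat_l; assumption.
    - eapply Rle_trans; [right; apply (norm_zero (V := VE))|].
      specialize (Hi v); unfold Rdiv; apply Rmult_le_pos; [nra|lra]. }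
  set (Lf := ext0 (T := E) (fun s => scal (w (c s)) (F (c s)))).
  assert (HL : forall s, is_line_int (V := VE) (f s) (Lf s)).
  { intros s; unfold Lf, f, ext0; destruct (Rlt_dec 0 s) as [Hs|Hs].
    - apply (is_RInt_gen_linear (V := VE) (W := VE) (fun x : E => scal (w (c s)) x) (Cmod (w (c s)))).
      + intros x y; apply (scal_distr_l (V := E)).
      + intros r x; change (scal (w (c s)) (scal (RtoC r) x) = scal (RtoC r) (scal (w (c s)) x)); Cmodule E.
      + intros x; apply Enorm_scal.
      + typeclasses eauto.
      + typeclasses eauto.
      + apply HF, Hc0, Hs.
    - apply (is_line_int_intro (V := VE) 0).
      + intros v; apply continuous_const.
      + intros n Hn.
        assert (E0 : minus (RInt (V := VE) (fun _ => zero : VE) (- n) n) zero = @zero VE).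
        { assert (E1 : RInt (V := VE) (fun _ => zero : VE) (- n) n = zero).
          { rewrite (RInt_const (V := VE)); apply (scal_zero_r (V := VE)). }
          transitivity (minus zero zero : E); [|Cmodule E].
          apply (f_equal (fun x => minus x zero : E)), E1. }
        eapply Rle_trans; [right; apply (f_equal (norm (V := VE)) E0)|].
        eapply Rle_trans; [right; apply (norm_zero (V := VE))|lra].
      + intros v; eapply Rle_trans; [right; apply (norm_zero (V := VE))|]. unfold Rdiv; lra. }
  destruct (line_int_fubini (V := VE) f Lf (W * K) 0 1 Rle_0_1 Cf Df HL) as (_ & FC & FI).
  assert (Eavg : forall t, RInt (V := VE) (fun s => f s t) 0 1 = scal (k t) (avg g (t, tau))).
  { intros t; apply (is_RInt_unique (V := VE)).
    destruct (HgB t) as [B HB].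
    assert (HA := avg_correct g (t, tau) B (fun s Hs => conj (Hg s t Hs) (HB s Hs))).
    apply (is_RInt_Cscal E _ (k t)) in HA.
    eapply (is_RInt_ext (V := VE)); [|exact HA].
    intros s Hs; rewrite Rmin_left, Rmax_right in Hs by lra.
    unfold f, ext0; destruct (Rlt_dec 0 s); [|lra].
    replace (c s) with s by (unfold c; rewrite Rmin_left; lra).
    change (scal (k t) (scal (w s) (g (Cplus (t, tau) (l s)))) = scal (w s) (scal (k t) (g (Cplus (t, tau) (l s))))).
    Cmodule E. }
  split.
  - apply (is_line_int_ext (V := VE) _ _ _ Eavg).
    replace (RInt (V := VE) (ext0 (T := E) (fun s => scal (w s) (F s))) 0 1) with (RInt (V := VE) Lf 0 1); [exact FI|].
    apply (RInt_ext (V := VE)); intros s Hs; rewrite Rmin_left, Rmax_right in Hs by lra.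
    unfold Lf, ext0; destruct (Rlt_dec 0 s); [|lra].
    replace (c s) with s by (unfold c; rewrite Rmin_left; lra). reflexivity.
  - intros v; apply (continuous_ext (U := VE) (fun t => RInt (V := VE) (fun s => f s t) 0 1)); [exact Eavg|apply FC].
Qed.
End Average.

(** * Laplace transforms in the logarithmic coordinate *)

Lemma exp_abs_dominated_scaled (a : R) : 0 < a ->
  exists C0, 0 < C0 /\ forall v, exp (- a * Rabs v) <= C0 / (1 + v ^ 2).
Proof.
  intros Ha; exists (16 * (1 + / (2 * a) ^ 2)).
  assert (H2a : 0 < / (2 * a) ^ 2) by (apply Rinv_0_lt_compat; nra).
  split; [lra|]; intros v.
  pose proof (exp_abs_dominated (2 * a * v)) as H.
  rewrite Rabs_mult, (Rabs_pos_eq (2 * a)) in H by lra.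
  replace (- (2 * a * Rabs v) / 2) with (- a * Rabs v) in H by field.
  eapply Rle_trans; [exact H|].
  apply Rmult_le_reg_r with ((1 + (2 * a * v) ^ 2) * (1 + v ^ 2)); [apply Rmult_lt_0_compat; nra|].
  replace (16 / (1 + (2 * a * v) ^ 2) * ((1 + (2 * a * v) ^ 2) * (1 + v ^ 2))) with (16 * (1 + v ^ 2)) by (field; nra).
  replace (16 * (1 + / (2 * a) ^ 2) / (1 + v ^ 2) * ((1 + (2 * a * v) ^ 2) * (1 + v ^ 2))) with
    (16 * (1 + v ^ 2 + (/ (2 * a) ^ 2 + (2 * a * v) ^ 2))) by (field; nra).
  assert (0 <= (2 * a * v) ^ 2) by nra. lra.
Qed.

(** The integral representation along every direction [tau] of a closed subsector,
    and a bound, with a radius that depends neither on [tau] nor on [arg z]. This is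
    the form in which averages along a contour, which move [z] and [tau]
    simultaneously, can be taken. *)
Definition uniform_laplace {E : CompleteNormedModule C_AbsRing} (M : nat -> R) (e : logsurf -> C)
    (d th : R) (h f : C -> E) : Prop :=
  forall th' dl, 0 < th' < th -> 0 < dl < omega M * PI / 2 ->
  exists r B, 0 < r /\ forall z tau, modulus z < r -> Rabs (tau - d) <= th' / 2 -> Rabs (arg z - tau) <= dl ->
    norm (f z) <= B /\
    is_line_int (V := restrict_scalars E) (fun v => scal (e (Cminus (v, tau) z)) (h (v, tau))) (f z).

Section Laplace.
Context {E : CompleteNormedModule C_AbsRing}.
Let VE := restrict_scalars E.
Context (M : nat -> R) (e : logsurf -> C) (Ek : C -> C) (m : nat -> R)
  (HM : weight M) (HK : strong_kernel M e Ek m).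
Let eta := omega M * PI / 2.

(** Near the vertex of the sector the decay of the kernel beats the growth allowed
    for [h], uniformly in the direction of integration. *)
Lemma laplace_domination (dl c k : R) : 0 < dl < eta -> 0 < c -> 0 < k ->
  exists r K, 0 < r /\ 0 < K /\ forall (z : C) (v tau : R) (x : E),
    modulus z < r -> Rabs (arg z - tau) <= dl -> norm x <= c * exp (Mfun M (exp v / k)) ->
    Cmod (e (Cminus (v, tau) z)) * norm x <= K / (1 + (v - Re z) ^ 2).
Proof.
  intros Hdl Hc Hk.
  destruct (exp_Mfun_absorb M HM) as (A & HA & Habs).
  destruct (sk_e_inf _ _ _ _ HK (eta - dl) ltac:(lra)) as (c1 & k1 & Hc1 & Hk1 & Hinf).
  destruct (sk_e_zero _ _ _ _ HK) as (al & Hal & Hz0).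
  destruct (Hz0 (- ((dl + eta) / 2)) ((dl + eta) / 2) 2) as (c0 & Hc0 & Hzero); try (unfold eta in *; lra).
  set (a := Rmin al 1).
  assert (Ha : 0 < a) by (apply Rmin_glb_lt; lra).
  assert (Ha1 : a <= al) by apply Rmin_l. assert (Ha2 : a <= 1) by apply Rmin_r.
  destruct (exp_abs_dominated_scaled a Ha) as (C0 & HC0 & Hdom).
  set (q := k1 * A). assert (Hq : 0 < q) by (unfold q; nra).
  pose proof (w_pos M HM 1%nat) as HM1.
  set (K1 := c0 * (c * exp (Mfun M (1 / q)))). set (K2 := c1 * c * (M 1%nat * q)).
  assert (HK1 : 0 < K1) by (unfold K1; pose proof (exp_pos (Mfun M (1 / q))); apply Rmult_lt_0_compat; nra).
  assert (HK2 : 0 < K2) by (unfold K2; apply Rmult_lt_0_compat; nra).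
  exists (k / q), ((K1 + K2) * C0).
  split; [apply Rdiv_lt_0_compat; lra|]. split; [nra|].
  intros z v tau x Hz Harg Hx.
  set (u := v - Re z).
  set (y := Cminus (v, tau) z).
  assert (Ey1 : Re y = u) by (unfold y, u, Re, Cminus, Cplus, Copp; simpl; ring).
  assert (Ey2 : arg y = tau - arg z) by (unfold y, arg, Im, Cminus, Cplus, Copp; simpl; ring).
  assert (Ey3 : modulus y = exp u) by (unfold modulus; rewrite Ey1; reflexivity).
  assert (Hxb : norm x <= c * exp (Mfun M (exp u / q))).
  { eapply Rle_trans; [exact Hx|]; apply Rmult_le_compat_l; [lra|]; apply exp_le_mono, Mfun_mono; [exact HM|].
    replace v with (u + Re z) by (unfold u; ring).
    rewrite exp_plus; fold (modulus z).
    unfold Rdiv; rewrite Rmult_assoc; apply Rmult_le_compat_l; [left; apply exp_pos|].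
    apply Rmult_le_reg_r with k; [exact Hk|]. rewrite Rmult_assoc, Rinv_l by lra.
    replace (/ q * k) with (k / q) by (unfold Rdiv; ring). lra. }
  assert (Goal : Cmod (e y) * norm x <= (K1 + K2) * exp (- a * Rabs u)).
  { pose proof (Cmod_ge_0 (e y)) as He0; pose proof (Enorm_ge_0 E x) as Hx0.
    pose proof (exp_pos (- a * Rabs u)) as Hea.
    assert (Hr : Rabs (tau - arg z) <= dl) by (rewrite Rabs_minus_sym; exact Harg).
    destruct (Rle_dec u 0) as [Hu|Hu].
    - assert (Hr3 : - dl <= tau - arg z <= dl) by (unfold Rabs in Hr; destruct (Rcase_abs (tau - arg z)); lra).
      assert (He1 : exp u <= 1) by (rewrite <- exp_0; apply exp_le_mono, Hu).
      specialize (Hzero y ltac:(rewrite Ey2; lra) ltac:(rewrite Ey3; lra)).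
      rewrite Ey3 in Hzero; unfold Rpower in Hzero; rewrite ln_exp in Hzero.
      assert (exp (al * u) <= exp (- a * Rabs u)) by (apply exp_le_mono; rewrite Rabs_left1 by lra; nra).
      assert (Hxc : norm x <= c * exp (Mfun M (1 / q))).
      { eapply Rle_trans; [exact Hxb|]; apply Rmult_le_compat_l; [lra|]; apply exp_le_mono, Mfun_mono; [exact HM|].
        apply Rmult_le_compat_r; [left; apply Rinv_0_lt_compat, Hq|exact He1]. }
      apply Rle_trans with (c0 * exp (- a * Rabs u) * (c * exp (Mfun M (1 / q)))).
      + apply Rmult_le_compat; auto. nra.
      + replace (c0 * exp (- a * Rabs u) * (c * exp (Mfun M (1 / q)))) with (K1 * exp (- a * Rabs u)) by (unfold K1; ring).
        nra.
    - assert (Hsec : sector 0 (omega M * PI - (eta - dl)) y).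
      { unfold sector; rewrite Rminus_0_r, Ey2; unfold eta in *; lra. }
      specialize (Hinf y Hsec); rewrite Ey3 in Hinf.
      set (t := exp u / q) in *.
      assert (Ht : 0 < t) by (apply Rdiv_lt_0_compat; [apply exp_pos|lra]).
      specialize (Habs 1%nat t Ht); rewrite pow_1 in Habs.
      replace (A * t) with (exp u / k1) in Habs by (unfold t, q; field; lra).
      rewrite exp_Ropp in Hinf.
      set (P := exp (Mfun M (exp u / k1))) in *. set (R1 := exp (Mfun M t)) in *.
      assert (HP : 0 < P) by apply exp_pos. assert (HR1 : 0 < R1) by apply exp_pos.
      apply Rle_trans with (c1 * / P * (c * R1)); [apply Rmult_le_compat; auto|].
      assert (HPt : R1 * / P <= M 1%nat * q * exp (- u)).
      { apply Rmult_le_reg_r with (t * P); [nra|].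
        replace (R1 * / P * (t * P)) with (t * R1) by (field; lra).
        replace (M 1%nat * q * exp (- u) * (t * P)) with (M 1%nat * P); [exact Habs|].
        unfold t; rewrite exp_Ropp; field; split; [lra|]. pose proof (exp_pos u); lra. }
      assert (Hexp : exp (- u) <= exp (- a * Rabs u)) by (apply exp_le_mono; rewrite Rabs_pos_eq by lra; nra).
      apply Rle_trans with (K2 * exp (- a * Rabs u)); [|nra].
      unfold K2; replace (c1 * / P * (c * R1)) with (c1 * c * (R1 * / P)) by ring.
      apply Rle_trans with (c1 * c * (M 1%nat * q * exp (- a * Rabs u))); [|right; ring].
      apply Rmult_le_compat_l; [nra|].
      eapply Rle_trans; [exact HPt|]. apply Rmult_le_compat_l; [nra|exact Hexp]. }
  eapply Rle_trans; [exact Goal|].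
  unfold Rdiv; rewrite Rmult_assoc; apply Rmult_le_compat_l; [lra|]. apply Hdom.
Qed.

Lemma kernel_diff (y : C) : Rabs (Im y) < eta -> Cd e y.
Proof.
  intros Hy; destruct (sk_e_hol _ _ _ _ HK y) as [l Hl]; [|exists l; exact Hl].
  unfold sector, arg; rewrite Rminus_0_r; unfold eta in *; lra.
Qed.

(** By domination the integrals exist, and by rotation of the lines they do not
    depend on the direction. *)
Lemma laplace_exists (d th dl : R) (h : C -> E) : 0 < dl < eta -> 0 < th -> OM M d th h ->
  forall th', 0 < th' < th ->
  exists r B, 0 < r /\ forall z, modulus z < r ->
    (exists tau, Rabs (tau - d) < th' / 2 /\ Rabs (arg z - tau) <= dl) ->
    exists Y : E, norm Y <= B /\
    forall tau, Rabs (tau - d) < th' / 2 -> Rabs (arg z - tau) <= dl ->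
      is_line_int (V := VE) (fun v => scal (e (Cminus (v, tau) z)) (h (v, tau))) Y /\
      is_laplace e tau h z Y.
Proof.
  intros Hdl Hth [Hhol Hgr] th' Hth'.
  destruct (Hgr th' Hth') as (c & k & Hc & Hk & Hh).
  destruct (laplace_domination dl c k Hdl Hc Hk) as (r & K & Hr & HKp & Hdom).
  exists r, (K * PI); split; [exact Hr|]; intros z Hz (tau0 & Ht0 & Ht0').
  set (g := fun tau v => scal (e (Cminus (v, tau) z)) (h (v, tau))).
  set (G := fun y : C => scal (e (Cminus y (0, Im z))) (h (Cplus y (Re z, 0)))).
  assert (EG : forall tau v, G (v, tau) = g tau (v + Re z)).
  { intros tau v; unfold G, g.
    assert (E1 : Cminus (v, tau) (0, Im z) = Cminus (v + Re z, tau) z).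
    { destruct z as [z1 z2]; unfold Cminus, Cplus, Copp, Re, Im; simpl; apply f_equal2; ring. }
    assert (E2 : Cplus (v, tau) (Re z, 0) = (v + Re z, tau)).
    { unfold Cplus; simpl; apply f_equal2; ring. }
    rewrite E1, E2; reflexivity. }
  assert (HG : forall v tau, Rabs (tau - d) < th' / 2 -> Rabs (arg z - tau) <= dl ->
    C_differentiable E G (v, tau) /\ norm (G (v, tau)) <= K / (1 + v ^ 2)).
  { intros v tau H1 H2; split.
    - destruct (kernel_diff (Cminus (v, tau) (0, Im z))) as [l1 Hl1].
      { unfold arg in H2; unfold Im, Cminus, Cplus, Copp in *; simpl.
        replace (tau + - snd z) with (- (snd z - tau)) by ring. rewrite Rabs_Ropp; lra. }
      destruct (Hhol (Cplus (v, tau) (Re z, 0))) as [l2 Hl2].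
      { unfold sector, arg, Im, Cplus; simpl. rewrite Rplus_0_r; lra. }
      eexists; apply (is_derive_Cscal (fun y => e (Cminus y (0, Im z))) (fun y => h (Cplus y (Re z, 0)))).
      + apply (is_derive_shift (E := C_CompleteNormedModule) e (Copp (0, Im z))); exact Hl1.
      + apply (is_derive_shift h); exact Hl2.
    - rewrite EG; unfold g; eapply Rle_trans; [apply Enorm_scal|].
      replace (v ^ 2) with ((v + Re z - Re z) ^ 2) by ring.
      apply (Hdom z (v + Re z) tau); [exact Hz|exact H2|apply (Hh (v + Re z, tau)), H1]. }
  assert (Cg : forall tau, Rabs (tau - d) < th' / 2 -> Rabs (arg z - tau) <= dl ->
     forall v, continuous (U := VE) (fun v => G (v, tau)) v).
  { intros tau H1 H2 v; apply continuous_horizontal, C_differentiable_continuous, HG; assumption. }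
  destruct (ex_line_int (V := VE) K (fun v => G (v, tau0)) (Cg tau0 Ht0 Ht0')
    (fun v => proj2 (HG v tau0 Ht0 Ht0'))) as [Y HY].
  exists Y; split.
  { apply (line_int_norm (V := VE) K (fun v => G (v, tau0))); auto. intros v; apply HG; assumption. }
  intros tau H1 H2.
  assert (HYt : is_line_int (V := VE) (fun v => G (v, tau)) Y).
  { destruct (ex_line_int (V := VE) K (fun v => G (v, tau)) (Cg tau H1 H2)
      (fun v => proj2 (HG v tau H1 H2))) as [Y' HY'].
    assert (EY : Y = Y'); [|rewrite EY; exact HY'].
    apply Rabs_def2 in Ht0, H1.
    assert (Hb0 : - dl <= arg z - tau0 <= dl) by (unfold Rabs in Ht0'; destruct (Rcase_abs (arg z - tau0)); lra).
    assert (Hb1 : - dl <= arg z - tau <= dl) by (unfold Rabs in H2; destruct (Rcase_abs (arg z - tau)); lra).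
    destruct (Rle_dec tau0 tau).
    - apply (line_rotation G tau0 tau K Y Y'); auto.
      intros x y Hy; apply HG; [apply Rabs_def1; lra|apply Rabs_le; lra].
    - symmetry; apply (line_rotation G tau tau0 K Y' Y); auto; [lra|].
      intros x y Hy; apply HG; [apply Rabs_def1; lra|apply Rabs_le; lra]. }
  assert (HYg : is_line_int (V := VE) (g tau) Y).
  { apply (line_int_translate (V := VE) _ _ (- Re z)) in HYt.
    apply (is_line_int_ext (V := VE) (fun v => G (v + - Re z, tau))); [|exact HYt].
    intros v; rewrite EG; f_equal; ring. }
  split; [exact HYg|].
  apply (line_int_exp (V := VE) (g tau) Y); [|exact HYg].
  intros v; apply (continuous_ext (U := VE) (fun v => G (v + - Re z, tau))).
  - intros u; rewrite EG; f_equal; ring.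
  - apply (continuous_comp (V := R_UniformSpace) (fun v => v + - Re z) (fun v => G (v, tau))).
    + apply (ex_derive_continuous (V := R_NormedModule)); auto_derive; auto.
    + apply Cg; auto.
Qed.

(** For each direction the representation holds for some radius that may depend on
    it; it extends to the neighbouring directions by rotation, and finitely many
    directions suffice. *)
Lemma laplace_sum_uniform (d th : R) (h : C -> E) (G : logsurf -> Prop) (f : logsurf -> E) :
  0 < th -> OM M d th h -> laplace_sum M e d th h G f -> uniform_laplace M e d th h f.
Proof.
  intros Hth HOM (_ & _ & Hlap) th' dl Hth' Hdl.
  fold eta in Hdl.
  set (dl2 := (dl + eta) / 2).
  assert (Hdl2 : 0 < dl2 < eta) by (unfold dl2; lra).
  set (th2 := (th' + th) / 2).
  destruct (laplace_exists d th dl2 h Hdl2 Hth HOM th2 ltac:(unfold th2; lra)) as (r0 & B & Hr0 & HY).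
  assert (Hloc : forall t, exists rho : posreal, Rabs (t - d) <= th' / 2 ->
    rho <= dl2 - dl /\ forall z, Rabs (arg z - t) <= dl2 -> modulus z < rho -> is_laplace e t h z (f z)).
  { intros t; destruct (classic (Rabs (t - d) <= th' / 2)) as [Ht|Ht].
    - destruct (Hlap t dl2 ltac:(lra) Hdl2) as (r & Hr & Hz).
      assert (Hm : 0 < Rmin r (dl2 - dl)) by (apply Rmin_glb_lt; unfold dl2; lra).
      exists (mkposreal _ Hm); intros _; simpl; split; [apply Rmin_r|].
      intros z H1 H2; apply Hz; [exact H1|]. pose proof (Rmin_l r (dl2 - dl)); lra.
    - exists (mkposreal 1 Rlt_0_1); tauto. }
  assert (Hch : exists rho : R -> posreal, forall t, Rabs (t - d) <= th' / 2 ->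
    rho t <= dl2 - dl /\ forall z, Rabs (arg z - t) <= dl2 -> modulus z < rho t -> is_laplace e t h z (f z)).
  { exists (fun t => proj1_sig (constructive_indefinite_description _ (Hloc t))).
    intros t; exact (proj2_sig (constructive_indefinite_description _ (Hloc t))). }
  destruct Hch as [rho Hrho].
  destruct (compactness_value_1d (d - th' / 2) (d + th' / 2) rho) as [r1 Hr1].
  exists (Rmin r0 r1), B; split; [apply Rmin_glb_lt; [exact Hr0|apply cond_pos]|].
  intros z tau Hz Ht Harg.
  pose proof (Rmin_l r0 r1); pose proof (Rmin_r r0 r1).
  assert (Hti : d - th' / 2 <= tau <= d + th' / 2).
  { unfold Rabs in Ht; destruct (Rcase_abs (tau - d)); lra. }
  apply NNPP; intros Hn; apply (Hr1 tau Hti); intros (t & Ht1 & Ht2 & Ht3); apply Hn; clear Hn.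
  assert (Htd : Rabs (t - d) <= th' / 2) by (apply Rabs_le; lra).
  destruct (Hrho t Htd) as [Hrt Hlt].
  assert (Hat : Rabs (arg z - t) <= dl2).
  { replace (arg z - t) with ((arg z - tau) + (tau - t)) by ring.
    eapply Rle_trans; [apply Rabs_triang|]. unfold dl2 in *; lra. }
  specialize (Hlt z Hat ltac:(lra)).
  destruct (HY z ltac:(lra)) as (Y & HYB & HYt).
  { exists t; split; [unfold th2; lra|exact Hat]. }
  destruct (HYt t ltac:(unfold th2; lra) Hat) as [_ HL].
  assert (EY : f z = Y).
  { rewrite <- (is_RInt_gen_unique (V := VE) _ _ Hlt); apply (is_RInt_gen_unique (V := VE) _ _ HL). }
  rewrite EY; split; [exact HYB|].
  exact (proj1 (HYt tau ltac:(unfold th2; lra) ltac:(unfold dl2; lra))).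
Qed.
End Laplace.

(** * Averages and shifts of functions of exponential growth *)

Section Average3.
Context {E : CompleteNormedModule C_AbsRing}.
Let VE := restrict_scalars E.
Context (w l : nat -> R -> C) (W L delta : R) (Hct : forall i, contour (w i) (l i) W L delta)
  (Hdelta : 0 < delta).

(** The contours below consist of three pieces. *)
Definition avg3 (g : C -> E) (y : C) : E :=
  plus (plus (avg (w 0%nat) (l 0%nat) g y) (avg (w 1%nat) (l 1%nat) g y)) (avg (w 2%nat) (l 2%nat) g y).

Lemma avg3_norm (g : C -> E) (y : C) (B : R) :
  (forall i s, 0 < s -> C_differentiable E g (Cplus y (l i s)) /\ norm (g (Cplus y (l i s))) <= B) ->
  norm (avg3 g y) <= 3 * W * B.
Proof.
  intros Hg; unfold avg3.
  assert (H : forall i, norm (avg (w i) (l i) g y) <= W * B).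
  { intros i; apply (avg_norm _ _ _ _ _ (Hct i)); auto. }
  eapply Rle_trans; [apply Enorm_plus|].
  eapply Rle_trans; [apply Rplus_le_compat_r, Enorm_plus|].
  pose proof (H 0%nat); pose proof (H 1%nat); pose proof (H 2%nat). lra.
Qed.

Lemma avg3_differentiable (g : C -> E) (y : C) (r B : R) : 0 < r ->
  (forall i s h, 0 < s -> Cmod h < 4 * r ->
     C_differentiable E g (Cplus (Cplus y h) (l i s)) /\ norm (g (Cplus (Cplus y h) (l i s))) <= B) ->
  C_differentiable E (avg3 g) y.
Proof.
  intros Hr Hg.
  assert (H : forall i, C_differentiable E (avg (w i) (l i) g) y).
  { intros i; apply (avg_differentiable _ _ _ _ _ (Hct i) g y r B Hr); auto. }
  destruct (H 0%nat) as [d0 D0]; destruct (H 1%nat) as [d1 D1]; destruct (H 2%nat) as [d2 D2].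
  exists (plus (plus d0 d1) d2).
  exact (is_derive_plus (K := C_AbsRing) (V := E) _ _ _ _ _ (is_derive_plus (K := C_AbsRing) (V := E) _ _ _ _ _ D0 D1) D2).
Qed.

Lemma avg3_ext (g1 g2 : C -> E) (y : C) :
  (forall i s, 0 < s -> g1 (Cplus y (l i s)) = g2 (Cplus y (l i s))) -> avg3 g1 y = avg3 g2 y.
Proof.
  intros H; unfold avg3; rewrite !(avg_ext _ _ g1 g2); auto.
Qed.

(** The contours stay in a narrow sector, so averaging shrinks the opening a little
    and dilates the argument of the growth function. *)
Lemma OM_average (M : nat -> R) (d th : R) (g : C -> E) : weight M -> 0 < th -> delta <= th / 8 ->
  OM M d th g -> OM M d (th / 2) (avg3 g).
Proof.
  intros HM Hth Hde [Hhol Hgr].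
  destruct (Hgr (7 * th / 8)) as (c & k & Hc & Hk & Hb); [lra|].
  assert (Hin : forall i s y h, 0 < s -> sector d (th / 2) y -> Cmod h <= th / 16 ->
    sector d (7 * th / 8) (Cplus (Cplus y h) (l i s)) /\
    modulus (Cplus (Cplus y h) (l i s)) <= exp (Re y + th / 16 + L)).
  { intros i s y h Hs Hy Hh.
    pose proof (ct_im _ _ _ _ _ (Hct i) s Hs); pose proof (ct_re _ _ _ _ _ (Hct i) s Hs).
    pose proof (re_le_Cmod h); pose proof (im_le_Cmod h); pose proof (Rle_abs (Re h)).
    unfold sector, arg, modulus in *; split.
    - replace (Im (Cplus (Cplus y h) (l i s)) - d) with ((Im y - d) + (Im h + Im (l i s)))
        by (unfold Im, Cplus; simpl; ring).
      eapply Rle_lt_trans; [apply Rabs_triang|].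
      pose proof (Rabs_triang (Im h) (Im (l i s))). lra.
    - apply exp_le_mono; unfold Re, Cplus in *; simpl in *; lra. }
  assert (Hsec : forall y, sector d (7 * th / 8) y -> sector d th y) by (unfold sector; intros; lra).
  split.
  - intros y Hy.
    apply (avg3_differentiable g y (th / 64) (c * exp (Mfun M (exp (Re y + th / 16 + L) / k)))); [lra|].
    intros i s h Hs Hh; destruct (Hin i s y h Hs Hy ltac:(lra)) as [H1 H2]; split.
    + apply Hhol, Hsec, H1.
    + eapply Rle_trans; [apply Hb, H1|]; apply Rmult_le_compat_l; [lra|].
      apply exp_le_mono, Mfun_mono; [exact HM|]; apply Rmult_le_compat_r; [left; apply Rinv_0_lt_compat, Hk|exact H2].
  - intros th' Hth'.
    assert (HW := contour_W _ _ _ _ _ (Hct 0%nat)).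
    exists (3 * W * c + 1), (k * exp (- L)); repeat split; [nra|pose proof (exp_pos (- L)); nra|].
    intros y Hy.
    assert (Hy' : sector d (th / 2) y) by (unfold sector in *; lra).
    apply Rle_trans with (3 * W * (c * exp (Mfun M (modulus y / (k * exp (- L)))))).
    + apply avg3_norm; intros i s Hs.
      destruct (Hin i s y (RtoC 0) Hs Hy' ltac:(rewrite Cmod_0; lra)) as [H1 _].
      replace (Cplus (Cplus y (RtoC 0)) (l i s)) with (Cplus y (l i s)) in H1 by ring.
      split; [apply Hhol, Hsec, H1|].
      eapply Rle_trans; [apply Hb, H1|]; apply Rmult_le_compat_l; [lra|].
      apply exp_le_mono, Mfun_mono; [exact HM|].
      pose proof (ct_re _ _ _ _ _ (Hct i) s Hs).
      replace (modulus y / (k * exp (- L))) with (exp (Re y + L) / k).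
      * apply Rmult_le_compat_r; [left; apply Rinv_0_lt_compat, Hk|].
        apply exp_le_mono; unfold Re, Cplus in *; simpl in *; lra.
      * unfold modulus; rewrite exp_plus, exp_Ropp. pose proof (exp_pos L). field; lra.
    + pose proof (exp_pos (Mfun M (modulus y / (k * exp (- L))))). nra.
Qed.

Lemma avg3_pseries (mu : nat -> nat -> C) (a : nat -> E) (g : C -> E) (B R0 : R) (y : C) :
  (forall p i, is_RInt (V := VC) (ext0 (T := C_AbelianGroup)
       (fun s => Cmult (w i s) (Cexp (Cmult (RtoC (INR p)) (l i s))))) 0 1 (mu p i)) ->
  0 < R0 -> (forall n, norm (a n) * R0 ^ n <= B) ->
  (forall i s, 0 < s -> C_differentiable E g (Cplus y (l i s)) /\
     Cmod (Cexp (Cplus y (l i s))) <= R0 / 2 /\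
     is_pseries (K := C_AbsRing) a (Cexp (Cplus y (l i s))) (g (Cplus y (l i s)))) ->
  is_pseries (K := C_AbsRing) (fun n => scal (Cplus (Cplus (mu n 0%nat) (mu n 1%nat)) (mu n 2%nat)) (a n))
    (Cexp y) (avg3 g y).
Proof.
  intros Hmu HR Ha Hg.
  assert (H : forall i, is_pseries (K := C_AbsRing) (fun n => scal (mu n i) (a n)) (Cexp y) (avg (w i) (l i) g y)).
  { intros i; apply (avg_pseries _ _ _ _ _ (Hct i) (fun n => mu n i) a g B R0 y); auto. }
  pose proof (is_pseries_plus (K := C_AbsRing) (V := E) _ _ _ _ _
    (is_pseries_plus (K := C_AbsRing) (V := E) _ _ _ _ _ (H 0%nat) (H 1%nat)) (H 2%nat)) as HS.
  eapply (is_pseries_ext (K := C_AbsRing) (V := E)); [|exact HS].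
  intros n; unfold PS_plus.
  change (plus (plus (scal (mu n 0%nat) (a n)) (scal (mu n 1%nat) (a n))) (scal (mu n 2%nat) (a n)) =
    scal (Cplus (Cplus (mu n 0%nat) (mu n 1%nat)) (mu n 2%nat)) (a n)). Cmodule E.
Qed.

Lemma avg3_line_int (k : R -> C) (g f : C -> E) (tau K : R) (z : C) :
  (forall v, continuous (U := C_UniformSpace) k v) ->
  (forall i s v, 0 < s -> C_differentiable E g (Cplus (v, tau) (l i s))) ->
  (forall v, exists B, forall i s, 0 < s -> norm (g (Cplus (v, tau) (l i s))) <= B) ->
  (forall i s v, 0 < s -> Cmod (k v) * norm (g (Cplus (v, tau) (l i s))) <= K / (1 + v ^ 2)) ->
  (forall i s, 0 < s -> is_line_int (V := VE) (fun v => scal (k v) (g (Cplus (v, tau) (l i s)))) (f (Cplus z (l i s)))) ->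
  is_line_int (V := VE) (fun v => scal (k v) (avg3 g (v, tau))) (avg3 f z) /\
  (forall v, continuous (U := VE) (fun v => scal (k v) (avg3 g (v, tau))) v).
Proof.
  intros Hk Hg HgB Hdom HF.
  assert (H := fun i => avg_line_int _ _ _ _ _ (Hct i) k g tau K (fun s => f (Cplus z (l i s))) Hk
    (Hg i) (fun v => let (B, HB) := HgB v in ex_intro _ B (HB i)) (Hdom i) (HF i)).
  assert (Ed : forall v, plus (plus (scal (k v) (avg (w 0%nat) (l 0%nat) g (v, tau)))
      (scal (k v) (avg (w 1%nat) (l 1%nat) g (v, tau)))) (scal (k v) (avg (w 2%nat) (l 2%nat) g (v, tau))) =
      scal (k v) (avg3 g (v, tau))) by (intros v; unfold avg3; Cmodule E).
  split.
  - apply (is_line_int_ext (V := VE) _ _ _ Ed).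
    apply (is_RInt_gen_plus (V := VE)); [apply (is_RInt_gen_plus (V := VE))|]; apply H.
  - intros v; apply (continuous_ext (U := VE) _ _ _ Ed).
    apply (continuous_plus (V := VE)); [apply (continuous_plus (V := VE))|]; apply H.
Qed.
End Average3.

Section Shift.
Context {E : CompleteNormedModule C_AbsRing}.
Let VE := restrict_scalars E.

(** In the variable [x = exp z] this is [(h(x) - x0) / x]. *)
Definition shift_fun (x0 : E) (h : C -> E) : C -> E :=
  fun z => scal (Cexp (Copp z)) (minus (h z) x0).

Lemma shift_fun_diff (x0 : E) (h : C -> E) (z : C) :
  C_differentiable E h z -> C_differentiable E (shift_fun x0 h) z.
Proof.
  intros [l Hl]; eexists; apply (is_derive_Cscal (fun z => Cexp (Copp z)) (fun z => minus (h z) x0)).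
  - apply Cexp_opp_derive.
  - apply (is_derive_minus (K := C_AbsRing) (V := E) h (fun _ => x0)); [exact Hl|].
    apply (is_derive_const (K := C_AbsRing) (V := E)).
Qed.

Lemma OM_restrict (M : nat -> R) (d th th' : R) (h : C -> E) : 0 < th' <= th ->
  OM M d th h -> OM M d th' h.
Proof.
  intros Hth [H1 H2]; split.
  - intros z Hz; apply H1; unfold sector in *; lra.
  - intros t Ht; apply H2; lra.
Qed.

Lemma OM_shift (M : nat -> R) (d th : R) (h : C -> E) (x0 : E) (rho B : R) : weight M -> 0 < rho ->
  OM M d th h ->
  (forall z, sector d th z -> modulus z < rho -> norm (shift_fun x0 h z) <= B) ->
  OM M d th (shift_fun x0 h).
Proof.
  intros HM Hrho [H1 H2] Hb; split.
  - intros z Hz; apply shift_fun_diff, H1, Hz.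
  - intros th' Hth'; destruct (H2 th' Hth') as (c & k & Hc & Hk & Hg).
    pose proof (Enorm_ge_0 E x0) as Hx0.
    assert (Hir : 0 < / rho) by (apply Rinv_0_lt_compat, Hrho).
    exists (Rabs B + / rho * (c + norm x0)), k.
    assert (0 < / rho * (c + norm x0)) by (apply Rmult_lt_0_compat; lra).
    repeat split; [pose proof (Rabs_pos B); lra|exact Hk|].
    intros z Hz.
    assert (He : 1 <= exp (Mfun M (modulus z / k))) by (rewrite <- exp_0; apply exp_le_mono, Mfun_nonneg, HM).
    destruct (Rlt_dec (modulus z) rho) as [Hm|Hm].
    + eapply Rle_trans; [apply Hb; [unfold sector in *; lra|exact Hm]|].
      pose proof (Rle_abs B); pose proof (Rabs_pos B). nra.
    + unfold shift_fun; eapply Rle_trans; [apply Enorm_scal|].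
      rewrite Cmod_Cexp; unfold Copp, Re; cbn [fst].
      change (fst z) with (Re z); rewrite exp_Ropp; change (exp (Re z)) with (modulus z).
      apply Rle_trans with (/ rho * ((c + norm x0) * exp (Mfun M (modulus z / k)))).
      * apply Rmult_le_compat; [left; apply Rinv_0_lt_compat, modulus_pos|apply Enorm_ge_0| |].
        -- apply Rinv_le_contravar; lra.
        -- eapply Rle_trans; [apply Enorm_minus|]. specialize (Hg z Hz). nra.
      * pose proof (Rabs_pos B). nra.
Qed.

Context (M : nat -> R) (e : logsurf -> C) (Ek : C -> C) (m : nat -> R)
  (HM : weight M) (HK : strong_kernel M e Ek m).
Let eta := omega M * PI / 2.
Context (Heta : 0 < eta).

(** The moment of order 0, up to the logarithmic coordinate; it is constant by rotation. *)
Lemma kernel_mass : exists kappa : C, forall tau, Rabs tau < eta ->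
  is_line_int (V := VC) (fun v => e (v, tau)) kappa.
Proof.
  assert (Hs : forall t0, 0 < t0 < eta -> exists I : C, forall y, Rabs y <= t0 ->
    is_line_int (V := VC) (fun v => e (v, y)) I).
  { intros t0 Ht0.
    destruct (laplace_domination (E := C_CompleteNormedModule) M e Ek m HM HK t0 1 1 Ht0 Rlt_0_1 Rlt_0_1) as (r & K & Hr & HKp & Hd).
    apply (strip_line_int (E := C_CompleteNormedModule) e t0 K); [lra|].
    intros x y Hy; split.
    - apply (kernel_diff M e Ek m HK); unfold Im; simpl; fold eta; lra.
    - set (q := ln (r / 2)).
      assert (Hq : exp q < r) by (unfold q; rewrite exp_ln; lra).
      specialize (Hd (q, 0) (x + q) y (RtoC 1)).
      unfold modulus, arg, Re, Im in Hd; simpl in Hd.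
      specialize (Hd Hq ltac:(rewrite Rminus_0_l, Rabs_Ropp; exact Hy)).
      assert (E1 : Cminus (x + q, y) (q, 0) = (x, y)).
      { unfold Cminus, Cplus, Copp; simpl; apply f_equal2; ring. }
      rewrite E1 in Hd.
      change (Cmod (e (x, y)) <= K / (1 + x ^ 2)).
      replace (x ^ 2) with ((x + q - q) ^ 2) by ring.
      assert (H1 : norm (RtoC 1 : C_CompleteNormedModule) = 1) by apply Cmod_1.
      eapply Rle_trans; [|apply Hd].
      + rewrite H1; lra.
      + rewrite H1, Rmult_1_l, <- exp_0; apply exp_le_mono, Mfun_nonneg, HM. }
  destruct (Hs (eta / 2) ltac:(lra)) as [I HI]; exists I; intros tau Ht.
  destruct (Hs ((Rabs tau + eta) / 2)) as [I' HI'].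
  { pose proof (Rabs_pos tau); lra. }
  assert (EI : I = I').
  { apply (is_line_int_unique (V := VC) (fun v => e (v, 0))); [apply HI|apply HI'];
    rewrite Rabs_R0; pose proof (Rabs_pos tau); lra. }
  rewrite EI; apply HI'; lra.
Qed.

(** With [x = xi / z], the kernel [x e(x)] applied to [(h(xi) - h0) / xi] gives
    [(f(z) - x0) / z], where the constant [x0] is the transform of the constant
    [h0]. *)
Lemma laplace_shift (d th : R) (h : C -> E) (G : logsurf -> Prop) (f : logsurf -> E) (h0 : E) :
  0 < th -> OM M d th h -> laplace_sum M e d th h G f -> OM M d th (shift_fun h0 h) ->
  exists x0 : E, uniform_laplace M (shift_kernel e) d th (shift_fun h0 h) (shift_fun x0 f).
Proof.
  intros Hth HOM Hlap HOM1.
  destruct kernel_mass as [kappa Hkappa].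
  exists (scal kappa h0); intros th' dl Hth' Hdl; fold eta in Hdl.
  destruct (laplace_sum_uniform M e Ek m HM HK d th h G f Hth HOM Hlap th' dl Hth' Hdl) as (r1 & B1 & Hr1 & H1).
  set (th2 := (th' + th) / 2).
  destruct (laplace_exists M (shift_kernel e) _ _ HM (strong_kernel_shift M e Ek m HM HK) d th dl (shift_fun h0 h)
    Hdl Hth HOM1 th2 ltac:(unfold th2; lra)) as (r2 & B & Hr2 & H2).
  exists (Rmin r1 r2), B; split; [apply Rmin_glb_lt; assumption|].
  intros z tau Hz Ht Ha.
  pose proof (Rmin_l r1 r2); pose proof (Rmin_r r1 r2).
  destruct (H1 z tau ltac:(lra) Ht Ha) as [_ L1].
  assert (L2 : is_line_int (V := VE) (fun v => scal (e (Cminus (v, tau) z)) h0) (scal kappa h0)).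
  { assert (Hk := Hkappa (tau - arg z) ltac:(rewrite Rabs_minus_sym; lra)).
    apply (line_int_translate (V := VC) _ _ (- Re z)) in Hk.
    apply (is_RInt_gen_linear (V := VC) (W := VE) (fun c : C => scal c h0 : E) (norm h0)) in Hk.
    - apply (is_line_int_ext (V := VE) _ (fun v => scal (e (Cminus (v, tau) z)) h0)) in Hk; [exact Hk|].
      intros v; apply (f_equal (fun c => scal (e c) h0)).
      destruct z as [z1 z2]; unfold arg, Re, Im, Cminus, Cplus, Copp; simpl; reflexivity.
    - intros x y; apply (scal_distr_r (V := E)).
    - intros rr x; change (scal (Cmult (RtoC rr) x) h0 = scal (RtoC rr) (scal x h0)); Cmodule E.
    - intros x; rewrite Rmult_comm; apply Enorm_scal.
    - typeclasses eauto.
    - typeclasses eauto. }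
  assert (L3 : is_line_int (V := VE) (fun v => scal (shift_kernel e (Cminus (v, tau) z)) (shift_fun h0 h (v, tau)))
      (shift_fun (scal kappa h0) f z)).
  { pose proof (is_RInt_gen_minus (V := VE) _ _ _ _ L1 L2) as L.
    apply (is_RInt_gen_linear (V := VE) (W := VE) (fun x : E => scal (Cexp (Copp z)) x) (Cmod (Cexp (Copp z)))) in L.
    - apply (is_line_int_ext (V := VE) _ (fun v => scal (shift_kernel e (Cminus (v, tau) z)) (shift_fun h0 h (v, tau)))) in L;
        [exact L|].
      intros v; unfold shift_kernel, shift_fun.
      assert (Ee : Cexp (Copp z) = Cmult (Cexp (Cminus (v, tau) z)) (Cexp (Copp (v, tau)))).
      { rewrite <- Cexp_plus; apply f_equal; ring. }
      rewrite Ee; generalize (Cexp (Cminus (v, tau) z)) (Cexp (Copp (v, tau))) (e (Cminus (v, tau) z)) (h (v, tau)).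
      intros c1 c2 c3 x.
      change (scal (Cmult c1 c2) (minus (scal c3 x) (scal c3 h0)) = scal (Cmult c1 c3) (scal c2 (minus x h0))).
      Cmodule E.
    - intros x y; apply (scal_distr_l (V := E)).
    - intros rr x; change (scal (Cexp (Copp z)) (scal (RtoC rr) x) = scal (RtoC rr) (scal (Cexp (Copp z)) x)).
      generalize (Cexp (Copp z)); intros; Cmodule E.
    - intros x; apply Enorm_scal.
    - typeclasses eauto.
    - typeclasses eauto. }
  split; [|exact L3].
  assert (Ht2 : Rabs (tau - d) < th2 / 2) by (unfold th2; lra).
  destruct (H2 z ltac:(lra)) as (Y & HYB & HY); [exists tau; auto|].
  destruct (HY tau Ht2 Ha) as [LY _].
  rewrite (is_line_int_unique (V := VE) _ _ _ L3 LY); exact HYB.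
Qed.
End Shift.

(** * Transfer of the summability data to averages *)

Lemma segment_continuous (z0 z1 : C) (t : R) :
  continuous (U := C_UniformSpace) (fun t : R => Cplus z0 (Cmult (RtoC t) (Cminus z1 z0))) t.
Proof.
  apply (continuous_ext (U := C_UniformSpace)
    (fun t : R => (fst z0 + t * (fst z1 - fst z0), snd z0 + t * (snd z1 - snd z0)))).
  - intros u; unfold Cplus, Cmult, Cminus, Copp, RtoC; simpl; apply f_equal2; ring.
  - apply continuous_mkC; apply (ex_derive_continuous (V := R_NormedModule)); auto_derive; auto.
Qed.

(** A separation of the set would separate a segment. *)
Lemma convex_connected (G : C -> Prop) :
  (forall z0 z1 t, 0 <= t <= 1 -> G z0 -> G z1 -> G (Cplus z0 (Cmult (RtoC t) (Cminus z1 z0)))) ->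
  connected_set G.
Proof.
  intros Hconv U V HU HV Hcov (z0 & Hz0 & HU0) (z1 & Hz1 & HV1).
  set (p := fun t : R => Cplus z0 (Cmult (RtoC t) (Cminus z1 z0))).
  assert (Hp : forall t, 0 <= t <= 1 -> G (p t)) by (intros t Ht; apply Hconv; assumption).
  assert (p0 : p 0 = z0) by (unfold p; ring). assert (p1 : p 1 = z1) by (unfold p; ring).
  apply NNPP; intros Hno.
  assert (Hdis : forall t, 0 <= t <= 1 -> U (p t) -> V (p t) -> False).
  { intros t Ht H1 H2; apply Hno; exists (p t); auto. }
  assert (Hopen : forall (W : C -> Prop) t, open W -> W (p t) -> exists d, 0 < d /\ forall s, Rabs (s - t) < d -> W (p s)).
  { intros W t HW Ht; destruct (segment_continuous z0 z1 t W (HW _ Ht)) as [d Hd].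
    exists d; split; [apply cond_pos|]; intros s Hs; apply Hd, Hs. }
  set (S := fun t => 0 <= t <= 1 /\ forall s, 0 <= s <= t -> U (p s)).
  assert (HS0 : S 0).
  { split; [lra|]; intros s Hs; replace s with 0 by lra; rewrite p0; exact HU0. }
  destruct (completeness S) as [T [HT1 HT2]].
  - exists 1; intros t Ht; apply Ht.
  - exists 0; exact HS0.
  - assert (HT0 : 0 <= T) by (apply HT1, HS0).
    assert (HTle : T <= 1) by (apply HT2; intros t Ht; apply Ht).
    assert (Hbelow : forall s, 0 <= s < T -> U (p s)).
    { intros s Hs; apply NNPP; intros Hn.
      assert (T <= s); [|lra]. apply HT2; intros t [Ht1 Ht2].
      destruct (Rle_dec t s); [assumption|]. exfalso; apply Hn, Ht2; lra. }
    destruct (Hcov (p T) (Hp T ltac:(lra))) as [HUT|HVT].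
    + destruct (Hopen U T HU HUT) as (d & Hd & Hds).
      assert (HT1' : T < 1).
      { destruct (Rle_lt_or_eq_dec T 1 HTle) as [H|H]; [exact H|].
        exfalso; apply (Hdis T); [lra|exact HUT|]. rewrite H, p1; exact HV1. }
      set (t := Rmin 1 (T + d / 2)).
      assert (Ht : T < t) by (apply Rmin_glb_lt; lra).
      assert (Ht1 : t <= 1) by apply Rmin_l. assert (Ht2 : t <= T + d / 2) by apply Rmin_r.
      assert (t <= T); [|lra]. apply HT1; split; [lra|]; intros s Hs.
      destruct (Rlt_dec s T); [apply Hbelow; lra|]. apply Hds; rewrite Rabs_pos_eq; lra.
    + destruct (Rle_lt_or_eq_dec 0 T HT0) as [H|H].
      * destruct (Hopen V T HV HVT) as (d & Hd & Hds).
        set (s := Rmax 0 (T - d / 2)).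
        assert (Hs : s < T) by (apply Rmax_lub_lt; lra).
        assert (Hs0 : 0 <= s) by apply Rmax_l. assert (Hs1 : T - d / 2 <= s) by apply Rmax_r.
        apply (Hdis s); [lra|apply Hbelow; lra|]. apply Hds; rewrite Rabs_left1; lra.
      * apply (Hdis T); [lra| |exact HVT]. rewrite <- H, p0; exact HU0.
Qed.

(** In the logarithmic coordinate, the sector of radius [r] and half opening [A]. *)
Definition half_strip (d A r : R) (z : C) : Prop := Rabs (arg z - d) < A /\ modulus z < r.

Lemma modulus_lt_ln (z : C) (r : R) : 0 < r -> modulus z < r <-> Re z < ln r.
Proof.
  intros Hr; unfold modulus; split; intros H.
  - apply exp_lt_inv; rewrite exp_ln; assumption.
  - rewrite <- (exp_ln r Hr); apply exp_increasing, H.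
Qed.

Lemma sectorial_half_strip (d A r : R) : 0 < r -> sectorial_region d (2 * A) (half_strip d A r).
Proof.
  intros Hr.
  assert (Heq : forall z, half_strip d A r z <-> Im z < d + A /\ d - A < Im z /\ Re z < ln r).
  { intros z; unfold half_strip, arg; rewrite (modulus_lt_ln z r Hr); split.
    - intros [H1 H2]; apply Rabs_def2 in H1; lra.
    - intros (H1 & H2 & H3); split; [apply Rabs_def1; lra|exact H3]. }
  constructor.
  - apply (open_ext (T := C_UniformSpace) (fun z => Im z < d + A /\ d - A < Im z /\ Re z < ln r)).
    { intros z; symmetry; apply Heq. }
    assert (CI : forall z : C, continuous (T := C_UniformSpace) (U := R_UniformSpace) (fun z : C => Im z) z).
    { intros [x y]; apply (continuous_snd (U := R_UniformSpace) (V := R_UniformSpace)). }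
    assert (CR : forall z : C, continuous (T := C_UniformSpace) (U := R_UniformSpace) (fun z : C => Re z) z).
    { intros [x y]; apply (continuous_fst (U := R_UniformSpace) (V := R_UniformSpace)). }
    apply (open_and (T := C_UniformSpace)); [|apply (open_and (T := C_UniformSpace))].
    + apply (open_comp (T := C_UniformSpace) (U := R_UniformSpace) (fun z : C => Im z) (fun y => y < d + A)); [intros z _; apply CI|apply open_lt].
    + apply (open_comp (T := C_UniformSpace) (U := R_UniformSpace) (fun z : C => Im z) (fun y => d - A < y)); [intros z _; apply CI|apply open_gt].
    + apply (open_comp (T := C_UniformSpace) (U := R_UniformSpace) (fun z : C => Re z) (fun y => y < ln r)); [intros z _; apply CR|apply open_lt].
  - apply convex_connected; intros z0 z1 t Ht H0 H1.
    rewrite Heq in *. destruct z0 as [x0 y0], z1 as [x1 y1].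
    unfold Re, Im, Cplus, Cmult, Cminus, Copp, RtoC in *; simpl in *.
    assert (Hcv : forall p q c, p < c -> q < c -> p + t * (q - p) < c).
    { intros p q c Hp Hq; assert (0 <= t * (c - q)) by nra; assert (0 <= (1 - t) * (c - p)) by nra.
      destruct (Rle_dec t (1/2)); nra. }
    pose proof (Hcv y0 y1 (d + A)); pose proof (Hcv (- y0) (- y1) (A - d)); pose proof (Hcv x0 x1 (ln r)).
    repeat split; lra.
  - intros z [H _]; unfold sector; lra.
  - intros th' Hth'; exists r; split; [exact Hr|]; intros z H1 H2.
    split; [unfold sector in H1; lra|exact H2].
Qed.

Section Transfer.
Context {E : CompleteNormedModule C_AbsRing}.
Let VE := restrict_scalars E.

(** By the choice of the direction the bound reaches beyond the sector of opening
    [omega M * PI]. *)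
Lemma uniform_laplace_bounded (M : nat -> R) (e : logsurf -> C) (d th s : R) (h f : C -> E) :
  uniform_laplace M e d th h f -> 0 < s < th / 2 -> s < omega M * PI / 2 ->
  exists r B, 0 < r /\ forall z, Rabs (arg z - d) <= omega M * PI / 2 + s / 2 -> modulus z < r ->
    norm (f z) <= B.
Proof.
  intros Hf Hs Hs2.
  destruct (Hf (2 * s) (omega M * PI / 2 - s / 2) ltac:(lra) ltac:(lra)) as (r & B & Hr & Hz).
  exists r, B; split; [exact Hr|]; intros z Ha Hm.
  assert (Ha' : - (omega M * PI / 2 + s / 2) <= arg z - d <= omega M * PI / 2 + s / 2).
  { unfold Rabs in Ha; destruct (Rcase_abs (arg z - d)); lra. }
  set (tau := d + Rmax (- s) (Rmin s (arg z - d))).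
  refine (proj1 (Hz z tau Hm _ _)); apply Rabs_le; unfold tau, Rmax, Rmin;
    destruct (Rle_dec s (arg z - d)); destruct (Rle_dec (- s) _); lra.
Qed.

Lemma shift_pseries (a : nat -> E) (h : C -> E) (B R0 : R) (z : C) : 0 < R0 ->
  (forall n, norm (a n) * R0 ^ n <= B) -> modulus z < R0 / 2 ->
  is_pseries (K := C_AbsRing) a (Cexp z) (h z) ->
  is_pseries (K := C_AbsRing) (fun n => a (S n)) (Cexp z) (shift_fun (a 0%nat) h z) /\
  norm (shift_fun (a 0%nat) h z) <= 2 * (B / R0).
Proof.
  intros HR Ha Hz Hs.
  assert (HS := pseries_shift a (Cexp z) (h z) (Cexp_neq_0 z) Hs).
  assert (Ei : Cinv (Cexp z) = Cexp (Copp z)).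
  { rewrite <- (Cmult_1_r (Cinv (Cexp z))), <- (Cexp_opp z).
    field. apply Cexp_neq_0. }
  rewrite Ei in HS; split; [exact HS|].
  assert (Hb : forall n, norm (a (S n)) * R0 ^ n <= B / R0).
  { intros n; apply Rmult_le_reg_r with R0; [exact HR|].
    replace (B / R0 * R0) with B by (field; lra).
    replace (norm (a (S n)) * R0 ^ n * R0) with (norm (a (S n)) * R0 ^ S n) by (simpl; ring). apply Ha. }
  refine (proj1 (pseries_remainder (fun n => a (S n)) (B / R0) R0 (Cexp z) _ 0 HR Hb _ HS)).
  rewrite Cmod_Cexp; unfold modulus in Hz; lra.
Qed.

Context (w l : nat -> R -> C) (W L delta : R) (Hct : forall i, contour (w i) (l i) W L delta)
  (Hdelta : 0 < delta).

Lemma contour_shift (i : nat) (s : R) (y : C) (A r d : R) : 0 < s ->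
  Rabs (arg y - d) < A -> modulus y < r * exp (- L) ->
  Rabs (arg (Cplus y (l i s)) - d) < A + delta /\ modulus (Cplus y (l i s)) < r.
Proof.
  intros Hs Ha Hm.
  pose proof (ct_im _ _ _ _ _ (Hct i) s Hs); pose proof (ct_re _ _ _ _ _ (Hct i) s Hs).
  split.
  - unfold arg in *; replace (Im (Cplus y (l i s)) - d) with ((Im y - d) + Im (l i s))
      by (unfold Im, Cplus; simpl; ring).
    eapply Rle_lt_trans; [apply Rabs_triang|]; lra.
  - unfold modulus in *. replace (Re (Cplus y (l i s))) with (Re y + Re (l i s)) by (unfold Re, Cplus; reflexivity).
    rewrite exp_plus.
    apply Rle_lt_trans with (exp (Re y) * exp L).
    + apply Rmult_le_compat_l; [left; apply exp_pos|apply exp_le_mono; assumption].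
    + apply Rmult_lt_reg_r with (exp (- L)); [apply exp_pos|].
      rewrite Rmult_assoc, <- exp_plus, Rplus_opp_r, exp_0; lra.
Qed.

Lemma average_holomorphic (g : C -> E) (d A s r B : R) : 0 < s -> delta <= s ->
  (forall z, half_strip d (A + 2 * s) r z -> C_differentiable E g z /\ norm (g z) <= B) ->
  holomorphic_on (half_strip d A (r * exp (- L) * exp (- s))) (avg3 w l g).
Proof.
  intros Hs Hds Hg y [Hy1 Hy2].
  apply (avg3_differentiable w l W L delta Hct g y (s / 4) B); [lra|].
  intros i t h Ht Hh; apply Hg.
  pose proof (re_le_Cmod h); pose proof (im_le_Cmod h); pose proof (Rle_abs (Re h)).
  destruct (contour_shift i t (Cplus y h) (A + s) r d Ht).
  - unfold arg in *; replace (Im (Cplus y h) - d) with ((Im y - d) + Im h) by (unfold Im, Cplus; simpl; ring).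
    eapply Rle_lt_trans; [apply Rabs_triang|]; lra.
  - unfold modulus in *. replace (Re (Cplus y h)) with (Re y + Re h) by (unfold Re, Cplus; reflexivity).
    rewrite exp_plus.
    apply Rle_lt_trans with (exp (Re y) * exp s).
    + apply Rmult_le_compat_l; [left; apply exp_pos|apply exp_le_mono; lra].
    + apply Rmult_lt_reg_r with (exp (- s)); [apply exp_pos|].
      rewrite Rmult_assoc, <- exp_plus, Rplus_opp_r, exp_0; lra.
  - split; [lra|assumption].
Qed.

(** Multiplying the coefficients by the moments of the contours divides the radius
    of convergence by [exp L] at most. *)
Lemma average_borel (c : nat -> C) (a : nat -> E) (g : C -> E) (d th B R0 : R) :
  (forall p, exists mu : nat -> C,
     (forall i, is_RInt (V := VC) (ext0 (T := C_AbelianGroup)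
       (fun s => Cmult (w i s) (Cexp (Cmult (RtoC (INR p)) (l i s))))) 0 1 (mu i)) /\
     Cplus (Cplus (mu 0%nat) (mu 1%nat)) (mu 2%nat) = c p) ->
  0 < th -> delta <= th / 8 -> 0 < R0 ->
  (forall n, norm (a n) * R0 ^ n <= B) ->
  (forall z, sector d th z -> modulus z < R0 / 2 ->
     C_differentiable E g z /\ is_pseries (K := C_AbsRing) a (Cexp z) (g z)) ->
  exists r, 0 < r /\
    (forall x : C, Cmod x < r -> exists y : E, is_pseries (K := C_AbsRing) (fun n => scal (c n) (a n)) x y) /\
    (forall z, sector d (th / 2) z -> modulus z < r ->
      is_pseries (K := C_AbsRing) (fun n => scal (c n) (a n)) (proj z) (avg3 w l g z)).
Proof.
  intros Hmu Hth Hde HR Ha Hg.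
  set (mu := fun p => proj1_sig (constructive_indefinite_description _ (Hmu p))).
  assert (Hmu' : forall p, (forall i, is_RInt (V := VC) (ext0 (T := C_AbelianGroup)
       (fun s => Cmult (w i s) (Cexp (Cmult (RtoC (INR p)) (l i s))))) 0 1 (mu p i)) /\
     Cplus (Cplus (mu p 0%nat) (mu p 1%nat)) (mu p 2%nat) = c p).
  { intros p; exact (proj2_sig (constructive_indefinite_description _ (Hmu p))). }
  set (R' := R0 * exp (- L)).
  assert (HR' : 0 < R') by (apply Rmult_lt_0_compat; [exact HR|apply exp_pos]).
  assert (HW := contour_W _ _ _ _ _ (Hct 0%nat)).
  assert (Hc : forall n, Cmod (c n) <= 3 * W * exp L ^ n).
  { intros n; destruct (Hmu' n) as [H1 H2]; rewrite <- H2.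
    assert (H : forall i, Cmod (mu n i) <= W * exp L ^ n) by (intros i; apply (contour_moment_bound _ _ _ _ _ (Hct i)), H1).
    eapply Rle_trans; [apply Cmod_triangle|].
    eapply Rle_trans; [apply Rplus_le_compat_r, Cmod_triangle|].
    pose proof (H 0%nat); pose proof (H 1%nat); pose proof (H 2%nat). lra. }
  assert (Hb : forall n, norm (scal (c n) (a n)) * R' ^ n <= 3 * W * B).
  { intros n; apply Rle_trans with (3 * W * exp L ^ n * norm (a n) * R' ^ n).
    - apply Rmult_le_compat_r; [apply pow_le; lra|].
      eapply Rle_trans; [apply Enorm_scal|]. apply Rmult_le_compat_r; [apply Enorm_ge_0|apply Hc].
    - unfold R'; rewrite Rpow_mult_distr.
      replace (3 * W * exp L ^ n * norm (a n) * (R0 ^ n * exp (- L) ^ n)) with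
        (3 * W * (norm (a n) * R0 ^ n) * (exp L * exp (- L)) ^ n) by (rewrite Rpow_mult_distr; ring).
      rewrite <- exp_plus, Rplus_opp_r, exp_0, pow1, Rmult_1_r.
      apply Rmult_le_compat_l; [lra|apply Ha]. }
  exists (R' / 2); split; [lra|]; split.
  - intros x Hx; apply (pseries_geometric _ (3 * W * B) R'); auto; lra.
  - intros z Hz Hm.
    eapply (is_pseries_ext (K := C_AbsRing) (V := E)); [|apply (avg3_pseries w l W L delta Hct mu a g B R0 z);
      [intros p i; apply Hmu'|exact HR|exact Ha|]].
    + intros n; simpl; rewrite (proj2 (Hmu' n)); reflexivity.
    + intros i s Hs.
      destruct (contour_shift i s z (th / 4) (R0 / 2) d Hs) as [H1 H2].
      * unfold sector in Hz; lra.
      * unfold R' in Hm; lra.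
      * destruct (Hg (Cplus z (l i s))) as [H3 H4]; [unfold sector; lra|exact H2|].
        split; [exact H3|]; split; [|exact H4].
        rewrite Cmod_Cexp; unfold modulus in H2; lra.
Qed.

(** Multiplying both [z] and the variable of integration by [exp (l s)] leaves the
    kernel unchanged: averaging commutes with the Laplace transform. *)
Lemma average_laplace (M : nat -> R) (e : logsurf -> C) (Ek : C -> C) (m : nat -> R)
    (d th : R) (h f : C -> E) : weight M -> strong_kernel M e Ek m ->
  0 < th -> delta <= th / 8 -> OM M d th h -> uniform_laplace M e d th h f ->
  forall tau dl, Rabs (tau - d) < th / 4 -> 0 < dl < omega M * PI / 2 ->
  exists r, 0 < r /\ forall z, Rabs (arg z - tau) <= dl -> modulus z < r ->
    is_laplace e tau (avg3 w l h) z (avg3 w l f z).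
Proof.
  intros HM HK Hth Hde [Hhol Hgr] Hf tau dl Htau Hdl.
  destruct (Hgr (7 * th / 8) ltac:(lra)) as (c & k & Hc & Hk & Hh).
  destruct (Hf (7 * th / 8) dl ltac:(lra) Hdl) as (r1 & B & Hr1 & H1).
  set (k' := k * exp (- L)).
  assert (Hk' : 0 < k') by (apply Rmult_lt_0_compat; [exact Hk|apply exp_pos]).
  destruct (laplace_domination (E := E) M e Ek m HM HK dl c k' Hdl Hc Hk') as (r2 & K & Hr2 & HKp & Hdom).
  exists (Rmin (r1 * exp (- L)) r2); split.
  { apply Rmin_glb_lt; [apply Rmult_lt_0_compat; [exact Hr1|apply exp_pos]|exact Hr2]. }
  intros z Ha Hz.
  assert (Hz1 : modulus z < r1 * exp (- L)) by (eapply Rlt_le_trans; [exact Hz|apply Rmin_l]).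
  assert (Hz2 : modulus z < r2) by (eapply Rlt_le_trans; [exact Hz|apply Rmin_r]).
  assert (Hsec : forall i s v, 0 < s -> sector d (7 * th / 8) (Cplus (v, tau) (l i s))).
  { intros i s v Hs; pose proof (ct_im _ _ _ _ _ (Hct i) s Hs); unfold sector, arg.
    replace (Im (Cplus (v, tau) (l i s)) - d) with ((tau - d) + Im (l i s)) by (unfold Im, Cplus; simpl; ring).
    eapply Rle_lt_trans; [apply Rabs_triang|]; lra. }
  assert (Hnorm : forall i s v, 0 < s -> norm (h (Cplus (v, tau) (l i s))) <= c * exp (Mfun M (exp v / k'))).
  { intros i s v Hs; eapply Rle_trans; [apply Hh, Hsec, Hs|].
    apply Rmult_le_compat_l; [lra|]; apply exp_le_mono, Mfun_mono; [exact HM|].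
    pose proof (ct_re _ _ _ _ _ (Hct i) s Hs).
    replace (exp v / k') with (exp v * exp L / k).
    2:{ unfold k'; rewrite exp_Ropp; pose proof (exp_pos L); field; lra. }
    apply Rmult_le_compat_r; [left; apply Rinv_0_lt_compat, Hk|].
    unfold modulus; replace (Re (Cplus (v, tau) (l i s))) with (v + Re (l i s)) by reflexivity.
    rewrite exp_plus; apply Rmult_le_compat_l; [left; apply exp_pos|apply exp_le_mono; assumption]. }
  assert (Ck : forall v, continuous (T := R_UniformSpace) (U := C_UniformSpace) (fun v => e (Cminus (v, tau) z)) v).
  { intros v.
    apply (continuous_horizontal C_CompleteNormedModule (fun y => e (Cminus y z)) v tau).
    apply C_differentiable_continuous.
    destruct (kernel_diff M e Ek m HK (Cminus (v, tau) z)) as [d0 Hd0].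
    { replace (Im (Cminus (v, tau) z)) with (- (arg z - tau)) by (unfold arg, Im, Cminus, Cplus, Copp; simpl; ring).
      rewrite Rabs_Ropp; lra. }
    exists d0; apply (is_derive_shift (E := C_CompleteNormedModule) e (Copp z)); exact Hd0. }
  destruct (avg3_line_int w l W L delta Hct (fun v => e (Cminus (v, tau) z)) h f tau
    (2 * K * (1 + (Re z) ^ 2)) z Ck) as [HL HC].
  - intros i s v Hs; apply Hhol; pose proof (Hsec i s v Hs); unfold sector in *; lra.
  - intros v; exists (c * exp (Mfun M (exp v / k'))); intros i s Hs; apply Hnorm, Hs.
  - intros i s v Hs.
    eapply Rle_trans; [apply (Hdom z v tau); auto|].
    (* 1 + v^2 <= 2 (1 + x^2) (1 + (v - x)^2) *)
    generalize (Re z); intros x.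
    assert (P1 : 0 < 1 + (v - x) ^ 2) by (pose proof (pow2_ge_0 (v - x)); lra).
    assert (P2 : 0 < 1 + v ^ 2) by (pose proof (pow2_ge_0 v); lra).
    apply Rmult_le_reg_r with ((1 + (v - x) ^ 2) * (1 + v ^ 2)); [apply Rmult_lt_0_compat; assumption|].
    replace (K / (1 + (v - x) ^ 2) * ((1 + (v - x) ^ 2) * (1 + v ^ 2))) with (K * (1 + v ^ 2)) by (field; lra).
    replace (2 * K * (1 + x ^ 2) / (1 + v ^ 2) * ((1 + (v - x) ^ 2) * (1 + v ^ 2))) with
      (K * (2 * (1 + x ^ 2) * (1 + (v - x) ^ 2))) by (field; lra).
    apply Rmult_le_compat_l; [lra|].
    assert (0 <= (x * (v - x)) ^ 2) by apply pow2_ge_0.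
    assert (0 <= (x - (v - x)) ^ 2) by apply pow2_ge_0. nra.
  - intros i s Hs.
    pose proof (ct_im _ _ _ _ _ (Hct i) s Hs) as Him.
    destruct (H1 (Cplus z (l i s)) (tau + Im (l i s))) as [_ H2].
    + apply (contour_shift i s z (Rabs (arg z - d) + 1) r1 d Hs); [lra|exact Hz1].
    + replace (tau + Im (l i s) - d) with ((tau - d) + Im (l i s)) by ring.
      eapply Rle_trans; [apply Rabs_triang|]; lra.
    + unfold arg in *; replace (Im (Cplus z (l i s)) - (tau + Im (l i s))) with (Im z - tau)
        by (unfold Im, Cplus; simpl; ring). exact Ha.
    + apply (line_int_translate (V := VE) _ _ (Re (l i s))) in H2.
      eapply (is_line_int_ext (V := VE)); [|exact H2].
      intros v; cbv beta.
      assert (E1 : Cminus (v + Re (l i s), tau + Im (l i s)) (Cplus z (l i s)) = Cminus (v, tau) z).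
      { unfold Cminus, Cplus, Copp, Re, Im; simpl; apply f_equal2; ring. }
      rewrite E1; reflexivity.
  - apply (line_int_exp (V := VE) (fun v => scal (e (Cminus (v, tau) z)) (avg3 w l h (v, tau)))); assumption.
Qed.
End Transfer.

(** * Moment derivatives of multisummable series *)

Lemma powseq_quotient (M : nat -> R) (a b : R) :
  (fun p => powseq M (a + b) p / powseq M b p) = powseq M a.
Proof.
  apply functional_extensionality; intros p; unfold powseq.
  rewrite Rpower_plus; field; unfold Rpower; pose proof (exp_pos (b * ln (M p))); lra.
Qed.

(** The moment derivative is a shift followed by the multiplication with the
    quotients [me (p+1) / me p]; Borel transforms with shifted moments absorb the
    shift. *)
Lemma borel_moment_derivative {E : CompleteNormedModule C_AbsRing} (me m1 m2 : nat -> R) (u : nat -> E) (p : nat) :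
  borel (fun p => m2 (S p)) (borel (fun p => m1 (S p)) (moment_derivative me u)) p =
  scal (RtoC (me (S p) / me p)) (borel m2 (borel m1 u) (S p)).
Proof.
  unfold borel, moment_derivative, Rdiv; rewrite RtoC_mult.
  generalize (RtoC (/ m2 (S p))) (RtoC (/ m1 (S p))) (RtoC (/ me p)) (RtoC (me (S p))) (u (S p)).
  intros c1 c2 c3 c4 x.
  change (scal c1 (scal c2 (scal c3 (scal c4 x))) = scal (Cmult c4 c3) (scal c1 (scal c2 x))).
  Cmodule E.
Qed.

Theorem corollary1 (E : CompleteNormedModule C_AbsRing)
    (me : nat -> R) (Hme : moment_sequence me)
    (M : nat -> R) (HM : strongly_regular M)
    (HMpo : admits_nonzero_proximate_order M)
    (a b : R) (Ha : 0 < a) (Hb : 0 < b) (Hab : omega M < 2 / (a + b))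
    (d1 d2 : R) (Hd : Rabs (d1 - d2) < a * (omega M * PI / 2))
    (u : nat -> E)
    (Hu : multisummable (powseq M b) (powseq M (a + b)) d1 d2 u) :
  multisummable (powseq M b) (powseq M (a + b)) d1 d2 (moment_derivative me u).
Proof.
  unfold multisummable in *.
  rewrite powseq_quotient in *.
  assert (WM := strongly_regular_weight M HM).
  assert (WN := powseq_weight M a Ha WM). assert (WB := powseq_weight M b Hb WM).
  destruct (omega_powseq M a WM HMpo Ha) as [Hom HomN].
  assert (Heta : omega (powseq M a) * PI / 2 = a * (omega M * PI / 2)) by (rewrite HomN; field).
  set (N := powseq M a) in *.
  set (eta := omega N * PI / 2) in *.
  pose proof PI_RGT_0 as HPI.
  destruct Hu as (e1 & E1 & m1 & K1 & _ & G & f & HMsum & thF & F & HthF & HF & (thc & rc & Hthc & Hrc & Hcont)).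
  destruct HMsum as (e2 & E2 & m2 & th & h & K2 & (Hth & Hh & r0 & Hr0 & Hconv & Hser) & Hlap).
  destruct Hme as (Me & HMe & Hpoe & Home & ee & Ee & Ke).
  assert (We := strongly_regular_weight Me HMe).
  destruct (omega_powseq Me 1 We Hpoe Rlt_0_1) as [Home0 _].
  set (etae := omega Me * PI / 2).
  assert (Hetae : 0 < etae < PI) by (unfold etae; split; nra).
  assert (Heta0 : 0 < eta) by (rewrite Heta; apply Rmult_lt_0_compat; [lra|unfold Rdiv; nra]).
  rewrite <- Heta in Hd.
  destruct (proj1 Hlap) as (Theta & HTheta & Hreg).
  (* a common unit for the angles that are lost below *)
  set (b0 := Rmin (Rmin th (Theta - 2 * eta)) (Rmin eta (eta - Rabs (d1 - d2))) / 100).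
  assert (Hb0 : 0 < b0 /\ 100 * b0 <= th /\ 100 * b0 <= Theta - 2 * eta /\ 100 * b0 <= eta /\
    100 * b0 <= eta - Rabs (d1 - d2)).
  { assert (0 < Rmin (Rmin th (Theta - 2 * eta)) (Rmin eta (eta - Rabs (d1 - d2)))).
    { repeat apply Rmin_glb_lt; unfold eta in *; lra. }
    pose proof (Rmin_l (Rmin th (Theta - 2 * eta)) (Rmin eta (eta - Rabs (d1 - d2)))).
    pose proof (Rmin_r (Rmin th (Theta - 2 * eta)) (Rmin eta (eta - Rabs (d1 - d2)))).
    pose proof (Rmin_l th (Theta - 2 * eta)); pose proof (Rmin_r th (Theta - 2 * eta)).
    pose proof (Rmin_l eta (eta - Rabs (d1 - d2))); pose proof (Rmin_r eta (eta - Rabs (d1 - d2))).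
    unfold b0; lra. }
  clearbody b0. destruct Hb0 as (Hb0 & Hb1 & Hb2 & Hb3 & Hb4).
  set (th1 := Rmin thc (2 * b0)).
  assert (Hth1 : 0 < th1) by (apply Rmin_glb_lt; lra).
  assert (Hth1c : th1 <= thc) by apply Rmin_l. assert (Hth1b : th1 <= 2 * b0) by apply Rmin_r.
  clearbody th1.
  set (delta := Rmin (th1 / 8) (Rmin etae (PI - etae))).
  assert (Hdelta : 0 < delta) by (repeat apply Rmin_glb_lt; lra).
  assert (Hdl1 : delta <= th1 / 8) by apply Rmin_l.
  assert (Hdl2 : delta <= etae /\ delta <= PI - etae).
  { pose proof (Rmin_r (th1 / 8) (Rmin etae (PI - etae))).
    pose proof (Rmin_l etae (PI - etae)); pose proof (Rmin_r etae (PI - etae)). fold delta in H; lra. }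
  clearbody delta.
  (* the contours are narrow with respect to all the sectors of the given data *)
  destruct (moment_ratio_contours Me ee Ee me We Ke Hetae delta Hdelta (proj1 Hdl2) (proj2 Hdl2))
    as (w & l & W & L & Hct & Hmu).
  (* the shifted Borel sum (h - h 0) / x, bounded near the origin by its power series *)
  set (hc := borel m2 (borel m1 u)) in *.
  set (R0 := r0 / 2). assert (HR0 : 0 < R0) by (unfold R0; lra).
  destruct (Hconv (RtoC R0)) as [y0 Hy0].
  { rewrite Cmod_R, Rabs_pos_eq by lra; unfold R0; lra. }
  destruct (pseries_coef_bound hc (RtoC R0) y0 Hy0) as (B0 & HB0 & Hcoef).
  rewrite Cmod_R, (Rabs_pos_eq R0) in Hcoef by lra.
  set (h1 := shift_fun (hc 0%nat) h).
  assert (Hs1 : forall z, sector d2 th z -> modulus z < R0 / 2 ->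
    is_pseries (K := C_AbsRing) (fun n => hc (S n)) (Cexp z) (h1 z) /\ norm (h1 z) <= 2 * (B0 / R0)).
  { intros z Hz Hm; apply (shift_pseries hc h B0 R0 z HR0 Hcoef Hm); apply Hser; [exact Hz|unfold R0 in Hm; lra]. }
  assert (Hh1 : OM N d2 th h1).
  { apply (OM_shift N d2 th h (hc 0%nat) (R0 / 2) (2 * (B0 / R0)) WN); [lra|exact Hh|].
    intros z Hz Hm; apply Hs1; assumption. }
  destruct (laplace_shift N e2 E2 m2 WN K2 Heta0 d2 th h G f (hc 0%nat) Hth Hh Hlap Hh1) as [x0 Hf1].
  fold h1 in Hf1. set (f1 := shift_fun x0 f) in *.
  assert (K2' := strong_kernel_shift N e2 E2 m2 WN K2).
  assert (K1' := strong_kernel_shift (powseq M b) e1 E1 m1 WB K1).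
  (* the shifted sum f1 is bounded on a sector wider than omega N * PI, which leaves room for
     the contours *)
  destruct (uniform_laplace_bounded N (shift_kernel e2) d2 th (8 * b0) h1 f1 Hf1 ltac:(lra)
    ltac:(fold eta; lra)) as (rb & B & Hrb & Hfb).
  fold eta in Hfb.
  destruct (sreg_sectors _ _ _ Hreg (2 * (eta + 4 * b0)) ltac:(lra)) as (rg & Hrg & Hsub).
  set (r1 := Rmin rb rg). assert (Hr1 : 0 < r1) by (apply Rmin_glb_lt; assumption).
  assert (Hr1b : r1 <= rb) by apply Rmin_l. assert (Hr1g : r1 <= rg) by apply Rmin_r.
  assert (Hf1d : forall z, half_strip d2 (eta + b0 + 2 * b0) r1 z -> C_differentiable E f1 z /\ norm (f1 z) <= B).
  { intros z [Hz1 Hz2]; split; [|apply Hfb; lra].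
    apply shift_fun_diff; apply (proj1 (proj2 Hlap)); apply Hsub; [unfold sector|]; lra. }
  set (f' := avg3 w l f1). set (h' := avg3 w l h1).
  set (r2 := r1 * exp (- L) * exp (- b0)).
  assert (Hr2 : 0 < r2) by (repeat apply Rmult_lt_0_compat; [exact Hr1|apply exp_pos|apply exp_pos]).
  set (G' := half_strip d2 (eta + b0) r2).
  assert (HfG : holomorphic_on G' f').
  { apply (average_holomorphic w l W L delta Hct f1 d2 (eta + b0) b0 r1 B Hb0); [lra|exact Hf1d]. }
  assert (HOM' : OM N d2 (th / 2) h').
  { apply (OM_average w l W L delta Hct Hdelta N d2 th h1 WN Hth); [lra|exact Hh1]. }
  assert (Hborel : borel_sum N (fun p => m2 (S p)) d2 (th / 2)
    (borel (fun p => m1 (S p)) (moment_derivative me u)) h').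
  { split; [lra|]. split; [exact HOM'|].
    destruct (average_borel w l W L delta Hct Hdelta (fun p => RtoC (me (S p) / me p)) (fun n => hc (S n)) h1 d2 th
      (B0 / R0) R0 Hmu Hth ltac:(lra) HR0) as (r & Hr & Hr1' & Hr2').
    - intros n; apply Rmult_le_reg_r with R0; [exact HR0|].
      replace (B0 / R0 * R0) with B0 by (field; lra).
      replace (norm (hc (S n)) * R0 ^ n * R0) with (norm (hc (S n)) * R0 ^ S n) by (simpl; ring). apply Hcoef.
    - intros z Hz Hm; split; [apply Hh1, Hz|apply Hs1; assumption].
    - exists r; split; [exact Hr|]; split.
      + intros x Hx; destruct (Hr1' x Hx) as [y Hy]; exists y.
        eapply (is_pseries_ext (K := C_AbsRing) (V := E)); [|exact Hy].
        intros n; symmetry; apply borel_moment_derivative.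
      + intros z Hz Hm; eapply (is_pseries_ext (K := C_AbsRing) (V := E)); [|exact (Hr2' z Hz Hm)].
        intros n; symmetry; apply borel_moment_derivative. }
  exists (shift_kernel e1), (shift_entire E1 (fun p => RtoC (/ m1 p))), (fun p => m1 (S p)).
  split; [exact K1'|]. split.
  { exists (shift_kernel e2), (shift_entire E2 (fun p => RtoC (/ m2 p))), (fun p => m2 (S p)), (th / 2), h'.
    split; [exact K2'|exact Hborel]. }
  exists G', f'; split.
  { exists (shift_kernel e2), (shift_entire E2 (fun p => RtoC (/ m2 p))), (fun p => m2 (S p)), (th / 2), h'.
    split; [exact K2'|]. split; [exact Hborel|]. split; [|split; [exact HfG|]].
    - exists (2 * (eta + b0)); split; [unfold eta; lra|]. apply sectorial_half_strip, Hr2.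
    - intros tau dl Htau Hdl.
      apply (average_laplace w l W L delta Hct Hdelta N (shift_kernel e2) _ _ d2 th h1 f1 WN K2' Hth); try assumption; lra. }
  (* near the origin F1 coincides with f1, which is bounded there as d1 lies in the sector of f1 *)
  set (F1 := shift_fun x0 F).
  assert (HF1f : forall z, sector d1 thc z -> modulus z < rc -> F1 z = f1 z).
  { intros z Hz Hm; unfold F1, f1, shift_fun; rewrite (proj2 (Hcont z Hz Hm)); reflexivity. }
  assert (Hd12 : forall z t, sector d1 t z -> Rabs (arg z - d2) < Rabs (d1 - d2) + t / 2).
  { intros z t Hz; replace (arg z - d2) with ((arg z - d1) + (d1 - d2)) by ring.
    eapply Rle_lt_trans; [apply Rabs_triang|]; unfold sector in Hz; lra. }
  assert (HF1 : OM (powseq M b) d1 th1 F1).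
  { apply (OM_shift (powseq M b) d1 th1 F x0 (Rmin rb rc) B WB).
    - apply Rmin_glb_lt; assumption.
    - apply (OM_restrict (powseq M b) d1 thF); [lra|exact HF].
    - intros z Hz Hm.
      assert (modulus z < rb) by (eapply Rlt_le_trans; [exact Hm|apply Rmin_l]).
      assert (modulus z < rc) by (eapply Rlt_le_trans; [exact Hm|apply Rmin_r]).
      fold F1; rewrite HF1f; [|unfold sector in *; lra|assumption].
      apply Hfb; [|assumption]. specialize (Hd12 z th1 Hz); lra. }
  exists (th1 / 2), (avg3 w l F1); split; [lra|]; split.
  { apply (OM_average w l W L delta Hct Hdelta (powseq M b) d1 th1 F1 WB Hth1 Hdl1 HF1). }
  exists (th1 / 2), (Rmin r2 (rc * exp (- L))); split; [lra|]; split.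
  { apply Rmin_glb_lt; [exact Hr2|apply Rmult_lt_0_compat; [exact Hrc|apply exp_pos]]. }
  intros z Hz Hm; split.
  - split; [|eapply Rlt_le_trans; [exact Hm|apply Rmin_l]]. specialize (Hd12 z (th1 / 2) Hz); lra.
  - apply avg3_ext; intros i s Hs.
    destruct (contour_shift w l W L delta Hct i s z (th1 / 4) rc d1 Hs) as [H1 H2].
    + unfold sector in Hz; lra.
    + eapply Rlt_le_trans; [exact Hm|apply Rmin_r].
    + apply HF1f; [unfold sector; lra|exact H2].
Qed.
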